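(* As $n\to\infty$, the proposed importance sampling procedure is asymptotically efficient, i.e. $$\lim_{n\to\infty}\frac1n\log\mathbb E_{\mathbb Q}(\mathcal L_n^2\mathcal I_n)=\lim_{n\to\infty}\frac2n\log p_n(\boldsymbol a)=-2\inf_{f\in\mathscr F_t}\inf_{\boldsymbol b\in A}\sup_{\boldsymbol\vartheta}\big(\langle\boldsymbol\vartheta,\boldsymbol b\rangle-\log M_f(\boldsymbol\vartheta)\big).$$ This means that the number of runs needed grows subexponentially: $$\lim_{n\to\infty}\frac1n\log\Sigma_n=0.$$
   Context: Markov-modulated linear stochastic fluid network with $L$ nodes, starting empty; fix $t>0$. The background process $J(\cdot)$ is an irreducible continuous-time Markov chain on $\{1,\ldots,d\}$ with generator $Q=(q_{jj'})$ and $J(0)=j_0$ fixed. While $J$ is in state $j$: jobs arrive according to a Poisson process with rate $\lambda_j>0$; each arrival adds to the $L$ nodes a non-negative random vector with joint moment generating function $\beta_j(\boldsymbol\vartheta)$, $\boldsymbol\vartheta\in\mathbb R^L$ (finite near the origin), independently of everything else; and between arrivals the storage (row) vector satisfies $\frac{d}{ds}\boldsymbol X(s)=-\boldsymbol X(s)R_j$. Here $(R_j)_{ii}=r^{(j)}_{ii}+\sum_{i'\ne i}r^{(j)}_{ii'}$ and $(R_j)_{ii'}=-r^{(j)}_{ii'}$ for $i\ne i'$, with $r^{(j)}_{ii'}\ge0$ the flow rate from node $i$ to node $i'$ and $r^{(j)}_{ii}\ge 0$ the rate of leaving the network from node $i$. Slow-modulation scaling: $\lambda_j$ is replaced by $n\lambda_j$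 and $Q$ is left unchanged. $\boldsymbol Y_n(t)=(Y_n^{(1)}(t),\ldots,Y_n^{(L)}(t))$ is the resulting storage vector at time $t$. Let $A=[a_1,\infty)\times\cdots\times[a_L,\infty)$ and $p_n(\boldsymbol a)=\mathbb P(\boldsymbol Y_n(t)\in A)$. Paths: $\mathscr F_t$ is the set of (right-continuous, piecewise constant, finitely many jumps) paths $f:[0,t]\to\{1,\ldots,d\}$ of the background process. For $f\in\mathscr F_t$ with $K(f)$ jumps at epochs $t_1(f)<\cdots<t_{K(f)}(f)$, put $t_0(f)=0$, $t_{K(f)+1}(f)=t$, let $j_i(f)$ be the state on $[t_i(f),t_{i+1}(f))$, and set $D_i(u,f)=e^{-(t_{i+1}(f)-u)R_{j_i(f)}}$, $D_i(f)=e^{-(t_{i+1}(f)-t_i(f))R_{j_i(f)}}$, $P_i(u,f)=D_i(u,f)D_{i+1}(f)\cdots D_{K(f)}(f)$, and $$M_f(\boldsymbol\vartheta)=\prod_{i=0}^{K(f)}\exp\Big(\lambda_{j_i(f)}\int_{t_i(f)}^{t_{i+1}(f)}\big(\beta_{j_i(f)}(P_i(u,f)\boldsymbol\vartheta)-1\big)du\Big).$$ Given $J=f$, $\boldsymbol Y_n(t)$ is a sum of $n$ i.i.d. vectors with moment generating function $M_f$. Let $\mathbb I_f(\boldsymbol a)=\inf_{\boldsymbol b\in A}\sup_{\boldsymbol\vartheta}(\langle\boldsymbol\vartheta,\boldsymbol b\rangle-\log M_f(\boldsymbol\vartheta))$, with optimizers $\boldsymbol b^\star_f\in A$ and $\boldsymbol\vartheta_f^\star\ge\boldsymbol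 0$ (componentwise), assumed to exist. It is assumed that $\nabla M_f(\boldsymbol 0)\notin A$ for all $f\in\mathscr F_t$ (the event is rare). Importance sampling measure $\mathbb Q$: in each run, sample the path of $J$ on $[0,t]$ under the original measure $\mathbb P$; call it $f$. Conditional on $f$, the $n$ i.i.d. vectors composing $\boldsymbol Y_n(t)$ are independently sampled from the law exponentially twisted by $\boldsymbol\vartheta_f^\star$, i.e. with moment generating function $M_f(\boldsymbol\vartheta+\boldsymbol\vartheta_f^\star)/M_f(\boldsymbol\vartheta_f^\star)$. Concretely, for each of the $n$ vectors: the number of arrivals in $(t_i(f),t_{i+1}(f))$ is Poisson with mean $\int_{t_i(f)}^{t_{i+1}(f)}\lambda_{j_i(f)}\beta_{j_i(f)}(P_i(u,f)\boldsymbol\vartheta_f^\star)du$; the arrival epochs are i.i.d. with density proportional to $\beta_{j_i(f)}(P_i(u,f)\boldsymbol\vartheta_f^\star)$; and the job-size vector of an arrival at time $u$ has the original law exponentially twisted by $P_i(u,f)\boldsymbol\vartheta_f^\star$. The likelihood ratio, when $J=f$, is $\mathcal L_n=\frac{d\mathbb P}{d\mathbb Q}=\exp(-\langle\boldsymbol\vartheta_f^\star,\boldsymbol Y_n(t)\rangle+n\log M_f(\boldsymbol\vartheta_f^\star))$, and $\mathcal I_n$ is the indicator of $\{\boldsymbol Y_n(t)\in A\}$, so $\mathbb E_{\mathbb Q}(\mathcal L_n\mathcal I_n)=p_n(\boldsymbol a)$. For fixed critical value $T>0$ and precision $\varepsilon>0$, the required number of runs is $\Sigma_n:=\frac{T^2}{\varepsilon^2}\,\frac{\mathrm{Var}_{\mathbb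 Q}(\mathcal L_n\mathcal I_n)}{p_n(\boldsymbol a)^2}$.
   Formalization: The event that Y_n(t) lies in A is replaced by the event that Y_n(t)/n lies in A, both in p_n(a) and in the indicator I_n: Y_n(t) is a sum of n i.i.d. vectors, so without the factor 1/n the probability would not decay at the stated rate. *)

(* Defs.v *)
(* MathComp-Analysis; the reals are an arbitrary R : realType. *)
From HB Require Import structures.
From mathcomp Require Import all_boot all_order all_algebra.
From mathcomp Require Import all_classical all_reals all_analysis.
Set Implicit Arguments.
Unset Strict Implicit.
Unset Printing Implicit Defensive.
Import Order.TTheory GRing.Theory Num.Theory.
Import numFieldNormedType.Exports.
Local Open Scope classical_set_scope.
Local Open Scope ring_scope.

(* R^L with its Borel sigma-algebra.  Storage and job vectors are rows, the
   arguments of moment generating functions are columns. *)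
Definition borelV (R : realType) (L : nat) :=
  g_sigma_algebraType (@open 'rV[R]_L).

Definition inner (R : realType) (L : nat) (th : 'cV[R]_L) (b : 'rV[R]_L) : R :=
  \sum_(l < L) th l ord0 * b ord0 l.

Definition mgf (R : realType) (L : nat)
    (m : {measure set (borelV R L) -> \bar R}) (th : 'cV[R]_L) : \bar R :=
  (\int[m]_x (expR (inner th x))%:E)%E.

Definition orthant (R : realType) (L : nat) (a : 'rV[R]_L) : set 'rV[R]_L :=
  [set b | forall l, a ord0 l <= b ord0 l].

(* Entrywise sum of the exponential series (which converges entrywise). *)
Definition expmx (R : realType) (k : nat) (M : 'M[R]_k) : 'M[R]_k :=
  \matrix_(i, j)
    limn (fun N : nat => \sum_(m < N) (m`!%:R^-1 * (iter m (mulmx M) 1%:M) i j)).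

Definition flow_mx (R : realType) (L : nat) (r : 'M[R]_L) : 'M[R]_L :=
  \matrix_(i, i') if i == i' then r i i + \sum_(k < L | k != i) r i k
                  else - r i i'.

Definition generator (R : realType) (d : nat) (Q : 'M[R]_d) : Prop :=
  (forall x y, x != y -> 0 <= Q x y) /\ (forall x, \sum_y Q x y = 0).

Definition irreducible_gen (R : realType) (d : nat) (Q : 'M[R]_d) : Prop :=
  forall x y, connect [rel u v | (u != v) && (0 < Q u v)] x y.

(* A right-continuous piecewise constant path on [0, t] with finitely many
   jumps is encoded by its initial state and the list of its successive jump
   epochs, each with the state jumped to.  The encoding is one-to-one, since
   the epochs increase strictly in ]0, t] and consecutive states differ.  The
   state space 'I_d.+1 is nonempty. *)
Definition wf_path (R : realType) (d : nat) (t : R)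
    (p : 'I_d.+1 * seq (R * 'I_d.+1)) : bool :=
  [&& path (fun u v => u < v) 0 (unzip1 p.2),
      all (fun u => u <= t) (unzip1 p.2)
    & path (fun x y => x != y) p.1 (unzip2 p.2)].

Definition rawpath (R : realType) (d : nat) (t : R) : Type :=
  {p : 'I_d.+1 * seq (R * 'I_d.+1) | wf_path t p}.

Section Paths.
Context {R : realType} {d : nat} {t : R}.
Implicit Type f : rawpath d t.

Definition njumps f : nat := size (val f).2.

(* The default value of nth makes epoch f (njumps f).+1 equal to t. *)
Definition epoch f (i : nat) : R := nth t (0 :: unzip1 (val f).2) i.

Definition state f (i : nat) : 'I_d.+1 :=
  nth (val f).1 ((val f).1 :: unzip2 (val f).2) i.

Definition path_at f (s : R) : 'I_d.+1 :=
  state f (count (fun p => p.1 <= s) (val f).2).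

End Paths.

Lemma wf_const_path (R : realType) (d : nat) (t : R) :
  wf_path t (ord0 : 'I_d.+1, [::]).
Proof. by []. Qed.

HB.instance Definition _ (R : realType) (d : nat) (t : R) :=
  Choice.on (rawpath d t).
HB.instance Definition _ (R : realType) (d : nat) (t : R) :=
  isPointed.Build (rawpath d t)
    (exist (fun p => is_true (wf_path t p)) _ (wf_const_path d t)).

Definition path_cylinder (R : realType) (d : nat) (t : R)
    : set (set (rawpath d t)) :=
  [set F | exists s x, [/\ 0 <= s, s <= t & F = [set f | path_at f s = x]]].

(* The paths, with the sigma-algebra generated by the evaluations at the times
   in [0, t]. *)
Definition bpath (R : realType) (d : nat) (t : R) :=
  g_sigma_algebraType (@path_cylinder R d t).

Section ConditionalMgf.
Context {R : realType} {L d : nat} {t : R}.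
Variables (lam : 'I_d.+1 -> R) (mu : 'I_d.+1 -> probability (borelV R L) R)
  (r : 'I_d.+1 -> 'M[R]_L).
Implicit Types (f : bpath d t) (th : 'cV[R]_L) (b : 'rV[R]_L).

Definition decay f (i : nat) (u : R) : 'M[R]_L :=
  expmx (- (epoch f i.+1 - u) *: flow_mx (r (state f i))).

Definition transfer f (i : nat) (u : R) : 'M[R]_L :=
  decay f i u *m
  \big[mulmx/1%:M]_(i.+1 <= k < (njumps f).+1) decay f k (epoch f k).

(* Values in ]0, +oo]: the moment generating function of the job sizes may be
   infinite away from the origin. *)
Definition Mf f th : \bar R :=
  (\big[mule/1]_(0 <= i < (njumps f).+1)
     expeR ((lam (state f i))%:E *
       \int[lebesgue_measure]_(u in `[epoch f i, epoch f i.+1])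
         (mgf (mu (state f i)) (transfer f i u *m th) - 1)))%E.

Definition grad_Mf0 f : 'rV[R]_L :=
  \row_l (derive1 (fun h : R => fine (Mf f (h *: delta_mx l ord0))) 0).

Definition tilt f b th : \bar R := ((inner th b)%:E - lne (Mf f th))%E.

Definition legendre f b : \bar R := ereal_sup [set tilt f b th | th in setT].

Definition path_rate (a : 'rV[R]_L) f : \bar R :=
  ereal_inf [set legendre f b | b in orthant a].

Definition optimizers (a : 'rV[R]_L) f b th : Prop :=
  [/\ orthant a b,
      forall b', orthant a b' -> (legendre f b <= legendre f b')%E,
      forall th', (tilt f b th' <= tilt f b th)%E
    & forall l, 0 <= th l ord0].

End ConditionalMgf.

(* Probability that the chain started in x at time s0 visits the states p.2 at
   the successive times p.1, for p in ss. *)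
Fixpoint ctmc_fdd (R : realType) (d : nat) (Q : 'M[R]_d) (x : 'I_d) (s0 : R)
    (ss : seq (R * 'I_d)) : R :=
  if ss is (s, y) :: ss' then
    expmx ((s - s0) *: Q) x y * ctmc_fdd Q y s ss'
  else 1.

Definition ctmc (R : realType) (d : nat) (t : R) (Q : 'M[R]_d.+1) (j0 : 'I_d.+1)
    (dO : measure_display) (Om : measurableType dO) (P : probability Om R)
    (J : Om -> bpath d t) : Prop :=
  forall ss : seq (R * 'I_d.+1),
    path (fun u v => u <= v) 0 (unzip1 ss) ->
    all (fun u => u <= t) (unzip1 ss) ->
    P [set w | forall p, p \in ss -> path_at (J w) p.1 = p.2]
      = (ctmc_fdd Q j0 0 ss)%:E.

(* Sample-path dynamics.  The clock of state j rings at the epochs T j k, and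
   its k-th ring brings in the job B j k exactly when the background state is j
   at that time. *)
Definition storage_path (R : realType) (L d : nat) (t : R)
    (r : 'I_d.+1 -> 'M[R]_L) (f : bpath d t)
    (T : 'I_d.+1 -> nat -> R) (B : 'I_d.+1 -> nat -> 'rV[R]_L) (X : R -> 'rV[R]_L)
    : Prop :=
  let arrival s j k := T j k = s /\ path_at f s = j in
  [/\ X 0 = 0,
      forall s, 0 <= s -> s < t -> X u @[u --> s^'+] --> X s,
      forall s j k, 0 < s -> s <= t -> arrival s j k ->
        X u @[u --> s^'-] --> X s - B j k,
      forall s, 0 < s -> s <= t -> (forall j k, ~ arrival s j k) ->
        X u @[u --> s^'-] --> X s
    & forall s, 0 < s -> s < t -> (forall j k, ~ arrival s j k) ->
        (\forall u \near s, path_at f u = path_at f s) ->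
        forall l, is_derive s 1 (fun u => X u ord0 l)
          ((- (X s *m flow_mx (r (path_at f s)))) ord0 l)].

(* The network with Poisson arrivals of rate c * lam j while the background
   process is in state j: each state j has its own Poisson clock, with i.i.d.
   exponential gaps E j k and i.i.d. marks B j k.  All clocks, all marks and
   the background process J are mutually independent. *)
Record network (R : realType) (L d : nat) (t : R)
    (lam : 'I_d.+1 -> R) (mu : 'I_d.+1 -> probability (borelV R L) R)
    (r : 'I_d.+1 -> 'M[R]_L) (Q : 'M[R]_d.+1) (j0 : 'I_d.+1) (c : R)
    (dO : measure_display) (Om : measurableType dO) (P : probability Om R)
    (J : {mfun Om >-> bpath d t})
    (E : 'I_d.+1 -> nat -> {mfun Om >-> R})
    (B : 'I_d.+1 -> nat -> {mfun Om >-> borelV R L})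
    (X : R -> {mfun Om >-> borelV R L}) : Prop := Network {
  network_ctmc : ctmc Q j0 P J ;
  network_gap : forall j k (U : set R), measurable U ->
    P (E j k @^-1` U) = exponential_prob (c * lam j) U ;
  network_job : forall j k (U : set (borelV R L)), measurable U ->
    P (B j k @^-1` U) = mu j U ;
  network_indep : forall (N : nat) (F : set (bpath d t))
      (U : 'I_d.+1 -> 'I_N -> set R) (W : 'I_d.+1 -> 'I_N -> set (borelV R L)),
    measurable F ->
    (forall j k, measurable (U j k)) -> (forall j k, measurable (W j k)) ->
    P [set w | F (J w) /\ forall j k, U j k (E j k w) /\ W j k (B j k w)]
      = (P (J @^-1` F) *
         \big[mule/1]_(j < d.+1) \big[mule/1]_(k < N)
           (P (E j k @^-1` U j k) * P (B j k @^-1` W j k)))%E ;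
  network_storage : {ae P, forall w,
    storage_path r (J w) (fun j k => \sum_(m < k.+1) E j m w)
      (fun j k => B j k w) (fun s => X s w)} }.

(* kap f is the law with moment generating function Mf f exponentially twisted
   by ths f. *)
Definition twisted_kernel (R : realType) (L d : nat) (t : R)
    (lam : 'I_d.+1 -> R) (mu : 'I_d.+1 -> probability (borelV R L) R)
    (r : 'I_d.+1 -> 'M[R]_L) (ths : bpath d t -> 'cV[R]_L)
    (kap : R.-pker (bpath d t) ~> borelV R L) : Prop :=
  forall f th, mgf (kap f) th =
    (Mf lam mu r f (th + ths f)%R / Mf lam mu r f (ths f))%E.

(* Importance sampling: under QQ the path JQ has the law of J under P and,
   conditionally on JQ, the n vectors V i are i.i.d. with law kap JQ. *)
Record sampling (R : realType) (L d : nat) (t : R) (n : nat)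
    (dO : measure_display) (Om : measurableType dO) (P : probability Om R)
    (J : {mfun Om >-> bpath d t})
    (kap : R.-pker (bpath d t) ~> borelV R L)
    (dO' : measure_display) (Om' : measurableType dO') (QQ : probability Om' R)
    (JQ : {mfun Om' >-> bpath d t})
    (V : 'I_n -> {mfun Om' >-> borelV R L}) : Prop := Sampling {
  sampling_path : forall F : set (bpath d t), measurable F ->
    QQ (JQ @^-1` F) = P (J @^-1` F) ;
  sampling_vectors : forall (F : set (bpath d t))
      (W : 'I_n -> set (borelV R L)),
    measurable F -> (forall i, measurable (W i)) ->
    QQ [set w | F (JQ w) /\ forall i, W i (V i w)]
      = (\int[QQ]_(w in JQ @^-1` F) \big[mule/1]_(i < n) kap (JQ w) (W i))%E }.

Section Estimator.
Context {R : realType} {L d : nat} {t : R}.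
Variables (lam : 'I_d.+1 -> R) (mu : 'I_d.+1 -> probability (borelV R L) R)
  (r : 'I_d.+1 -> 'M[R]_L) (ths : bpath d t -> 'cV[R]_L) (a : 'rV[R]_L).
Context {n : nat} {Om : Type}.
Variables (J : Om -> bpath d t) (V : 'I_n -> Om -> borelV R L).

Definition sum_vectors (w : Om) : 'rV[R]_L := \sum_(i < n) (V i w : 'rV[R]_L).

Definition likelihood_ratio (w : Om) : R :=
  expR (- inner (ths (J w)) (sum_vectors w)
        + n%:R * fine (lne (Mf lam mu r (J w) (ths (J w))))).

(* The storage vector is a sum of n terms, so it is its average over n that is
   compared with a. *)
Definition rare_event : set Om :=
  [set w | orthant a (n%:R^-1 *: sum_vectors w)].

Definition rare_indicator (w : Om) : R := \1_rare_event w.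

End Estimator.

(* Main.v *)
Require Import Defs.
From HB Require Import structures.
From mathcomp Require Import all_boot all_order all_algebra.
From mathcomp Require Import all_classical all_reals all_analysis.
From mathcomp Require Import measurable_realfun ring lra.
Import Order.TTheory GRing.Theory Num.Theory.
Import numFieldNormedType.Exports.
Local Open Scope classical_set_scope.
Local Open Scope ring_scope.

(** Given the background path [f], the storage is a compound Poisson sum: each
    job that arrives at time [u] reaches the horizon multiplied by the flow from
    [u] on, so [log (Mf f th)] is the integral of [exp <th, y> - 1] against the
    measure [path_levy f] of the delivered jobs. That this describes the
    dynamics is [network_laplace]: a storage path is the sum of the delivered
    jobs ([storage_pathE]), and the Poisson clocks are integrated out ring by
    ring ([clock_elimination]), which leads to an equation whose solution is the
    exponential of a primitive ([thinning_void_fixpoint]). On the sampling side,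
    the sum of the twisted vectors has a convolution power as its law given [f]
    ([sampling_sum]); undoing the twist gives the same Laplace transform, and
    [laplace_unique] identifies the two laws on orthants. Hence [rare_prob],
    [sampling_mean] and [sampling_second_moment] express everything as averages
    over [f] of quantities of the twisted law of [f].

    Upper bounds. Optimality of [bs f] and [ths f] forces, almost surely on the
    rare event, [<ths f, y> >= n <ths f, bs f>] ([twisted_complementarity]), so
    the likelihood ratio is at most [exp (- n rate_of f)] there. With [rho] the
    infimum of the rates, the probability is at most [exp (- n rho)] and the
    second moment at most [exp (- 2 n rho)].

    Lower bound. For a nearly optimal path [g], a slight perturbation of
    [ths g], penalised and truncated, tilts the jumps so that their mean is
    nearly [bs g] ([near_optimal_tilt]); a Chernoff bound for the tilted Poisson
    sum then gives [exp (- n (rate_of g + e))] at [g] ([path_prob_lower],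
    [good_exists]). The conditions on the path are open ([good_open]) and the
    chain follows [g] closely with positive probability whatever its initial
    state ([neighborhood_pos]); Fatou's lemma ([integral_diverges]) concludes.
    The second moment is bounded below by the square of the mean.

    Number of runs. The variance is at most the second moment and at least the
    squared mean times the probability that the rare event fails. Under the
    twisted law that probability decays more slowly than any exponential
    ([escape_prob]). Indeed the rate is positive, as the mean lies off the
    orthant ([rate_of_gt0]), so reducing the optimal tilt by a small factor gains
    something exponential ([gap_gt0]) at a small cost ([gap_le]). *)

Set Implicit Arguments.
Unset Strict Implicit.
Unset Printing Implicit Defensive.

(** * Matrix exponentials of generators *)

Module Expmx.
Lemma is_derive_continuous (R : realType) (f : R -> R) (x df : R) :
  is_derive x (1 : R) f df -> {for x, continuous f}.
Proof.
by case=> df1 _; apply: differentiable_continuous; exact/derivable1_diffP.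
Qed.

Section Expmx.
Context {R : realType} {k : nat}.
Implicit Types (M N : 'M[R]_k) (s u : R).

Local Notation mxpow M m := (iter m (mulmx M) 1%:M).

Definition entry_sum M : R := \sum_i \sum_j `|M i j|.

Lemma entry_sum_ge0 M : 0 <= entry_sum M.
Proof. by apply: sumr_ge0 => i _; apply: sumr_ge0. Qed.

Lemma le_entry_sum M i : \sum_j `|M i j| <= entry_sum M.
Proof.
rewrite /entry_sum [leRHS](bigD1 i)//= lerDl.
by apply: sumr_ge0 => i' _; apply: sumr_ge0.
Qed.

Lemma mxpow_bound M m i j : `|(mxpow M m) i j| <= entry_sum M ^+ m.
Proof.
elim: m i j => [|m IH] i j /=.
  by rewrite mxE expr0; case: (i == j); rewrite ?normr1 ?normr0.
rewrite mxE (le_trans (ler_norm_sum _ _ _))// exprS.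
rewrite (le_trans (y := \sum_l `|M i l| * entry_sum M ^+ m))//.
  by apply: ler_sum => l _; rewrite normrM ler_wpM2l.
by rewrite -mulr_suml ler_wpM2r ?exprn_ge0 ?entry_sum_ge0// le_entry_sum.
Qed.

Lemma mxpowC M m : mxpow M m *m M = M *m mxpow M m.
Proof. by elim: m => [|m IH] /=; rewrite ?mul1mx ?mulmx1// -mulmxA IH. Qed.

Lemma mxpowZ M s m : mxpow (s *: M) m = s ^+ m *: mxpow M m.
Proof.
elim: m => [|m IH] /=; first by rewrite expr0 scale1r.
by rewrite IH -scalemxAl -scalemxAr scalerA exprS.
Qed.

Let coef M i j (m : nat) : R := m`!%:R^-1 * (mxpow M m) i j.

Let expmx_pseries M s i j : expmx (s *: M) i j = limn (pseries (coef M i j) s).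
Proof.
rewrite /expmx mxE; congr (limn _); apply/funext => N.
rewrite /pseries /series /= big_mkord; apply: eq_bigr => m _.
by rewrite mxpowZ mxE /coef mulrCA mulrC.
Qed.

Lemma cvg_series_fact_bound (c : nat -> R) (a C K : R) : 0 <= a -> 0 <= C ->
  (forall m, `|c m| <= a * C ^+ m * m`!%:R^-1) -> cvgn (pseries c K).
Proof.
move=> a0 C0 Hc; apply: normed_cvg.
apply: (@series_le_cvg _ _ (fun m => a * exp_coeff (C * `|K|) m)).
- by move=> m; rewrite normr_ge0.
- move=> m; by rewrite mulr_ge0// exp_coeff_ge0// mulr_ge0.
- move=> m /=; rewrite normrM normrX.
  rewrite [leRHS](_ : _ = a * C ^+ m * m`!%:R^-1 * `|K| ^+ m); last first.
    by rewrite /exp_coeff/= exprMn -!mulrA; congr (_ * (_ * _)); rewrite mulrC.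
  by rewrite ler_wpM2r ?exprn_ge0.
- have -> : series (fun m => a * exp_coeff (C * `|K|) m) = a *: series (exp_coeff (C * `|K|)).
    by apply/funext => n; rewrite /series /= -mulr_sumr.
  by apply: is_cvgZr; exact: is_cvg_series_exp_coeff.
Qed.

Let cvg_coef M i j K : cvgn (pseries (coef M i j) K).
Proof.
apply: (@cvg_series_fact_bound _ 1 (entry_sum M)); rewrite ?ler01 ?entry_sum_ge0//.
move=> m; rewrite mul1r normrM mulrC (@ger0_norm _ (_^-1)) ?invr_ge0// ler_wpM2r ?invr_ge0//.
exact: mxpow_bound.
Qed.

Let diffs_coef M i j : pseries_diffs (coef M i j) =
  fun m => m`!%:R^-1 * (mxpow M m.+1) i j.
Proof.
apply/funext => m; rewrite /pseries_diffs /coef mulrA factS natrM invfM mulVKf//.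
Qed.

Let diffs2_coef M i j : pseries_diffs (pseries_diffs (coef M i j)) =
  fun m => m`!%:R^-1 * (mxpow M m.+2) i j.
Proof.
by rewrite diffs_coef; apply/funext => m; rewrite /pseries_diffs /= mulrA factS natrM invfM mulVKf.
Qed.

Let cvg_mxpow_shift M i j n K :
  cvgn (pseries (fun m => m`!%:R^-1 * (mxpow M (n + m)) i j) K).
Proof.
apply: (@cvg_series_fact_bound _ (entry_sum M ^+ n) (entry_sum M)); rewrite ?exprn_ge0 ?entry_sum_ge0//.
move=> m; rewrite -exprD normrM mulrC (@ger0_norm _ (_^-1)) ?invr_ge0// ler_wpM2r ?invr_ge0//.
exact: mxpow_bound.
Qed.

Let mulmx_expmx_lim M s i j : (M *m expmx (s *: M)) i j =
  limn (pseries (fun m => m`!%:R^-1 * (mxpow M m.+1) i j) s).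
Proof.
rewrite mxE; apply/esym/cvg_lim => //.
under [X in _ --> X]eq_bigr do rewrite expmx_pseries.
rewrite (_ : pseries (fun m => m`!%:R^-1 * (mxpow M m.+1) i j) s =
    fun n => \sum_l M i l * pseries (coef M l j) s n); last first.
  apply/funext => n; rewrite /pseries /series /=.
  under [RHS]eq_bigr do rewrite mulr_sumr.
  rewrite exchange_big /=; apply: eq_bigr => m _.
  rewrite mxE mulr_sumr mulr_suml; apply: eq_bigr => l _.
  by rewrite /coef mulrCA !mulrA.
apply: cvg_big => [|l _]; first exact: add_continuous.
by apply: cvgM; [exact: cvg_cst|exact: cvg_coef].
Qed.

Let expmx_mulmx_lim M s i j : (expmx (s *: M) *m M) i j =
  limn (pseries (fun m => m`!%:R^-1 * (mxpow M m.+1) i j) s).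
Proof.
rewrite mxE; apply/esym/cvg_lim => //.
under [X in _ --> X]eq_bigr do rewrite expmx_pseries.
rewrite (_ : pseries (fun m => m`!%:R^-1 * (mxpow M m.+1) i j) s =
    fun n => \sum_l pseries (coef M i l) s n * M l j); last first.
  apply/funext => n; rewrite /pseries /series /=.
  under [RHS]eq_bigr do rewrite mulr_suml.
  rewrite exchange_big /=; apply: eq_bigr => m _.
  rewrite -mxpowC mxE mulr_sumr mulr_suml; apply: eq_bigr => l _.
  by rewrite /coef -!mulrA; congr (_ * (_ * _)); rewrite mulrC.
apply: cvg_big => [|l _]; first exact: add_continuous.
by apply: cvgM; [exact: cvg_coef|exact: cvg_cst].
Qed.

Lemma expmxC M s : expmx (s *: M) *m M = M *m expmx (s *: M).
Proof. by apply/matrixP => i j; rewrite expmx_mulmx_lim mulmx_expmx_lim. Qed.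

Lemma is_derive_expmx M i j s :
  is_derive s (1 : R) (fun v => expmx (v *: M) i j) ((M *m expmx (s *: M)) i j).
Proof.
have -> : (fun v => expmx (v *: M) i j) = (fun v => limn (pseries (coef M i j) v)).
  by apply/funext => v; rewrite expmx_pseries.
have -> : (M *m expmx (s *: M)) i j = limn (pseries (pseries_diffs (coef M i j)) s).
  by rewrite diffs_coef mulmx_expmx_lim.
apply: (@pseries_snd_diffs _ _ (`|s| + 1)).
- exact: cvg_coef.
- rewrite diffs_coef [X in pseries X](_ : _ = (fun m => m`!%:R^-1 * (mxpow M (1 + m)) i j)); last exact/funext.
  exact: cvg_mxpow_shift.
- rewrite diffs2_coef [X in pseries X](_ : _ = (fun m => m`!%:R^-1 * (mxpow M (2 + m)) i j)); last exact/funext.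
  exact: cvg_mxpow_shift.
- by rewrite [ltRHS]ger0_norm ?ltrDl// addr_ge0.
Qed.

Lemma expmx0 : expmx (0 : 'M[R]_k) = 1%:M.
Proof.
apply/matrixP => i j; rewrite mxE; apply: lim_near_cst => //.
near=> N; rewrite -[N]prednK; last by near: N; exact: nbhs_infty_gt.
rewrite big_ord_recl /= fact0 invr1 mul1r big1 ?addr0// => m _.
by rewrite /= mul0mx mxE mulr0.
Unshelve. all: by end_near. Qed.

Lemma is_derive_mulmx (F G : R -> 'M[R]_k) (F' G' : 'M[R]_k) s i j :
  (forall i j, is_derive s (1 : R) (fun v => F v i j) (F' i j)) ->
  (forall i j, is_derive s (1 : R) (fun v => G v i j) (G' i j)) ->
  is_derive s (1 : R) (fun v => (F v *m G v) i j) ((F' *m G s + F s *m G') i j).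
Proof.
move=> HF HG.
have -> : (fun v => (F v *m G v) i j) = \sum_l ((fun v => F v i l) * (fun v => G v l j)).
  by apply/funext => v; rewrite mxE fct_sumE.
rewrite !mxE -big_split /=.
apply: is_derive_sum => l.
have H := @is_deriveM _ _ (fun v => F v i l) (fun v => G v l j) s 1 _ _ (HF i l) (HG l j).
apply: (is_derive_eq H).
by rewrite addrC; congr (_ + _); exact: mulrC.
Qed.

Lemma is_derive0_mx_cst (F : R -> 'M[R]_k) :
  (forall s i j, is_derive s (1 : R) (fun v => F v i j) 0) -> forall s u, F s = F u.
Proof. by move=> H s u; apply/matrixP => i j; apply: (@is_derive_0_is_cst _ (fun v => F v i j)) => x; exact: H. Qed.

Lemma is_derive_expmx_affine M (a b s : R) i j :
  is_derive s (1 : R) (fun v => expmx ((a + b * v) *: M) i j)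
    ((b *: (M *m expmx ((a + b * s) *: M))) i j).
Proof.
have H : is_derive s (1 : R) (fun v : R => a + b * v) b.
  apply: is_derive_eq; rewrite add0r.
  by rewrite mul1r /GRing.scale/= mulr1.
have := @is_derive1_comp _ (fun v => expmx (v *: M) i j) (fun v => a + b * v) s _ _ (is_derive_expmx M i j (a + b * s)) H.
by rewrite [X in _ -> is_derive _ _ _ X]mxE mulrC.
Qed.

(** Both sides solve [F' = M F]; multiplying by the exponential of [- M] turns
    this into a vanishing derivative. *)
Lemma expmx_unique M (F : R -> 'M[R]_k) : F 0 = 1%:M ->
  (forall s i j, is_derive s (1 : R) (fun v => F v i j) ((M *m F s) i j)) ->
  forall s, F s = expmx (s *: M).
Proof.
move=> F0 HF s.
pose K v := expmx ((s + (-1) * v) *: M) *m F v.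
have HK v u : K v = K u.
  apply: is_derive0_mx_cst => {v u} v i j.
  have H := is_derive_mulmx i j (fun i j => is_derive_expmx_affine M s (-1) v i j) (HF v).
  apply: (is_derive_eq H).
  by rewrite -expmxC scaleN1r mulNmx mulmxA addNr mxE.
have := HK s 0.
by rewrite /K mulN1r subrr scale0r expmx0 mul1mx mulr0 addr0 F0 mulmx1.
Qed.

Lemma expmxD M s u : expmx ((s + u) *: M) = expmx (s *: M) *m expmx (u *: M).
Proof.
pose K v := expmx ((s + u + (-1) * v) *: M) *m expmx ((0 + 1 * v) *: M).
have HK v w : K v = K w.
  apply: is_derive0_mx_cst => {v w} v i j.
  have H := is_derive_mulmx i j (fun i j => is_derive_expmx_affine M (s + u) (-1) v i j)
    (fun i j => is_derive_expmx_affine M 0 1 v i j).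
  apply: (is_derive_eq H).
  by rewrite scale1r scaleN1r mulNmx -expmxC -!mulmxA addNr mxE.
have := HK 0 u.
rewrite /K !mulr0 !addr0 scale0r expmx0 mulmx1 => ->.
by rewrite mulN1r addrK mul1r add0r.
Qed.

Lemma expmx_ge_term M s m i j : (forall i j, 0 <= M i j) -> 0 <= s ->
  s ^+ m * m`!%:R^-1 * (mxpow M m) i j <= expmx (s *: M) i j.
Proof.
move=> M0 s0; rewrite expmx_pseries.
have pw0 n i' j' : 0 <= (mxpow M n) i' j'.
  elim: n i' j' => [|n IH] i' j' /=; rewrite mxE; first by case: (i' == j').
  by apply: sumr_ge0 => l _; rewrite mulr_ge0.
apply: limr_ge; first exact: cvg_coef.
near=> n; rewrite /pseries /series /= big_mkord.
have mn : (m < n)%N by near: n; exact: nbhs_infty_gt.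
rewrite (bigD1 (Ordinal mn))//= /coef [X in _ <= X + _](_ : _ = s ^+ m / m`!%:R * (mxpow M m) i j); last first.
  by rewrite mulrC mulrA.
rewrite lerDl; apply: sumr_ge0 => l _.
by rewrite !mulr_ge0// ?invr_ge0// exprn_ge0.
Unshelve. all: by end_near. Qed.

Lemma expmx_ge0 M s i j : (forall i j, 0 <= M i j) -> 0 <= s ->
  0 <= expmx (s *: M) i j.
Proof.
move=> M0 s0; apply: le_trans (@expmx_ge_term M s 0 i j M0 s0).
by rewrite expr0 mul1r mxE fact0 invr1 mul1r; case: (i == j).
Qed.

(** Adding a multiple of the identity makes the entries of a Metzler matrix
    non-negative, so that its exponential series can be bounded termwise. *)
Lemma expmx_shift M c s :
  expmx (s *: M) = expR (- c * s) *: expmx (s *: (c%:M + M)).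
Proof.
pose F v := expR (- c * v) *: expmx (v *: (c%:M + M)).
rewrite -/(F s); apply/esym.
move: s; apply: expmx_unique; first by rewrite /F mulr0 expR0 scale1r scale0r expmx0.
move=> v i j.
have -> : (fun v => F v i j) =
    (fun v => expR (- c * v)) * (fun v => expmx (v *: (c%:M + M)) i j).
  by apply/funext => w; rewrite /F mxE.
have H : is_derive v (1 : R) (fun v : R => - c * v) (- c).
  by apply: is_derive_eq; rewrite /GRing.scale/= mulr1.
have H1 := @is_derive1_comp _ expR (fun v => - c * v) v _ _ (is_derive_expR (- c * v)) H.
have H2 := @is_deriveM _ _ (expR \o (fun v => - c * v)) (fun v => expmx (v *: (c%:M + M)) i j) v 1 _ _ H1 (is_derive_expmx (c%:M + M) i j v).
apply: (is_derive_eq H2).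
rewrite /F -scalemxAr mulmxDl mul_scalar_mx !mxE /GRing.scale/=.
by ring.
Qed.

Lemma entry_shift_ge0 M : (forall i j, i != j -> 0 <= M i j) ->
  forall i j, 0 <= ((entry_sum M)%:M + M) i j.
Proof.
move=> M0 i j; rewrite !mxE.
case: (eqVneq i j) => [<-|ij]; last by rewrite mulr0n add0r M0.
rewrite mulr1n -lerBlDr sub0r (le_trans _ (le_entry_sum M i))//.
rewrite (bigD1 i)//= (le_trans (ler_norm _))// normrN lerDl.
exact: sumr_ge0.
Qed.

Lemma expmx_metzler_ge0 M s i j : (forall i j, i != j -> 0 <= M i j) ->
  0 <= s -> 0 <= expmx (s *: M) i j.
Proof.
move=> M0 s0; rewrite (expmx_shift _ (entry_sum M)) mxE mulr_ge0 ?expR_ge0//.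
by apply: expmx_ge0 => //; exact: entry_shift_ge0.
Qed.

Lemma expmx_metzler_diag M s i : (forall i j, i != j -> 0 <= M i j) ->
  0 <= s -> expR (- entry_sum M * s) <= expmx (s *: M) i i.
Proof.
move=> M0 s0; rewrite (expmx_shift _ (entry_sum M)) mxE ler_peMr ?expR_ge0//.
apply: le_trans (@expmx_ge_term _ s 0 i i (entry_shift_ge0 M0) s0).
by rewrite expr0 mxE eqxx invr1 !mulr1.
Qed.

(** A step along an edge of the graph has positive probability in half of the
    time; the semigroup property chains the steps. *)
Lemma expmx_irreducible_gt0 M s i j : (forall i j, i != j -> 0 <= M i j) ->
  connect [rel u v | (u != v) && (0 < M u v)] i j -> 0 < s ->
  0 < expmx (s *: M) i j.
Proof.
move=> M0 /connectP[p + ->].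
elim: p i s => [|l p IH] i s /=.
  by move=> _ s0; rewrite (lt_le_trans _ (expmx_metzler_diag i M0 (ltW s0)))// expR_gt0.
move=> /andP[/andP[il Mil] lp] s0.
rewrite (splitr s) expmxD mxE (bigD1 l)//=.
have s20 : 0 < s / 2 by rewrite divr_gt0.
apply: ltr_pwDl; last first.
  by apply: sumr_ge0 => m _; rewrite mulr_ge0// expmx_metzler_ge0// ltW.
rewrite mulr_gt0 ?IH// (expmx_shift _ (entry_sum M)) mxE mulr_gt0 ?expR_gt0//.
apply: lt_le_trans (@expmx_ge_term _ (s / 2) 1 i l (entry_shift_ge0 M0) (ltW s20)).
rewrite expr1 invr1 mulr1 mulr_gt0//= mulmx1 !mxE (negbTE il) mulr0n add0r.
by rewrite Mil.
Qed.

Lemma is_derive_sum_row M s i :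
  is_derive s (1 : R) (fun v => \sum_j expmx (v *: M) i j)
    (\sum_l expmx (s *: M) i l * \sum_j M l j).
Proof.
have -> : (fun v => \sum_j expmx (v *: M) i j) =
    \sum_j (fun v => expmx (v *: M) i j).
  by apply/funext => v; rewrite fct_sumE.
under [X in is_derive _ _ _ X]eq_bigr do rewrite mulr_sumr.
rewrite exchange_big /=; apply: is_derive_sum => j.
by have := is_derive_expmx M i j s; rewrite -expmxC mxE.
Qed.

(** The row sums have a non-positive derivative. *)
Lemma expmx_row_sum_le1 M s i : (forall i j, i != j -> 0 <= M i j) ->
  (forall i, \sum_j M i j <= 0) -> 0 <= s -> \sum_j expmx (s *: M) i j <= 1.
Proof.
move=> M0 M1 s0.
have [||x /[!in_itv]/= /andP[x0 _]] // := @MVT_segment _ (fun v => \sum_j expmx (v *: M) i j)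
  (fun s => \sum_l expmx (s *: M) i l * \sum_j M l j) 0 s s0.
- by move=> x _; exact: is_derive_sum_row.
- apply: continuous_subspaceT => x; exact: is_derive_continuous (is_derive_sum_row M x i).
rewrite [X in _ - X](_ : _ = 1); last first.
  rewrite scale0r expmx0 (bigD1 i)//= mxE eqxx big1 ?addr0// => j ji.
  by rewrite mxE eq_sym (negbTE ji).
move=> /eqP; rewrite subr_eq => /eqP ->; rewrite gerDr mulr_le0_ge0 ?subr0//.
apply: sumr_le0 => l _; rewrite mulr_ge0_le0// expmx_metzler_ge0//.
Qed.

Lemma expmx_lip M s i j : (forall i j, i != j -> 0 <= M i j) ->
  (forall i, \sum_j M i j <= 0) -> 0 <= s ->
  `|expmx (s *: M) i j - (i == j)%:R| <= entry_sum M * s.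
Proof.
move=> M0 M1 s0.
have [||x /[!in_itv]/= /andP[x0 _]] // := @MVT_segment _ (fun v => expmx (v *: M) i j)
  (fun s => (M *m expmx (s *: M)) i j) 0 s s0.
- by move=> x _; exact: is_derive_expmx.
- apply: continuous_subspaceT => x; exact: is_derive_continuous (is_derive_expmx M i j x).
rewrite subr0 scale0r expmx0 [X in _ - X]mxE => ->.
rewrite normrM (ger0_norm s0) ler_wpM2r// mxE (le_trans (ler_norm_sum _ _ _))//.
apply: le_trans (le_entry_sum M i); apply: ler_sum => l _.
rewrite normrM ler_piMr// ger0_norm ?expmx_metzler_ge0//.
apply: le_trans (expmx_row_sum_le1 l M0 M1 x0); rewrite (bigD1 j)//= lerDl.
by apply: sumr_ge0 => l' _; rewrite expmx_metzler_ge0.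
Qed.

End Expmx.

End Expmx.
Export Expmx.

(** * Borel structure of vectors *)

Module Borel.
Lemma countable_bigcup_measurable d (X : measurableType d) (I : countType)
    (P : set I) (F : I -> set X) :
  (forall i, P i -> measurable (F i)) -> measurable (\bigcup_(i in P) F i).
Proof.
move=> mF.
have -> : \bigcup_(i in P) F i =
    \bigcup_n (if unpickle n is Some i then [set x | P i /\ F i x] else set0).
  apply/seteqP; split => [x [i Pi Fix]|x [n _]].
    by exists (pickle i) => //; rewrite pickleK.
  by case: unpickle => // i [Pi Fix]; exists i.
apply: bigcupT_measurable => n; case: unpickle => // i.
have [Pi|nPi] := pselect (P i).
  by rewrite (_ : [set x | _] = F i); [exact: mF|apply/seteqP; split => x //= []].
by rewrite (_ : [set x | _] = set0)//; apply/seteqP; split => x //= [].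
Qed.

Section Borel.
Context {R : realType} {L : nat}.
Local Notation T := (borelV R L).

Lemma borelV_measurableE : @measurable _ T = <<s @open 'rV[R]_L >>.
Proof. by []. Qed.

Lemma measurable_coordV (l : 'I_L) :
  measurable_fun setT (fun y : T => (y : 'rV[R]_L) ord0 l).
Proof.
apply: (measurability _ (RGenOInfty.measurableE R)) => /= _ [_ [x ->] <-].
rewrite setTI; apply: sub_sigma_algebra.
apply: (@open_comp _ _ (fun y : 'rV[R]_L => y ord0 l)); last exact: rray_open.
by move=> y _; exact: coord_continuous.
Qed.

(** An open set is a countable union of boxes with rational ends, and a box is
    an intersection of conditions on the coordinates. *)
Lemma measurable_to_borelV d (X : measurableType d) (D : set X) (f : X -> T) :
  measurable D ->
  (forall l, measurable_fun D (fun x => (f x : 'rV[R]_L) ord0 l)) ->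
  measurable_fun D f.
Proof.
move=> mD mf; apply: (measurability _ borelV_measurableE) => _ [U oU <-].
pose box (q : 'rV[rat]_L * rat) : set 'rV[R]_L :=
  [set y | forall l, `|y ord0 l - ratr (q.1 ord0 l)| < ratr q.2].
have -> : U = \bigcup_(q in [set q | box q `<=` U]) box q.
  rewrite eqEsubset; split => [y Uy|y [q /= qU qy]]; last exact: qU.
  have /nbhs_ballP[e /= e0 eU] : nbhs y U by exact: open_nbhs_nbhs.
  have e20 : 0 < e / 2 by rewrite divr_gt0.
  have [r] := rat_in_itvoo e20; rewrite in_itv /= => /andP[r0 re].
  have /choice[q qP] : forall l, exists q : rat, `|y ord0 l - ratr q| < ratr r.
    move=> l; have [|q] := @rat_in_itvoo R (y ord0 l - ratr r) (y ord0 l + ratr r).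
      by lra.
    rewrite in_itv /= => /andP[q1 q2].
    by exists q; rewrite ltr_distl; apply/andP; split; lra.
  exists (\row_l q l, r) => [z zq|l]; last by rewrite mxE.
  apply: eU; split => // i l; rewrite !ord1.
  have := zq l; rewrite mxE /= => zl; rewrite /ball /=.
  have := ler_normB (y ord0 l - ratr (q l)) (z ord0 l - ratr (q l)).
  rewrite opprB addrA subrK => yz; apply: le_lt_trans yz _.
  by have := qP l; lra.
rewrite preimage_bigcup setI_bigcupr.
apply: countable_bigcup_measurable => q qU; rewrite /box.
have -> : D `&` f @^-1` [set y | forall l, `|y ord0 l - ratr (q.1 ord0 l)| < ratr q.2] =
  D `&` \bigcap_(l in [set: 'I_L])
     (D `&` (fun x => `|(f x : 'rV[R]_L) ord0 l - ratr (q.1 ord0 l)|) @^-1` `]-oo, ratr q.2[ ).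
  apply/seteqP; split => [x [Dx fx]|x [Dx fx]]; split => //.
    by move=> l _; split => //=; rewrite in_itv /=; exact: fx.
  by move=> l; have [_ /=] := fx l I; rewrite in_itv.
apply: measurableI => //; apply: fin_bigcap_measurable; first exact: finite_finset.
 move=> l _; apply: (measurableT_comp (@normr_measurable R setT)) => //.
exact: measurable_funB.
Qed.

Lemma measurable_addV :
  measurable_fun setT (fun p : T * T => ((p.1 : 'rV[R]_L) + p.2 : 'rV[R]_L) : T).
Proof.
apply: measurable_to_borelV => // l.
under eq_fun do rewrite mxE.
apply: measurable_funD.
- exact: (measurableT_comp (measurable_coordV l) measurable_fst).
- exact: (measurableT_comp (measurable_coordV l) measurable_snd).
Qed.

Lemma measurable_inner (th : 'cV[R]_L) : measurable_fun setT (fun y : T => inner th y).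
Proof.
rewrite /inner; apply: measurable_sum => l; apply: measurable_funM => //.
exact: measurable_coordV.
Qed.

Lemma measurable_expinner (th : 'cV[R]_L) :
  measurable_fun setT (fun y : T => (expR (inner th y))%:E).
Proof.
apply/measurable_EFinP; apply: measurableT_comp => //; exact: measurable_inner.
Qed.

Lemma measurable_orthant (a : 'rV[R]_L) : measurable (orthant a : set T).
Proof.
have -> : (orthant a : set T) = \bigcap_(l in [set: 'I_L])
    ((fun y : T => (y : 'rV[R]_L) ord0 l) @^-1` `[a ord0 l, +oo[ ).
  apply/seteqP; split => [y ay l _ /=|y ay l]; first by rewrite in_itv /= andbT; exact: ay.
  by have /= := ay l I; rewrite in_itv/= andbT.
apply: fin_bigcap_measurable; first exact: finite_finset.
 move=> l _; rewrite -[X in measurable X]setTI.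
by apply: (measurable_coordV l).
Qed.

End Borel.

End Borel.
Export Borel.

(** * Freezing independent variables *)

Module Freeze.
Local Open Scope ereal_scope.

Section PushMeasure.
Context d1 d2 (T1 : measurableType d1) (T2 : measurableType d2) (R : realType).
Variables (m : {measure set T1 -> \bar R}) (f : T1 -> T2).
Hypothesis mf : measurable_fun setT f.

Definition push_measure : {measure set T2 -> \bar R} :=
  @measure_function.measure_function_pushforward__canonical__measure_function_Measure
    _ _ T1 T2 R m f mf.

Lemma push_measureE A : push_measure A = m (f @^-1` A).
Proof. by []. Qed.

Lemma ge0_integral_push (g : T2 -> \bar R) : measurable_fun setT g ->
  (forall y, 0 <= g y) -> \int[push_measure]_y g y = \int[m]_x g (f x).
Proof. by move=> mg g0; rewrite (ge0_integral_pushforward mf). Qed.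

End PushMeasure.

Section IntegralKernel.
Context d1 d2 (T1 : measurableType d1) (T2 : measurableType d2) (R : realType).
Variable kap : T1 -> {measure set T2 -> \bar R}.
Hypothesis mkap : forall W, measurable W -> measurable_fun setT (kap ^~ W).
Hypothesis kap1 : forall x, kap x setT = 1.

Definition proba_kernel : T1 -> {measure set T2 -> \bar R} := kap.

HB.instance Definition _ := isKernel.Build _ _ _ _ _ proba_kernel mkap.
HB.instance Definition _ := Kernel_isProbability.Build _ _ _ _ _ proba_kernel kap1.

Lemma measurable_integral_kernel (g : T1 * T2 -> \bar R) :
  (forall z, 0 <= g z) -> measurable_fun setT g ->
  measurable_fun setT (fun x => \int[kap x]_y g (x, y)).
Proof. exact: (@measurable_fun_integral_finite_kernel _ _ _ _ _ g proba_kernel). Qed.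

Lemma measurable_xsection_kernel U : measurable U ->
  measurable_fun setT (fun x => kap x (xsection U x)).
Proof.
by move=> mU; apply: (@measurable_fun_xsection_finite_kernel _ _ _ _ _ proba_kernel); rewrite inE.
Qed.

End IntegralKernel.

Section Disintegration.
Context d1 d2 (T1 : measurableType d1) (T2 : measurableType d2) (R : realType).
Variables (P : {measure set T1 -> \bar R}) (kap : T1 -> {measure set T2 -> \bar R}).
Hypothesis Pfin : P setT < +oo.
Hypothesis mkap : forall W, measurable W -> measurable_fun setT (kap ^~ W).
Hypothesis kap1 : forall x, kap x setT = 1.

Let pairk (p : T1 * T1) : {measure set (T1 * T2) -> \bar R} :=
  push_measure (kap p.2) (pair1_measurable p.2).

Let mpairk U : measurable U -> measurable_fun setT (pairk ^~ U).
Proof.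
move=> mU; rewrite (_ : pairk ^~ U = (fun x => kap x (xsection U x)) \o snd).
  by apply: measurableT_comp (measurable_xsection_kernel mkap kap1 mU) _.
apply/funext => p /=; rewrite /pairk push_measureE.
suff -> : pair p.2 @^-1` U = xsection U p.2 by [].
  by apply/seteqP; split => y; rewrite /xsection /= inE.
exact: pair1_measurable.
Qed.

Let pairk1 p : pairk p setT = 1.
Proof. by rewrite /pairk push_measureE preimage_setT kap1. Qed.

HB.instance Definition _ := isKernel.Build _ _ _ _ _ pairk mpairk.
HB.instance Definition _ := Kernel_isProbability.Build _ _ _ _ _ pairk pairk1.

Let cstk (x : T1) : {measure set T1 -> \bar R} := P.

Let mcstk U : measurable U -> measurable_fun setT (cstk ^~ U).
Proof. by move=> mU; exact: measurable_cst. Qed.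

Let cstk_fin : measure_fam_uub cstk.
Proof.
have Pf : P setT \is a fin_num by rewrite ge0_fin_numE.
by exists (fine (P setT) + 1)%R => x; rewrite /cstk EFinD fineK// lteDl ?lte_fin.
Qed.

HB.instance Definition _ := isKernel.Build _ _ _ _ _ cstk mcstk.
HB.instance Definition _ := Kernel_isFinite.Build _ _ _ _ _ cstk cstk_fin.

Let joint : {measure set (T1 * T2) -> \bar R} := mkcomp cstk pairk point.

Let integral_joint g : measurable_fun setT g -> (forall z, 0 <= g z) ->
  \int[joint]_z g z = \int[P]_x \int[kap x]_y g (x, y).
Proof.
move=> mg g0; rewrite integral_kcomp//.
by apply: eq_integral => x _; rewrite ge0_integral_push.
Qed.

(** Two finite measures on a product that agree on rectangles are equal. *)
Lemma disintegration (C : set (set T1)) (m : {measure set (T1 * T2) -> \bar R})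
    (g : T1 * T2 -> \bar R) :
  @measurable _ T1 = <<s C >> -> setI_closed C -> C setT ->
  (forall A W, C A -> measurable W -> m (A `*` W) = \int[P]_(x in A) kap x W) ->
  measurable_fun setT g -> (forall z, 0 <= g z) ->
  \int[m]_z g z = \int[P]_x \int[kap x]_y g (x, y).
Proof.
move=> CE CI CT mE mg g0; rewrite -integral_joint//.
have mC A : C A -> measurable A by rewrite CE; exact: sub_sigma_algebra.
apply: eq_measure_integral => U mU _.
apply: (measure_unique [set A `*` W | A in C & W in measurable] (fun=> setT)) => //.
- rewrite measurable_prod_measurableType; apply/seteqP; split; last first.
    apply: smallest_sub; first exact: smallest_sigma_algebra.
    move=> _ [A CA [W mW <-]]; apply: sub_sigma_algebra.
    by exists A; [exact: mC|exists W].
  apply: smallest_sub; first exact: smallest_sigma_algebra.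
  move=> _ [A mA [W mW <-]].
  have -> : A `*` W = (A `*` setT) `&` (setT `*` W) by rewrite -setXI setIT setTI.
  apply: (@measurableI _ (g_sigma_algebraType [set A `*` W | A in C & W in measurable])); last by apply: sub_sigma_algebra; exists setT => //; exists W.
  move: A mA; rewrite CE; apply: smallest_sub; last first.
    by move=> A CA; apply: sub_sigma_algebra; exists A => //; exists setT.
  split => /=.
  - by rewrite set0X; exact: sigma_algebra0.
  - move=> A mA; rewrite (_ : _ `*` _ = setT `\` (A `*` setT)); first exact: sigma_algebraCD.
    rewrite !setTD; apply/seteqP; split => [[x y] [nA _] [Ax _]|[x y] nA]; first exact: nA.
    by split => // Ax; exact: nA.
  - move=> F mF; rewrite (_ : _ `*` _ = \bigcup_i (F i `*` setT)); first exact: sigma_algebra_bigcup.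
    by apply/seteqP; split => [[x y] [[i _ Fi] _]|[x y] [i _ [Fi _]]]; [exists i|split => //; exists i].
- move=> _ _ [A CA [W mW <-]] [B CB [V mV <-]].
  exists (A `&` B); first exact: CI.
  by exists (W `&` V); [exact: measurableI|rewrite setXI].
- by move=> _; exists setT => //; exists setT => //; rewrite setXTT.
- by rewrite bigcup_const//; exists 0%N.
- move=> _ [A CA [W mW <-]]; rewrite mE// /joint /mkcomp /kcomp /= [LHS]integral_mkcond.
  apply: eq_integral => x _; rewrite /pairk push_measureE patchE /=.
  case: ifPn => [/set_mem xA|/negP nA].
    suff -> : pair x @^-1` (A `*` W) = W by [].
    by apply/seteqP; split => // y [].
  rewrite (_ : _ @^-1` _ = set0) ?measure0//.
  by rewrite -subset0 => y [/= Ax _]; apply: nA; rewrite inE.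
- move=> _; rewrite -setXTT mE// (eq_integral (cst 1)); last by move=> x _; exact: kap1.
  by rewrite integral_cst// mul1e.
Qed.

End Disintegration.

(** Conditional independence is only known on rectangles; it extends to all
    non-negative functions. *)
Lemma freezing d d2 (Om : measurableType d) (T2 : measurableType d2) (R : realType)
    (P : {measure set Om -> \bar R}) (C : set (set Om)) (Z : Om -> T2)
    (kap : g_sigma_algebraType C -> {measure set T2 -> \bar R})
    (g : g_sigma_algebraType C * T2 -> \bar R) :
  P setT < +oo ->
  (forall A, C A -> measurable A) -> setI_closed C -> C setT ->
  measurable_fun setT Z ->
  (forall W, measurable W -> measurable_fun setT (kap ^~ W)) ->
  (forall x, kap x setT = 1) ->
  (forall A W, C A -> measurable W ->
     P (A `&` Z @^-1` W) = \int[P]_(x in A) kap x W) ->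
  measurable_fun setT g -> (forall z, 0 <= g z) ->
  \int[P]_w g (w, Z w) = \int[P]_w \int[kap w]_y g (w, y).
Proof.
move=> Pfin mC CI CT mZ mkap kap1 PE mg g0.
have mid : measurable_fun setT (id : Om -> g_sigma_algebraType C).
  by apply: (@measurability _ _ Om (g_sigma_algebraType C) _ _ C) => // _ [A CA <-];
    rewrite setTI; exact: mC.
have mpair : measurable_fun setT (fun w => (w, Z w) : g_sigma_algebraType C * T2).
  exact: measurable_fun_pair.
have := @disintegration _ _ (g_sigma_algebraType C) T2 R (push_measure P mid) kap Pfin mkap kap1
  C (push_measure P mpair) g erefl CI CT.
rewrite (ge0_integral_push P mpair)// (ge0_integral_push P mid)//; first apply => //.
- move=> A W CA mW; rewrite push_measureE.
  transitivity (P (A `&` Z @^-1` W)); first by congr (P _).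
  rewrite PE// (ge0_integral_pushforward mid)//.
  + exact: sub_sigma_algebra.
  + by apply: measurable_funTS; exact: mkap.
- exact: measurable_integral_kernel.
- by move=> x; apply: integral_ge0.
Qed.

End Freeze.
Export Freeze.

(** * Convolution powers of a kernel *)

Module Conv.
Local Open Scope ereal_scope.

Section Density.
Import HBNNSimple.
Context d (X : measurableType d) (R : realType).
Variables (mu nu : {measure set X -> \bar R}) (p : X -> \bar R).
Hypotheses (mp : measurable_fun setT p) (p0 : forall x, 0 <= p x).
Hypothesis pfin : forall x, p x < +oo.
Hypothesis nuE : forall F, measurable F -> nu F = \int[mu]_(x in F) p x.

Let density_nnsfun (f : {nnsfun X >-> R}) :
  \int[nu]_x (f x)%:E = \int[mu]_x (p x * (f x)%:E).
Proof.
under eq_integral do rewrite fimfunE -fsumEFin//.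
rewrite ge0_integral_fsum//; last 2 first.
  - by move=> r; exact/measurable_EFinP/measurableT_comp.
  - by move=> r z _; rewrite EFinM nnfun_muleindic_ge0.
under [RHS]eq_integral.
  move=> x _; rewrite fimfunE -fsumEFin// ge0_mule_fsumr; last first.
    by move=> r; rewrite EFinM nnfun_muleindic_ge0.
  over.
rewrite ge0_integral_fsum//; last 2 first.
  - move=> r; apply: emeasurable_funM => //.
    by apply/measurable_EFinP/measurableT_comp.
  - by move=> r z _; rewrite mule_ge0// EFinM nnfun_muleindic_ge0.
apply: eq_fsbigr => r _.
have [r0|r0] := leP 0%R r; last first.
  rewrite !integral0_eq// => x _; rewrite preimage_nnfun0// indic0 ?mulr0 ?mule0//.
under eq_integral do rewrite EFinM.
rewrite ge0_integralZl//; last by apply/measurable_EFinP/measurable_indic.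
rewrite integral_indic// setIT nuE//.
under [RHS]eq_integral do rewrite EFinM muleCA.
rewrite ge0_integralZl//; last 2 first.
  - by apply: emeasurable_funM => //; apply/measurable_EFinP/measurable_indic.
  - by move=> x _; rewrite mule_ge0// lee_fin.
congr (_ * _); rewrite integral_mkcond; apply: eq_integral => x _.
by rewrite patchE indicE; case: (x \in _); rewrite ?mule1 ?mule0.
Qed.

Lemma density_integral (h : X -> \bar R) : measurable_fun setT h ->
  (forall x, 0 <= h x) -> \int[nu]_x h x = \int[mu]_x (p x * h x).
Proof.
move=> mh h0; pose f_ := nnsfun_approx measurableT mh.
transitivity (\int[nu]_z (lim ((f_ n z)%:E @[n --> \oo]))).
  by apply/eq_integral => z _; apply/esym/cvg_lim => //=; exact: cvg_nnsfun_approx.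
rewrite monotone_convergence//; last 3 first.
  by move=> n; exact/measurable_EFinP.
  by move=> n z _; rewrite lee_fin.
  by move=> z _ a b ab; rewrite lee_fin; exact/lefP/nd_nnsfun_approx.
under eq_fun do rewrite density_nnsfun.
rewrite -monotone_convergence//; last 3 first.
  by move=> n; apply: emeasurable_funM => //; exact/measurable_EFinP.
  by move=> n z _; rewrite mule_ge0// lee_fin.
  by move=> z _ a b ab; rewrite lee_wpmul2l// lee_fin; exact/lefP/nd_nnsfun_approx.
apply/eq_integral => z _; apply/cvg_lim => //.
by apply: cvgeZl; [rewrite ge0_fin_numE//|exact: cvg_nnsfun_approx].
Qed.

End Density.

Section Convolution.
Context {R : realType} {L : nat}.
Local Notation T := (borelV R L).

Definition addV (p : T * T) : T := ((p.1 : 'rV[R]_L) + (p.2 : 'rV[R]_L))%R.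

Definition zeroV : T := (0%R : 'rV[R]_L).

Section conv.
Variables m1 m2 : {finite_measure set T -> \bar R}.

Definition conv : set T -> \bar R := push_measure (m1 \x m2) measurable_addV.

HB.instance Definition _ := Measure.on conv.

Lemma integral_conv (g : T -> \bar R) : measurable_fun setT g ->
  (forall y, 0 <= g y) ->
  \int[conv]_y g y = \int[m1]_x \int[m2]_y g (addV (x, y)).
Proof.
move=> mg g0; rewrite ge0_integral_push//; last exact: measurable_addV.
rewrite (@fubini_tonelli1 _ _ _ _ _ m1 m2 (fun p => g (addV p)))//.
by apply: measurableT_comp => //; exact: measurable_addV.
Qed.

Let conv_fin : fin_num_fun conv.
Proof.
apply: lty_fin_num_fun; rewrite -[X in X < _]mul1e -integral_cst// integral_conv//.
under eq_integral do rewrite integral_cst// mul1e.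
by rewrite integral_cst// lte_mul_pinfty// -?ge0_fin_numE// fin_num_measure.
Qed.

HB.instance Definition _ := Measure_isFinite.Build _ _ _ conv conv_fin.

End conv.

Fixpoint cpow (m : {finite_measure set T -> \bar R}) (k : nat) :
    {finite_measure set T -> \bar R} :=
  if k is k'.+1 then conv m (cpow m k') else dirac zeroV.

Lemma integral_cpow0 m (g : T -> \bar R) : measurable_fun setT g ->
  \int[cpow m 0]_y g y = g zeroV.
Proof. by move=> mg; rewrite integral_dirac// diracT mul1e. Qed.

Lemma integral_cpowS m k (g : T -> \bar R) : measurable_fun setT g ->
  (forall y, 0 <= g y) ->
  \int[cpow m k.+1]_y g y = \int[m]_x \int[cpow m k]_y g (addV (x, y)).
Proof. exact: integral_conv. Qed.

Lemma mgf_addV (th : 'cV[R]_L) (x y : T) :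
  inner th (addV (x, y)) = (inner th x + inner th y)%R.
Proof.
by rewrite /inner -big_split /=; apply: eq_bigr => l _; rewrite mxE mulrDr.
Qed.

Lemma mgf_cpow m k (th : 'cV[R]_L) : mgf (cpow m k) th = mgf m th ^+ k.
Proof.
elim: k => [|k IH]; rewrite /mgf.
  rewrite integral_cpow0; last exact: measurable_expinner.
  by rewrite /inner big1 ?expR0// => l _; rewrite mxE mulr0.
rewrite integral_cpowS//; last exact: measurable_expinner.
under eq_integral.
  move=> x _; under eq_integral do rewrite mgf_addV expRD EFinM.
  rewrite ge0_integralZl//; last exact: measurable_expinner.
  over.
rewrite ge0_integralZr//; last 2 first.
- exact: measurable_expinner.
- by apply: integral_ge0 => y _; rewrite lee_fin expR_ge0.
by rewrite -/(mgf _ th) -/(mgf _ th) IH expeS.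
Qed.

End Convolution.

(** Iterating this operator averages over the sum of independent increments. *)
Section ConvKernel.
Context {R : realType} {L : nat} d (X : measurableType d).
Local Notation T := (borelV R L).
Variable kap : R.-pker X ~> T.

Definition kapf (f : X) : set T -> \bar R := kap f.
HB.instance Definition _ f := Measure.on (kapf f).
HB.instance Definition _ f := Measure_isFinite.Build _ _ _ (kapf f) (finite_kernel_measure kap f).

Definition convK (g : X * T -> \bar R) (p : X * T) : \bar R :=
  \int[kap p.1]_y g (p.1, addV (p.2, y)).

Let kap' (p : X * T) : {measure set T -> \bar R} := kap p.1.

Lemma measurable_convK g : measurable_fun setT g -> (forall z, 0 <= g z) ->
  measurable_fun setT (convK g).
Proof.
move=> mg g0.
apply: (@measurable_integral_kernel _ _ _ _ _ kap' _ _
    (fun q : X * T * T => g (q.1.1, addV (q.1.2, q.2)))) => //.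
- move=> W mW; apply: measurableT_comp (measurable_kernel kap W mW) _.
  exact: measurable_fst.
- by move=> p; exact: prob_kernel.
- apply: measurableT_comp => //; apply: measurable_fun_pair.
    by apply: measurableT_comp => //; exact: measurableT_comp.
  apply: (@measurableT_comp _ _ _ _ _ _ addV); first exact: measurable_addV.
  by apply: measurable_fun_pair => //; apply: measurableT_comp.
Qed.

Lemma convK_ge0 g : (forall z, 0 <= g z) -> forall z, 0 <= convK g z.
Proof. by move=> g0 z; apply: integral_ge0 => y _. Qed.

Lemma iter_convK n g : measurable_fun setT g -> (forall z, 0 <= g z) ->
  measurable_fun setT (iter n convK g) /\ (forall z, 0 <= iter n convK g z).
Proof.
move=> mg g0; elim: n => [|n [IH1 IH2]] //=.
by split; [exact: measurable_convK|exact: convK_ge0].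
Qed.

Lemma measurable_section (g : X * T -> \bar R) f z : measurable_fun setT g ->
  measurable_fun setT (fun y => g (f, addV (z, y))).
Proof.
move=> mg; apply: measurableT_comp => //; apply: measurable_fun_pair => //.
apply: (@measurableT_comp _ _ _ _ _ _ addV); first exact: measurable_addV.
exact: measurable_fun_pair.
Qed.

Lemma addV_assoc (x y z : T) : addV (x, addV (y, z)) = addV (addV (x, y), z).
Proof. by rewrite /addV /= addrA. Qed.

Lemma iter_convKE n g f z : measurable_fun setT g -> (forall z, 0 <= g z) ->
  iter n convK g (f, z) = \int[cpow (kapf f) n]_y g (f, addV (z, y)).
Proof.
move=> mg g0; elim: n z => [|n IH] z.
  rewrite integral_cpow0; last exact: measurable_section.
  by rewrite /= /addV /= addr0.
rewrite iterS integral_cpowS//; last exact: measurable_section.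
by rewrite /convK /=; apply: eq_integral => x _; rewrite IH; apply: eq_integral => y _; rewrite addV_assoc.
Qed.

End ConvKernel.

End Conv.
Export Conv.

(** * Sums of conditionally independent vectors *)

Module Sums.
Local Open Scope ereal_scope.

Lemma emeasurable_prode d (X : measurableType d) (R : realType) (I : Type)
    (s : seq I) (h : I -> X -> \bar R) :
  (forall i, measurable_fun setT (h i)) ->
  measurable_fun setT (fun x => \big[mule/1]_(i <- s) h i x).
Proof.
move=> mh; elim: s => [|i s IH].
  by under eq_fun do rewrite big_nil; exact: measurable_cst.
by under eq_fun do rewrite big_cons; exact: emeasurable_funM.
Qed.

Section Sampling.
Context {R : realType} {L n : nat} dX (X : measurableType dX).
Local Notation T := (borelV R L).
Context dO (Om : measurableType dO) (QQ : probability Om R).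
Variables (kap : R.-pker X ~> T) (J : {mfun Om >-> X}) (V : 'I_n -> {mfun Om >-> T}).
Hypothesis law_vectors : forall (F : set X) (W : 'I_n -> set T),
  measurable F -> (forall i, measurable (W i)) ->
  QQ [set w | F (J w) /\ forall i, W i (V i w)]
    = \int[QQ]_(w in J @^-1` F) \big[mule/1]_(i < n) kap (J w) (W i).

Definition past (k : nat) : set (set Om) :=
  [set A | exists F W, [/\ measurable F, forall i, measurable (W i),
     forall i : 'I_n, (k <= i)%N -> W i = setT &
     A = [set w | F (J w) /\ forall i, W i (V i w)]]].

Let mbox (W : 'I_n -> set T) : (forall i, measurable (W i)) ->
  measurable [set w | forall i, W i (V i w)].
Proof.
move=> mW; rewrite (_ : [set w | _] = \bigcap_(i in [set: 'I_n]) (V i @^-1` W i)).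
  apply: fin_bigcap_measurable; first exact: finite_finset.
  by move=> i _; rewrite -[X in measurable X]setTI; exact: measurable_funPT.
by apply/seteqP; split => [w wW i _|w wW i]; [exact: wW|exact: (wW i I)].
Qed.

Let prod_ge0 (W : 'I_n -> set T) f : 0 <= \big[mule/1]_(i < n) kap f (W i).
Proof. by apply: prode_ge0 => i _. Qed.

Lemma past_measurable k A : past k A -> measurable A.
Proof.
move=> [F [W [mF mW _ ->]]].
rewrite (_ : [set w | _] = J @^-1` F `&` [set w | forall i, W i (V i w)])//.
by apply: measurableI; [rewrite -[X in measurable X]setTI; exact: measurable_funPT|exact: mbox].
Qed.

Lemma past_setI k : setI_closed (past k).
Proof.
move=> _ _ [F [W [mF mW Wk ->]]] [F' [W' [mF' mW' Wk' ->]]].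
exists (F `&` F'), (fun i => W i `&` W' i); split.
- exact: measurableI.
- by move=> i; exact: measurableI.
- by move=> i ki; rewrite Wk// Wk'// setIT.
- apply/seteqP; split => [w [[h1 h2] [h3 h4]]|w [[h1 h2] h3]].
    by split; [split|move=> i; split].
  by split; split => // i; case: (h3 i).
Qed.

Lemma past_setT k : past k setT.
Proof.
by exists setT, (fun=> setT); split => //; apply/seteqP; split.
Qed.

(** An event of the past of [k] leaves the vector [k] free, so the product
    formula factors into the density of the event and the kernel. *)
Lemma freeze_vector (k : 'I_n) A W : past k A -> measurable W ->
  QQ (A `&` V k @^-1` W) = \int[QQ]_(w in A) kap (J w) W.
Proof.
move=> [F [U [mF mU Uk ->]]] mW.
set D := [set w | forall i, U i (V i w)].
have mD : measurable D by exact: mbox.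
have mJ : measurable_fun setT J by exact: measurable_funPT.
pose mu := push_measure QQ mJ.
pose nu := push_measure (mrestr QQ mD) mJ.
pose p f := \big[mule/1]_(i < n) kap f (U i).
have mp : measurable_fun setT p by apply: emeasurable_prode => i; exact: measurable_kernel.
have nuE G : measurable G -> nu G = \int[mu]_(f in G) p f.
  move=> mG; rewrite push_measureE /mrestr /= ge0_integral_pushforward//.
  - by rewrite -law_vectors.
  - exact: measurable_funTS.
  - by move=> f _; exact: prod_ge0.
pose U' i := if i == k then W else U i.
transitivity (QQ [set w | F (J w) /\ forall i, U' i (V i w)]).
  congr (QQ _); apply/seteqP; split => [w [[h1 h2] h3]|w [h1 h2]].
    by split => // i; rewrite /U'; case: eqP => [->|].
  split; last by have := h2 k; rewrite /U' eqxx.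
  split => // i; have := h2 i; rewrite /U'; case: eqP => [->|//] _.
  by rewrite Uk.
rewrite law_vectors//; last by move=> i; rewrite /U'; case: ifP.
have U'E f : \big[mule/1]_(i < n) kap f (U' i) = p f * kap f W.
  rewrite (bigD1 k)//= /U' eqxx muleC; congr (_ * _).
  rewrite /p [RHS](bigD1 k)//= Uk// prob_kernel mul1e; apply: eq_bigr => i ik.
  by rewrite (negbTE ik).
under eq_integral do rewrite U'E.
have indE (G : set Om) (h : Om -> \bar R) : measurable G ->
    \int[QQ]_(w in G) h w = \int[QQ]_w ((\1_G w)%:E * h w).
  move=> mG; rewrite integral_mkcond; apply: eq_integral => w _.
  by rewrite patchE indicE; case: (w \in G); rewrite ?mul1e ?mul0e.
have mJF : measurable (J @^-1` F).
  by rewrite -[X in measurable X]setTI; exact: measurable_funPT.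
pose h f := (\1_F f)%:E * kap f W.
have h0 f : 0 <= h f by rewrite mule_ge0// lee_fin.
have mh : measurable_fun setT h.
  apply: emeasurable_funM; last exact: measurable_kernel.
  by apply/measurable_EFinP/measurable_indic.
have hJ : measurable_fun setT (h \o J) by exact: measurableT_comp.
have p0 f : 0 <= p f by exact: prod_ge0.
have p_fin f : p f < +oo.
  rewrite -ge0_fin_numE// /p; elim/big_ind : _ => [//|x y|i _]; first exact: fin_numM.
  exact: finite_kernel_measure.
transitivity (\int[QQ]_w ((\1_D w)%:E * h (J w))); last first.
  rewrite -indE// [RHS]indE; last exact: measurableI.
  rewrite indE//; apply: eq_integral => w _; rewrite /h muleA -EFinM.
  congr (_%:E * _); rewrite -[RHS]/(\1_(J @^-1` F `&` D) w) indicI mulrC; congr (_ * _)%R.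
rewrite -(@density_integral _ Om R QQ (mrestr QQ mD) (fun w => (\1_D w)%:E))//; last 2 first.
- by move=> w; rewrite ltry.
- by move=> G mG; rewrite integral_indic// setIC.
have := ge0_integral_push (mrestr QQ mD) mJ mh h0; rewrite -/nu => <-.
rewrite (@density_integral _ X R mu nu p)//.
rewrite ge0_integral_push//; last 2 first.
- exact: emeasurable_funM.
- by move=> f; rewrite mule_ge0.
rewrite indE//; apply: eq_integral => w _.
  by rewrite /h /= !muleA; congr (_ * _); rewrite muleC.
by apply/measurable_EFinP/measurable_indic.
Qed.

Definition partial_sum (k : nat) (w : Om) : T :=
  (\sum_(i < n | (i < k)%N) (V i w : 'rV[R]_L))%R.

Lemma sampling_step (k : 'I_n) (g : X * T -> \bar R) :
  measurable_fun setT g -> (forall z, 0 <= g z) ->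
  \int[QQ]_w g (J w, partial_sum k.+1 w) =
  \int[QQ]_w convK kap g (J w, partial_sum k w).
Proof.
move=> mg g0.
have mJ : measurable_fun setT (J : g_sigma_algebraType (past k) -> X).
  move=> _ F mF; rewrite setTI; apply: sub_sigma_algebra.
  by exists F, (fun=> setT); split => //; apply/seteqP; split => // w [].
have mV (i : 'I_n) : (i < k)%N ->
    measurable_fun setT (V i : g_sigma_algebraType (past k) -> T).
  move=> ik _ W mW; rewrite setTI; apply: sub_sigma_algebra.
  exists setT, (fun j => if j == i then W else setT); split => //.
  - by move=> j; case: ifP.
  - by move=> j kj; case: eqP => // ji; move: kj; rewrite ji leqNgt ik.
  - apply/seteqP; split => [w Ww|w [_ /(_ i)]]; last by rewrite eqxx.
    by split => // j; case: eqP => // ->.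
have mS : measurable_fun setT (partial_sum k : g_sigma_algebraType (past k) -> T).
  apply: measurable_to_borelV => // l.
  under eq_fun do rewrite /partial_sum summxE.
  under eq_fun do rewrite big_mkcond.
  have mterm (i : 'I_n) : measurable_fun setT (fun w : g_sigma_algebraType (past k) =>
      if (i < k)%N then (V i w : 'rV[R]_L) ord0 l else 0%R).
    case: (boolP (i < k)%N) => // ik.
    by apply: (measurableT_comp (measurable_coordV l)); exact: mV.
  exact: measurable_sum.
pose G (z : g_sigma_algebraType (past k) * T) := g (J z.1, addV (partial_sum k z.1, z.2)).
have mG : measurable_fun setT G.
  apply: measurableT_comp => //; apply: measurable_fun_pair; first exact: measurableT_comp.
  apply: (@measurableT_comp _ _ _ _ _ _ addV); first exact: measurable_addV.
  by apply: measurable_fun_pair => //; exact: measurableT_comp.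
have -> : \int[QQ]_w g (J w, partial_sum k.+1 w) = \int[QQ]_w G (w, V k w).
  apply: eq_integral => w _; rewrite /G /=; congr (g (_, _)).
  rewrite /partial_sum /addV /= (bigD1 k)//= addrC; congr (_ + _)%R.
  by apply: eq_bigl => i; rewrite ltnS ltn_neqAle andbC.
apply: (@freezing _ _ _ _ R QQ (past k) (V k) (fun w => kap (J w)) G) => //.
- exact: (le_lt_trans (@probability_le1 _ _ _ QQ setT measurableT) (ltry 1)).
- exact: past_measurable.
- exact: past_setI.
- exact: past_setT.
- by move=> W mW; exact: measurableT_comp (measurable_kernel kap W mW) mJ.
- by move=> w; exact: prob_kernel.
- by move=> A W; exact: freeze_vector.
- by move=> z; exact: g0.
Qed.

(** The vectors are integrated out one at a time, each step being one
    convolution with the kernel. *)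
Lemma sampling_sum (g : X * T -> \bar R) :
  measurable_fun setT g -> (forall z, 0 <= g z) ->
  \int[QQ]_w g (J w, (\sum_(i < n) (V i w : 'rV[R]_L))%R) =
  \int[QQ]_w \int[cpow (kapf kap (J w)) n]_y g (J w, y).
Proof.
move=> mg g0.
have step j : (j <= n)%N -> \int[QQ]_w g (J w, partial_sum n w) =
    \int[QQ]_w iter j (convK kap) g (J w, partial_sum (n - j) w).
  elim: j => [|j IH] jn; first by rewrite subn0.
  rewrite IH 1?ltnW//.
  have jn' : (n - j.+1 < n)%N by rewrite ltn_subrL /= (leq_trans _ jn).
  have [m1 m2] := iter_convK kap j mg g0.
  have := @sampling_step (Ordinal jn') (iter j (convK kap) g) m1 m2.
  by rewrite /= subnSK.
have -> : \int[QQ]_w g (J w, (\sum_(i < n) (V i w : 'rV[R]_L))%R) =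
    \int[QQ]_w g (J w, partial_sum n w).
  apply: eq_integral => w _; congr (g (_, _)); apply: eq_bigl => i; rewrite ltn_ord//.
rewrite (step n)// subnn; apply: eq_integral => w _.
rewrite iter_convKE// /partial_sum big_pred0_eq; apply: eq_integral => y _.
by rewrite /addV /= add0r.
Qed.

End Sampling.

End Sums.
Export Sums.

(** * Substochastic flows *)

Module Flow.
Section Flow.
Context {R : realType} {L d : nat}.
Variable r : 'I_d.+1 -> 'M[R]_L.
Hypothesis r0 : forall j i i', 0 <= r j i i'.
Variable t : R.

Definition substoch (A : 'M[R]_L) : Prop :=
  (forall i j, 0 <= A i j) /\ (forall i, \sum_j A i j <= 1).

Lemma substochM A B : substoch A -> substoch B -> substoch (A *m B).
Proof.
move=> [A0 A1] [B0 B1]; split=> [i j|i].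
  by rewrite mxE; apply: sumr_ge0 => l _; rewrite mulr_ge0.
under eq_bigr do rewrite mxE.
rewrite exchange_big /= (le_trans _ (A1 i))//; apply: ler_sum => l _.
by rewrite -mulr_sumr ler_piMr.
Qed.

Lemma substoch_le1 A i j : substoch A -> A i j <= 1.
Proof.
move=> [A0 A1]; apply: le_trans (A1 i); rewrite (bigD1 j)//= lerDl.
by apply: sumr_ge0.
Qed.

Lemma substoch_contract A (D : 'M[R]_L) e : substoch A -> 0 <= e ->
  (forall i j, `|D i j| <= e) -> forall i j, `|(A *m D) i j| <= e.
Proof.
move=> [A0 A1] e0 De i j; rewrite mxE (le_trans (ler_norm_sum _ _ _))//.
rewrite (le_trans (y := \sum_k A i k * e))//.
  by apply: ler_sum => k _; rewrite normrM (ger0_norm (A0 i k)) ler_wpM2l.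
by rewrite -mulr_suml ler_piMl.
Qed.

Definition drift (j : 'I_d.+1) : 'M[R]_L := - flow_mx (r j).

Lemma drift_offdiag j i i' : i != i' -> 0 <= drift j i i'.
Proof. by move=> ii; rewrite /drift /flow_mx !mxE (negbTE ii) opprK r0. Qed.

Lemma drift_row j i : \sum_i' drift j i i' <= 0.
Proof.
rewrite (bigD1 i)//= /drift /flow_mx !mxE eqxx.
under eq_bigr do rewrite !mxE.
rewrite (eq_bigr (fun k => r j i k)); last first.
  by move=> k ki; rewrite eq_sym (negbTE ki) opprK.
by rewrite opprD subrK oppr_le0.
Qed.

Lemma drift_substoch j s : 0 <= s -> substoch (expmx (s *: drift j)).
Proof.
move=> s0; split=> [i i'|i].
- by apply: expmx_metzler_ge0 => // *; exact: drift_offdiag.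
- by apply: expmx_row_sum_le1 => // *; [exact: drift_offdiag|exact: drift_row].
Qed.

Definition drift_bound : R := \sum_j entry_sum (drift j).

Lemma drift_bound_ge0 : 0 <= drift_bound.
Proof. by apply: sumr_ge0 => j _; exact: entry_sum_ge0. Qed.

Lemma drift_lip j s i i' : 0 <= s ->
  `|expmx (s *: drift j) i i' - (i == i')%:R| <= drift_bound * s.
Proof.
move=> s0; apply: le_trans (expmx_lip _ _ _ _ s0) _ => //.
- by move=> *; exact: drift_offdiag.
- by move=> *; exact: drift_row.
rewrite ler_wpM2r// /drift_bound [leRHS](bigD1 j)//= lerDl.
by apply: sumr_ge0 => k _; exact: entry_sum_ge0.
Qed.

(** [D u] propagates a unit of storage from time [u] to the horizon [t] along
    the background trajectory [phi]. *)
Record is_flow (phi : R -> 'I_d.+1) (D : R -> 'M[R]_L) : Prop := IsFlow {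
  flow_end : D t = 1%:M ;
  flow_mphi : forall j, measurable [set u | phi u = j] ;
  flow_mD : forall i j, measurable_fun setT (fun u => D u i j) ;
  flow_substoch : forall u, u <= t -> substoch (D u) ;
  flow_lip : forall u v i j, u <= v -> v <= t ->
    `|D u i j - D v i j| <= L%:R * drift_bound * (v - u) ;
  flow_step : forall u v y, u <= v -> v <= t ->
    (forall w, u <= w -> w < v -> phi w = y) ->
    D u = expmx ((v - u) *: drift y) *m D v }.

(** A substochastic factor does not increase the distance. *)
Lemma flow_close_good phi D phi' D' u v y e :
  is_flow phi D -> is_flow phi' D' -> u <= v -> v <= t -> 0 <= e ->
  (forall w, u <= w -> w < v -> phi w = y) ->
  (forall w, u <= w -> w < v -> phi' w = y) ->
  (forall i j, `|D v i j - D' v i j| <= e) ->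
  forall i j, `|D u i j - D' u i j| <= e.
Proof.
move=> fD fD' uv vt e0 hphi hphi' De i j.
rewrite (flow_step fD uv vt hphi) (flow_step fD' uv vt hphi').
have := @substoch_contract (expmx ((v - u) *: drift y)) (D v - D' v) e.
rewrite mulmxBr => H; have := H _ e0 _ i j; rewrite !mxE; apply.
  by apply: drift_substoch; rewrite subr_ge0.
by move=> i' j'; rewrite !mxE.
Qed.

Lemma flow_close_bad phi D phi' D' u v e :
  is_flow phi D -> is_flow phi' D' -> u <= v -> v <= t ->
  (forall i j, `|D v i j - D' v i j| <= e) ->
  forall i j, `|D u i j - D' u i j| <= e + 2 * (L%:R * drift_bound) * (v - u).
Proof.
move=> fD fD' uv vt De i j.
have := flow_lip fD i j uv vt; have := flow_lip fD' i j uv vt; have := De i j.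
have -> : 2 * (L%:R * drift_bound) * (v - u) = 2 * (L%:R * drift_bound * (v - u)).
  by rewrite -mulrA.
move: (L%:R * drift_bound * (v - u)) => C; rewrite !ler_norml.
by move=> /andP[? ?] /andP[? ?] /andP[? ?]; apply/andP; split; lra.
Qed.

Fixpoint jstate (x : 'I_d.+1) (l : seq (R * 'I_d.+1)) (u : R) : 'I_d.+1 :=
  if l is (s, y) :: l' then (if u < s then x else jstate y l' u) else x.

Fixpoint jflow (x : 'I_d.+1) (l : seq (R * 'I_d.+1)) (u : R) : 'M[R]_L :=
  if l is (s, y) :: l' then
    (if u < s then expmx ((s - u) *: drift x) *m jflow y l' s else jflow y l' u)
  else expmx ((t - u) *: drift x).

Let sorted_ (l : seq (R * 'I_d.+1)) := sorted <=%R (unzip1 l) && all (fun s => s <= t) (unzip1 l).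

Lemma jflow_end x l : sorted_ l -> jflow x l t = 1%:M.
Proof.
elim: l x => [|[s y] l IH] x /=; first by rewrite subrr scale0r expmx0.
rewrite /sorted_ /= => /andP[sl /andP[st al]].
by rewrite ltNge st /= IH// /sorted_ al (path_sorted sl).
Qed.

Lemma jstate_measurable x l j : measurable [set u | jstate x l u = j].
Proof.
elim: l x => [|[s y] l IH] x /=.
  have [->|xj] := eqVneq x j; first by rewrite (_ : [set _ | _] = setT)//; apply/seteqP; split.
  by rewrite (_ : [set _ | _] = set0)//; apply/seteqP; split => // u /= /eqP; rewrite (negbTE xj).
have -> : [set u | (if u < s then x else jstate y l u) = j] =
    (`]-oo, s[ `&` [set u | x = j]) `|` (`[s, +oo[ `&` [set u | jstate y l u = j]).
  apply/seteqP; split => u /=.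
    by rewrite !in_itv /= andbT; case: ltP => us; [left|right].
  rewrite !in_itv /= andbT; case: ltP => us; first by case=> -[].
  by case=> -[].
apply: measurableU; apply: measurableI => //.
have [->|xj] := eqVneq x j; first by rewrite (_ : [set _ | _] = setT)//; apply/seteqP; split.
by rewrite (_ : [set _ | _] = set0)//; apply/seteqP; split => // u /= /eqP; rewrite (negbTE xj).
Qed.

Lemma measurable_expmx_affine (M : 'M[R]_L) (s : R) i j :
  measurable_fun setT (fun u : R => expmx ((s - u) *: M) i j).
Proof.
have -> : (fun u => expmx ((s - u) *: M) i j) = (fun u => expmx ((s + (-1) * u) *: M) i j).
  by apply/funext => u; rewrite mulN1r.
by apply: continuous_measurable_fun => u; exact: is_derive_continuous (is_derive_expmx_affine M s (-1) u i j).
Qed.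

Lemma jflow_measurable x l i j : measurable_fun setT (fun u => jflow x l u i j).
Proof.
elim: l x i j => [|[s y] l IH] x i j /=; first exact: measurable_expmx_affine.
have -> : (fun u => (if u < s then expmx ((s - u) *: drift x) *m jflow y l s else jflow y l u) i j)
  = (fun u => if u < s then (expmx ((s - u) *: drift x) *m jflow y l s) i j else jflow y l u i j).
  by apply/funext => u; case: ifP.
apply: measurable_fun_if => //.
- by apply: (measurable_fun_bool true); rewrite setTI (_ : _ @^-1` _ = `]-oo, s[%classic)//;
    apply/seteqP; split => u /=; rewrite in_itv.
- apply: measurable_funTS; under eq_fun do rewrite mxE.
  by apply: measurable_sum => k; apply: measurable_funM => //; exact: measurable_expmx_affine.
- exact: measurable_funTS.
Qed.

Lemma jflow_step x l u v y : sorted_ l -> u <= v -> v <= t ->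
  (forall w, u <= w -> w < v -> jstate x l w = y) ->
  jflow x l u = expmx ((v - u) *: drift y) *m jflow x l v.
Proof.
elim: l x u => [|[s z] l IH] x u /=.
  move=> _ uv vt H; rewrite le_eqVlt in uv; case/orP: uv => [/eqP ->|uv].
    by rewrite subrr scale0r expmx0 mul1mx.
  rewrite -(H u)//; have -> : t - u = (v - u) + (t - v) by ring.
  by rewrite expmxD.
rewrite /sorted_ /= => /andP[sl /andP[st al]] uv vt H.
have sl' : sorted_ l by rewrite /sorted_ al (path_sorted sl).
have [->|nuv] := eqVneq u v; first by rewrite subrr scale0r expmx0 mul1mx.
have ltuv : u < v by rewrite lt_neqAle nuv.
case: (ltP u s) => us; last first.
  rewrite ltNge (le_trans us uv) /=; apply: IH => // w uw wv.
  by have := H w uw wv; rewrite ltNge (le_trans us uw).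
have xy : x = y by have := H u (lexx _) ltuv; rewrite us.
subst y; case: (ltP v s) => vs.
  have -> : s - u = (v - u) + (s - v) by ring.
  by rewrite expmxD mulmxA.
have Hs w : s <= w -> w < v -> jstate z l w = x.
  by move=> sw wv; have := H w (le_trans (ltW us) sw) wv; rewrite ltNge sw.
rewrite (IH z s sl' vs vt Hs); have -> : v - u = (s - u) + (v - s) by ring.
by rewrite [in RHS]expmxD mulmxA.
Qed.

Lemma jflow_factor x l u v : sorted_ l -> u <= v -> v <= t ->
  exists2 W, jflow x l u = W *m jflow x l v &
    substoch W /\ forall i j, `|W i j - (i == j)%:R| <= drift_bound * (v - u).
Proof.
elim: l x u => [|[s z] l IH] x u /=.
  move=> _ uv vt; exists (expmx ((v - u) *: drift x)).
    by have -> : t - u = (v - u) + (t - v) by [ring|]; rewrite expmxD.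
  split; first by apply: drift_substoch; rewrite subr_ge0.
  by move=> i j; apply: drift_lip; rewrite subr_ge0.
rewrite /sorted_ /= => /andP[sl /andP[st al]] uv vt.
have sl' : sorted_ l by rewrite /sorted_ al (path_sorted sl).
case: (ltP u s) => us; last first.
  by rewrite ltNge (le_trans us uv) /=; exact: IH.
case: (ltP v s) => vs.
  exists (expmx ((v - u) *: drift x)).
    by have -> : s - u = (v - u) + (s - v) by [ring|]; rewrite expmxD mulmxA.
  split; first by apply: drift_substoch; rewrite subr_ge0.
  by move=> i j; apply: drift_lip; rewrite subr_ge0.
have [W Ws [W1 W2]] := IH z s sl' vs vt.
have su0 : 0 <= s - u by rewrite subr_ge0 ltW.
exists (expmx ((s - u) *: drift x) *m W); first by rewrite Ws mulmxA.
split; first by apply: substochM => //; exact: drift_substoch.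
move=> i j.
have -> : (expmx ((s - u) *: drift x) *m W) i j - (i == j)%:R =
    (expmx ((s - u) *: drift x) *m (W - 1%:M)) i j +
    (expmx ((s - u) *: drift x) i j - (i == j)%:R).
  by rewrite mulmxBr mulmx1 !mxE; ring.
have -> : drift_bound * (v - u) = drift_bound * (v - s) + drift_bound * (s - u) by ring.
apply: le_trans (ler_normD _ _) _; apply: lerD; last exact: drift_lip.
apply: substoch_contract; first exact: drift_substoch.
  by rewrite mulr_ge0 ?drift_bound_ge0// subr_ge0.
by move=> i' j'; rewrite mxE mxE mxE; exact: W2.
Qed.

Lemma jflow_is_flow x l : sorted_ l -> is_flow (jstate x l) (jflow x l).
Proof.
move=> sl.
have sub u : u <= t -> substoch (jflow x l u).
  move=> ut; have [W -> [W1 _]] := @jflow_factor x l u t sl ut (lexx _).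
  by rewrite jflow_end// mulmx1.
split => //.
- exact: jflow_end.
- exact: jstate_measurable.
- exact: jflow_measurable.
- move=> u v i j uv vt; have [W -> [W1 W2]] := @jflow_factor x l u v sl uv vt.
  have -> : (W *m jflow x l v) i j - jflow x l v i j = ((W - 1%:M) *m jflow x l v) i j.
    by rewrite mulmxBl mul1mx !mxE.
  rewrite mxE (le_trans (ler_norm_sum _ _ _))// -mulrA mulr_natl.
  rewrite -[X in _ *+ X]card_ord -sumr_const; apply: ler_sum => k _.
  have [D0 _] := sub v vt.
  rewrite normrM (le_trans (y := drift_bound * (v - u) * 1))//; last by rewrite mulr1.
  apply: ler_pM => //; last by rewrite ger0_norm ?substoch_le1//; exact: sub.
  by rewrite mxE mxE mxE; exact: W2.
- by move=> u v y uv vt; exact: jflow_step.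
Qed.

End Flow.

End Flow.
Export Flow.

(** * Measures of delivered jobs *)

Module Jumps.
Definition restrict_fin d (X : measurableType d) (R : realType)
    (m : {measure set X -> \bar R}) (A : set X) (mA : measurable A)
    (Afin : (m A < +oo)%E) : {finite_measure set X -> \bar R} := mfrestr mA Afin.

Lemma integral_restrict_fin d (X : measurableType d) (R : realType)
    (m : {measure set X -> \bar R}) (A : set X) (mA : measurable A)
    (Afin : (m A < +oo)%E) (h : X -> \bar R) : measurable_fun setT h ->
  (forall u, 0 <= h u)%E ->
  (\int[restrict_fin mA Afin]_u h u = \int[m]_(u in A) h u)%E.
Proof.
move=> mh h0.
rewrite (@density_integral _ X R m (restrict_fin mA Afin) (fun u => (\1_A u)%:E))//.
- rewrite [RHS]integral_mkcond; apply: eq_integral => u _.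
  by rewrite patchE indicE; case: (u \in _); rewrite ?mul1e ?mul0e.
- by apply/measurable_EFinP/measurable_indic.
- by move=> u; rewrite ltry.
- by move=> F mF; rewrite integral_indic//= setIC.
Qed.

Section Levy.
Context {R : realType} {L d : nat}.
Local Notation T := (borelV R L).
Variables (lam : 'I_d.+1 -> R) (mu : 'I_d.+1 -> probability T R).
Variables (r : 'I_d.+1 -> 'M[R]_L) (t : R) (phi : R -> 'I_d.+1) (D : R -> 'M[R]_L).
Hypothesis fl : is_flow r t phi D.

Definition occupied (j : 'I_d.+1) : set R := `[0, t]%classic `&` [set u | phi u = j].

Lemma measurable_occupied j : measurable (occupied j).
Proof. by apply: measurableI => //; exact: (flow_mphi fl). Qed.

Lemma occupied_fin j : (lebesgue_measure (occupied j) < +oo)%E.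
Proof.
apply: (@le_lt_trans _ _ (lebesgue_measure (`[0, t]%classic : set R))).
  by apply: le_measure; rewrite ?inE//; [exact: measurable_occupied|exact: subIsetl].
by rewrite lebesgue_measure_itv /=; case: ifP => // _; rewrite -EFinB ltry.
Qed.

Definition delivered (p : measurableTypeR R * T) : T := (p.2 : 'rV[R]_L) *m D p.1.

Lemma measurable_delivered : measurable_fun setT delivered.
Proof.
apply: measurable_to_borelV => // l.
under eq_fun do rewrite /delivered mxE.
apply: measurable_sum => k; apply: measurable_funM.
  by apply: measurableT_comp (measurable_coordV k) _.
by apply: measurableT_comp (flow_mD fl k l) _.
Qed.

Definition occupation j : {finite_measure set (measurableTypeR R) -> \bar R} :=
  @restrict_fin _ (measurableTypeR R) R lebesgue_measure _ (measurable_occupied j) (occupied_fin j).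

Definition levy1 j : {measure set T -> \bar R} :=
  push_measure (occupation j \x mu j)%E measurable_delivered.

Definition levy : {measure set T -> \bar R} :=
  msum (fun k => mscale `|lam (inord k)|%:nng (levy1 (inord k))) d.+1.

Hypothesis lam0 : forall j, 0 <= lam j.

Local Open Scope ereal_scope.

Lemma integral_occupation j (h : R -> \bar R) : measurable_fun setT h ->
  (forall u, 0 <= h u) ->
  \int[occupation j]_u h u = \int[lebesgue_measure]_(u in occupied j) h u.
Proof.
by move=> mh h0; exact: integral_restrict_fin.
Qed.

Lemma integral_levy (g : T -> \bar R) : measurable_fun setT g ->
  (forall y, 0 <= g y) ->
  \int[levy]_y g y = \sum_j (lam j)%:E *
    \int[lebesgue_measure]_(u in occupied j) \int[mu j]_x g (delivered (u, x)).
Proof.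
move=> mg g0; rewrite ge0_integral_measure_sum//; apply: eq_bigr => j _.
rewrite ge0_integral_mscale//= inord_val ger0_norm//; congr (_ * _).
rewrite ge0_integral_push//; last exact: measurable_delivered.
have mgd : measurable_fun setT (g \o delivered).
  by apply: measurableT_comp => //; exact: measurable_delivered.
rewrite (@fubini_tonelli1 _ _ _ _ _ (occupation j) (mu j) (g \o delivered))//; last first.
  by move=> p; exact: g0.
rewrite integral_occupation//.
  by apply: (@measurable_fun_fubini_tonelli_F _ _ (measurableTypeR R) T R (mu j) (g \o delivered)) => // p; exact: g0.
by move=> u; apply: integral_ge0 => x _; exact: g0.
Qed.

Definition mass : R := \sum_j lam j * fine (lebesgue_measure (occupied j)).

Lemma levy_setT : levy setT = mass%:E.
Proof.
rewrite -[LHS]mul1e -integral_cst// integral_levy//.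
have h1 j (u : R) : \int[mu j]_x (cst 1 (delivered (u, x)) : \bar R) = 1.
  by rewrite (integral_cst _ measurableT) mul1e; exact: probability_setT.
under eq_bigr => j _ do under eq_integral do rewrite h1.
rewrite /mass -sumEFin; apply: eq_bigr => j _.
rewrite integral_cst ?mul1e; last exact: measurable_occupied.
by rewrite EFinM fineK// ge0_fin_numE// occupied_fin.
Qed.

End Levy.

End Jumps.
Export Jumps.

(** * Flow and jump measure along a path *)

Module Along.
Lemma inner_mul (R : realType) (L : nat) (th : 'cV[R]_L) (x : 'rV[R]_L) (A : 'M[R]_L) :
  inner th (x *m A) = inner (A *m th) x.
Proof.
rewrite /inner.
under eq_bigr do rewrite mxE mulr_sumr.
rewrite exchange_big /=; apply: eq_bigr => k _; rewrite mxE mulr_suml.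
by apply: eq_bigr => l _; ring.
Qed.

Local Opaque expmx.

Section PathFlow.
Context {R : realType} {L d : nat}.
Variables (r : 'I_d.+1 -> 'M[R]_L) (t : R).
Implicit Types (x : 'I_d.+1) (l : seq (R * 'I_d.+1)) (s u : R).

Definition jepoch s l (i : nat) : R := nth t (s :: unzip1 l) i.

Definition jstep x l (i : nat) : 'I_d.+1 := nth x (x :: unzip2 l) i.

Definition jdecay x s l i u : 'M[R]_L :=
  expmx ((jepoch s l i.+1 - u) *: drift r (jstep x l i)).

Definition jtransfer x s l i u : 'M[R]_L :=
  jdecay x s l i u *m
  \big[mulmx/1%:M]_(i.+1 <= k < (size l).+1) jdecay x s l k (jepoch s l k).

Lemma jstep_cons x s y l i : (i <= size l)%N ->
  jstep x ((s, y) :: l) i.+1 = jstep y l i.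
Proof.
by move=> il; rewrite /jstep /=; apply: set_nth_default; rewrite /= size_map ltnS.
Qed.

Lemma jdecay_cons x s0 s y l i u : (i <= size l)%N ->
  jdecay x s0 ((s, y) :: l) i.+1 u = jdecay y s l i u.
Proof. by move=> il; rewrite /jdecay jstep_cons. Qed.

Lemma jtransfer_cons x s0 s y l i u : (i <= size l)%N ->
  jtransfer x s0 ((s, y) :: l) i.+1 u = jtransfer y s l i u.
Proof.
move=> il; rewrite /jtransfer jdecay_cons; last exact: il.
apply: (f_equal (mulmx _)); rewrite big_add1; apply: eq_big_nat => k /andP[_ kl].
by rewrite jdecay_cons.
Qed.

Lemma jtransfer0 x s0 l u : path <%R s0 (unzip1 l) ->
  (forall s y l', l = (s, y) :: l' -> u < s) ->
  jtransfer x s0 l 0 u = jflow r t x l u.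
Proof.
elim: l x s0 u => [|[s y] l IH] x s0 u /=.
  by move=> _ _; rewrite /jtransfer big_geq// mulmx1 /jdecay.
move=> /andP[s0s sl] us; rewrite (us s y l erefl) /jtransfer /=.
rewrite {1}/jdecay /= big_ltn; last by [].
apply: (f_equal (mulmx _)).
have Hs : forall s' (y' : 'I_d.+1) l', l = (s', y') :: l' -> s < s'.
  by move=> s' y' l' ls; move: sl; rewrite ls /= => /andP[].
rewrite -(IH y s s sl Hs) /jtransfer jdecay_cons; last by [].
apply: (f_equal (mulmx _)); rewrite big_add1; apply: eq_big_nat => k /andP[_ kl].
by rewrite jdecay_cons.
Qed.

Local Open Scope ereal_scope.

(** The transfer matrices of the definition of [Mf] are the flow of the path, up
    to the null set of its jump times. *)
Lemma jflow_integral (H : 'I_d.+1 -> 'M[R]_L -> \bar R) x s0 l :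
  (forall j D, 0 <= H j D) ->
  (forall x l, measurable_fun setT (fun u => H (jstate x l u) (jflow r t x l u))) ->
  path <%R s0 (unzip1 l) -> all (fun s => s <= t)%R (unzip1 l) -> (s0 <= t)%R ->
  \sum_(0 <= i < (size l).+1)
    \int[lebesgue_measure]_(u in `[jepoch s0 l i, jepoch s0 l i.+1])
      H (jstep x l i) (jtransfer x s0 l i u) =
  \int[lebesgue_measure]_(u in `[s0, t]) H (jstate x l u) (jflow r t x l u).
Proof.
move=> H0 mH; elim: l x s0 => [|[s y] l IH] x s0 /=.
  move=> _ _ s0t; rewrite big_nat1 /=; apply: eq_integral => u _.
  by rewrite jtransfer0.
move=> /andP[s0s sl] /andP[st al] s0t.
rewrite big_nat_recl//=.
under eq_big_nat => i /andP[_ il].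
  rewrite jstep_cons//.
  under eq_integral do rewrite jtransfer_cons//.
  over.
rewrite IH//.
have mf := mH x ((s, y) :: l).
rewrite /jepoch /= -integral_itv_bndo_bndc; last first.
  apply: (@eq_measurable_fun _ _ _ _ _ (fun u => H (jstate x ((s, y) :: l) u) (jflow r t x ((s, y) :: l) u))).
    move=> u; rewrite inE /= in_itv /= => /andP[_ us]; rewrite us jtransfer0//=.
      by rewrite us.
    by rewrite s0s.
    by move=> ? ? ? [<- _ _].
  exact: measurable_funTS.
have -> : `[s0, t]%classic = (`[s0, s[ `|` `[s, t])%classic :> set R.
  by rewrite -itv_bndbnd_setU// bnd_simp ltW.
rewrite ge0_integral_setU//=.
- congr (_ + _); apply: eq_integral => u; rewrite inE /= in_itv /= => /andP[h1 us].
    rewrite us jtransfer0//=; first by rewrite us.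
      by rewrite s0s.
    by move=> ? ? ? [<- _ _].
  by rewrite ltNge h1.
- exact: measurable_funTS.
- rewrite disj_set2E; apply/eqP; rewrite -subset0 => u [] /=.
  by rewrite !in_itv /= => /andP[_ us] /andP[su _]; move: us; rewrite ltNge su.
Qed.

Lemma integral_sub1 (a b : R) (g : R -> \bar R) : (a <= b)%R ->
  measurable_fun `[a, b]%classic g -> (forall u, 0 <= g u) ->
  \int[lebesgue_measure]_(u in `[a, b]) (g u - 1) =
  \int[lebesgue_measure]_(u in `[a, b]) g u - (b - a)%:E.
Proof.
move=> ab mg g0; set I := `[a, b]%classic.
have mI : measurable (I : set (measurableTypeR R)) by exact: measurable_itv.
pose f u := g u - 1.
have mf : measurable_fun I f by apply: emeasurable_funB => //; exact: measurable_cst.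
have len : \int[lebesgue_measure]_(u in I) (cst 1 u : \bar R) = (b - a)%:E.
  rewrite integral_cst//= mul1e lebesgue_measure_itv /= lte_fin.
  by case: ltP => // ba; have -> : (b - a = 0)%R by apply/eqP; rewrite subr_eq0 eq_le ab ba.
have fn1 u : f^\- u <= 1.
  rewrite funenegE /f; have := g0 u; case: (g u) => [x||] //= x0.
    by rewrite ge_max lee01 andbT lee_fin; move: x0; rewrite lee_fin; lra.
  by rewrite maxNye lee01.
have nfin : \int[lebesgue_measure]_(u in I) f^\- u \is a fin_num.
  rewrite ge0_fin_numE; last exact: integral_ge0.
  apply: (@le_lt_trans _ _ (\int[lebesgue_measure]_(u in I) (cst 1 u : \bar R))).
    by apply: ge0_le_integral => //; exact: measurable_funeneg.
  by rewrite len ltry.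
have key : \int[lebesgue_measure]_(u in I) f^\+ u + (b - a)%:E =
    \int[lebesgue_measure]_(u in I) g u + \int[lebesgue_measure]_(u in I) f^\- u.
  rewrite -len -!ge0_integralD//; last 2 first.
  - exact: measurable_funeneg.
  - exact: measurable_funepos.
  apply: eq_integral => u _; rewrite funeposE funenegE /f /=.
  have := g0 u; case: (g u) => [x||] //= x0; last by rewrite maxNye ?maxye.
  rewrite -!EFin_max -!EFinD; congr (_%:E); rewrite /Num.max.
  by case: ltP => h1; case: ltP => h2; lra.
rewrite [LHS]integralE -/f.
have -> : \int[lebesgue_measure]_(u in I) f^\+ u =
    \int[lebesgue_measure]_(u in I) g u + \int[lebesgue_measure]_(u in I) f^\- u - (b - a)%:E.
  by rewrite -key addeK.
by rewrite addeAC addeK.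
Qed.

End PathFlow.

Section MfLevy.
Context {R : realType} {L d : nat} {t : R}.
Local Notation T := (borelV R L).
Variables (lam : 'I_d.+1 -> R) (mu : 'I_d.+1 -> probability T R)
  (r : 'I_d.+1 -> 'M[R]_L).
Hypothesis t0 : 0 <= t.
Hypothesis r0 : forall j i i', 0 <= r j i i'.
Hypothesis lam0 : forall j, 0 <= lam j.
Implicit Types f : bpath d t.

Definition path_flow f : R -> 'M[R]_L := jflow r t (val f).1 (val f).2.

Lemma path_atE f u : path_at f u = jstate (val f).1 (val f).2 u.
Proof.
have := valP f; rewrite /path_at /state; case: (val f) => x l /and3P[/= + _ _].
elim: l x {1}0 => [|[s y] l IH] x s0 //= /andP[_ sl].
case: (ltP u s) => us.
  rewrite add0n (_ : count _ _ = 0%N)//.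
  apply/eqP; rewrite -leqn0 leqNgt -has_count; apply/hasPn => -[s' y'] ls /=.
  rewrite -ltNge (lt_trans us)//; move: sl; rewrite lt_path_sortedE => /andP[/allP + _].
  by apply; apply/mapP; exists (s', y').
rewrite add1n /=.
rewrite (set_nth_default y); last by rewrite /= size_map ltnS count_size.
exact: IH sl.
Qed.

Lemma path_flow_is_flow f : is_flow r t (path_at f) (path_flow f).
Proof.
have -> : path_at f = jstate (val f).1 (val f).2 by apply/funext => u; rewrite path_atE.
apply: jflow_is_flow => //.
have := valP f; case: (val f) => x l /and3P[/= h1 h2 _]; rewrite h2 andbT.
by apply: sub_sorted (path_sorted h1) => u v; exact: ltW.
Qed.

Definition path_levy f : {measure set T -> \bar R} := levy lam mu (path_flow_is_flow f).

Definition path_mass f : R := mass lam t (path_at f).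

Local Open Scope ereal_scope.

Lemma integral_path_levy f (g : T -> \bar R) : measurable_fun setT g ->
  (forall y, 0 <= g y) ->
  \int[path_levy f]_y g y = \sum_j (lam j)%:E *
    \int[lebesgue_measure]_(u in occupied t (path_at f) j)
      \int[mu j]_x g (delivered (path_flow f) (u, x)).
Proof. exact: integral_levy. Qed.

Lemma mgf_ge0 (m : {measure set T -> \bar R}) th : 0 <= mgf m th.
Proof. by apply: integral_ge0 => x _; rewrite lee_fin expR_ge0. Qed.

Lemma mgf_path_levy f th : mgf (path_levy f) th = \sum_j (lam j)%:E *
  \int[lebesgue_measure]_(u in occupied t (path_at f) j) mgf (mu j) (path_flow f u *m th).
Proof.
have H := @integral_path_levy f _ (measurable_expinner th).
have /H : forall y : T, 0 <= (expR (inner th y))%:E by move=> y; rewrite lee_fin expR_ge0.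
rewrite -/(mgf _ th) => ->.
apply: eq_bigr => j _; apply: (f_equal (mule _)).
apply: eq_integral => u _; rewrite /mgf; apply: eq_integral => y _.
by rewrite /delivered inner_mul.
Qed.

Lemma measurable_mgf_mx (D : measurableTypeR R -> 'M[R]_L) j th :
  (forall i k, measurable_fun setT (fun u => D u i k)) ->
  measurable_fun setT (fun u => mgf (mu j) (D u *m th)).
Proof.
move=> mD.
have -> : (fun u => mgf (mu j) (D u *m th)) =
    fubini_F (mu j) (fun p => (expR (inner th (delivered D p)))%:E).
  apply/funext => u; rewrite /mgf /fubini_F; apply: eq_integral => x _.
  by rewrite /delivered inner_mul.
apply: measurable_fun_fubini_tonelli_F => //.
apply: (measurableT_comp (measurable_expinner th)).
apply: measurable_to_borelV => // l.
under eq_fun do rewrite /delivered mxE.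
apply: measurable_sum => k; apply: measurable_funM.
  by apply: measurableT_comp (measurable_coordV k) _.
by apply: measurableT_comp (mD k l) _.
Qed.

(** The occupation sets of the states partition the interval. *)
Lemma integral_by_state (phi : R -> 'I_d.+1) (h : 'I_d.+1 -> R -> \bar R) :
  (forall j, measurable [set u | phi u = j]) ->
  (forall j u, 0 <= h j u) ->
  (forall j, measurable_fun setT (h j : measurableTypeR R -> \bar R)) ->
  measurable_fun setT (fun u : measurableTypeR R => (lam (phi u))%:E * h (phi u) u) /\
  \int[lebesgue_measure]_(u in `[0%R, t]) ((lam (phi u))%:E * h (phi u) u) =
  \sum_j (lam j)%:E * \int[lebesgue_measure]_(u in occupied t phi j) h j u.
Proof.
move=> mphi h0 mh.
have E u : (lam (phi u))%:E * h (phi u) u =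
    \sum_j (lam j)%:E * ((\1_[set u | phi u = j] u)%:E * h j u).
  rewrite (bigD1 (phi u))//= big1 ?adde0.
    by rewrite indicE mem_set// mul1e.
  by move=> j jp; rewrite indicE memNset ?mul0e ?mule0//= => pj; move: jp; rewrite pj eqxx.
have mterm j : measurable_fun setT
    (fun u : measurableTypeR R => (\1_[set u | phi u = j] u)%:E * h j u).
  apply: emeasurable_funM; last exact: mh.
  by apply/measurable_EFinP; apply: measurable_indic; exact: mphi.
have mterm2 j : measurable_fun setT
    (fun u : measurableTypeR R => (lam j)%:E * ((\1_[set u | phi u = j] u)%:E * h j u)).
  by apply: emeasurable_funM; [exact: measurable_cst|exact: mterm].
split.
  under eq_fun do rewrite E.
  exact: emeasurable_sum.
under eq_integral do rewrite E.
rewrite ge0_integral_sum//; last 2 first.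
- by move=> j; apply: measurable_funTS; exact: mterm2.
- by move=> j u _; rewrite !mule_ge0// lee_fin.
apply: eq_bigr => j _; rewrite ge0_integralZl//; last 3 first.
- by apply: measurable_funTS; exact: mterm.
- by move=> u _; rewrite mule_ge0// lee_fin.
- by rewrite lee_fin.
congr (_ * _); rewrite integral_mkcond [RHS]integral_mkcond.
apply: eq_integral => u _; rewrite !patchE indicE /occupied.
case: (boolP (phi u == j)) => [/eqP pj|pj].
  have pu : u \in [set u | phi u = j] by rewrite inE.
  by rewrite in_setI pu andbT mul1e.
have np : ~ phi u = j by move=> /eqP; rewrite (negbTE pj).
have nu : (u \in [set u | phi u = j]) = false by apply/negP; rewrite inE.
by rewrite in_setI nu andbF mul0e; case: ifP.
Qed.

Lemma jepoch_le s0 (l : seq (R * 'I_d.+1)) i : path <%R s0 (unzip1 l) ->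
  all (fun s => s <= t)%R (unzip1 l) -> (s0 <= t)%R -> (i <= size l)%N ->
  (jepoch t s0 l i <= jepoch t s0 l i.+1)%R.
Proof.
elim: l s0 i => [|[s y] l IH] s0 i /=.
  by move=> _ _ s0t; rewrite leqn0 => /eqP ->.
move=> /andP[s0s sl] /andP[st al] s0t.
case: i => [|i] il; first by rewrite /jepoch /= ltW.
exact: (IH s i sl al st il).
Qed.

Lemma transferE f i u :
  transfer r f i u = jtransfer r t (val f).1 0%R (val f).2 i u.
Proof.
have E k v : decay r f k v = jdecay r t (val f).1 0%R (val f).2 k v.
  by rewrite /decay /jdecay /drift scaleNr scalerN.
rewrite /transfer /jtransfer E; apply: (f_equal (mulmx _)).
by apply: eq_bigr => k _; rewrite E.
Qed.

Lemma jtransfer_measurable x s0 l i a b :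
  measurable_fun setT (fun u : measurableTypeR R => jtransfer r t x s0 l i u a b).
Proof.
rewrite /jtransfer; under eq_fun do rewrite mxE.
apply: measurable_sum => k; apply: measurable_funM => //.
exact: measurable_expmx_affine.
Qed.

(** The moment generating function of a compound Poisson law: given the path, a
    job of state [j] arrives at [u] at rate [lam j] and is transferred to the
    horizon, so that [path_levy] is the intensity of the delivered jobs. *)
Lemma MfE f th : Mf lam mu r f th = expeR (mgf (path_levy f) th - (path_mass f)%:E).
Proof.
have fl := path_flow_is_flow f.
have := valP f; rewrite /wf_path; set x := (val f).1; set l := (val f).2.
move=> /and3P[sl al _].
pose G i := \int[lebesgue_measure]_(u in `[jepoch t 0%R l i, jepoch t 0%R l i.+1])
  mgf (mu (jstep x l i)) (jtransfer r t x 0%R l i u *m th).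
pose len i : R := (jepoch t 0 l i.+1 - jepoch t 0 l i)%R.
have lenE i : (i <= size l)%N -> (0 <= len i)%R.
  by move=> il; rewrite subr_ge0; exact: jepoch_le.
have mtr i : measurable_fun setT (fun u : measurableTypeR R =>
    mgf (mu (jstep x l i)) (jtransfer r t x 0%R l i u *m th)).
  by apply: measurable_mgf_mx => a b; exact: jtransfer_measurable.
transitivity (expeR (\sum_(0 <= i < (size l).+1)
    ((lam (jstep x l i))%:E * G i + (- (lam (jstep x l i) * len i))%:E))).
  rewrite (big_morph _ (@expeRD R) (@expeR0 R)) /Mf; apply: eq_big_nat => i /andP[_ il].
  congr expeR.
  transitivity ((lam (jstep x l i))%:E * (G i - (len i)%:E)).
    congr (_ * _); rewrite /G /len -integral_sub1.
    - by apply: eq_integral => u _; rewrite transferE.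
    - exact: jepoch_le.
    - by apply: measurable_funTS; exact: mtr.
    - by move=> u; exact: mgf_ge0.
  by rewrite muleBr// fin_num_adde_defl.
congr expeR; rewrite big_split /=; congr (_ + _).
- transitivity (\sum_(0 <= i < (size l).+1)
    \int[lebesgue_measure]_(u in `[jepoch t 0%R l i, jepoch t 0%R l i.+1])
     ((lam (jstep x l i))%:E * mgf (mu (jstep x l i)) (jtransfer r t x 0%R l i u *m th))).
    apply: eq_bigr => i _; rewrite ge0_integralZl//.
    + exact: measurable_funTS.
    + by move=> u _; exact: mgf_ge0.
    + by rewrite lee_fin.
  have mh j (x' : 'I_d.+1) l' : measurable_fun setT
      (fun u : measurableTypeR R => mgf (mu j) (jflow r t x' l' u *m th)).
    by apply: measurable_mgf_mx => a b; exact: jflow_measurable.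
  pose H j D := (lam j)%:E * mgf (mu j) (D *m th).
  rewrite (@jflow_integral _ _ _ r t H)//; last 2 first.
  + by move=> j D; rewrite mule_ge0 ?lee_fin ?mgf_ge0.
  + move=> x' l'; have [+ _] := integral_by_state (jstate_measurable x' l')
      (fun j u => mgf_ge0 (mu j) (jflow r t x' l' u *m th)) (fun j => mh j x' l').
    exact.
  have [_ ->] := integral_by_state (jstate_measurable x l)
    (fun j u => mgf_ge0 (mu j) (jflow r t x l u *m th)) (fun j => mh j x l).
  rewrite mgf_path_levy (_ : path_at f = jstate x l); last by apply/funext => u; rewrite path_atE.
  by [].
- pose H (j : 'I_d.+1) (D : 'M[R]_L) := (lam j)%:E * 1.
  have m1 (x' : 'I_d.+1) l' := integral_by_state (jstate_measurable x' l')
    (h := fun _ _ => 1) (fun _ _ => lee01) (fun _ => @measurable_cst _ _ _ _ setT (1 : \bar R)).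
  transitivity (- \sum_(0 <= i < (size l).+1)
    \int[lebesgue_measure]_(u in `[jepoch t 0%R l i, jepoch t 0%R l i.+1])
     H (jstep x l i) (jtransfer r t x 0%R l i u)).
    have Hi i : (i <= size l)%N -> \int[lebesgue_measure]_(u in `[jepoch t 0%R l i, jepoch t 0%R l i.+1])
        H (jstep x l i) (jtransfer r t x 0%R l i u) = (lam (jstep x l i) * len i)%:E.
      move=> il; rewrite /H mule1 integral_cst//.
      rewrite EFinM; congr (_ * _); rewrite [LHS]lebesgue_measure_itv /= lte_fin.
      have := lenE i il; rewrite /len subr_ge0.
      by case: ltgtP => // -> _; rewrite subrr.
    under [in RHS]eq_big_nat => i /andP[_ il] do rewrite Hi//.
    by rewrite !sumEFin -EFinN -sumrN.
  rewrite (@jflow_integral _ _ _ r t H)//; last 2 first.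
  + by move=> j D; rewrite /H mule1 lee_fin.
  + by move=> x' l'; have [+ _] := m1 x' l'.
  have [_ ->] := m1 x l.
  rewrite EFinN; apply: (f_equal oppe); rewrite /path_mass /mass -sumEFin.
  rewrite (_ : path_at f = jstate x l); last by apply/funext => u; rewrite path_atE.
  apply: eq_bigr => j _; rewrite EFinM.
  rewrite integral_cst; last by apply: measurableI => //; exact: jstate_measurable.
  rewrite mul1e fineK// ge0_fin_numE//.
  have := occupied_fin (path_flow_is_flow f) j.
  by rewrite (_ : path_at f = jstate x l)//; apply/funext => u; rewrite path_atE.
Qed.

End MfLevy.

End Along.
Export Along.

(** * Dependence of the flow on the path *)

Module Limits.
Local Opaque expmx.

Lemma bounded_cvg_integral_ae d (X : measurableType d) (R : realType)
    (m : {measure set X -> \bar R}) (D : set X) (F : nat -> X -> R) (G : X -> R) (M : R) :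
  measurable D -> (m D < +oo)%E -> 0 <= M ->
  (forall k, measurable_fun D (F k)) -> measurable_fun D G ->
  (forall k x, D x -> `|F k x| <= M) ->
  {ae m, forall x, D x -> F k x @[k --> \oo] --> G x} ->
  (\int[m]_(x in D) (F k x)%:E)%E @[k --> \oo] --> (\int[m]_(x in D) (G x)%:E)%E.
Proof.
move=> mD mDfin M0 mF mG FM FG.
have mGE : measurable_fun D (EFin \o G) by exact/measurable_EFinP.
have mFE k : measurable_fun D (EFin \o F k) by apply/measurable_EFinP; exact: mF.
have Mint : m.-integrable D (cst M%:E).
  apply/integrableP; split; first exact: measurable_cst.
  by rewrite integral_cst//= ger0_norm// lte_mul_pinfty.
have FGE : {ae m, forall x, D x -> (EFin \o F k) x @[k --> \oo] --> (EFin \o G) x}.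
  move: FG; apply: filterS => x H Dx.
  by apply: cvg_EFin; [exact: nearW|exact: H].
have [_ _] := dominated_convergence mD mFE mGE FGE Mint
  (aeW m (fun x k Dx => FM k x Dx)).
exact.
Qed.

Lemma bounded_cvg_integral d (X : measurableType d) (R : realType)
    (m : {measure set X -> \bar R}) (D : set X) (F : nat -> X -> R) (G : X -> R) (M : R) :
  measurable D -> (m D < +oo)%E -> 0 <= M ->
  (forall k, measurable_fun D (F k)) ->
  (forall k x, D x -> `|F k x| <= M) ->
  (forall x, D x -> F k x @[k --> \oo] --> G x) ->
  (\int[m]_(x in D) (F k x)%:E)%E @[k --> \oo] --> (\int[m]_(x in D) (G x)%:E)%E.
Proof.
move=> mD mDfin M0 mF FM FG; apply: (@bounded_cvg_integral_ae _ _ _ _ _ _ _ M) => //.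
  exact: (measurable_fun_cvg mF).
exact: aeW.
Qed.

Section FlowDistance.
Context {R : realType} {L d : nat}.
Variables (r : 'I_d.+1 -> 'M[R]_L) (t : R).
Hypothesis r0 : forall j i i', 0 <= r j i i'.
Local Notation dbound := (2 * (L%:R * drift_bound r)).

Definition constant_between (b : seq R) (phi : R -> 'I_d.+1) :=
  forall u v w, (forall s, s \in b -> ~ (u < s < v)) -> u <= w -> w < v -> phi w = phi u.

Lemma jstate_constant x (l : seq (R * 'I_d.+1)) :
  constant_between (unzip1 l) (jstate x l).
Proof.
elim: l x => [|[s y] l IH] x u v w //= H uw wv.
have Hl s' : s' \in unzip1 l -> ~ u < s' < v.
  by move=> s'l; apply: H; rewrite inE s'l orbT.
case: (ltP u s) => us; last by rewrite ltNge (le_trans us uw) /=; exact: IH Hl _ _.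
case: ltP => // sw; exfalso; apply: (H s); first by rewrite inE eqxx.
by rewrite us (le_lt_trans sw wv).
Qed.

Variables (phi phi' : R -> 'I_d.+1) (D D' : R -> 'M[R]_L).
Hypotheses (fl : is_flow r t phi D) (fl' : is_flow r t phi' D').

Definition discord (u v : R) : set R := `[u, v[%classic `&` [set w | phi w != phi' w].

Lemma measurable_disagree : measurable [set w | phi w != phi' w].
Proof.
have -> : [set w | phi w != phi' w] =
    \bigcup_(j in [set: 'I_d.+1]) ([set w | phi w = j] `&` ~` [set w | phi' w = j]).
  apply/seteqP; split => w /=.
    by move=> /eqP ne; exists (phi w) => //; split => // h; apply: ne.
  by move=> [j _ [-> ne]]; apply/eqP => h; apply: ne.
apply: countable_bigcup_measurable => j _; apply: measurableI.
  exact: (flow_mphi fl).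
by apply: measurableC; exact: (flow_mphi fl').
Qed.

Lemma measurable_discord u v : measurable (discord u v).
Proof. by apply: measurableI => //; exact: measurable_disagree. Qed.

Lemma discord_fin u v : (lebesgue_measure (discord u v) < +oo)%E.
Proof.
apply: (@le_lt_trans _ _ (lebesgue_measure (`[u, v[%classic : set R))).
  by apply: le_measure; rewrite ?inE//; [exact: measurable_discord|exact: subIsetl].
by rewrite lebesgue_measure_itv /=; case: ifP => // _; rewrite -EFinB ltry.
Qed.

Definition discordance u v : R := fine (lebesgue_measure (discord u v)).

Lemma discordance_ge0 u v : 0 <= discordance u v.
Proof. exact: fine_ge0. Qed.

Lemma discordance_split u s v : u <= s -> s <= v ->
  discordance u v = discordance u s + discordance s v.
Proof.
move=> us sv; rewrite /discordance -fineD ?ge0_fin_numE ?discord_fin//.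
congr fine; rewrite -measureU.
- congr (lebesgue_measure _); rewrite /discord -setIUl; congr (_ `&` _).
  by rewrite -itv_bndbnd_setU// bnd_simp.
- exact: measurable_discord.
- exact: measurable_discord.
- rewrite -subset0 => w [] [] /=; rewrite !in_itv /= => /andP[_ ws] _ [/andP[sw _] _].
  by move: ws; rewrite ltNge; move: sw; rewrite bnd_simp => ->.
Qed.

(** While the trajectories agree, both flows are moved by a common substochastic
    factor, which does not spread them apart; otherwise they move at bounded
    speed. Induction on the number of jumps. *)
Lemma flow_close b b' u : constant_between b phi -> constant_between b' phi' ->
  u <= t -> forall i j, `|D u i j - D' u i j| <= dbound * discordance u t.
Proof.
move=> cb cb' ut.
have C0 : 0 <= dbound by rewrite !mulr_ge0// drift_bound_ge0.
suff H n (v w : R) : (count (fun s => v < s < w)%R (b ++ b') <= n)%N -> v <= w -> w <= t ->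
    forall e, 0 <= e -> (forall i j, `|D w i j - D' w i j| <= e) ->
    forall i j, `|D v i j - D' v i j| <= e + dbound * discordance v w.
  move=> i j; rewrite -[leRHS]add0r; apply: (H _ u t (leqnn _)) => // i' j'.
  by rewrite (flow_end fl) (flow_end fl') subrr normr0.
elim: n v w => [|n IH] v w; last first.
  case: (boolP (has (fun s => v < s < w) (b ++ b'))) => [/hasP[s sb /andP[vs sw]]|]; last first.
    rewrite has_count -leqNgt leqn0 => /eqP c0 _; apply: (IH v w).
    by rewrite c0.
  move=> cn vw wt e e0 He i j.
  have cs : (count (pred1 s) (b ++ b') > 0)%N by rewrite -has_count has_pred1.
  have c1 : (count (fun x => v < x < s)%R (b ++ b') + count (pred1 s) (b ++ b')
      <= count (fun x => v < x < w)%R (b ++ b'))%N.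
    rewrite -count_predUI [X in (_ + X)%N](_ : _ = 0%N) ?addn0.
      apply: sub_count => x /= /orP[/andP[-> xs]|/eqP ->]; last by rewrite vs.
      exact: lt_trans xs sw.
    apply/eqP; rewrite -leqn0 leqNgt -has_count; apply/hasPn => x _ /=.
    by apply/negP => /andP[/andP[_ xs] /eqP xE]; move: xs; rewrite xE ltxx.
  have c2 : (count (fun x => s < x < w)%R (b ++ b') + count (pred1 s) (b ++ b')
      <= count (fun x => v < x < w)%R (b ++ b'))%N.
    rewrite -count_predUI [X in (_ + X)%N](_ : _ = 0%N) ?addn0.
      apply: sub_count => x /= /orP[/andP[xs ->]|/eqP ->]; last by rewrite vs.
      by rewrite (lt_trans vs xs).
    apply/eqP; rewrite -leqn0 leqNgt -has_count; apply/hasPn => x _ /=.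
    by apply/negP => /andP[/andP[xs _] /eqP xE]; move: xs; rewrite xE ltxx.
  rewrite (discordance_split (ltW vs) (ltW sw)) mulrDr [_ * _ + _]addrC addrA.
  apply: (IH v s) => //.
  - by rewrite -ltnS (leq_trans _ cn)// (leq_trans _ c1)// -addn1 leq_add2l.
  - exact: ltW.
  - exact: le_trans (ltW sw) wt.
  - by rewrite addr_ge0// mulr_ge0// discordance_ge0.
  apply: (IH s w) => //; last exact: ltW.
  by rewrite -ltnS (leq_trans _ cn)// (leq_trans _ c2)// -addn1 leq_add2l.
rewrite leqn0 => /eqP c0 vw wt e e0 He i j.
have nb s : s \in b ++ b' -> ~ (v < s < w).
  move=> sb vsw; have : has (fun s => v < s < w) (b ++ b') by apply/hasP; exists s.
  by rewrite has_count c0.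
have k1 x : v <= x -> x < w -> phi x = phi v.
  by apply: cb => s sb; apply: nb; rewrite mem_cat sb.
have k2 x : v <= x -> x < w -> phi' x = phi' v.
  by apply: cb' => s sb; apply: nb; rewrite mem_cat sb orbT.
have [E|NE] := eqVneq (phi v) (phi' v).
  apply: (@le_trans _ _ e); last by rewrite lerDl mulr_ge0// discordance_ge0.
  apply: (@flow_close_good _ _ _ r r0 t phi D phi' D' v w (phi v) e) => // x vx xw.
  by rewrite k2.
have -> : discordance v w = w - v.
  rewrite /discordance (_ : discord v w = `[v, w[%classic); last first.
    apply/seteqP; split => x /=; first by case.
    by move=> /=; rewrite in_itv /= => /andP[vx xw]; split => /=; [rewrite in_itv /= vx|rewrite k1// k2].
  rewrite lebesgue_measure_itv /= lte_fin; move: vw; rewrite le_eqVlt => /orP[/eqP ->|->//].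
  by rewrite ltxx subrr.
apply: (flow_close_bad fl fl' vw wt He).
Qed.

End FlowDistance.

Section Grid.
Context {R : realType} {L d : nat} {t : R}.
Variables (r : 'I_d.+1 -> 'M[R]_L).
Hypothesis t0 : 0 < t.
Hypothesis r0 : forall j i i', 0 <= r j i i'.
Implicit Types f : bpath d t.

Definition grid (m i : nat) : R := i%:R * (t / m.+1%:R).

Lemma grid_step m i : grid m i.+1 - grid m i = t / m.+1%:R.
Proof. by rewrite /grid -mulrBl -natrB// subSnn mul1r. Qed.

Lemma grid_le m i k : (i <= k)%N -> grid m i <= grid m k.
Proof. by move=> ik; rewrite ler_wpM2r ?ler_nat// divr_ge0// ltW. Qed.

Lemma grid_last m : grid m m.+1 = t.
Proof. by rewrite /grid mulrCA mulfV ?mulr1// pnatr_eq0. Qed.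

Lemma grid_ge0 m i : 0 <= grid m i.
Proof. by rewrite /grid mulr_ge0// divr_ge0// ltW. Qed.

(** The trajectory that takes on each cell of the grid the value of [p] at the
    right end of the cell, so that right-continuity makes it converge. *)
Definition grid_list (m k n : nat) (p : nat -> 'I_d.+1) : seq (R * 'I_d.+1) :=
  [seq (grid m i, p i.+1) | i <- iota k.+1 n].

Lemma grid_jstate m k n p u : grid m k <= u -> u <= grid m (k + n).+1 ->
  exists i, [/\ (k <= i <= k + n)%N, jstate (p k.+1) (grid_list m k n p) u = p i.+1,
    grid m i <= u & u <= grid m i.+1].
Proof.
elim: n k => [|n IH] k ku uk.
  by exists k; rewrite addn0 leqnn; split => //; move: uk; rewrite addn0.
rewrite /grid_list /=; case: ltP => us.
  by exists k; rewrite leqnn leq_addr; split => //; exact: ltW.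
have [|i [/andP[ki il] -> *]] := IH k.+1 us; first by rewrite addSnnS.
by exists i; rewrite (ltnW ki) -addSnnS il; split.
Qed.

Lemma grid_list_sorted m p :
  sorted <=%R (unzip1 (grid_list m 0 m p)) && all (fun s => s <= t) (unzip1 (grid_list m 0 m p)).
Proof.
rewrite /grid_list /unzip1 -map_comp; apply/andP; split.
  apply: (@homo_sorted _ _ _ leq) => [i k|]; last exact: iota_sorted.
  exact: grid_le.
rewrite all_map; apply/allP => i; rewrite mem_iota => /andP[_ im] /=.
by rewrite -(grid_last m) grid_le//; move: im; rewrite add1n; exact: ltnW.
Qed.

Lemma path_at_rcont f u : exists2 e, 0 < e & forall v, u <= v -> v < u + e -> path_at f v = path_at f u.
Proof.
suff [e e0 H] : exists2 e, 0 < e & forall v, u <= v -> v < u + e ->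
    jstate (val f).1 (val f).2 v = jstate (val f).1 (val f).2 u.
  by exists e => // v *; rewrite !path_atE; exact: H.
elim: (val f).2 (val f).1 => [|[s y] l IH] x /=; first by exists 1.
case: (ltP u s) => us.
  exists (s - u); first by rewrite subr_gt0.
  by move=> v uv; rewrite addrC subrK => ->.
have [e e0 H] := IH y; exists e => // v uv vu.
by rewrite ltNge (le_trans us uv) /=; exact: H.
Qed.

Definition grid_pattern m f : {ffun 'I_m.+2 -> 'I_d.+1} := [ffun i : 'I_m.+2 => path_at f (grid m i)].

Definition pattern_fun m (q : {ffun 'I_m.+2 -> 'I_d.+1}) (i : nat) : 'I_d.+1 := q (inord i).

Definition grid_state m q : R -> 'I_d.+1 :=
  jstate (pattern_fun q 1) (grid_list m 0 m (@pattern_fun m q)).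

Definition grid_flow m q : R -> 'M[R]_L :=
  jflow r t (pattern_fun q 1) (grid_list m 0 m (@pattern_fun m q)).

Lemma grid_flow_is_flow m q : is_flow r t (@grid_state m q) (grid_flow q).
Proof. by apply: jflow_is_flow => //; exact: grid_list_sorted. Qed.

Lemma grid_mesh_cvg e : 0 < e -> \forall m \near \oo, t / m.+1%:R < e.
Proof.
move=> e0; near=> m; rewrite ltr_pdivrMr// mulrC -ltr_pdivrMr//.
have : t / e <= m%:R by near: m; exact: nbhs_infty_ger.
by move=> /le_lt_trans; apply; rewrite ltr_nat.
Unshelve. all: by end_near. Qed.

Lemma grid_state_cvg f u : 0 <= u -> u <= t ->
  \forall m \near \oo, grid_state (grid_pattern m f) u = path_at f u.
Proof.
move=> u0 ut; have [e e0 He] := path_at_rcont f u.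
near=> m; have me : t / m.+1%:R < e by near: m; exact: grid_mesh_cvg.
rewrite /grid_state; have [||i [/andP[_ im] -> iu ui]] := @grid_jstate m 0 m (pattern_fun (grid_pattern m f)) u.
- by rewrite /grid mul0r.
- by rewrite add0n grid_last.
rewrite /pattern_fun ffunE inordK ?ltnS//; apply: He => //.
by rewrite -(subrK (grid m i) (grid m i.+1)) grid_step addrC ler_ltD.
Unshelve. all: by end_near. Qed.

Lemma path_at_constant f : constant_between (unzip1 (val f).2) (path_at f).
Proof.
have -> : path_at f = jstate (val f).1 (val f).2 by apply/funext => u; rewrite path_atE.
exact: jstate_constant.
Qed.

(** By dominated convergence the trajectories disagree during a vanishing total
    time, which controls the flows by [flow_close]. *)
Lemma flow_cvg (phi : nat -> R -> 'I_d.+1) (D : nat -> R -> 'M[R]_L) (b : nat -> seq R) f u :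
  (forall m, is_flow r t (phi m) (D m)) -> (forall m, constant_between (b m) (phi m)) ->
  (forall v, 0 < v -> v < t -> ~ (v \in unzip1 (val f).2) ->
     \forall m \near \oo, phi m v = path_at f v) ->
  0 <= u -> u <= t ->
  forall i j, D m u i j @[m --> \oo] --> path_flow r f u i j.
Proof.
move=> fl cb Hphi u0 ut i j.
have flf := path_flow_is_flow r0 f.
pose S := [set` 0 :: unzip1 (val f).2] : set R.
have S0 : lebesgue_measure S = 0%E.
  by apply: countable_lebesgue_measure0; apply: finite_set_countable; exact: finite_seq.
have dE m : discordance (phi m) (path_at f) u t =
    fine (\int[lebesgue_measure]_(v in `[u, t[) (\1_[set w | phi m w != path_at f w] v)%:E).
  by rewrite integral_indic//; [rewrite setIC|exact: (measurable_disagree (fl m) flf)].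
have d0 : discordance (phi m) (path_at f) u t @[m --> \oo] --> (0 : R).
  under eq_fun do rewrite dE.
  suff H : (\int[lebesgue_measure]_(v in `[u, t[) (\1_[set w | phi m w != path_at f w] v)%:E)%E
      @[m --> \oo] --> (0 : \bar R) by exact: (fine_cvg H).
  rewrite -[X in _ --> X](integral0 lebesgue_measure `[u, t[%classic).
  apply: (@bounded_cvg_integral_ae _ _ _ _ _ _ _ 1) => //.
  - rewrite [X in (X < _)%E](_ : _ = lebesgue_measure (`[u, t[%classic : set R))//.
    by rewrite lebesgue_measure_itv /=; case: ifP => // _; rewrite -EFinB ltry.
  - by move=> m; apply: measurable_funTS; apply: measurable_indic; exact: (measurable_disagree (fl m) flf).
  - by move=> m v _; rewrite indicE; case: (_ \in _); rewrite ?normr1 ?normr0.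
  - exists S; split => //; first by apply: countable_measurable => //; apply: finite_set_countable; exact: finite_seq.
    move=> v /= nv; apply: contrapT => nS; apply: nv; rewrite in_itv /= => /andP[uv vt].
    have v0 : 0 < v.
      by rewrite lt_neqAle (le_trans u0 uv) andbT; apply/negP => /eqP v0; apply: nS; rewrite /S /= inE -v0 eqxx.
    have vS : ~ (v \in unzip1 (val f).2) by move=> h; apply: nS; rewrite /S /= inE h orbT.
    apply: cvg_near_cst; have := Hphi v v0 vt vS.
    by apply: filterS => m pm; rewrite indicE memNset//= pm eqxx.
apply/cvgrPdist_le => e e0.
have C0 : 0 <= 2 * (L%:R * drift_bound r) by rewrite !mulr_ge0// drift_bound_ge0.
have C1 : 0 < 2 * (L%:R * drift_bound r) + 1 by rewrite ltr_wpDl.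
near=> m.
rewrite distrC; apply: le_trans (flow_close r0 (fl m) flf (cb m) (@path_at_constant f) ut i j) _.
apply: (@le_trans _ _ ((2 * (L%:R * drift_bound r) + 1) * discordance (phi m) (path_at f) u t)).
  by rewrite ler_wpM2r ?discordance_ge0// lerDl.
rewrite mulrC -ler_pdivlMr//; near: m.
move/cvgrPdist_le : d0 => /(_ (e / (2 * (L%:R * drift_bound r) + 1)))[]; first by rewrite divr_gt0.
move=> N _ HN; exists N => // m Nm; have := HN m Nm.
by rewrite /= sub0r normrN ger0_norm// discordance_ge0.
Unshelve. all: by end_near. Qed.

End Grid.

Section JointMeasurability.
Context {R : realType} {L d : nat} {t : R}.
Local Notation T := (borelV R L).
Local Notation X := (bpath d t).
Local Notation RR := (measurableTypeR R).
Variables (r : 'I_d.+1 -> 'M[R]_L).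
Hypothesis t0 : 0 < t.
Hypothesis r0 : forall j i i', 0 <= r j i i'.

Lemma measurable_path_at_fixed s j : 0 <= s -> s <= t ->
  measurable [set f : X | path_at f s = j].
Proof. by move=> s0 st; apply: sub_sigma_algebra; exists s, j. Qed.

Lemma measurable_pattern m q : measurable [set f : X | grid_pattern m f = q].
Proof.
have -> : [set f : X | grid_pattern m f = q] =
    \bigcap_(i in [set: 'I_m.+2]) [set f : X | path_at f (@grid R t m i) = q i].
  apply/seteqP; split => f /=.
    by move=> fq i _ /=; rewrite -fq ffunE.
  by move=> H; apply/ffunP => i; rewrite ffunE; exact: H.
apply: fin_bigcap_measurable; first exact: finite_finset.
move=> i _; apply: measurable_path_at_fixed; first exact: grid_ge0.
apply: (@le_trans _ _ (@grid R t m m.+1)); first by rewrite grid_le// -ltnS.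
by rewrite grid_last.
Qed.

(** There are finitely many patterns; limits over finer grids then give the
    joint measurability of functions of the path and of time. *)
Lemma measurable_by_pattern m (G : {ffun 'I_m.+2 -> 'I_d.+1} -> RR -> R) :
  (forall q, measurable_fun setT (G q)) ->
  measurable_fun setT (fun p : X * RR => G (grid_pattern m p.1) p.2).
Proof.
move=> mG.
have -> : (fun p : X * RR => G (grid_pattern m p.1) p.2) =
    (fun p => \sum_q (\1_[set f : X | grid_pattern m f = q] p.1 : R) * G q p.2).
  apply/funext => p; rewrite (bigD1 (grid_pattern m p.1))//= big1 ?addr0.
    by rewrite indicE mem_set// mul1r.
  move=> q qp; rewrite indicE memNset ?mul0r//= => pq.
  by move: qp; rewrite pq eqxx.
apply: measurable_sum => q; apply: measurable_funM.
  apply: (@measurableT_comp _ _ _ _ _ _ (\1_[set f : X | grid_pattern m f = q] : X -> R)) => //.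
  by apply: measurable_indic; exact: measurable_pattern.
by apply: (@measurableT_comp _ _ _ _ _ _ (G q)) => //.
Qed.

Definition arrives (f : X) j (u : R) : bool := [&& 0 <= u, u <= t & path_at f u == j].

Let D : set (X * RR) := setT `*` `[0, t]%classic.

Let mD : measurable D.
Proof. by apply: measurableX => //; exact: measurable_itv. Qed.

Lemma measurable_path_at j :
  measurable_fun D (fun p : X * RR => (path_at p.1 p.2 == j)%:R : R).
Proof.
apply: (@measurable_fun_cvg _ _ _ _
  (fun m (p : X * RR) => (grid_state (grid_pattern m p.1) p.2 == j)%:R : R)).
  move=> m; apply: measurable_funTS.
  apply: (@measurable_by_pattern m (fun q u => (grid_state q u == j)%:R)) => q.
  have : measurable_fun setT (\1_[set u | @grid_state R d t m q u = j] : RR -> R).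
    by apply: measurable_indic; exact: jstate_measurable.
  apply: eq_measurable_fun => u _; rewrite indicE.
  suff -> : (u \in [set u0 | @grid_state R d t m q u0 = j]) = (@grid_state R d t m q u == j) by [].
  by apply/idP/eqP; rewrite inE.
move=> p [_ /=]; rewrite in_itv /= => /andP[p0 pt]; apply: cvg_near_cst.
by have := grid_state_cvg p.1 p0 pt; apply: filterS => m ->.
Qed.

Lemma measurable_path_flow i k :
  measurable_fun D (fun p : X * RR => path_flow r p.1 p.2 i k).
Proof.
apply: (@measurable_fun_cvg _ _ _ _
  (fun m (p : X * RR) => grid_flow r (grid_pattern m p.1) p.2 i k)).
  move=> m; apply: measurable_funTS.
  apply: (@measurable_by_pattern m (fun q u => grid_flow r q u i k)) => q.
  exact: jflow_measurable.
move=> p [_ /=]; rewrite in_itv /= => /andP[p0 pt].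
have fl m := grid_flow_is_flow t0 r0 (grid_pattern m p.1).
have cb m : constant_between (unzip1 (@grid_list R d t m 0 m (pattern_fun (grid_pattern m p.1))))
    (@grid_state R d t m (grid_pattern m p.1)) by exact: jstate_constant.
apply: (flow_cvg r0 fl cb) => // v v0 vt _.
by apply: grid_state_cvg => //; exact: ltW.
Qed.

Lemma measurable_arrives j : measurable [set p : X * RR | arrives p.1 j p.2].
Proof.
have -> : [set p : X * RR | arrives p.1 j p.2] =
    D `&` (fun p : X * RR => (path_at p.1 p.2 == j)%:R : R) @^-1` [set 1].
  apply/seteqP; split => p /=; rewrite /arrives /D /=.
    by move=> /and3P[p0 pt ->]; split => //; split => //=; rewrite in_itv /= p0.
  by move=> [[_ /=]]; rewrite in_itv /= => /andP[-> ->]; case: (_ == _) => // /eqP; rewrite eq_sym oner_eq0.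
exact: measurable_path_at.
Qed.

(** What a job [b] brought in at time [u] while the background state is [j]
    contributes to the storage at the horizon. *)
Definition contribution (f : X) j (u : R) (b : T) : T :=
  if arrives f j u then (b : 'rV[R]_L) *m path_flow r f u else 0.

Lemma measurable_contribution j :
  measurable_fun setT (fun q : (X * RR) * T => contribution q.1.1 j q.1.2 q.2).
Proof.
apply: measurable_to_borelV => // l.
pose D0 i k : X * RR -> R := (fun p : X * RR => path_flow r p.1 p.2 i k) \_ D.
have mD0 i k : measurable_fun setT (D0 i k).
  by apply/(measurable_restrictT _ mD); exact: measurable_path_flow.
have -> : (fun q : (X * RR) * T => (contribution q.1.1 j q.1.2 q.2 : 'rV[R]_L) ord0 l) =
   (fun q => (\1_[set p : X * RR | arrives p.1 j p.2] q.1 : R) *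
     \sum_k (q.2 : 'rV[R]_L) ord0 k * D0 k l q.1).
  apply/funext => -[[f u] b] /=; rewrite /contribution indicE.
  case: (boolP (arrives f j u)) => A; last by rewrite memNset ?mul0r ?mxE//=; exact/negP.
  rewrite mem_set// mul1r mxE; apply: eq_bigr => k _; congr (_ * _).
  rewrite /D0 patchE mem_set//; split => //=; rewrite in_itv /=.
  by case/and3P: A => -> ->.
apply: measurable_funM.
  apply: (@measurableT_comp _ _ _ _ _ _ (\1_[set p : X * RR | arrives p.1 j p.2] : X * RR -> R)) => //.
  by apply: measurable_indic; exact: measurable_arrives.
apply: measurable_sum => k; apply: measurable_funM.
  apply: (@measurableT_comp _ _ _ _ _ _ (fun y : T => (y : 'rV[R]_L) ord0 k)) => //.
  exact: measurable_coordV.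
exact: (@measurableT_comp _ _ _ _ _ _ (D0 k l)).
Qed.

Variables (lam : 'I_d.+1 -> R) (mu : 'I_d.+1 -> probability T R).
Hypothesis lam0 : forall j, 0 <= lam j.

Local Open Scope ereal_scope.

Lemma integral_arrives (h : RR -> \bar R) f j :
  \int[lebesgue_measure]_(u in occupied t (path_at f) j) h u =
  \int[lebesgue_measure]_u ((\1_[set p : X * RR | arrives p.1 j p.2] (f, u))%:E * h u).
Proof.
rewrite integral_mkcond; apply: eq_integral => u _.
rewrite patchE indicE /arrives; case: ifPn.
  rewrite inE => -[/=]; rewrite in_itv /= => /andP[u0 ut] uj.
  by rewrite mem_set ?mul1e//= u0 ut uj eqxx.
move=> /negP nu; rewrite memNset ?mul0e//= => /and3P[u0 ut /eqP uj]; apply: nu.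
by rewrite inE; split => //=; rewrite in_itv /= u0.
Qed.

Lemma measurable_integral_path_levy (g : T -> \bar R) : measurable_fun setT g ->
  (forall y, 0 <= g y) ->
  measurable_fun setT (fun f : X => \int[path_levy lam mu r0 f]_y g y).
Proof.
move=> mg g0.
have -> : (fun f : X => \int[path_levy lam mu r0 f]_y g y) = (fun f => \sum_j (lam j)%:E *
    \int[lebesgue_measure]_u ((\1_[set p : X * RR | arrives p.1 j p.2] (f, u))%:E *
       \int[mu j]_x g (contribution f j u x))).
  apply/funext => f; rewrite integral_path_levy//; apply: eq_bigr => j _; congr (_ * _).
  rewrite integral_arrives; apply: eq_integral => u _; rewrite indicE.
  case: (boolP (arrives f j u)) => A; last by rewrite memNset ?mul0e//=; exact/negP.
  by rewrite mem_set// !mul1e; apply: eq_integral => x _; rewrite /contribution A.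
apply: emeasurable_sum => j; apply: emeasurable_funM; first exact: measurable_cst.
pose H := fun p : X * RR => (\1_[set p : X * RR | arrives p.1 j p.2] p)%:E *
  \int[mu j]_x g (contribution p.1 j p.2 x).
have H0 p : 0 <= H p.
  by apply: mule_ge0; [rewrite lee_fin|apply: integral_ge0 => x _; exact: g0].
apply: (@measurable_fun_fubini_tonelli_F _ _ X RR R lebesgue_measure H) => //.
apply: emeasurable_funM.
  by apply/measurable_EFinP; apply: measurable_indic; exact: measurable_arrives.
apply: (@measurable_fun_fubini_tonelli_F _ _ (X * RR)%type T R (mu j)
  (fun q => g (contribution q.1.1 j q.1.2 q.2))) => //.
by apply: measurableT_comp => //; exact: measurable_contribution.
Qed.

End JointMeasurability.

End Limits.
Export Limits.

(** * Storage as a sum of contributions *)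

Module Storage.
Local Opaque expmx.

Lemma cvg_sumr (R : realType) (U I : Type) (F : set_system U) (FF : Filter F)
    (s : seq I) (f : I -> U -> R) (a : I -> R) :
  (forall i, f i u @[u --> F] --> a i) ->
  (\sum_(i <- s) f i u) @[u --> F] --> \sum_(i <- s) a i.
Proof. by move=> H; apply: cvg_big => //; exact: add_continuous. Qed.

Lemma isolated_from_seq (R : realType) (b : seq R) (s : R) : s \notin b ->
  exists2 e, 0 < e & forall x, x \in b -> e <= `|x - s|.
Proof.
elim: b => [|x b IH]; first by exists 1.
rewrite inE negb_or => /andP[sx /IH[e e0 He]].
exists (Num.min e `|x - s|); first by rewrite lt_min e0 normr_gt0 subr_eq0 eq_sym.
move=> y; rewrite inE => /orP[/eqP ->|yb]; first by rewrite ge_min lexx orbT.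
by rewrite ge_min He.
Qed.

(** Induction on the exceptional points: an interval without exceptional point
    is dealt with by the mean value theorem. *)
Lemma constant_off_finite (R : realType) (h : R -> R) (e : seq R) (a b : R) : a <= b ->
  (forall s, a <= s -> s < b -> h u @[u --> s^'+] --> h s) ->
  (forall s, a < s -> s <= b -> h u @[u --> s^'-] --> h s) ->
  (forall s, a < s -> s < b -> s \notin e -> is_derive s (1 : R) h 0) ->
  h a = h b.
Proof.
elim: e a b => [|x e IH] a b ab Hr Hl Hd.
  move: ab; rewrite le_eqVlt => /orP[/eqP -> //|ab].
  have hc : {within `[a, b], continuous h}.
    apply/continuous_within_itvP => //; split; last 2 first.
    - exact: Hr.
    - exact: Hl.
    by move=> s; rewrite in_itv /= => /andP[as_ sb]; exact: is_derive_continuous (Hd s as_ sb isT).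
  have Hd' s : s \in `]a, b[%R -> is_derive s (1 : R) h ((fun=> 0 : R) s).
    by rewrite in_itv /= => /andP[as_ sb]; exact: Hd.
  have [c _] := MVT_segment (ltW ab) Hd' hc.
  by rewrite mul0r => /eqP; rewrite subr_eq0 => /eqP.
have [/andP[ax xb]|nax] := boolP (a < x < b); last first.
  apply: IH => // s as_ sb se; apply: Hd => //; rewrite inE negb_or se andbT.
  by apply: contra nax => /eqP <-; rewrite as_.
apply: (@etrans _ _ (h x)).
  apply: IH; first exact: ltW.
  - by move=> s as_ sx; apply: Hr => //; exact: lt_trans xb.
  - by move=> s as_ sx; apply: Hl => //; exact: le_trans (ltW xb).
  move=> s as_ sx se; apply: Hd => //; first exact: lt_trans xb.
  by rewrite inE negb_or se andbT; move: sx; rewrite lt_neqAle => /andP[].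
apply: IH; first exact: ltW.
- by move=> s xs sb; apply: Hr => //; exact: le_trans (ltW ax) xs.
- by move=> s xs sb; apply: Hl => //; exact: lt_trans xs.
move=> s xs sb se; apply: Hd => //; first exact: lt_trans xs.
by rewrite inE negb_or se andbT; move: xs; rewrite lt_neqAle eq_sym => /andP[].
Qed.

Section StepFunction.
Context {R : realType}.
Implicit Types (x s : R).

Lemma step_right_cvg x s : ((x <= u)%R%:R : R) @[u --> s^'+] --> ((x <= s)%R%:R : R).
Proof.
apply: cvg_near_cst; case: (leP x s) => xs.
  near=> u; have -> // : x <= u; apply: le_trans xs _; apply: ltW.
  by near: u; exact: nbhs_right_gt.
near=> u; have -> // : (x <= u) = false; apply/negbTE; rewrite -ltNge.
by near: u; exact: nbhs_right_lt.
Unshelve. all: by end_near. Qed.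

Lemma step_left_cvg x s : ((x <= u)%R%:R : R) @[u --> s^'-] --> ((x < s)%R%:R : R).
Proof.
apply: cvg_near_cst; case: (ltP x s) => xs.
  by near=> u; have -> // : x <= u; near: u; exact: nbhs_left_ge.
near=> u; have -> // : (x <= u) = false; apply/negbTE; rewrite -ltNge.
by apply: lt_le_trans xs; near: u; exact: nbhs_left_lt.
Unshelve. all: by end_near. Qed.

End StepFunction.

Section Network.
Context {R : realType} {L d : nat} {t : R}.
Variables (r : 'I_d.+1 -> 'M[R]_L).
Hypothesis t0 : 0 < t.
Hypothesis r0 : forall j i i', 0 <= r j i i'.
Variables (f : bpath d t) (T : 'I_d.+1 -> nat -> R)
  (B : 'I_d.+1 -> nat -> 'rV[R]_L) (X : R -> 'rV[R]_L).
Hypothesis HX : storage_path r f T B X.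
Hypothesis T0 : forall j k, 0 < T j k.
Hypothesis Tincr : forall j k l, (k < l)%N -> T j k < T j l.
Variable N : nat.
Hypothesis TN : forall j k, (N <= k)%N -> t < T j k.

Let D := path_flow r f.
Let fl : is_flow r t (path_at f) D := path_flow_is_flow r0 f.

Let D_continuous s i j : 0 <= s -> (s < t -> D u i j @[u --> s^'+] --> D s i j) /\
  (s <= t -> D u i j @[u --> s^'-] --> D s i j).
Proof.
move=> s0; set C := L%:R * drift_bound r.
have C0 : 0 <= C by rewrite mulr_ge0 ?drift_bound_ge0.
have C1 : 0 < C + 1 by rewrite ltr_wpDl.
have K e x y : 0 < e -> 0 <= y - x -> y - x < e / (C + 1) -> C * (y - x) <= e.
  move=> e0 xy0 xy; apply: (@le_trans _ _ ((C + 1) * (y - x))).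
    by rewrite ler_wpM2r// lerDl.
  by rewrite mulrC -ler_pdivlMr// ltW.
split=> st; apply/cvgrPdist_le => e e0; have e1 : 0 < e / (C + 1) by rewrite divr_gt0.
  near=> u; have su : s < u by near: u; exact: nbhs_right_gt.
  apply: le_trans (flow_lip fl i j (ltW su) _) _.
    by apply: ltW; near: u; exact: nbhs_right_lt.
  apply: K => //; first by rewrite subr_ge0 ltW.
  by rewrite ltrBlDl; near: u; apply: nbhs_right_lt; rewrite ltrDl.
near=> u; have su : u < s by near: u; exact: nbhs_left_lt.
rewrite distrC; apply: le_trans (flow_lip fl i j (ltW su) st) _.
apply: K => //; first by rewrite subr_ge0 ltW.
rewrite ltrBlDl -ltrBlDr; near: u; apply: nbhs_left_gt.
by rewrite gtrDl oppr_lt0.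
Unshelve. all: by end_near. Qed.

Let c j k l : R := (contribution r f j (T j k) (B j k) : 'rV[R]_L) ord0 l.
Let S l u : R := \sum_(j < d.+1) \sum_(k < N) (T j k <= u)%R%:R * c j k l.
Let h l u : R := (X u *m D u) ord0 l - S l u.

Let S_right l s : S l u @[u --> s^'+] --> S l s.
Proof.
apply: cvg_sumr => j; apply: cvg_sumr => k.
by apply: cvgMl; exact: step_right_cvg.
Qed.

Let S_left l s : S l u @[u --> s^'-] -->
  S l s - \sum_(j < d.+1) \sum_(k < N) (T j k == s)%:R * c j k l.
Proof.
rewrite /S -sumrB; under eq_bigr => j _.
  rewrite -sumrB; under eq_bigr => k _.
    rewrite -mulrBl (_ : _ - _ = (T j k < s)%R%:R); last first.
      by case: ltgtP => _; rewrite ?subrr ?subr0.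
    over.
  over.
apply: cvg_sumr => j; apply: cvg_sumr => k.
by apply: cvgMl; exact: step_left_cvg.
Qed.

Let XD_cvg (F : set_system R) (FF : Filter F) l s (Y : 'rV[R]_L) :
  X u @[u --> F] --> Y -> (forall i j, D u i j @[u --> F] --> D s i j) ->
  ((X u *m D u) ord0 l) @[u --> F] --> (Y *m D s) ord0 l.
Proof.
move=> HXY HD; rewrite mxE; under eq_fun do rewrite mxE.
apply: cvg_sumr => i; apply: cvgM; last exact: HD.
exact: (cvg_comp _ _ HXY (@coord_continuous R 1 L ord0 i Y)).
Qed.

Let h_right l s : 0 <= s -> s < t -> h l u @[u --> s^'+] --> h l s.
Proof.
move=> s0 st; case: HX => _ Xr _ _ _; apply: cvgB; last exact: S_right.
by apply: XD_cvg; [exact: Xr|move=> i j; exact: (D_continuous i j s0).1].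
Qed.

Let Tinj j k k' : T j k = T j k' -> k = k'.
Proof.
by move=> E; case: (ltngtP k k') => // kk; have := Tincr j kk; rewrite E ltxx.
Qed.

Let h_left l s : 0 < s -> s <= t -> h l u @[u --> s^'-] --> h l s.
Proof.
move=> s0 st; case: HX => _ _ Xa Xn _.
have [[j [k [Tk fs]]]|na] := pselect (exists j k, T j k = s /\ path_at f s = j).
  have -> : h l s = ((X s - B j k) *m D s) ord0 l -
     (S l s - \sum_(j < d.+1) \sum_(k < N) (T j k == s)%:R * c j k l).
    have kN : (k < N)%N by rewrite ltnNge; apply/negP => /(TN j); rewrite Tk ltNge st.
    rewrite (bigD1 j)//= [X in _ - (_ - (_ + X))]big1 ?addr0; last first.
      move=> j' jj'; rewrite big1// => k' _; case: eqP => Tk'; last by rewrite mul0r.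
      rewrite /c /contribution /arrives Tk' fs [j == j']eq_sym (negbTE jj') !andbF.
      by rewrite mxE mulr0.
    rewrite (bigD1 (Ordinal kN))//= [X in _ - (_ - (_ + X))]big1 ?addr0; last first.
      move=> k' kk'; case: eqP => Tk'; last by rewrite mul0r.
      move: kk'; rewrite (_ : k' = Ordinal kN) ?eqxx//; apply: val_inj => /=.
      by apply: (@Tinj j); rewrite Tk Tk'.
    rewrite Tk eqxx mul1r /c /contribution /arrives Tk fs eqxx st (ltW s0) /=.
    by rewrite mulmxBl [X in _ = X - _]mxE [X in _ = _ + X - _]mxE /h -/D; ring.
  apply: cvgB; last exact: S_left.
  by apply: XD_cvg; [exact: Xa|move=> i i'; exact: (D_continuous i i' (ltW s0)).2].
have na' j k : ~ (T j k = s /\ path_at f s = j) by move=> H; apply: na; exists j, k.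
have -> : h l s = (X s *m D s) ord0 l -
     (S l s - \sum_(j < d.+1) \sum_(k < N) (T j k == s)%:R * c j k l).
  rewrite big1 ?subr0// => j _; rewrite big1// => k _; case: eqP => Tk; last by rewrite mul0r.
  rewrite /c /contribution /arrives Tk; case: eqP => fs; first by case: (na' j k).
  by rewrite !andbF mxE mulr0.
apply: cvgB; last exact: S_left.
by apply: XD_cvg; [exact: Xn|move=> i i'; exact: (D_continuous i i' (ltW s0)).2].
Qed.

Let exceptional : seq R := unzip1 (val f).2 ++ [seq T j k | j <- enum 'I_d.+1, k <- iota 0 N].

Let h_derive l s : 0 < s -> s < t -> s \notin exceptional -> is_derive s (1 : R) (h l) 0.
Proof.
move=> s0 st /isolated_from_seq[e1 e10 He1]; case: HX => _ _ _ _ Xd.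
pose e := Num.min e1 (t - s).
have e0 : 0 < e by rewrite lt_min e10 subr_gt0.
have He x : x \in exceptional -> ~ (s - e < x < s + e).
  move=> /He1 H; rewrite -ltr_distl => h1.
  by move: H; rewrite leNgt (lt_le_trans h1)// ge_min lexx.
have fc w : s - e <= w -> w < s + e -> path_at f w = path_at f s.
  have H w' : s - e <= w' -> w' < s + e -> path_at f w' = path_at f (s - e).
    by apply: path_at_constant => x xb; apply: He; rewrite mem_cat xb.
  move=> w1 w2; rewrite H// [RHS]H//; first by rewrite gerBl ltW.
  by rewrite ltrDl.
set y := path_at f s in fc *; set v := s + e / 2.
have vt : v <= t.
  rewrite /v -lerBrDl (le_trans (_ : _ <= e)) ?ge_min ?lexx ?orbT//.
  by rewrite ler_pdivrMr// mulr_natr mulr2n lerDl ltW.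
pose A := drift r y.
have e2 : e / 2 < e by rewrite ltr_pdivrMr// ltr_pMr// ltr1n.
have De u : s - e / 2 < u -> u < s + e / 2 -> D u = expmx ((v + (-1) * u) *: A) *m D v.
  move=> u1 u2; rewrite mulN1r; apply: (flow_step fl) => //; first exact: ltW.
  move=> w uw wv; apply: fc; last by rewrite (lt_trans wv)// ltrD2l.
  by apply: ltW; rewrite (lt_le_trans _ uw)// (lt_trans _ u1)// ltrD2l ltrN2.
have e20 : 0 < e / 2 by rewrite divr_gt0.
apply: (@near_eq_is_derive _ _ _
  (fun u => (\sum_i ((fun u => X u ord0 i) * (fun u => (expmx ((v + (-1) * u) *: A) *m D v) i l))
     - cst (S l s)) u)).
  near=> u.
  have u1 : s - e / 2 < u by near: u; apply: lt_nbhsr; rewrite gtrBl.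
  have u2 : u < s + e / 2 by near: u; apply: lt_nbhsl; rewrite ltrDl.
  rewrite /h !fctE fct_sumE; congr (_ - _).
    by rewrite mxE (De u)//; apply: eq_bigr => i _; rewrite fctE.
  apply: eq_bigr => j _; apply: eq_bigr => k _; congr ((nat_of_bool _)%:R * _).
  have Tx : T j k \in exceptional.
    rewrite mem_cat; apply/orP; right; apply/allpairsP; exists (j, k : nat).
    by rewrite mem_enum mem_iota /= add0n.
  have := He _ Tx; have h1 : s - e < u by rewrite (lt_trans _ u1)// ltrD2l ltrN2.
  have h2 : u < s + e by rewrite (lt_trans u2)// ltrD2l.
  case: (ltP (s - e) (T j k)) => q1 /= nq.
    have q2 : s + e <= T j k by rewrite leNgt; apply/negP.
    by rewrite !leNgt (lt_le_trans h2 q2) (lt_le_trans _ q2)// ltrDl.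
  by rewrite (le_trans q1 (ltW h1)) (le_trans q1)// gerBl ltW.
have sna j k : ~ (T j k = s /\ path_at f s = j).
  move=> [Tk fs]; have sN : (k < N)%N by rewrite ltnNge; apply/negP => /(TN j); rewrite Tk ltNge ltW.
  apply: (He s); last by rewrite gtrBl e0 ltrDl.
  rewrite -Tk mem_cat; apply/orP; right; apply/allpairsP; exists (j, k).
  by rewrite mem_enum mem_iota /= add0n.
have near_f : \forall u \near s, path_at f u = path_at f s.
  near=> u; apply: fc; last by near: u; apply: lt_nbhsl; rewrite ltrDl.
  by near: u; apply: lt_le_nbhsr; rewrite gtrBl.
have XD := Xd s s0 st sna near_f.
have ED i : is_derive s (1 : R) (fun u => (expmx ((v + (-1) * u) *: A) *m D v) i l)
   ((- (A *m D s)) i l).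
  have D0 i' j : is_derive s (1 : R) (cst (D v i' j)) ((0 : 'M[R]_L) i' j).
    by rewrite mxE; exact: is_derive_cst.
  have H := is_derive_mulmx i l (fun i j => is_derive_expmx_affine A v (-1) s i j) D0.
  apply: (is_derive_eq H); rewrite mulmx0 addr0 scaleN1r mulNmx -mulmxA -De//.
  - by rewrite gtrBl.
  - by rewrite ltrDl.
have := @is_derive_sum _ _ _ L (fun i => (fun u => X u ord0 i) * (fun u => (expmx ((v + (-1) * u) *: A) *m D v) i l)) s 1 _
  (fun i => is_deriveM (XD i) (ED i)).
move=> /is_deriveB /(_ (is_derive_cst (S l s) s 1)) H.
apply: (is_derive_eq H).
rewrite subr0.
have -> : \sum_(i < L) (X s ord0 i *: (- (A *m D s)) i l +
     (expmx ((v + (-1) * s) *: A) *m D v) i l *: (- (X s *m flow_mx (r (path_at f s)))) ord0 i) =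
    (X s *m (- (A *m D s)) + (- (X s *m flow_mx (r y))) *m D s) ord0 l.
  rewrite mxE [in RHS]mxE [in X in _ = _ + X]mxE -big_split /=; apply: eq_bigr => i _.
  congr (_ + _); rewrite -De; first by rewrite mulrC.
  - by rewrite gtrBl.
  - by rewrite ltrDl.
by rewrite /A /drift mulNmx opprK mulmxA mulNmx subrr mxE.
Unshelve. all: by end_near. Qed.

(** The storage at the horizon is the sum of the contributions of the jobs: the
    storage propagated to the horizon minus the contributions so far is
    continuous and has zero derivative off finitely many times. *)
Lemma storage_pathE :
  X t = \sum_(j < d.+1) \sum_(k < N) (contribution r f j (T j k) (B j k) : 'rV[R]_L).
Proof.
apply/rowP => l.
have := @constant_off_finite _ (h l) exceptional 0 t (ltW t0)
  (@h_right l) (@h_left l) (@h_derive l).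
case: HX => X0 _ _ _ _.
rewrite /h X0 mul0mx mxE (flow_end fl) mulmx1 sub0r.
have -> : S l 0 = 0.
  rewrite /S big1// => j _; rewrite big1// => k _.
  by rewrite leNgt T0 mul0r.
rewrite oppr0 => /eqP; rewrite eq_sym subr_eq0 => /eqP ->.
rewrite /S summxE; apply: eq_bigr => j _; rewrite summxE; apply: eq_bigr => k _.
case: (leP (T j k) t) => Tt; first by rewrite mul1r.
by rewrite mul0r /contribution /arrives [T j k <= t]leNgt Tt andbF mxE.
Qed.

End Network.

End Storage.
Export Storage.

(** * Void probabilities of thinned Poisson processes *)

Module Void.
Lemma measurable_natr_bool d (X : measurableType d) (R : realType) (b : X -> bool) :
  measurable_fun setT b -> measurable_fun setT (fun x => (b x)%:R : R).
Proof.
move=> mb.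
have mB : measurable [set x | b x].
  have -> : [set x | b x] = setT `&` b @^-1` [set true] by rewrite setTI.
  exact: mb.
have : measurable_fun setT (\1_[set x | b x] : X -> R) by exact: measurable_indic.
apply: eq_measurable_fun => x _; rewrite indicE.
by suff -> : (x \in [set x | b x]) = b x by []; apply/idP/idP; rewrite inE.
Qed.

Section Primitive.
Context {R : realType}.
Local Notation leb := (@lebesgue_measure R).
Implicit Types (f : R -> R) (u v s : R).

Definition bounded_measurable f (C : R) :=
  measurable_fun setT f /\ forall x, `|f x| <= C.

Lemma itv_lty u v : (lebesgue_measure (`[u, v]%classic : set R) < +oo)%E.
Proof. by rewrite lebesgue_measure_itv /=; case: ifP => // _; rewrite -EFinB ltry. Qed.

Lemma itv_length u v : u <= v -> fine (lebesgue_measure (`[u, v]%classic : set R)) = v - u.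
Proof.
move=> uv; rewrite lebesgue_measure_itv /= lte_fin.
by case: ltgtP uv => // -> _; rewrite subrr.
Qed.

Lemma bounded_integrable f C u v : bounded_measurable f C ->
  leb.-integrable `[u, v]%classic (EFin \o f).
Proof.
move=> [mf fC]; have C0 : 0 <= C by exact: le_trans (fC 0).
apply: (@le_integrable _ _ _ _ _ _ _ (EFin \o cst C)) => //.
- by apply/measurable_EFinP; exact: measurable_funTS.
- by move=> x _; rewrite lee_fin (le_trans (fC x))// ger0_norm.
- apply/integrableP; split; first by apply/measurable_EFinP; exact: measurable_cst.
  rewrite (eq_integral (cst C%:E)); last by move=> x _; rewrite /= ger0_norm.
  by rewrite integral_cst// lte_mul_pinfty// itv_lty.
Qed.

Definition primitive f u v : R := \int[leb]_(x in `[u, v]) f x.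

Lemma primitive_split f C u s v : bounded_measurable f C -> u <= s -> s <= v ->
  primitive f u v = primitive f u s + primitive f s v.
Proof.
move=> bf us sv; apply/eqP; rewrite addrC -subr_eq; apply/eqP.
rewrite /primitive (Rintegral_itvB (bounded_integrable u v bf)) ?bnd_simp//.
rewrite Rintegral_itv_obnd_cbnd//.
by apply: integrableS (bounded_integrable s v bf) => //; exact: subset_itv_oc_cc.
Qed.

Lemma primitive_le f g C C' u v : bounded_measurable f C -> bounded_measurable g C' ->
  (forall x, u <= x -> x <= v -> f x <= g x) -> primitive f u v <= primitive g u v.
Proof.
move=> bf bg fg; apply: le_Rintegral => //; [exact: bounded_integrable bf|exact: bounded_integrable bg|].
by move=> x /=; rewrite in_itv /= => /andP[]; exact: fg.
Qed.

Lemma primitive_cst c u v : u <= v -> primitive (fun=> c) u v = c * (v - u).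
Proof. by move=> uv; rewrite /primitive Rintegral_cst// itv_length. Qed.

Lemma bounded_measurable_cst c : bounded_measurable (fun=> c) `|c|.
Proof. by split. Qed.

Lemma primitive_gt f u v : v < u -> primitive f u v = 0.
Proof. by move=> vu; rewrite /primitive set_itv_ge ?Rintegral_set0// bnd_simp -ltNge. Qed.

Lemma primitive_refl f u : primitive f u u = 0.
Proof. by rewrite /primitive set_itv1 Rintegral_set1. Qed.

Lemma primitive_bound f C u v : bounded_measurable f C -> (forall x, 0 <= f x) -> u <= v ->
  0 <= primitive f u v <= C * (v - u).
Proof.
move=> bf f0 uv; apply/andP; split; first by apply: Rintegral_ge0 => x _; exact: f0.
rewrite -primitive_cst//; apply: (primitive_le bf (bounded_measurable_cst C)) => x _ _.
by rewrite (le_trans (ler_norm _))//; exact: bf.2.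
Qed.

Lemma primitive_continuous f C s : bounded_measurable f C -> (forall x, 0 <= f x) ->
  continuous (primitive f s).
Proof.
move=> bf f0 v; have C0 : 0 <= C by exact: le_trans (bf.2 0).
have E w : primitive f s w = primitive f s (Num.max s w).
  by case: (leP s w) => // ws; rewrite primitive_gt// primitive_refl.
have lip x y : x <= y -> `|primitive f s x - primitive f s y| <= C * (y - x).
  move=> xy; rewrite (E x) (E y).
  have mxy : Num.max s x <= Num.max s y by rewrite ge_max !le_max lexx xy orbT.
  rewrite (@primitive_split f C s (Num.max s x) (Num.max s y))// ?le_max ?lexx//.
  have /andP[p1 p2] := primitive_bound bf f0 mxy.
  rewrite opprD addrA subrr sub0r normrN ger0_norm// (le_trans p2)// ler_wpM2l//.
  by rewrite /Num.max; case: ifP; case: ifP => h1 h2; lra.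
have lip2 x y : `|primitive f s x - primitive f s y| <= (C + 1) * `|x - y|.
  apply: (@le_trans _ _ (C * `|x - y|)); last by rewrite ler_wpM2r// lerDl.
  case: (leP x y) => xy.
    by rewrite (le_trans (lip _ _ xy))// distrC ger0_norm// subr_ge0.
  by rewrite distrC (le_trans (lip _ _ (ltW xy)))// ger0_norm// subr_ge0 ltW.
have C1 : 0 < C + 1 by rewrite ltr_wpDl.
apply/cvgrPdist_le => e e0; near=> w.
rewrite (le_trans (lip2 _ _))// mulrC -ler_pdivlMr//.
near: w; apply: cvgr_dist_le; last by rewrite divr_gt0.
exact: cvg_id.
Unshelve. all: by end_near. Qed.

(** Increments that are quadratically small add up to nothing over finer and
    finer subdivisions. *)
Lemma quadratic_increments_cst f (K s t : R) : 0 <= K -> s <= t ->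
  (forall u v, s <= u -> u <= v -> v <= t -> `|f v - f u| <= K * (v - u) ^+ 2) ->
  f t = f s.
Proof.
move=> K0 st H.
have key n : `|f t - f s| <= K * (t - s) ^+ 2 / n.+1%:R.
  pose x i := s + (t - s) * i%:R / n.+1%:R.
  have xE i : x i.+1 - x i = (t - s) / n.+1%:R.
    by rewrite /x -natr1 mulrDr mulr1 mulrDl; ring.
  have d0 : 0 <= (t - s) / n.+1%:R by rewrite divr_ge0// subr_ge0.
  have x0 : x 0%N = s by rewrite /x mulr0 mul0r addr0.
  have xn : x n.+1 = t by rewrite /x mulfK ?pnatr_eq0// addrC subrK.
  have xm i k : (i <= k)%N -> x i <= x k.
    move=> ik; rewrite /x lerD2l ler_wpM2r ?invr_ge0// ler_wpM2l ?ler_nat// subr_ge0//.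
  have -> : f t - f s = \sum_(0 <= i < n.+1) (f (x i.+1) - f (x i)).
    by rewrite telescope_sumr// xn x0.
  apply: le_trans (ler_norm_sum _ _ _) _.
  apply: (@le_trans _ _ (\sum_(0 <= i < n.+1) K * ((t - s) / n.+1%:R) ^+ 2)).
    apply: ler_sum_nat => i /andP[_ iN]; rewrite -(xE i); apply: H.
    - by rewrite -x0; exact: xm.
    - exact: xm.
    - by rewrite -xn; exact: xm.
  rewrite sumr_const_nat subn0 -[leLHS]mulr_natr.
  have : n.+1%:R != 0 :> R by rewrite pnatr_eq0.
  move: (n.+1%:R : R) => N N0; rewrite le_eqVlt; apply/orP; left; apply/eqP.
  by field.
apply/eqP; rewrite -subr_eq0 -normr_le0; apply/ler_addgt0Pl => e e0; rewrite addr0.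
have M0 : 0 <= K * (t - s) ^+ 2 / e by apply: divr_ge0; [rewrite mulr_ge0 ?sqr_ge0|exact: ltW].
have hb := archi_boundP M0; set m := Num.bound _ in hb.
apply: (le_trans (key m)).
rewrite ler_pdivrMr// [e * _]mulrC -ler_pdivrMr//.
by rewrite (le_trans (ltW hb))// ler_nat.
Qed.

Lemma exp_increment_bound (x y d q : R) : 0 <= x -> x <= 1 -> 0 <= d -> 0 <= y ->
  1 - d <= y -> (1 + d) * y <= 1 -> x * y * d <= q -> q <= x * d ->
  `|q - (x - x * y)| <= d * d.
Proof.
move=> x0 x1 d0 y0 e1 e2 q1 q2.
have h0 : 1 - y <= d by lra.
have y1 : y <= 1 by nra.
have h1 : x * (1 - y) <= x * d by rewrite ler_wpM2l.
have h2 : x * (y * d) <= x * (1 - y) by apply: ler_wpM2l => //; lra.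
have h3 : x * (d * (1 - y)) <= 1 * (d * d).
  by apply: ler_pM => //; rewrite ?mulr_ge0 ?subr_ge0// ler_wpM2l.
clear - q1 q2 h1 h2 h3.
by rewrite ler_norml; apply/andP; split; lra.
Qed.

Lemma bounded_measurable_exp a C s : bounded_measurable a C -> (forall x, 0 <= a x) ->
  measurable_fun setT (fun v => expR (- primitive a s v)) /\
  bounded_measurable (fun v => a v * expR (- primitive a s v)) C.
Proof.
move=> ba a0.
have mH : measurable_fun setT (fun v => expR (- primitive a s v)).
  apply: continuous_measurable_fun => v; apply: continuous_comp; last exact: continuous_expR.
  by apply: continuousN; exact: primitive_continuous ba a0 _.
split => //; split; first by apply: measurable_funM => //; exact: ba.1.
move=> x; rewrite normrM -[leRHS]mulr1 ler_pM//; first exact: ba.2.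
rewrite ger0_norm ?expR_ge0// -expR0 ler_expR oppr_le0.
by apply: Rintegral_ge0 => y _; exact: a0.
Qed.

(** The fundamental theorem of calculus for the exponential of a primitive, for
    a density that is merely bounded and measurable. *)
Lemma primitive_exp a C s t : bounded_measurable a C -> (forall x, 0 <= a x) -> s <= t ->
  primitive (fun v => a v * expR (- primitive a s v)) s t = 1 - expR (- primitive a s t).
Proof.
move=> ba a0 st; have C0 : 0 <= C by exact: le_trans (ba.2 0).
pose H v := expR (- primitive a s v).
have I0 v : 0 <= primitive a s v by apply: Rintegral_ge0 => x _; exact: a0.
have H1 v : H v <= 1 by rewrite /H -expR0 ler_expR oppr_le0.
have [mH baH] := bounded_measurable_exp s ba a0.
pose D v := primitive (fun v => a v * H v) s v - (1 - H v).
suff : D t = D s.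
  rewrite /D /H !primitive_refl oppr0 expR0 !subrr => /eqP; rewrite subr_eq0 => /eqP ->.
  by [].
apply: (@quadratic_increments_cst D (C ^+ 2)) => //; first exact: sqr_ge0.
move=> u v su uv vt.
have sv := le_trans su uv.
set d := primitive a u v.
have /andP[d0 dC] := primitive_bound ba a0 uv; rewrite -/d in d0 dC.
have Hv : H v = H u * expR (- d).
  by rewrite /H (primitive_split ba su uv) opprD expRD.
have Hmono x y : s <= x -> x <= y -> H y <= H x.
  move=> sx xy; rewrite /H ler_expR lerN2 (primitive_split ba sx xy) lerDl.
  by apply: Rintegral_ge0 => z _; exact: a0.
have baC c : 0 <= c -> bounded_measurable (fun x => c * a x) (c * C).
  move=> c0; split; first by apply: measurable_funM => //; exact: ba.1.
  by move=> x; rewrite normrM ger0_norm// ler_wpM2l//; exact: ba.2.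
have pZ c : primitive (fun x => c * a x) u v = c * d.
  by rewrite /primitive RintegralZl//; exact: bounded_integrable ba.
set J := primitive (fun v => a v * H v) u v.
have Ju : J <= H u * d.
  rewrite -pZ; apply: (primitive_le baH (baC _ (expR_ge0 _))) => x ux xv.
  by rewrite mulrC; apply: ler_wpM2r; [exact: a0|exact: Hmono].
have Jl : H v * d <= J.
  rewrite -pZ; apply: (primitive_le (baC _ (expR_ge0 _)) baH) => x ux xv.
  by rewrite mulrC; apply: ler_wpM2l; [exact: a0|apply: (Hmono _ _ _ xv); exact: le_trans ux].
have -> : D v - D u = J - (H u - H v).
  rewrite /D (primitive_split baH su uv) -/J.
  clear Ju Jl; clearbody J.
  by move: (primitive _ s u) (H u) (H v) => p x y; ring.
have e1 : 1 - d <= expR (- d) by exact: expR_ge1Dx.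
have e2 : (1 + d) * expR (- d) <= 1.
  by rewrite expRN ler_pdivrMr ?expR_gt0// mul1r expR_ge1Dx.
have Hu0 : 0 <= H u by exact: expR_ge0.
have Hu1 := H1 u.
apply: (@le_trans _ _ (d * d)).
  rewrite Hv; rewrite Hv in Jl.
  exact: (exp_increment_bound Hu0 Hu1 d0 (expR_ge0 _) e1 e2 Jl Ju).
have -> : C ^+ 2 * (v - u) ^+ 2 = (C * (v - u)) * (C * (v - u)) by ring.
by apply: ler_pM.
Qed.

End Primitive.

Section Exponential.
Context {R : realType}.
Local Notation RR := (measurableTypeR R).
Local Notation leb := (@lebesgue_measure R).

Lemma lebesgue_measure_shift (c : R) (A : set R) : measurable A ->
  leb A = leb ((fun x : R => c + x) @^-1` A).
Proof.
have mc : measurable_fun setT (fun x : RR => c + x : RR) by exact: measurable_funD.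
move=> mA; rewrite -(push_measureE leb mc).
apply: lebesgue_measure_unique => // _ [[a b]] _ <-; rewrite push_measureE.
have -> : (fun x : RR => c + x : RR) @^-1` `]a, b] = `]a - c, b - c]%classic :> set R.
  by apply/seteqP; split => x /=; rewrite !in_itv /= ltrBlDl lerBrDl.
rewrite /= !lebesgue_measure_itv /= !lte_fin ltrD2r.
by case: ifP => // _; rewrite -!EFinD opprD opprK addrACA [- c + c]addrC subrr addr0.
Qed.

Lemma ge0_integral_shift (c : R) (f : R -> \bar R) : measurable_fun setT f ->
  (forall x, 0 <= f x)%E ->
  (\int[leb]_x f x = \int[leb]_x f (c + x)%R)%E.
Proof.
move=> mf f0.
have mc : measurable_fun setT (fun x : RR => c + x : RR) by exact: measurable_funD.
rewrite -(ge0_integral_push leb mc mf f0).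
by apply: eq_measure_integral => A mA _; rewrite push_measureE; exact: lebesgue_measure_shift.
Qed.

Lemma primitive_shift (f : R -> R) C (c u v : R) : bounded_measurable f C ->
  (forall x, 0 <= f x) ->
  primitive f (c + u) (c + v) = primitive (fun x => f (c + x)) u v.
Proof.
move=> [mf fC] f0; rewrite /primitive /Rintegral; congr fine.
rewrite integral_mkcond [RHS]integral_mkcond (ge0_integral_shift c).
- apply: eq_integral => x _; rewrite !patchE; congr (if _ then _ else _).
  by apply/idP/idP; rewrite !inE /= !in_itv /= !lerD2l.
- have mD : measurable (`[c + u, c + v]%classic : set RR) by exact: measurable_itv.
  by apply/(measurable_restrictT _ mD); apply/measurable_EFinP; exact: measurable_funTS.
- by move=> x; rewrite patchE; case: ifP => // _; rewrite lee_fin.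
Qed.

Definition exp_law (c : R) (c0 : 0 < c) : probability RR R :=
  @exponential_distribution_exponential_prob__canonical__probability_measure_Probability R c c0.

Lemma exp_lawE c (c0 : 0 < c) U : exp_law c0 U = exponential_prob c U.
Proof. by []. Qed.

Lemma integral_exp_law c (c0 : 0 < c) (h : RR -> \bar R) : measurable_fun setT h ->
  (forall x, 0 <= h x)%E ->
  (\int[exp_law c0]_e h e = \int[leb]_e ((exponential_pdf c e)%:E * h e))%E.
Proof.
move=> mh h0; apply: (@density_integral _ RR R leb (exp_law c0)) => //.
- by apply/measurable_EFinP; exact: measurable_exponential_pdf.
- by move=> x; rewrite lee_fin exponential_pdf_ge0// ltW.
- by move=> x; rewrite ltry.
Qed.

Lemma integral_primitive (f : R -> R) C (u v : R) : bounded_measurable f C ->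
  (\int[leb]_(x in `[u, v]) (f x)%:E)%E = (primitive f u v)%:E.
Proof.
move=> bf; rewrite /primitive /Rintegral fineK//.
by apply: integrable_fin_num => //; exact: bounded_integrable bf.
Qed.

Variables (c t C : R) (c0 : 0 < c) (phi : R -> R).
Hypotheses (mphi : measurable_fun setT phi) (phi0 : forall u, 0 <= phi u)
  (phi1 : forall u, phi u <= 1) (phit : forall u, t < u -> phi u = 0).

(** Probability that no point of the thinned Poisson process falls after [s]. *)
Definition thinning_void (s : R) : R := expR (- (c * primitive phi s t)).

Let bphi : bounded_measurable phi 1.
Proof. by split => // x; rewrite ger0_norm. Qed.

Lemma thinning_void_ge0 s : 0 <= thinning_void s.
Proof. exact: expR_ge0. Qed.

Lemma thinning_void_after s : t < s -> thinning_void s = 1.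
Proof. by move=> ts; rewrite /thinning_void primitive_gt// mulr0 oppr0 expR0. Qed.

Lemma measurable_thinning_void : measurable_fun setT (thinning_void : RR -> R).
Proof.
apply: measurableT_comp => //; apply: measurableT_comp => //; apply: measurable_funM => //.
pose h (p : RR * RR) : \bar R := (((p.1 <= p.2) && (p.2 <= t))%R%:R * phi p.2)%:E.
have -> : (fun s => primitive phi s t) = fine \o fubini_F leb h.
  apply/funext => s; rewrite /primitive /Rintegral /= /fubini_F; congr fine.
  rewrite [LHS]integral_mkcond; apply: eq_integral => x _; rewrite patchE /h /=.
  have -> : (x \in `[s, t]%classic) = ((s <= x) && (x <= t)).
    by apply/idP/idP; rewrite inE /= in_itv.
  by case: (_ && _); rewrite ?mul1r ?mul0r.
apply: measurableT_comp => //.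
apply: (@measurable_fun_fubini_tonelli_F _ _ RR RR R leb h); last first.
  by move=> p; rewrite lee_fin mulr_ge0.
apply/measurable_EFinP; apply: measurable_funM; last exact: measurableT_comp.
apply: measurable_natr_bool; apply: measurable_and; apply: measurable_fun_ler => //.
Qed.

(** The first point of the thinned process is the first ring that is not thinned
    out. Conditioning on the first ring gives an integral equation, which the
    exponential of the primitive solves. *)
Lemma thinning_void_fixpoint s :
  (\int[exp_law c0]_e ((1 - phi (s + e)) * thinning_void (s + e))%:E)%E = (thinning_void s)%:E.
Proof.
have pdf_ge e : 0 <= e -> exponential_pdf c e = c * expR (- c * e) by exact: exponential_pdfE.
have mG : measurable_fun setT (fun e : RR => thinning_void (s + e)).
  apply: (measurableT_comp (f := thinning_void)); last exact: measurable_funD.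
  exact: measurable_thinning_void.
have mF : measurable_fun setT (fun e : RR => ((1 - phi (s + e)) * thinning_void (s + e))%:E).
  apply/measurable_EFinP; apply: measurable_funM => //; apply: measurable_funB => //.
  by apply: (measurableT_comp mphi); exact: measurable_funD.
have F0 e : (0 <= ((1 - phi (s + e)) * thinning_void (s + e))%:E)%E.
  by rewrite lee_fin mulr_ge0 ?thinning_void_ge0// subr_ge0.
rewrite integral_exp_law//.
have mpdf : measurable_fun setT (EFin \o exponential_pdf c : RR -> \bar R).
  by apply/measurable_EFinP; exact: measurable_exponential_pdf.
have late e : t < s + e ->
   ((exponential_pdf c e)%:E * ((1 - phi (s + e)) * thinning_void (s + e))%:E = (exponential_pdf c e)%:E)%E.
  by move=> te; rewrite phit// thinning_void_after// subr0 mul1r mule1.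
have early e : e < 0 -> exponential_pdf c e = 0 by exact: lt0_exponential_pdf.
case: (ltP t s) => [ts|st].
  rewrite thinning_void_after// -(integral_exponential_pdf c0); apply: eq_integral => e _.
  case: (ltP e 0) => e0; first by rewrite early// mul0e.
  by rewrite late// (lt_le_trans ts)// lerDl.
pose tau := t - s; have tau0 : 0 <= tau by rewrite subr_ge0.
have tE : t = s + tau by rewrite /tau addrC subrK.
pose psi e := phi (s + e).
have bpsi : bounded_measurable psi 1.
  by split; [apply: (measurableT_comp mphi); exact: measurable_funD|move=> x; exact: bphi.2].
have psi0 e : 0 <= psi e by exact: phi0.
pose b e := c * (1 - psi e).
have b0 e : 0 <= b e by apply: mulr_ge0; [exact: ltW|rewrite subr_ge0; exact: phi1].
have bb : bounded_measurable b c.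
  split; first by apply: measurable_funM => //; apply: measurable_funB => //; exact: bpsi.1.
  by move=> x; rewrite ger0_norm// /b -[leRHS]mulr1; apply: ler_wpM2l; [exact: ltW|rewrite gerBl].
have pb v : 0 <= v -> primitive b 0 v = c * (v - primitive psi 0 v).
  move=> v0; have b1 : bounded_measurable (fun x => 1 - psi x) 1.
    split; first by apply: measurable_funB => //; exact: bpsi.1.
    by move=> x; rewrite ger0_norm ?gerBl// subr_ge0; exact: phi1.
  rewrite /primitive RintegralZl//; last exact: bounded_integrable b1.
  rewrite RintegralB//; [|exact: bounded_integrable (bounded_measurable_cst 1)|exact: bounded_integrable bpsi].
  by congr (_ * (_ - _)); have := primitive_cst 1 v0; rewrite /primitive mul1r subr0.
have GE e : 0 <= e -> e <= tau ->
    c * expR (- c * e) * ((1 - phi (s + e)) * thinning_void (s + e)) =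
    thinning_void s * (b e * expR (- primitive b 0 e)).
  move=> e0 et; rewrite pb// /thinning_void tE (primitive_shift s e tau bphi phi0).
  have := primitive_shift s 0 tau bphi phi0; rewrite addr0 => ->.
  rewrite (primitive_split bpsi e0 et) -/(psi e) /b.
  move: (primitive psi 0 e) (primitive psi e tau) => p1 p2.
  have -> : expR (- (c * (p1 + p2))) * (c * (1 - psi e) * expR (- (c * (e - p1)))) =
     c * (1 - psi e) * (expR (- (c * (p1 + p2))) * expR (- (c * (e - p1)))) by ring.
  have -> : c * expR (- c * e) * ((1 - psi e) * expR (- (c * p2))) =
     c * (1 - psi e) * (expR (- c * e) * expR (- (c * p2))) by ring.
  by rewrite -!expRD; congr (_ * expR _); ring.
pose I := `[0, tau]%classic : set RR.
have mI : measurable I by exact: measurable_itv.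
have mIc : measurable (~` I) by exact: measurableC.
have split_I (h : RR -> \bar R) : measurable_fun setT h -> (forall x, 0 <= h x)%E ->
    (\int[leb]_x h x = \int[leb]_(x in I) h x + \int[leb]_(x in ~` I) h x)%E.
  move=> mh h0; rewrite -ge0_integral_setU//; first by rewrite setUv.
    by rewrite setUv.
  exact/disj_setPCl.
have mFp : measurable_fun setT (fun e : RR =>
    ((exponential_pdf c e)%:E * ((1 - phi (s + e)) * thinning_void (s + e))%:E)%E).
  exact: emeasurable_funM.
have pdf0 e : (0 <= (exponential_pdf c e)%:E)%E by rewrite lee_fin exponential_pdf_ge0// ltW.
rewrite split_I//; last by move=> x; exact: mule_ge0.
have H := split_I _ mpdf pdf0.
have cc : bounded_measurable (fun=> c) c by split => // x; rewrite ger0_norm// ltW.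
have pI : (\int[leb]_(x in I) (exponential_pdf c x)%:E = (1 - expR (- (c * tau)))%:E)%E.
  have b1 := @primitive_exp R (fun=> c) c 0 tau cc (fun=> ltW c0) tau0.
  rewrite primitive_cst// subr0 in b1; rewrite -b1 -(@integral_primitive _ c).
    apply: eq_integral => x; rewrite inE /I /= in_itv /= => /andP[x0 _].
    by rewrite primitive_cst// subr0 pdf_ge// mulNr.
  exact: (bounded_measurable_exp 0 cc (fun=> ltW c0)).2.
have tail : (\int[leb]_(x in ~` I) (exponential_pdf c x)%:E = (expR (- (c * tau)))%:E)%E.
  have : (1 = (1 - expR (- (c * tau)))%:E + \int[leb]_(x in ~` I) (exponential_pdf c x)%:E)%E.
    by rewrite -pI -H -(integral_exponential_pdf c0).
  move=> /(congr1 (fun z => z - (1 - expR (- (c * tau)))%:E)%E).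
  by rewrite [X in _ = (X - _)%E]addeC addeK// -EFinB => <-; congr (_%:E); ring.
have -> : (\int[leb]_(x in ~` I)
   ((exponential_pdf c x)%:E * ((1 - phi (s + x)) * thinning_void (s + x))%:E) =
   (expR (- (c * tau)))%:E)%E.
  rewrite -tail; apply: eq_integral => e; rewrite inE /I /= in_itv /= => /negP.
  rewrite negb_and -!ltNge => /orP[e0|et]; first by rewrite early// mul0e.
  by rewrite late// tE ltrD2l.
have -> : (\int[leb]_(x in I)
   ((exponential_pdf c x)%:E * ((1 - phi (s + x)) * thinning_void (s + x))%:E) =
   (thinning_void s * (1 - expR (- primitive b 0 tau)))%:E)%E.
  rewrite -(primitive_exp bb b0 tau0) EFinM -(@integral_primitive _ c).
    rewrite -ge0_integralZl//; first last.
    - exact: thinning_void_ge0.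
    - by move=> e _; rewrite lee_fin mulr_ge0 ?expR_ge0.
    - apply: measurable_funTS; apply/measurable_EFinP.
      exact: (bounded_measurable_exp 0 bb b0).2.1.
    apply: eq_integral => e; rewrite inE /I /= in_itv /= => /andP[e0 et].
    by rewrite pdf_ge// -!EFinM GE.
  exact: (bounded_measurable_exp 0 bb b0).2.
rewrite -EFinD; congr (_%:E); rewrite pb//.
have -> : expR (- (c * tau)) = thinning_void s * expR (- (c * (tau - primitive psi 0 tau))).
  rewrite /thinning_void tE; have := primitive_shift s 0 tau bphi phi0; rewrite addr0 => ->.
  by rewrite -expRD; congr expR; ring.
ring.
Qed.

End Exponential.

End Void.
Export Void.

(** * Integrating out one ring of one clock *)

Module Clock.
Local Open Scope ereal_scope.

Lemma integrate_out d d2 (Om : measurableType d) (T2 : measurableType d2) (R : realType)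
    (P : {measure set Om -> \bar R}) (C : set (set Om)) (Z : Om -> T2)
    (nu : probability T2 R) (g : g_sigma_algebraType C * T2 -> \bar R) :
  P setT < +oo ->
  (forall A, C A -> measurable A) -> setI_closed C -> C setT ->
  measurable_fun setT Z ->
  (forall A W, C A -> measurable W -> P (A `&` Z @^-1` W) = P A * nu W) ->
  measurable_fun setT g -> (forall z, 0 <= g z) ->
  \int[P]_w g (w, Z w) = \int[P]_w \int[nu]_y g (w, y).
Proof.
move=> Pfin mC CI CT mZ PE mg g0.
apply: (@freezing _ _ _ _ R P C Z (fun=> nu) g) => //.
- by move=> x; exact: probability_setT.
- by move=> A W CA mW; rewrite (PE _ _ CA mW) (integral_cst _ (mC _ CA)); exact: muleC.
Qed.

Section Clocks.
Context {R : realType} {L d : nat} dX (X : measurableType dX).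
Local Notation T := (borelV R L).
Local Notation RR := (measurableTypeR R).
Local Notation St := 'I_d.+1.

Section Observables.
Context (O : Type).
Variables (w : St -> (X * RR) * T -> R) (J : O -> X) (E : St -> nat -> O -> R) (B : St -> nat -> O -> T).

Definition ring_time j k (o : O) : R := \sum_(m < k) E j m o.

Definition clock_weight j k (o : O) : R :=
  \prod_(m < k) w j ((J o, ring_time j m.+1 o : RR), B j m o).

End Observables.

Lemma measurable_ring_time dO (O : measurableType dO) (E : St -> nat -> O -> R) j k :
  (forall m, (m < k)%N -> measurable_fun setT (E j m)) ->
  measurable_fun setT (ring_time E j k : O -> RR).
Proof. by move=> mE; apply: measurable_sum => m; exact: mE. Qed.

Lemma measurable_clock_weight dO (O : measurableType dO) (w : St -> (X * RR) * T -> R)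
    (J : O -> X) (E : St -> nat -> O -> R) (B : St -> nat -> O -> T) j k :
  measurable_fun setT (w j) -> measurable_fun setT J ->
  (forall m, (m < k)%N -> measurable_fun setT (E j m)) ->
  (forall m, (m < k)%N -> measurable_fun setT (B j m)) ->
  measurable_fun setT (clock_weight w J E B j k).
Proof.
move=> mw mJ mE mB; apply: measurable_prod => m _.
apply: (measurableT_comp mw); apply: measurable_fun_pair; last exact: mB.
apply: measurable_fun_pair => //; apply: measurable_ring_time => l lm; apply: mE.
exact: leq_trans lm _.
Qed.

Variables (c : St -> R) (c0 : forall j, (0 < c j)%R) (mu : St -> probability T R).
Variable (w : St -> (X * RR) * T -> R).
Hypothesis mw : forall j, measurable_fun setT (w j).
Hypothesis w0 : forall j p, (0 <= w j p)%R.

Definition mean_weight j (p : X * RR) : \bar R := \int[mu j]_b (w j (p, b))%:E.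

Definition next_ring j (G : X * RR -> \bar R) (p : X * RR) : \bar R :=
  \int[exp_law (c0 j)]_e (mean_weight j (p.1, p.2 + e : RR)%R * G (p.1, p.2 + e : RR)%R).

Lemma measurable_mean_weight j : measurable_fun setT (mean_weight j).
Proof.
apply: (@measurable_fun_fubini_tonelli_F _ _ (X * RR)%type T R (mu j) (fun q => (w j q)%:E)).
  by apply/measurable_EFinP; exact: mw.
by move=> q; rewrite lee_fin.
Qed.

Lemma mean_weight_ge0 j p : 0 <= mean_weight j p.
Proof. by apply: integral_ge0 => b _; rewrite lee_fin. Qed.

Lemma measurable_shift_pair (G : X * RR -> \bar R) : measurable_fun setT G ->
  measurable_fun setT (fun q : (X * RR) * RR => G (q.1.1, q.1.2 + q.2 : RR)%R).
Proof.
move=> mG; apply: (measurableT_comp mG); apply: measurable_fun_pair.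
  by apply: measurableT_comp => //.
by apply: measurable_funD => //; exact: measurableT_comp.
Qed.

Lemma measurable_next_ring j (G : X * RR -> \bar R) : measurable_fun setT G ->
  (forall p, 0 <= G p) ->
  measurable_fun setT (next_ring j G) /\ (forall p, 0 <= next_ring j G p).
Proof.
move=> mG G0; split; last first.
  by move=> p; apply: integral_ge0 => e _; rewrite mule_ge0// mean_weight_ge0.
apply: (@measurable_fun_fubini_tonelli_F _ _ (X * RR)%type RR R (exp_law (c0 j))
  (fun q => mean_weight j (q.1.1, q.1.2 + q.2 : RR)%R * G (q.1.1, q.1.2 + q.2 : RR)%R)).
  apply: emeasurable_funM; last exact: measurable_shift_pair.
  by apply: measurable_shift_pair; exact: measurable_mean_weight.
by move=> q; rewrite mule_ge0// mean_weight_ge0.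
Qed.

Lemma measurable_iter_next_ring j n : measurable_fun setT (iter n (next_ring j) (cst 1)) /\
  (forall p, 0 <= iter n (next_ring j) (cst 1) p).
Proof.
elim: n => [|n [IH1 IH2]] /=; first by split => //; exact: measurable_cst.
exact: measurable_next_ring.
Qed.

Context dO (Om : measurableType dO) (P : probability Om R).
Variables (J : {mfun Om >-> X}) (E : St -> nat -> {mfun Om >-> R}) (B : St -> nat -> {mfun Om >-> T}).
Hypothesis gap : forall j k (U : set R), measurable U -> P (E j k @^-1` U) = exponential_prob (c j) U.
Hypothesis job : forall j k (U : set T), measurable U -> P (B j k @^-1` U) = mu j U.
Hypothesis indep : forall (N : nat) (F : set X) (U : St -> 'I_N -> set R) (W : St -> 'I_N -> set T),
    measurable F ->
    (forall j k, measurable (U j k)) -> (forall j k, measurable (W j k)) ->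
    P [set o | F (J o) /\ forall j k, U j k (E j k o) /\ W j k (B j k o)]
      = P (J @^-1` F) *
         \big[mule/1]_(j < d.+1) \big[mule/1]_(k < N)
           (P (E j k @^-1` U j k) * P (B j k @^-1` W j k)).

Variable N : nat.

Definition box (exE exB : St -> nat -> bool) : set (set Om) :=
  [set A | exists F U W, [/\ measurable F, (forall j (k : 'I_N), measurable (U j k : set R)),
     (forall j (k : 'I_N), measurable (W j k : set T)),
     (forall j (k : 'I_N), exE j k -> U j k = setT) /\
     (forall j (k : 'I_N), exB j k -> W j k = setT) &
     A = [set o | F (J o) /\ forall j (k : 'I_N), U j k (E j k o) /\ W j k (B j k o)]]].

Lemma box_measurable exE exB A : box exE exB A -> measurable A.
Proof.
move=> [F [U [W [mF mU mW _ ->]]]].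
have -> : [set o | F (J o) /\ forall j (k : 'I_N), U j k (E j k o) /\ W j k (B j k o)] =
    J @^-1` F `&` \bigcap_(j in [set: St]) \bigcap_(k in [set: 'I_N])
      (E j k @^-1` U j k `&` B j k @^-1` W j k).
  apply/seteqP; split => o /=.
    by move=> [h1 h2]; split => // j _ k _; exact: h2.
  by move=> [h1 h2]; split => // j k; exact: (h2 j I k I).
apply: measurableI; first by rewrite -[X in measurable X]setTI; exact: measurable_funPT.
apply: fin_bigcap_measurable; first exact: finite_finset.
move=> j _; apply: fin_bigcap_measurable; first exact: finite_finset.
move=> k _; apply: measurableI.
  by rewrite -[X in measurable X]setTI; apply: measurable_funPT.
by rewrite -[X in measurable X]setTI; apply: measurable_funPT.
Qed.

Lemma box_setI exE exB : setI_closed (box exE exB).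
Proof.
move=> _ _ [F [U [W [mF mU mW [EU BW] ->]]]] [F' [U' [W' [mF' mU' mW' [EU' BW'] ->]]]].
exists (F `&` F'), (fun j k => U j k `&` U' j k), (fun j k => W j k `&` W' j k); split.
- exact: measurableI.
- by move=> j k; exact: measurableI.
- by move=> j k; exact: measurableI.
- by split=> j k ex; rewrite ?EU ?EU' ?BW ?BW' ?setIT.
- apply/seteqP; split => o /=.
    by move=> [[h1 h2] [h3 h4]]; split => // j k; have [? ?] := h2 j k; have [? ?] := h4 j k.
  move=> [[h1 h3] h2]; split; split => // j k; have [[? ?] [? ?]] := h2 j k; by [].
Qed.

Lemma box_setT exE exB : box exE exB setT.
Proof.
exists setT, (fun _ _ => setT), (fun _ _ => setT); split => //.
by apply/seteqP; split.
Qed.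

Let box_update (p p' : St -> 'I_N -> \bar R) j0 k0 x : p' j0 k0 = x * p j0 k0 ->
  (forall j k, (j, k) != (j0, k0) -> p' j k = p j k) ->
  \big[mule/1]_(j < d.+1) \big[mule/1]_(k < N) p' j k =
  x * \big[mule/1]_(j < d.+1) \big[mule/1]_(k < N) p j k.
Proof.
move=> E0 E1; rewrite (bigD1 j0)//= (bigD1 k0)//= E0.
rewrite [in RHS](bigD1 j0)//= [in RHS](bigD1 k0)//= !muleA; congr (_ * _ * _).
  apply: eq_bigr => k kk; apply: E1; apply: contra kk.
  by move=> /eqP[->].
apply: eq_bigr => j jj; apply: eq_bigr => k _; apply: E1; apply: contra jj.
by move=> /eqP[->].
Qed.

Lemma box_gap (exE exB : St -> nat -> bool) j0 (k0 : 'I_N) A W0 : exE j0 k0 -> box exE exB A -> measurable W0 ->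
  P (A `&` E j0 k0 @^-1` W0) = P A * exp_law (c0 j0) W0.
Proof.
move=> ex [F [U [W [mF mU mW [EU BW] ->]]]] mW0.
pose U' j k := if (j, k) == (j0, k0) then W0 else U j k.
have -> : [set o | F (J o) /\ forall j (k : 'I_N), U j k (E j k o) /\ W j k (B j k o)] `&`
    E j0 k0 @^-1` W0 =
    [set o | F (J o) /\ forall j (k : 'I_N), U' j k (E j k o) /\ W j k (B j k o)].
  apply/seteqP; split => o /=.
    move=> [[h1 h2] h3]; split => // j k; have [h4 h5] := h2 j k; split => //.
    by rewrite /U'; case: eqP => // -[-> ->].
  move=> [h1 h2]; split; last by have [] := h2 j0 k0; rewrite /U' eqxx.
  split => // j k; have [] := h2 j k; rewrite /U'; case: eqP => // -[-> ->] _ ?.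
  by rewrite EU.
have mU' j k : measurable (U' j k) by rewrite /U'; case: ifP.
rewrite (indep mF mU' mW) (indep mF mU mW).
rewrite (@box_update (fun j k => P (E j k @^-1` U j k) * P (B j k @^-1` W j k)) _ j0 k0
    (exp_law (c0 j0) W0)).
- by rewrite muleCA muleC.
- by rewrite /U' eqxx EU// preimage_setT probability_setT mul1e gap.
- by move=> j k /negbTE h; rewrite /U' h.
Qed.

Lemma box_job (exE exB : St -> nat -> bool) j0 (k0 : 'I_N) A W0 : exB j0 k0 -> box exE exB A -> measurable W0 ->
  P (A `&` B j0 k0 @^-1` W0) = P A * mu j0 W0.
Proof.
move=> ex [F [U [W [mF mU mW [EU BW] ->]]]] mW0.
pose W' j k := if (j, k) == (j0, k0) then W0 else W j k.
have -> : [set o | F (J o) /\ forall j (k : 'I_N), U j k (E j k o) /\ W j k (B j k o)] `&`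
    B j0 k0 @^-1` W0 =
    [set o | F (J o) /\ forall j (k : 'I_N), U j k (E j k o) /\ W' j k (B j k o)].
  apply/seteqP; split => o /=.
    move=> [[h1 h2] h3]; split => // j k; have [h4 h5] := h2 j k; split => //.
    by rewrite /W'; case: eqP => // -[-> ->].
  move=> [h1 h2]; split; last by have [] := h2 j0 k0; rewrite /W' eqxx.
  split => // j k; have [] := h2 j k; rewrite /W'; case: eqP => // -[-> ->] ? _.
  by rewrite BW.
have mW' j k : measurable (W' j k) by rewrite /W'; case: ifP.
rewrite (indep mF mU mW') (indep mF mU mW).
rewrite (@box_update (fun j k => P (E j k @^-1` U j k) * P (B j k @^-1` W j k)) _ j0 k0
    (mu j0 W0)).
- by rewrite muleCA muleC.
- by rewrite /W' eqxx BW// preimage_setT probability_setT mule1 job// muleC.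
- by move=> j k /negbTE h; rewrite /W' h.
Qed.

Lemma box_measurable_J exE exB :
  measurable_fun setT (J : g_sigma_algebraType (box exE exB) -> X).
Proof.
move=> _ F mF; rewrite setTI; apply: sub_sigma_algebra.
by exists F, (fun _ _ => setT), (fun _ _ => setT); split => //; apply/seteqP; split => // o [].
Qed.

Lemma box_measurable_E (exE exB : St -> nat -> bool) j0 (k0 : 'I_N) : ~~ exE j0 k0 ->
  measurable_fun setT (E j0 k0 : g_sigma_algebraType (box exE exB) -> R).
Proof.
move=> nex _ U mU; rewrite setTI; apply: sub_sigma_algebra.
exists setT, (fun j k => if (j, k) == (j0, k0) then U else setT), (fun _ _ => setT); split => //.
- by move=> j k; case: ifP.
- by split => // j k ex; case: eqP => // -[jj kk]; move: nex; rewrite -jj -kk ex.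
- apply/seteqP; split => o /=; last by move=> [_ H]; have := H j0 k0; rewrite eqxx; case.
  by move=> Uo; split => // j k; split => //; case: eqP => // -[-> ->].
Qed.

Lemma box_measurable_B (exE exB : St -> nat -> bool) j0 (k0 : 'I_N) : ~~ exB j0 k0 ->
  measurable_fun setT (B j0 k0 : g_sigma_algebraType (box exE exB) -> T).
Proof.
move=> nex _ U mU; rewrite setTI; apply: sub_sigma_algebra.
exists setT, (fun _ _ => setT), (fun j k => if (j, k) == (j0, k0) then U else setT); split => //.
- by move=> j k; case: ifP.
- by split => // j k ex; case: eqP => // -[jj kk]; move: nex; rewrite -jj -kk ex.
- apply/seteqP; split => o /=; last by move=> [_ H]; have := H j0 k0; rewrite eqxx; case.
  by move=> Uo; split => // j k; split => //; case: eqP => // -[-> ->].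
Qed.

Definition clock_value j k (o : Om) : \bar R :=
  (clock_weight w J (fun j k => E j k) (fun j k => B j k) j k o)%:E *
  iter (N - k) (next_ring j) (cst 1) (J o, ring_time (fun j k => E j k) j k o : RR).

(** The gap and the mark of the next ring are independent of everything else
    that the integrand involves; integrating them out is one application of
    [next_ring]. *)
Lemma clock_step (kv : St -> nat) j0 k : (forall j, (kv j <= N)%N) -> kv j0 = k.+1 ->
  \int[P]_o \big[mule/1]_(j < d.+1) clock_value j (kv j) o =
  \int[P]_o \big[mule/1]_(j < d.+1) clock_value j (if j == j0 then k else kv j) o.
Proof.
move=> kN Ek; have kN0 : (k < N)%N by rewrite -Ek.
pose k0 := Ordinal kN0.
set G := iter (N - k.+1) (next_ring j0) (cst 1).
have [mG G0] : measurable_fun setT G /\ forall p, 0 <= G p by exact: measurable_iter_next_ring.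
pose rt (o : Om) : RR := ring_time (fun j k => E j k) j0 k o.
pose Rest o := (\big[mule/1]_(j < d.+1 | j != j0) clock_value j (kv j) o) *
  (clock_weight w J (fun j k => E j k) (fun j k => B j k) j0 k o)%:E.
have cw0 j m o : (0 <= clock_weight w J (fun j k => E j k) (fun j k => B j k) j m o)%R.
  by apply: prodr_ge0 => i _.
have cv0 j m o : 0 <= clock_value j m o.
  apply: mule_ge0; first by rewrite lee_fin; exact: cw0.
  exact: (measurable_iter_next_ring j (N - m)).2.
have Rest0 o : 0 <= Rest o by rewrite mule_ge0 ?lee_fin//; apply: prode_ge0.
pose ex (j : St) (m : nat) := (j == j0) && (m == k).
pose nex (j : St) (m : nat) := false.
have mE (exE exB : St -> nat -> bool) j m : (forall j m, exE j m -> ex j m) -> (m < N)%N -> ~~ ex j m ->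
    measurable_fun setT (E j m : g_sigma_algebraType (box exE exB) -> R).
  move=> H mN nx; apply: (@box_measurable_E exE exB j (Ordinal mN)).
  by apply: contra nx; exact: H.
have mB (exE exB : St -> nat -> bool) j m : (forall j m, exB j m -> ex j m) -> (m < N)%N -> ~~ ex j m ->
    measurable_fun setT (B j m : g_sigma_algebraType (box exE exB) -> T).
  move=> H mN nx; apply: (@box_measurable_B exE exB j (Ordinal mN)).
  by apply: contra nx; exact: H.
have mrt (exE exB : St -> nat -> bool) : (forall j m, exE j m -> ex j m) ->
    measurable_fun setT (rt : g_sigma_algebraType (box exE exB) -> RR).
  move=> H1; apply: (@measurable_ring_time _ (g_sigma_algebraType (box exE exB)) (fun j k => E j k)) => m mk.
  by apply: mE => //; [exact: (ltn_trans mk kN0)|rewrite /ex ltn_eqF// andbF].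
have mRest (exE exB : St -> nat -> bool) : (forall j m, exE j m -> ex j m) -> (forall j m, exB j m -> ex j m) ->
    measurable_fun setT (Rest : g_sigma_algebraType (box exE exB) -> \bar R).
  move=> H1 H2.
  have mcw j m : (m <= N)%N -> (j != j0) || (m <= k)%N -> measurable_fun setT
     (clock_weight w J (fun j k => E j k) (fun j k => B j k) j m : g_sigma_algebraType (box exE exB) -> R).
    move=> mN jm; have nx l : (l < m)%N -> ~~ ex j l.
      move=> lm; rewrite /ex negb_and; case/orP: jm => [->//|mk].
      by rewrite (ltn_eqF (leq_trans lm mk)) orbT.
    apply: (@measurable_clock_weight _ (g_sigma_algebraType (box exE exB)) w J (fun j k => E j k) (fun j k => B j k)) => //.
    - exact: box_measurable_J.
    - by move=> l lm; apply: mE => //; [exact: leq_trans lm mN|exact: nx].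
    - by move=> l lm; apply: mB => //; [exact: leq_trans lm mN|exact: nx].
  apply: emeasurable_funM; last first.
    by apply/measurable_EFinP; apply: mcw; [exact: ltnW|rewrite leqnn orbT].
  rewrite (_ : (fun o => _) = fun o => \big[mule/1]_(j < d.+1)
      (if j != j0 then clock_value j (kv j) o else 1)); last first.
    by apply/funext => o; rewrite big_mkcond.
  apply: emeasurable_prode => j; case: (boolP (j == j0)) => jj /=; first exact: measurable_cst.
  apply: emeasurable_funM.
    by apply/measurable_EFinP; apply: mcw => //; rewrite jj.
  have [mi _] := measurable_iter_next_ring j (N - kv j).
  apply: (measurableT_comp mi); apply: measurable_fun_pair; first exact: box_measurable_J.
  apply: (@measurable_ring_time _ (g_sigma_algebraType (box exE exB)) (fun j k => E j k)) => m mk.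
  by apply: mE => //; [exact: leq_trans mk (kN j)|rewrite /ex (negbTE jj)].
have Pfin : P setT < +oo by rewrite probability_setT ltry.
pose O1 := g_sigma_algebraType (box nex ex).
pose g1 (z : O1 * T) := Rest z.1 * ((w j0 ((J z.1, (rt z.1 + E j0 k z.1)%R : RR), z.2))%:E *
   G (J z.1, (rt z.1 + E j0 k z.1)%R : RR)).
pose O2 := g_sigma_algebraType (box ex ex).
pose g2 (z : O2 * RR) := Rest z.1 * (mean_weight j0 (J z.1, (rt z.1 + z.2)%R : RR) *
   G (J z.1, (rt z.1 + z.2)%R : RR)).
transitivity (\int[P]_o g1 (o, B j0 k o)).
  apply: eq_integral => o _; rewrite (bigD1 j0)//= {1}/clock_value Ek -/G.
  rewrite /g1 /Rest /= /clock_weight big_ord_recr /= /ring_time big_ord_recr /=.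
  rewrite EFinM muleC -!muleA; congr (_ * _); congr (_ * _); congr (_%:E * G _).
have mJ1 : measurable_fun setT (J : O1 -> X) by exact: box_measurable_J.
have mJ2 : measurable_fun setT (J : O2 -> X) by exact: box_measurable_J.
have mt1 : measurable_fun setT (fun z : O1 => (rt z + E j0 k z)%R : RR).
  apply: measurable_funD; first exact: mrt.
  exact: (@box_measurable_E nex ex j0 k0).
have mp1 : measurable_fun setT (fun z : O1 => (J z, (rt z + E j0 k z)%R : RR)).
  exact: measurable_fun_pair.
rewrite (@integrate_out _ _ Om T R P (box nex ex) (B j0 k) (mu j0) g1)//; last 6 first.
- exact: box_measurable.
- exact: box_setI.
- exact: box_setT.
- by move=> A W CA mW; apply: (@box_job nex ex j0 k0) => //; rewrite /ex !eqxx.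
- apply: emeasurable_funM; first by apply: measurableT_comp => //; exact: mRest.
  apply: emeasurable_funM.
    apply/measurable_EFinP; apply: (measurableT_comp (mw j0)).
    by apply: measurable_fun_pair => //; exact: (measurableT_comp mp1).
  by apply: (measurableT_comp mG); exact: (measurableT_comp mp1).
- move=> z; apply: mule_ge0; first exact: Rest0.
  by apply: mule_ge0; [rewrite lee_fin; exact: w0|exact: G0].
transitivity (\int[P]_o g2 (o, E j0 k o)).
  apply: eq_integral => o _; rewrite /g1 /g2 /=.
  rewrite ge0_integralZl//; last 2 first.
  - apply: emeasurable_funM; last exact: measurable_cst.
    apply/measurable_EFinP; apply: (measurableT_comp (mw j0)).
    by apply: measurable_fun_pair.
  - by move=> b _; rewrite mule_ge0// lee_fin.
  rewrite ge0_integralZr//.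
  - apply/measurable_EFinP; apply: (measurableT_comp (mw j0)).
    by apply: measurable_fun_pair.
  - by move=> b _; rewrite lee_fin.
have mp2 : measurable_fun setT (fun z : O2 * RR => (J z.1, (rt z.1 + z.2)%R : RR)).
  apply: measurable_fun_pair; first exact: measurableT_comp.
  by apply: measurable_funD => //; apply: measurableT_comp => //; exact: mrt.
rewrite (@integrate_out _ _ Om RR R P (box ex ex) (E j0 k) (exp_law (c0 j0)) g2)//; last 7 first.
- exact: box_measurable.
- exact: box_setI.
- exact: box_setT.
- exact: (@measurable_funPT _ _ _ _ (E j0 k)).
- by move=> A W CA mW; apply: (@box_gap ex ex j0 k0) => //; rewrite /ex !eqxx.
- apply: emeasurable_funM; first by apply: measurableT_comp => //; exact: mRest.
  apply: emeasurable_funM; last exact: (measurableT_comp mG).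
  by apply: (measurableT_comp (measurable_mean_weight j0)).
- move=> z; apply: mule_ge0; first exact: Rest0.
  by apply: mule_ge0; [exact: mean_weight_ge0|exact: G0].
apply: eq_integral => o _; rewrite /g2 /=.
have mpo : measurable_fun setT (fun e : RR => (J o, (rt o + e)%R : RR)).
  by apply: measurable_fun_pair => //; exact: measurable_funD.
rewrite ge0_integralZl//; last 2 first.
- apply: emeasurable_funM; last exact: (measurableT_comp mG).
  by apply: (measurableT_comp (measurable_mean_weight j0)).
- by move=> e _; rewrite mule_ge0// mean_weight_ge0.
rewrite [RHS](bigD1 j0)//= eqxx /Rest [RHS]muleC -muleA; congr (_ * _).
  by apply: eq_bigr => j /negbTE ->.
by rewrite /clock_value -(subnSK kN0).
Qed.

Lemma clock_elimination :
  \int[P]_o (\prod_(j < d.+1) clock_weight w J (fun j k => E j k) (fun j k => B j k) j N o)%:E =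
  \int[P]_o \big[mule/1]_(j < d.+1) iter N (next_ring j) (cst 1) (J o, 0%R : RR).
Proof.
have H n (kv : St -> nat) : (forall j, (kv j <= N)%N) -> (\sum_j kv j = n)%N ->
    \int[P]_o \big[mule/1]_(j < d.+1) clock_value j (kv j) o =
    \int[P]_o \big[mule/1]_(j < d.+1) clock_value j 0 o.
  elim: n kv => [|n IH] kv kN.
    move=> /eqP; rewrite sum_nat_eq0 => /forallP k0; apply: eq_integral => o _.
    by apply: eq_bigr => j _; have := k0 j => /= /eqP ->.
  move=> kn; have [j0 kj0] : exists j0, (0 < kv j0)%N.
    apply/existsP; apply: contraT; rewrite negb_exists => /forallP h.
    by move: kn; rewrite big1// => j _; apply/eqP; rewrite -leqn0 leqNgt.
  case Ek : (kv j0) kj0 => [//|k] _.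
  rewrite (clock_step kN Ek); apply: IH.
    by move=> j; case: eqP => // _; have := kN j0; rewrite Ek; exact: ltnW.
  move: kn; rewrite (bigD1 j0)//= Ek addSn => -[] <-.
  rewrite [LHS](bigD1 j0)//= eqxx; congr (_ + _)%N.
  by apply: eq_bigr => j /negbTE ->.
have := H _ (fun=> N) (fun=> leqnn N) erefl.
have -> : \int[P]_o \big[mule/1]_(j < d.+1) clock_value j N o =
    \int[P]_o (\prod_(j < d.+1) clock_weight w J (fun j k => E j k) (fun j k => B j k) j N o)%:E.
  apply: eq_integral => o _; rewrite -prodEFin; apply: eq_bigr => j _.
  by rewrite /clock_value subnn /= mule1.
move=> ->; apply: eq_integral => o _; apply: eq_bigr => j _.
by rewrite /clock_value subn0 /clock_weight /ring_time !big_ord0 mul1e.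
Qed.

End Clocks.

End Clock.
Export Clock.

(** * Iterated rings *)

Module Rings.
Local Open Scope ereal_scope.

Section ExpLaw.
Context {R : realType}.
Local Notation RR := (measurableTypeR R).
Variables (c : R) (c0 : (0 < c)%R).

Lemma exp_law_lt0 : exp_law c0 (`]-oo, 0%R[%classic : set RR) = 0.
Proof.
rewrite exp_lawE /exponential_prob integral0_eq// => x; rewrite /= in_itv /= => x0.
by rewrite lt0_exponential_pdf.
Qed.

Lemma exp_law_ae_ge0 : {ae exp_law c0, forall e : RR, (0 <= e :> R)%R}.
Proof.
exists (`]-oo, 0%R[%classic : set RR); split => //.
- exact: exp_law_lt0.
- by move=> e /= /negP; rewrite -ltNge in_itv.
Qed.

Lemma exp_law_le (x : R) : (0 < x)%R ->
  exp_law c0 (`]-oo, x]%classic : set RR) = (1 - expR (- (c * x)))%:E.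
Proof.
move=> x0; have -> : `]-oo, x]%classic = `]-oo, 0%R[ `|` `[0%R, x] :> set R.
  by rewrite -itv_bndbnd_setU// bnd_simp ltW.
rewrite measureU.
- by rewrite [X in X + _]exp_law_lt0 add0e [LHS](exponential_prob_itv0c _ x0) mulNr.
- exact: measurable_itv.
- exact: measurable_itv.
- rewrite -subset0 => y [] /=; rewrite !in_itv /= => y0 /andP[y1 _].
  by move: y0; rewrite ltNge y1.
Qed.

Lemma exp_law_remaining (t s : R) : (0 < t)%R -> (0 <= s)%R ->
  \int[exp_law c0]_e ((s + e <= t)%R%:R)%:E <= (1 - expR (- (c * t)))%:E * ((s <= t)%R%:R)%:E.
Proof.
move=> t0 s0.
have -> : (fun e : RR => ((s + e <= t)%R%:R)%:E) = (fun e => (\1_(`]-oo, (t - s)%R]%classic : set RR) e)%:E) :> (RR -> \bar R).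
  apply/funext => e; rewrite indicE; congr (_%:E).
  suff -> : (e \in (`]-oo, (t - s)%R]%classic : set RR)) = (s + e <= t)%R by [].
  by apply/idP/idP; rewrite inE /= in_itv /= lerBrDl.
rewrite integral_indic//.
rewrite setIT; case: (leP s t) => st; rewrite ?mule1 ?mule0.
  rewrite -exp_law_le//; apply: le_measure; rewrite ?inE; try exact: measurable_itv.
  by apply: subset_itvl; rewrite bnd_simp gerBl.
rewrite -exp_law_lt0; apply: le_measure; rewrite ?inE; try exact: measurable_itv.
by move=> x /=; rewrite !in_itv /= => xt; rewrite (le_lt_trans xt)// subr_lt0.
Qed.

End ExpLaw.

Section Iterates.
Context {R : realType} {L d : nat} dX (X : measurableType dX).
Local Notation T := (borelV R L).
Local Notation RR := (measurableTypeR R).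
Local Notation St := 'I_d.+1.
Variables (c : St -> R) (c0 : forall j, (0 < c j)%R) (mu : St -> probability T R).
Variable (w : St -> (X * RR) * T -> R).
Hypothesis mw : forall j, measurable_fun setT (w j).
Hypothesis w0 : forall j p, (0 <= w j p)%R.
Hypothesis w1 : forall j p, (w j p <= 1)%R.
Variables (j : St) (f : X) (t : R).
Hypothesis t0 : (0 < t)%R.

Local Notation K := (next_ring c0 mu w j).
Local Notation it n s := (iter n K (cst 1) (f, s)).

Let rho : R := (1 - expR (- (c j * t)))%R.

Let rho0 : (0 <= rho)%R.
Proof. by rewrite subr_ge0 -expR0 ler_expR oppr_le0 mulr_ge0// ltW. Qed.

Lemma mean_weight_le1 p : mean_weight mu w j p <= 1.
Proof.
rewrite -(@probability_setT _ _ _ (mu j)) -[leRHS]mul1e -integral_cst//.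
apply: ge0_le_integral => //.
- by move=> b _; rewrite lee_fin.
- apply/measurable_EFinP; apply: (measurableT_comp (mw j)).
  exact: measurable_fun_pair.
- by move=> b _; rewrite lee_fin.
Qed.

Let mshift (G : X * RR -> \bar R) s : measurable_fun setT G ->
  measurable_fun setT (fun e : RR => G (f, (s + e)%R : RR)).
Proof.
move=> mG; apply: (measurableT_comp mG); apply: measurable_fun_pair => //.
exact: measurable_funD.
Qed.

Let mit n : measurable_fun setT (iter n K (cst 1)) := (measurable_iter_next_ring c0 mu mw w0 j n).1.
Let it0 n p : 0 <= iter n K (cst 1) p := (measurable_iter_next_ring c0 mu mw w0 j n).2 p.

Let next_ring_le n s (h : RR -> \bar R) : measurable_fun setT h -> (forall e, 0 <= h e) ->
  (forall e, (0 <= e)%R -> mean_weight mu w j (f, (s + e)%R : RR) * it n (s + e)%R <= h e) ->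
  it n.+1 s <= \int[exp_law (c0 j)]_e h e.
Proof.
move=> mh h0 H /=; apply: ae_ge0_le_integral => //.
- by move=> e _; rewrite mule_ge0// mean_weight_ge0.
- apply: emeasurable_funM; first by apply: mshift; exact: measurable_mean_weight.
  exact: mshift.
- by move: (exp_law_ae_ge0 (c0 j)); apply: filterS => e e0 _; exact: H.
Qed.

Lemma iter_next_ring_le1 n s : it n s <= 1.
Proof.
elim: n s => [//|n IH] s.
rewrite [leRHS](_ : _ = \int[exp_law (c0 j)]_e (cst 1 e : \bar R)); last first.
  by rewrite integral_cst// mul1e; exact/esym/(@probability_setT _ _ _ (exp_law (c0 j))).
apply: next_ring_le => // e _.
by rewrite -[leRHS]mule1; apply: lee_pmul => //; [exact: mean_weight_ge0|exact: mean_weight_le1].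
Qed.

(** The weight vanishes after the horizon, so every further ring has to fall
    before it, which costs a factor [rho]. *)
Lemma iter_next_ring_geometric n s : (0 <= s)%R ->
  (forall u, (t < u)%R -> mean_weight mu w j (f, u) = 0) -> it n s <= (rho ^+ n)%:E.
Proof.
move=> + Hw; elim: n s => [//|n IH] s s0.
apply: (@le_trans _ _ (\int[exp_law (c0 j)]_e ((rho ^+ n)%:E * ((s + e <= t)%R%:R)%:E))).
  apply: next_ring_le.
  - apply: emeasurable_funM; first exact: measurable_cst.
    apply/measurable_EFinP; apply: measurable_natr_bool; apply: measurable_fun_ler => //.
    exact: measurable_funD.
  - by move=> e; rewrite mule_ge0 ?lee_fin// exprn_ge0.
  move=> e e0; case: (leP (s + e)%R t) => se; last by rewrite Hw// mul0e mule0.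
  rewrite mule1 -[leRHS]mul1e; apply: lee_pmul => //; first exact: mean_weight_ge0.
    exact: mean_weight_le1.
  by apply: IH; rewrite addr_ge0.
rewrite ge0_integralZl//; last 2 first.
- apply/measurable_EFinP; apply: measurable_natr_bool; apply: measurable_fun_ler => //.
  exact: measurable_funD.
- by rewrite lee_fin exprn_ge0.
rewrite exprSr EFinM; apply: lee_pmul => //.
- by rewrite lee_fin exprn_ge0.
- by apply: integral_ge0 => e _; rewrite lee_fin.
apply: le_trans (exp_law_remaining (c0 j) t0 s0) _.
by rewrite -[leRHS]mule1; apply: lee_pmul; rewrite ?lee_fin//; case: (s <= t)%R.
Qed.

Variable phi : R -> R.
Hypotheses (mphi : measurable_fun setT phi) (phi0 : forall u, (0 <= phi u)%R)
  (phi1 : forall u, (phi u <= 1)%R) (phit : forall u, (t < u)%R -> (phi u = 0)%R).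
Hypothesis phiE : forall u, mean_weight mu w j (f, u) = (1 - phi u)%:E.

Let V := thinning_void (c j) t phi.

Let mV : measurable_fun setT (V : RR -> R).
Proof. exact: measurable_thinning_void. Qed.

Let mVs s : measurable_fun setT (fun e : RR => ((1 - phi (s + e)) * V (s + e))%:E : \bar R).
Proof.
have ms : measurable_fun setT (fun e : RR => (s + e)%R : RR) by exact: measurable_funD.
apply/measurable_EFinP; apply: measurable_funM; last exact: (measurableT_comp mV ms).
by apply: measurable_funB => //; exact: (measurableT_comp mphi ms).
Qed.

Lemma iter_next_ring_ge n s : (V s)%:E <= it n s.
Proof.
elim: n s => [|n IH] s.
  rewrite lee_fin /V /thinning_void -expR0 ler_expR oppr_le0.
  by apply: mulr_ge0; [exact: ltW|exact: Rintegral_ge0].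
rewrite -(thinning_void_fixpoint (c0 j) mphi phi0 phi1 phit) /=.
apply: ge0_le_integral => //.
- by move=> e _; rewrite lee_fin mulr_ge0 ?subr_ge0// thinning_void_ge0.
- apply: emeasurable_funM; first by apply: mshift; exact: measurable_mean_weight.
  exact: mshift.
move=> e _; rewrite phiE EFinM; apply: lee_pmul => //.
- by rewrite lee_fin subr_ge0.
- by rewrite lee_fin thinning_void_ge0.
Qed.

Lemma iter_next_ring_le n s : (0 <= s)%R -> it n s <= (V s + rho ^+ n)%:E.
Proof.
suff H : (0 <= s)%R -> it n s <= (V s)%:E + (rho ^+ n)%:E * ((s <= t)%R%:R)%:E.
  move=> /H /le_trans; apply; rewrite -EFinM -EFinD lee_fin lerD2l.
  by rewrite -[leRHS]mulr1 ler_wpM2l ?exprn_ge0//; case: (s <= t)%R.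
elim: n s => [|n IH] s s0.
  rewrite -EFinM -EFinD lee_fin mul1r; case: (leP s t) => st /=.
    by rewrite lerDr thinning_void_ge0.
  by rewrite /V thinning_void_after// addr0.
have mind : measurable_fun setT (fun e : RR => ((s + e <= t)%R%:R)%:E : \bar R).
  apply/measurable_EFinP; apply: measurable_natr_bool; apply: measurable_fun_ler => //.
  exact: measurable_funD.
apply: (@le_trans _ _ (\int[exp_law (c0 j)]_e (((1 - phi (s + e)) * V (s + e))%:E +
    (rho ^+ n)%:E * ((s + e <= t)%R%:R)%:E))).
  apply: next_ring_le.
  - apply: emeasurable_funD; first exact: mVs.
    by apply: emeasurable_funM => //; exact: measurable_cst.
  - move=> e; rewrite adde_ge0// ?mule_ge0 ?lee_fin ?exprn_ge0//.
    by rewrite mulr_ge0 ?subr_ge0// thinning_void_ge0.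
  move=> e e0; rewrite phiE.
  apply: (@le_trans _ _ ((1 - phi (s + e))%:E * ((V (s + e)%R)%:E + (rho ^+ n)%:E * ((s + e <= t)%R%:R)%:E))).
    by apply: lee_wpmul2l; [rewrite lee_fin subr_ge0|apply: IH; rewrite addr_ge0].
  rewrite -!EFinM -!EFinD lee_fin mulrDr lerD2l -[leRHS]mul1r.
  by apply: ler_wpM2r; [rewrite mulr_ge0 ?exprn_ge0|rewrite gerBl].
rewrite ge0_integralD//; last 3 first.
- by move=> e _; rewrite lee_fin mulr_ge0 ?subr_ge0// thinning_void_ge0.
- by move=> e _; rewrite mule_ge0 ?lee_fin ?exprn_ge0.
- by apply: emeasurable_funM => //; exact: measurable_cst.
rewrite [X in X + _](thinning_void_fixpoint (c0 j) mphi phi0 phi1 phit) -/V.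
apply: leeD2l; rewrite ge0_integralZl//; last by rewrite lee_fin exprn_ge0.
rewrite exprSr EFinM -muleA; apply: lee_wpmul2l; first by rewrite lee_fin exprn_ge0.
exact: exp_law_remaining.
Qed.

Lemma iter_next_ring_cvg : fine (it n 0%R) @[n --> \oo] --> V 0%R.
Proof.
have rho1 : (rho < 1)%R by rewrite gtrBl expR_gt0.
have h : (V 0 + rho ^+ n @[n --> \oo] --> V 0 + 0)%R.
  by apply: cvgD; [exact: cvg_cst|apply: cvg_expr; rewrite ger0_norm].
rewrite addr0 in h.
apply: squeeze_cvgr (cvg_cst (V 0%R)) h; near=> n.
have h1 := iter_next_ring_ge n 0%R; have h2 := iter_next_ring_le n (lexx 0%R).
have fi : it n 0%R \is a fin_num.
  by rewrite ge0_fin_numE ?it0// (le_lt_trans h2)// ltry.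
by rewrite -!lee_fin fineK// h1 h2.
Unshelve. all: by end_near. Qed.

End Iterates.

End Rings.
Export Rings.

(** * Laplace transform of the storage *)

Module Transf.
Local Open Scope ereal_scope.

Lemma cvg_prodr (R : realType) (U I : Type) (F : set_system U) (FF : Filter F)
    (s : seq I) (f : I -> U -> R) (a : I -> R) :
  (forall i, f i u @[u --> F] --> a i) ->
  (\prod_(i <- s) f i u)%R @[u --> F] --> (\prod_(i <- s) a i)%R.
Proof. by move=> H; apply: cvg_big => //; exact: mul_continuous. Qed.

Lemma fine_prode (R : realType) (I : Type) (s : seq I) (f : I -> \bar R) :
  (forall i, f i \is a fin_num) ->
  \big[mule/1]_(i <- s) f i = (\prod_(i <- s) fine (f i))%R%:E.
Proof. by move=> h; rewrite -prodEFin; apply: eq_bigr => i _; rewrite fineK. Qed.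

Lemma probability_lty d (X : measurableType d) (R : realType) (P : probability X R) : P setT < +oo.
Proof. exact: (le_lt_trans (probability_le1 P measurableT) (ltry 1)). Qed.

Lemma prode_le1 (R : realDomainType) (I : Type) (s : seq I) (p : pred I) (f : I -> \bar R) :
  (forall i, p i -> 0 <= f i <= 1) -> \big[mule/1]_(i <- s | p i) f i <= 1.
Proof.
move=> h; suff /andP[] : 0 <= \big[mule/1]_(i <- s | p i) f i <= 1 by [].
elim/big_rec : _ => [|i x pi /andP[x0 x1]]; first by rewrite lee01 lexx.
have /andP[f0 f1] := h i pi; rewrite mule_ge0//= -[leRHS]mule1.
exact: lee_pmul.
Qed.

Lemma inner_sum (R : realType) (L : nat) (I : Type) (s : seq I) (f : I -> 'rV[R]_L) (th : 'cV[R]_L) :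
  inner th (\sum_(i <- s) f i)%R = (\sum_(i <- s) inner th (f i))%R.
Proof.
rewrite /inner exchange_big /=; apply: eq_bigr => l _.
by rewrite summxE mulr_sumr.
Qed.

Section NetworkLaplace.
Context {R : realType} {L d : nat} {t : R}.
Local Notation T := (borelV R L).
Local Notation X := (bpath d t).
Local Notation RR := (measurableTypeR R).
Local Notation St := 'I_d.+1.
Variables (lam : St -> R) (mu : St -> probability T R) (r : St -> 'M[R]_L)
  (Q : 'M[R]_d.+1) (j0 : St) (c : R).
Hypotheses (t0 : (0 < t)%R) (c0 : (0 < c)%R) (lam0 : forall j, (0 < lam j)%R).
Hypothesis mu_ge0 : forall j, {ae mu j, forall x : T, forall l, (0 <= (x : 'rV[R]_L) ord0 l)%R}.
Hypothesis r0 : forall j i i', (0 <= r j i i')%R.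
Context dO (Om : measurableType dO) (P : probability Om R).
Variables (J : {mfun Om >-> X}) (E : St -> nat -> {mfun Om >-> R})
  (B : St -> nat -> {mfun Om >-> T}) (Y : R -> {mfun Om >-> T}).
Hypothesis net : network lam mu r Q j0 c P J E B Y.

Let cl0 j : (0 < c * lam j)%R. Proof. exact: mulr_gt0. Qed.
Let lam_ge0 j : (0 <= lam j)%R. Proof. exact: ltW. Qed.
Let fE := fun j k => (E j k : Om -> R).
Let fB := fun j k => (B j k : Om -> T).

Let elim_ (w : St -> (X * RR) * T -> R) (mw : forall j, measurable_fun setT (w j)) (w0 : forall j p, (0 <= w j p)%R) N :
  \int[P]_o (\prod_(j < d.+1) clock_weight w J fE fB j N o)%:E =
  \int[P]_o \big[mule/1]_(j < d.+1) iter N (next_ring cl0 mu w j) (cst 1) (J o, 0%R : RR).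
Proof.
exact: (@clock_elimination R L d _ X (fun j => c * lam j)%R cl0 mu w mw w0 dO Om P J E B
  (network_gap net) (network_job net) (network_indep net)).
Qed.

Lemma interarrival_gt0 j k : {ae P, forall o, (0 < E j k o)%R}.
Proof.
exists (E j k @^-1` `]-oo, 0%R]%classic); split.
- by rewrite -[X in measurable X]setTI; apply: measurable_funPT => //; exact: measurable_itv.
- rewrite (network_gap net)// -(exp_lawE (cl0 j)).
  apply/eqP; rewrite -measure_le0; apply/lee_addgt0Pr => e e0; rewrite add0e.
  have x0 : (0 < e / (c * lam j))%R by rewrite divr_gt0.
  apply: (@le_trans _ _ (exp_law (cl0 j) (`]-oo, (e / (c * lam j))%R]%classic : set RR))).
    apply: le_measure; rewrite ?inE; try exact: measurable_itv.
    by apply: subset_itvl; rewrite bnd_simp ltW.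
  rewrite exp_law_le// lee_fin mulrCA mulfV ?gt_eqF// mulr1.
  by rewrite lerBlDr -lerBlDl expR_ge1Dx.
- by move=> o /= /negP; rewrite -leNgt in_itv.
Qed.

Lemma job_ge0 j k : {ae P, forall o l, (0 <= (B j k o : 'rV[R]_L) ord0 l)%R}.
Proof.
have mO : measurable (orthant (0 : 'rV[R]_L) : set T) by exact: measurable_orthant.
exists (B j k @^-1` ~` (orthant (0 : 'rV[R]_L) : set T)); split.
- by rewrite -[X in measurable X]setTI; apply: measurable_funPT => //; exact: measurableC.
- rewrite (network_job net); last exact: measurableC.
  have [N [mN N0 HN]] := mu_ge0 j.
  apply/eqP; rewrite -measure_le0 -N0; apply: le_measure; rewrite ?inE//.
    exact: measurableC.
  move=> x /= nx; apply: HN => /= H; apply: nx => l; rewrite mxE; exact: H.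
- move=> o /= H H2; apply: H => l; have := H2 l; by rewrite mxE.
Qed.

(** With the indicators of the rings before the horizon as weights, the
    elimination of the rings bounds the probability that [N] rings fall before
    the horizon by [rho ^+ N]. *)
Lemma ring_time_unbounded j : {ae P, forall o, exists N, (t < ring_time fE j N o)%R}.
Proof.
pose w (i : St) (q : (X * RR) * T) : R := if i == j then (q.1.2 <= t)%R%:R else 1%R.
have mw i : measurable_fun setT (w i).
  rewrite /w; case: (i == j); last exact: measurable_cst.
  apply: measurable_natr_bool; apply: measurable_fun_ler => //.
  by apply: measurableT_comp => //; exact: measurableT_comp.
have w0 i q : (0 <= w i q)%R by rewrite /w; case: ifP.
have w1 i q : (w i q <= 1)%R by rewrite /w; case: ifP => // _; rewrite lern1 leq_b1.
pose A := \bigcap_N [set o | (ring_time fE j N o <= t)%R].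
have mrt N : measurable_fun setT (ring_time fE j N : Om -> RR).
  by apply: measurable_ring_time => m _; exact: measurable_funPT.
have mA : measurable A.
  apply: bigcap_measurable; first by exists 0%N.
  move=> N _; have -> : [set o | (ring_time fE j N o <= t)%R] =
      setT `&` ring_time fE j N @^-1` `]-oo, t]%classic.
    by apply/seteqP; split => o /=; rewrite in_itv //= => -[].
  by apply: mrt => //; exact: measurable_itv.
exists A; split => //; last first.
  move=> o /= H N _ /=; rewrite leNgt; apply/negP => h; apply: H; by exists N.
set rho := (1 - expR (- (c * lam j * t)))%R.
have rho0 : (0 <= rho)%R by rewrite subr_ge0 -expR0 ler_expR oppr_le0 mulr_ge0// ltW.
have rho1 : (rho < 1)%R by rewrite gtrBl expR_gt0.
have bound N : P A <= (rho ^+ N)%:E.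
  apply: (@le_trans _ _ (\int[P]_o (\prod_(i < d.+1) clock_weight w J fE fB i N o)%:E)).
    rewrite -[leLHS]mul1e -integral_cst// integral_mkcond.
    apply: ge0_le_integral => //.
    - by move=> o _; rewrite patchE; case: ifP => // _; rewrite lee_fin.
    - by apply/(measurable_restrictT _ mA); exact: measurable_cst.
    - apply/measurable_EFinP; apply: measurable_prod => i _.
      by apply: measurable_clock_weight => // *; exact: measurable_funPT.
    move=> o _; rewrite patchE; case: ifPn => [|_]; last first.
      by rewrite lee_fin; apply: prodr_ge0 => i _; apply: prodr_ge0.
    rewrite inE => Ao; rewrite lee_fin big1// => i _; rewrite /clock_weight big1// => m _.
    by rewrite /w; case: eqP => // ->; rewrite (Ao m.+1 I).
  rewrite elim_//; apply: (@le_trans _ _ (\int[P]_o (cst (rho ^+ N)%:E o))); last first.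
    rewrite integral_cst// -[leRHS]mule1; apply: lee_wpmul2l; first by rewrite lee_fin exprn_ge0.
    exact: probability_le1.
  have it0 i p := (measurable_iter_next_ring cl0 mu mw w0 i N).2 p.
  apply: ge0_le_integral => //.
  - by move=> o _; apply: prode_ge0 => i _.
  - apply: emeasurable_prode => i.
    apply: (measurableT_comp (measurable_iter_next_ring cl0 mu mw w0 i N).1).
    by apply: measurable_fun_pair => //; exact: measurable_cst.
  move=> o _; rewrite (bigD1 j)//= -[leRHS]mule1; apply: lee_pmul => //.
  - by apply: prode_ge0 => i _.
  - apply: (@iter_next_ring_geometric R L d _ X _ cl0 mu w mw w0 w1 j (J o) t t0 N 0%R) => // u tu.
    rewrite /mean_weight; apply: integral0_eq => b _; rewrite /w eqxx /=.
    by rewrite leNgt tu.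
  - by apply: prode_le1 => i _; rewrite it0; exact: (iter_next_ring_le1 cl0 mu mw w0 w1).
apply/eqP; rewrite -measure_le0; apply/lee_addgt0Pr => e e0; rewrite add0e.
have := cvg_expr (z := rho); rewrite ger0_norm// => /(_ rho1) /cvgrPdist_le /(_ e e0)[N _ HN].
apply: le_trans (bound N) _; rewrite lee_fin; have := HN N (leqnn N).
by rewrite /= sub0r normrN ger0_norm// exprn_ge0.
Qed.

Definition regular (o : Om) : Prop :=
  [/\ forall j k, (0 < E j k o)%R, forall j k l, (0 <= (B j k o : 'rV[R]_L) ord0 l)%R,
      forall j, exists N, (t < ring_time fE j N o)%R &
      storage_path r (J o) (fun j k => \sum_(m < k.+1) E j m o)%R (fun j k => B j k o) (fun s => Y s o)].

Lemma ae_regular : {ae P, forall o, regular o}.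
Proof.
have H1 : {ae P, forall o, forall j k, (0 < E j k o)%R}.
  by apply: filter_forall => j; apply: ae_foralln => k; exact: interarrival_gt0.
have H2 : {ae P, forall o, forall j k l, (0 <= (B j k o : 'rV[R]_L) ord0 l)%R}.
  by apply: filter_forall => j; apply: ae_foralln => k; exact: job_ge0.
have H3 : {ae P, forall o, forall j, exists N, (t < ring_time fE j N o)%R}.
  by apply: filter_forall => j; exact: ring_time_unbounded.
have H4 := network_storage net.
apply: filterS (filterI H1 (filterI H2 (filterI H3 H4))) => o [h1 [h2 [h3 h4]]].
by split.
Qed.

(** After finitely many rings, all the jobs delivered by the horizon are in. *)
Lemma regular_storage o : regular o -> exists N0, forall N, (N0 <= N)%N ->
  (Y t o : 'rV[R]_L) = (\sum_(j < d.+1) \sum_(k < N)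
     (contribution r (J o) j (ring_time fE j k.+1 o) (B j k o) : 'rV[R]_L))%R.
Proof.
move=> [E0 B0 rt sp].
have inc j k l : (k < l)%N -> (ring_time fE j k o < ring_time fE j l o)%R.
  apply: (@homo_ltn _ (fun k => ring_time fE j k o) (fun x y => x < y)%R).
    by move=> y x z; exact: lt_trans.
  by move=> i; rewrite /ring_time big_ord_recr /= ltrDl; exact: E0.
have /choice[g Hg] := rt.
pose N0 := (\max_j g j)%N.
have HN0 j : (t < ring_time fE j N0 o)%R.
  apply: lt_le_trans (Hg j) _; have : (g j <= N0)%N by exact: leq_bigmax.
  by rewrite leq_eqVlt => /orP[/eqP -> //|/(inc j)/ltW].
exists N0 => N N0N.
apply: (storage_pathE t0 r0 sp).
- move=> j k; have := inc j 0%N k.+1 isT; rewrite /ring_time big_ord0; exact.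
- by move=> j k l kl; apply: (inc j k.+1 l.+1).
- move=> j k Nk; apply: lt_trans (HN0 j) _; apply: (inc j N0 k.+1).
  by rewrite ltnS (leq_trans N0N).
Qed.

Variable th : 'cV[R]_L.
Hypothesis th0 : forall l, (0 <= th l ord0)%R.

(** The cap at 1 is immaterial for non-negative jobs. *)
Definition discount j (q : (X * RR) * T) : R :=
  Num.min 1%R (expR (- inner th (contribution r q.1.1 j q.1.2 q.2))).

Lemma measurable_discount j : measurable_fun setT (discount j).
Proof.
apply: measurable_minr; first exact: measurable_cst.
apply: measurableT_comp => //; apply: measurableT_comp => //.
apply: (measurableT_comp (measurable_inner th)); exact: measurable_contribution.
Qed.

Lemma discount_ge0 j q : (0 <= discount j q)%R.
Proof. by rewrite le_min ler01 expR_ge0. Qed.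

Lemma discount_le1 j q : (discount j q <= 1)%R.
Proof. by rewrite ge_min lexx. Qed.

Lemma inner_contribution_ge0 (f : X) j u (b : T) : (forall l, (0 <= (b : 'rV[R]_L) ord0 l)%R) ->
  (0 <= inner th (contribution r f j u b))%R.
Proof.
move=> b0; rewrite /inner; apply: sumr_ge0 => l _; apply: mulr_ge0 => //.
rewrite /contribution; case: ifP => [/and3P[u0 ut _]|_]; last by rewrite mxE.
rewrite mxE; apply: sumr_ge0 => i _; apply: mulr_ge0 => //.
by have [h _] := flow_substoch (path_flow_is_flow r0 f) ut; exact: h.
Qed.

Let m_ j f u : \bar R := mean_weight mu discount j (f, u : RR).

Let m_ge0 j f u : 0 <= m_ j f u. Proof. exact: mean_weight_ge0 discount_ge0 _ _. Qed.
Let m_le1 j f u : m_ j f u <= 1.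
Proof. exact: (mean_weight_le1 mu measurable_discount discount_ge0 discount_le1). Qed.
Let m_fin j f u : m_ j f u \is a fin_num.
Proof. by rewrite ge0_fin_numE// (le_lt_trans (m_le1 _ _ _))// ltry. Qed.

Lemma mean_discount j (f : X) u : arrives f j u ->
  m_ j f u = mgf (mu j) (path_flow r f u *m (- th))%R.
Proof.
move=> fu; rewrite /m_ /mean_weight /mgf.
apply: ae_eq_integral => //.
- apply/measurable_EFinP; apply: (measurableT_comp (measurable_discount j)).
  exact: measurable_fun_pair.
- exact: measurable_expinner.
move: (mu_ge0 j); apply: filterS => b b0 _; rewrite /discount /=.
have h := inner_contribution_ge0 f j u b0.
rewrite min_r; last by rewrite -expR0 ler_expR oppr_le0.
congr (expR _)%:E; rewrite /contribution fu inner_mul.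
by rewrite mulmxN /inner -sumrN; apply: eq_bigr => l _; rewrite [in RHS]mxE mulNr.
Qed.

Lemma mean_discount_late j (f : X) u : ~~ arrives f j u -> m_ j f u = 1.
Proof.
move=> fu; rewrite /m_ /mean_weight (eq_integral (cst 1)).
  by rewrite integral_cst// mul1e; exact: (@probability_setT _ _ _ (mu j)).
move=> b _; rewrite /discount /contribution /= (negbTE fu) /inner big1 ?oppr0 ?expR0 ?minxx//.
by move=> l _; rewrite mxE mulr0.
Qed.

Let phi j f u : R := (1 - fine (m_ j f u))%R.

Let mphi j f : measurable_fun setT (phi j f).
Proof.
apply: measurable_funB => //; apply: measurableT_comp => //.
apply: (measurableT_comp (measurable_mean_weight mu measurable_discount discount_ge0 j)).
exact: measurable_fun_pair.
Qed.

Let phi0 j f u : (0 <= phi j f u)%R.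
Proof. by rewrite subr_ge0 -lee_fin fineK. Qed.

Let phi1 j f u : (phi j f u <= 1)%R.
Proof. by rewrite gerBl fine_ge0. Qed.

Let phit j f u : (t < u)%R -> (phi j f u = 0)%R.
Proof. by move=> tu; rewrite /phi mean_discount_late ?subrr// /arrives [(u <= t)%R]leNgt tu andbF. Qed.

Let phiE j f u : m_ j f u = (1 - phi j f u)%:E.
Proof. by rewrite /phi opprB addrC subrK fineK. Qed.

(** The logarithm of the Laplace transform, given the path. *)
Definition laplace_exponent f : R := (\sum_(j < d.+1) lam j * primitive (phi j f) 0 t)%R.

Lemma laplace_exponent_ge0 f : (0 <= laplace_exponent f)%R.
Proof.
apply: sumr_ge0 => j _; apply: mulr_ge0; first exact: lam_ge0.
by apply: Rintegral_ge0 => u _; exact: phi0.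
Qed.

(** Jobs enter [path_levy] with the intensity of their clock, and the clock only
    counts when the path is in its state. *)
Lemma laplace_exponentE f :
  mgf (path_levy lam mu r0 f) (- th)%R - (path_mass lam f)%:E = (- laplace_exponent f)%:E.
Proof.
have mocc j : measurable (occupied t (path_at f) j).
  exact: measurable_occupied (path_flow_is_flow r0 f) j.
have focc j : lebesgue_measure (occupied t (path_at f) j) \is a fin_num.
  by rewrite ge0_fin_numE//; exact: occupied_fin (path_flow_is_flow r0 f) j.
have mm j : measurable_fun setT (fun u : RR => m_ j f u).
  apply: (measurableT_comp (measurable_mean_weight mu measurable_discount discount_ge0 j)).
  exact: measurable_fun_pair.
have bphi j : bounded_measurable (phi j f) 1.
  by split => [|u]; [exact: mphi|rewrite ger0_norm].
have occE j u : (u \in occupied t (path_at f) j) = arrives f j u.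
  apply/idP/idP; rewrite inE /occupied /arrives /= in_itv /=.
    by move=> [/andP[-> ->] ->]; rewrite eqxx.
  by move=> /and3P[-> -> /eqP].
have H j : \int[lebesgue_measure]_(u in occupied t (path_at f) j) mgf (mu j) (path_flow r f u *m (- th))%R
    = (fine (lebesgue_measure (occupied t (path_at f) j)) - primitive (phi j f) 0 t)%:E.
  have -> : \int[lebesgue_measure]_(u in occupied t (path_at f) j) mgf (mu j) (path_flow r f u *m (- th))%R
    = \int[lebesgue_measure]_(u in occupied t (path_at f) j) m_ j f u.
    by apply: eq_integral => u; rewrite occE => fu; rewrite mean_discount.
  have p1 : (primitive (phi j f) 0 t)%:E = \int[lebesgue_measure]_(u in occupied t (path_at f) j) (phi j f u)%:E.
    rewrite -(integral_primitive _ _ (bphi j)) integral_mkcond [RHS]integral_mkcond.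
    apply: eq_integral => u _; rewrite !patchE occE.
    case: (boolP (arrives f j u)) => fu.
      by case/and3P: fu => u0 ut _; rewrite mem_set//= in_itv /= u0.
    by rewrite /phi mean_discount_late// subrr; case: ifP.
  have s1 : (primitive (phi j f) 0 t)%:E + \int[lebesgue_measure]_(u in occupied t (path_at f) j) m_ j f u
      = (fine (lebesgue_measure (occupied t (path_at f) j)))%:E.
    rewrite p1 -ge0_integralD//.
    - rewrite (eq_integral (cst (1 : \bar R))); last by move=> u _; rewrite phiE -EFinD addrC subrK.
      rewrite integral_cst; last exact: mocc.
        by rewrite mul1e fineK.
    - exact: mocc.
    - by move=> u _; rewrite lee_fin.
    - by apply/measurable_EFinP; apply: measurable_funTS; exact: mphi.
    - by apply: measurable_funTS; exact: mm.
  by rewrite EFinB -s1 addeAC subee// add0e.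
rewrite mgf_path_levy//; under eq_bigr do rewrite H -EFinM.
rewrite sumEFin -EFinB; congr (_%:E).
rewrite /path_mass /mass /laplace_exponent -sumrB -sumrN; apply: eq_bigr => j _; ring.
Qed.

Lemma network_laplace :
  \int[P]_o (expR (- inner th (Y t o)))%:E = \int[P]_o (expR (- (c * laplace_exponent (J o))))%:E.
Proof.
pose F N o := (\prod_(j < d.+1) clock_weight discount J fE fB j N o)%R.
pose G N o := (\prod_(j < d.+1) fine (iter N (next_ring cl0 mu discount j) (cst 1%E) (J o, 0%R : RR)))%R.
have it01 j N o : 0 <= iter N (next_ring cl0 mu discount j) (cst 1) (J o, 0%R : RR) <= 1.
  rewrite (measurable_iter_next_ring cl0 mu measurable_discount discount_ge0 j N).2.
  exact: (iter_next_ring_le1 cl0 mu measurable_discount discount_ge0 discount_le1).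
have itfin j N o : iter N (next_ring cl0 mu discount j) (cst 1) (J o, 0%R : RR) \is a fin_num.
  by have /andP[h1 h2] := it01 j N o; rewrite ge0_fin_numE// (le_lt_trans h2)// ltry.
have it01f j N o : (0 <= fine (iter N (next_ring cl0 mu discount j) (cst 1%E) (J o, 0%R : RR)) <= 1)%R.
  by rewrite -!lee_fin fineK.
have FG N : \int[P]_o (F N o)%:E = \int[P]_o (G N o)%:E.
  rewrite elim_//; last 2 first.
  - exact: measurable_discount.
  - exact: discount_ge0.
  by apply: eq_integral => o _; rewrite fine_prode// => j; exact: itfin.
have cw1 j N o : (0 <= clock_weight discount J fE fB j N o <= 1)%R.
  apply/andP; split; first by apply: prodr_ge0 => k _; exact: discount_ge0.
  by apply: prodr_ile1 => k _; rewrite discount_ge0 discount_le1.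
have cF : \int[P]_o (F N o)%:E @[N --> \oo] --> \int[P]_o (expR (- inner th (Y t o)))%:E.
  apply: (@bounded_cvg_integral_ae _ _ _ _ _ _ _ 1%R) => //.
  - exact: probability_lty.
  - move=> N; apply: measurable_prod => j _; apply: measurable_clock_weight => // *.
    exact: measurable_discount.
  - apply: measurableT_comp => //; apply: measurableT_comp => //.
    exact: (measurableT_comp (measurable_inner th)).
  - move=> N o _; rewrite ger0_norm.
      by apply: prodr_ile1 => j _; exact: cw1.
    by apply: prodr_ge0 => j _; have /andP[] := cw1 j N o.
  move: ae_regular; apply: filterS => o ro _; apply: cvg_near_cst.
  have [N0 HN0] := regular_storage ro; exists N0 => // N /= /HN0 ->.
  have [_ B0 _ _] := ro.
  rewrite inner_sum -sumrN expR_sum; apply: eq_bigr => j _.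
  rewrite inner_sum -sumrN expR_sum; apply: eq_bigr => k _.
  rewrite /discount /= min_r// -expR0 ler_expR oppr_le0.
  by apply: inner_contribution_ge0; exact: B0.
have cG : \int[P]_o (G N o)%:E @[N --> \oo] --> \int[P]_o (expR (- (c * laplace_exponent (J o))))%:E.
  apply: (@bounded_cvg_integral _ _ _ _ _ _ _ 1%R) => //.
  - exact: probability_lty.
  - move=> N; apply: measurable_prod => j _; apply: measurableT_comp => //.
    apply: (measurableT_comp (measurable_iter_next_ring cl0 mu measurable_discount discount_ge0 j N).1).
    by apply: measurable_fun_pair => //; exact: measurable_cst.
  - move=> N o _; rewrite ger0_norm.
      by apply: prodr_ile1 => j _; exact: it01f.
    by apply: prodr_ge0 => j _; have /andP[] := it01f j N o.
  move=> o _.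
  have -> : expR (- (c * laplace_exponent (J o))) =
      (\prod_(j < d.+1) thinning_void (c * lam j) t (phi j (J o)) 0)%R.
    rewrite /laplace_exponent mulr_sumr -sumrN expR_sum; apply: eq_bigr => j _.
    by rewrite /thinning_void mulrA.
  apply: cvg_prodr => j.
  have H := @iter_next_ring_cvg R L d _ X (fun j => c * lam j)%R cl0 mu discount
    measurable_discount discount_ge0 j (J o) t t0 (phi j (J o)) (mphi j (J o)) (phi0 j (J o))
    (phi1 j (J o)) (@phit j (J o)) (phiE j (J o)).
  exact: H.
have E_ : (fun N => \int[P]_o (F N o)%:E) = (fun N => \int[P]_o (G N o)%:E).
  by apply/funext => N; exact: FG.
rewrite E_ in cF.
exact: (cvg_unique (@ereal_hausdorff R) cF cG).
Qed.

End NetworkLaplace.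

End Transf.
Export Transf.

(** * Uniqueness of Laplace transforms on orthants *)

Module Laplace.
Section DensityMeasure.
Local Open Scope ereal_scope.
Context d (X : measurableType d) (R : realType).
Variables (mu : {measure set X -> \bar R}) (p : X -> \bar R).
Hypotheses (mp : measurable_fun setT p) (p0 : forall x, 0 <= p x).

Definition density (mp : measurable_fun setT p) (p0 : forall x, 0 <= p x) (F : set X) : \bar R :=
  \int[mu]_(x in F) p x.

Local Notation nu := (density mp p0).

Let nu0 : nu set0 = 0. Proof. exact: integral_set0. Qed.

Let nu_ge0 F : 0 <= nu F. Proof. exact: integral_ge0. Qed.

Let nu_additive : semi_sigma_additive nu.
Proof.
move=> F mF tF mUF; rewrite /density; apply: cvg_toP.
  apply: ereal_nondecreasing_is_cvgn => m n mn.
  by apply: lee_sum_nneg_natr => // k _ _; exact: integral_ge0.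
by rewrite ge0_integral_bigcup//; exact: measurable_funTS.
Qed.

HB.instance Definition _ := isMeasure.Build _ _ _ nu nu0 nu_ge0 nu_additive.

End DensityMeasure.

Section Laplace.
Context {R : realType}.

Lemma bernoulli (x : R) n : 0 <= x -> x <= 1 -> 1 - n%:R * x <= (1 - x) ^+ n.
Proof.
move=> x0 x1; elim: n => [|n IH]; first by rewrite mul0r subr0 expr0.
have y0 : 0 <= 1 - x by rewrite subr_ge0.
rewrite exprS; apply: le_trans (ler_wpM2l y0 IH).
rewrite -natr1; have : 0 <= n%:R * x * x by rewrite !mulr_ge0.
by rewrite mulrDl mul1r; move: (n%:R * x) => z; lra.
Qed.

Lemma inv_cvg0 : (k.+1%:R^-1 : R) @[k --> \oo] --> (0 : R).
Proof.
apply/cvgrPdist_le => e e0; near=> k.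
rewrite sub0r normrN ger0_norm ?invr_ge0// invf_ple ?posrE//.
rewrite (@le_trans _ _ k%:R)//; last by rewrite ler_nat.
by near: k; exact: nbhs_infty_ger.
Unshelve. all: by end_near. Qed.

(** The exponents that turn a power of [1 - exp (- k y)] into the indicator of
    [a <= y], boundary included: [r exp (- k y)] is at most [1/k] when [a <= y]
    and tends to infinity when [y < a]. *)
Definition threshold_exponent (a : R) (k : nat) : nat :=
  Num.truncn (expR (k.+1%:R * a) / k.+1%:R).

Lemma threshold_cvg (a y : R) : 0 <= y ->
  (1 - expR (- (k.+1%:R * y))) ^+ threshold_exponent a k @[k --> \oo] --> ((a <= y)%R%:R : R).
Proof.
move=> y0; pose x k : R := expR (- (k.+1%:R * y)).
have x0 k : 0 <= x k by exact: expR_ge0.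
have x1 k : x k <= 1 by rewrite /x -expR0 ler_expR oppr_le0 mulr_ge0.
have q0 k : 0 <= expR (k.+1%:R * a) / k.+1%:R by rewrite divr_ge0// expR_ge0.
have u1 k : (1 - x k) ^+ threshold_exponent a k <= 1.
  by apply: exprn_ile1; rewrite ?subr_ge0// gerBl.
have prodE k : expR (k.+1%:R * a) / k.+1%:R * x k = expR (k.+1%:R * (a - y)) / k.+1%:R.
  by rewrite /x mulrAC -expRD mulrBr.
case: (leP a y) => ay.
  have h : (1 - k.+1%:R^-1 : R) @[k --> \oo] --> (1 : R).
    by rewrite -[X in _ --> X]subr0; apply: cvgB; [exact: cvg_cst|exact: inv_cvg0].
  suff H : (1 - x k) ^+ threshold_exponent a k @[k --> \oo] --> (1 : R) by exact: H.
  apply: (squeeze_cvgr _ h (cvg_cst (1 : R))).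
  near=> k; rewrite u1 andbT.
  apply: le_trans (bernoulli _ (x0 k) (x1 k)); rewrite lerD2l lerN2.
  apply: (@le_trans _ _ (expR (k.+1%:R * a) / k.+1%:R * x k)).
    by rewrite ler_wpM2r// truncn_le.
  rewrite prodE -[leRHS]mul1r ler_wpM2r ?invr_ge0// -[leRHS]expR0 ler_expR.
  by rewrite pmulr_rle0 ?ltr0Sn// subr_le0.
set dl := a - y; have dl0 : 0 < dl by rewrite subr_gt0.
pose z := expR (- (dl ^+ 2 / 4)).
have z1 : `|z| < 1.
  by rewrite ger0_norm ?expR_ge0// /z -expR0 ltr_expR oppr_lt0 divr_gt0// exprn_gt0.
have h : (expR 1 * z ^+ k : R) @[k --> \oo] --> (0 : R).
  by rewrite -[X in _ --> X](mulr0 (expR 1)); apply: cvgMr; exact: cvg_expr.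
suff H : (1 - x k) ^+ threshold_exponent a k @[k --> \oo] --> (0 : R) by exact: H.
apply: (squeeze_cvgr _ (cvg_cst (0 : R)) h).
near=> k.
rewrite exprn_ge0 ?subr_ge0//=.
apply: (@le_trans _ _ (expR (- (threshold_exponent a k)%:R * x k))).
  rewrite mulNr mulrC -mulNr expRM_natr; apply: lerXn2r; rewrite ?nnegrE ?expR_ge0 ?subr_ge0//.
  exact: expR_ge1Dx.
have rk : expR (k.+1%:R * a) / k.+1%:R - 1 <= (threshold_exponent a k)%:R.
  by rewrite lerBlDr natr1 ltW// truncnS_gt.
have e1 : k.+1%:R * (dl ^+ 2 / 4) <= expR (k.+1%:R * dl) / k.+1%:R.
  rewrite ler_pdivlMr//.
  have -> : k.+1%:R * (dl ^+ 2 / 4) * k.+1%:R = (k.+1%:R * dl / 2) ^+ 2 by field.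
  set w := k.+1%:R * dl / 2.
  have -> : expR (k.+1%:R * dl) = expR w ^+ 2 by rewrite expr2 -expRD; congr expR; rewrite /w; field.
  have kd : 0 <= w by rewrite divr_ge0// mulr_ge0// ltW.
  apply: lerXn2r; rewrite ?nnegrE ?expR_ge0//.
  by apply: le_trans (expR_ge1Dx _); rewrite lerDr.
rewrite /z -expRM_natr -expRD ler_expR.
have e2 : (expR (k.+1%:R * a) / k.+1%:R - 1) * x k <= (threshold_exponent a k)%:R * x k.
  by rewrite ler_wpM2r.
rewrite mulrBl prodE mul1r in e2.
have : k%:R * (dl ^+ 2 / 4) <= k.+1%:R * (dl ^+ 2 / 4) by rewrite ler_wpM2r ?divr_ge0 ?sqr_ge0// ler_nat.
have := x1 k; rewrite mulNr.
rewrite -/dl in e2; move: e1 e2.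
move: (expR _ / _) (_ * x k) => u v; rewrite mulNr [_ * k%:R]mulrC.
by move: (k%:R * _) (k.+1%:R * _) (x k) => p q w; lra.
Unshelve. all: by end_near. Qed.

Lemma measure_le_integral d (X : measurableType d) (m : {measure set X -> \bar R})
    (A : set X) (h : X -> \bar R) : measurable A -> measurable_fun setT h ->
  (forall x, 0 <= h x)%E -> (forall x, A x -> 1 <= h x)%E -> (m A <= \int[m]_x h x)%E.
Proof.
move=> mA mh h0 hA.
have -> : m A = (\int[m]_x (\1_A x)%:E)%E by rewrite integral_indic// setIT.
apply: ge0_le_integral => //.
- by apply/measurable_EFinP; exact: measurable_indic.
move=> x _; rewrite indicE; case: (boolP (x \in A)) => [|_]; last exact: h0.
by rewrite inE; exact: hA.
Qed.

Context {L : nat}.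
Local Notation T := (borelV R L).

Definition laplace (m : {measure set T -> \bar R}) (th : 'cV[R]_L) : \bar R :=
  (\int[m]_y (expR (- inner th y))%:E)%E.

Lemma innerD (th th' : 'cV[R]_L) (y : 'rV[R]_L) : inner (th + th') y = inner th y + inner th' y.
Proof. by rewrite /inner -big_split /=; apply: eq_bigr => l _; rewrite mxE mulrDl. Qed.

Lemma innerN (th : 'cV[R]_L) (y : 'rV[R]_L) : inner (- th) y = - inner th y.
Proof. by rewrite /inner -sumrN; apply: eq_bigr => l _; rewrite mxE mulNr. Qed.

Lemma inner_delta k l (y : 'rV[R]_L) : inner (k *: delta_mx l ord0) y = k * y ord0 l.
Proof.
rewrite /inner (bigD1 l)//= big1 ?addr0; last first.
  by move=> i il; rewrite !mxE (negbTE il) mulr0 mul0r.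
by rewrite !mxE !eqxx mulr1.
Qed.

Lemma laplaceE (m : {measure set T -> \bar R}) th : laplace m th = mgf m (- th).
Proof. by rewrite /laplace /mgf; apply: eq_integral => y _; rewrite innerN. Qed.

Let nonneg : set T := orthant (0 : 'rV[R]_L).

Let mnonneg : measurable nonneg. Proof. exact: measurable_orthant. Qed.

(** Mass with a negative coordinate would make the Laplace transform unbounded
    along that axis. *)
Lemma laplace_bounded_nonneg (m : {measure set T -> \bar R}) (C : R) :
  (forall l k, laplace m (k%:R *: delta_mx l ord0) <= C%:E)%E -> m (~` nonneg) = 0%E.
Proof.
move=> mC.
have H l i : {ae m, forall y : T, - i.+1%:R^-1 < (y : 'rV[R]_L) ord0 l}.
  pose A := (fun y : T => (y : 'rV[R]_L) ord0 l) @^-1` `]-oo, (- i.+1%:R^-1)]%classic.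
  have mA : measurable A.
    by rewrite -[A]setTI; apply: measurable_coordV => //; exact: measurable_itv.
  exists A; split => //; last by move=> y /= /negP; rewrite -leNgt /A /= in_itv.
  apply/eqP; rewrite -measure_le0; apply/lee_addgt0Pr => e e0; rewrite add0e.
  have C0 : 0 <= C.
    by rewrite -lee_fin; apply: le_trans (mC l 0%N); apply: integral_ge0 => y _; rewrite lee_fin expR_ge0.
  have q0 : 0 <= C * i.+1%:R / e by rewrite divr_ge0 ?mulr_ge0// ltW.
  set k := Num.bound (C * i.+1%:R / e).
  have hk : C * i.+1%:R / e < k%:R by exact: archi_boundP.
  have k0 : (0 : R) < k%:R by exact: le_lt_trans hk.
  have mh : measurable_fun setT (fun y : T =>
      ((i.+1%:R / k%:R)%:E * (expR (- inner (k%:R *: delta_mx l ord0) y))%:E)%E).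
    apply: emeasurable_funM; first exact: measurable_cst.
    by apply/measurable_EFinP; do 2 apply: measurableT_comp => //; exact: measurable_inner.
  apply: (@le_trans _ _ (\int[m]_y ((i.+1%:R / k%:R)%:E *
      (expR (- inner (k%:R *: delta_mx l ord0) y))%:E))%E).
    apply: measure_le_integral => //.
    move=> y; rewrite /A /= in_itv /= => yl.
    rewrite -EFinM lee_fin inner_delta -ler_pdivrMl ?divr_gt0// mulr1 invf_div.
    apply: (@le_trans _ _ (1 + - (k%:R * (y : 'rV[R]_L) ord0 l))); last exact: expR_ge1Dx.
    rewrite -mulrN; apply: ler_wpDl => //; apply: ler_wpM2l; first exact: ltW.
    by rewrite lerNr.
  rewrite ge0_integralZl//; last first.
    by apply/measurable_EFinP; do 2 apply: measurableT_comp => //; exact: measurable_inner.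
  apply: (@le_trans _ _ ((i.+1%:R / k%:R)%:E * C%:E)%E).
    by apply: lee_wpmul2l; [rewrite lee_fin divr_ge0|exact: mC].
  rewrite -EFinM lee_fin mulrAC ler_pdivrMr// [i.+1%:R * C]mulrC [e * _]mulrC -ler_pdivrMr//.
  exact: ltW.
have H2 : {ae m, forall y : T, forall l i, - i.+1%:R^-1 < (y : 'rV[R]_L) ord0 l}.
  by apply: filter_forall => l; apply: ae_foralln => i; exact: H.
apply: measure_negligible; first exact: measurableC.
move: H2; apply: negligibleS => y /= ny Hy; apply: ny => l; rewrite mxE leNgt; apply/negP => yl.
have y0 : 0 < - (y : 'rV[R]_L) ord0 l by rewrite oppr_gt0.
have h0 : 0 <= (- (y : 'rV[R]_L) ord0 l)^-1 by rewrite invr_ge0 ltW.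
have := archi_boundP h0; set k := Num.bound _ => hk.
have := Hy l k; rewrite ltrNl ltNge => /negP; apply.
rewrite -[leRHS]invrK lef_pV2 ?posrE ?invr_gt0//.
by rewrite (le_trans (ltW hk))// ler_nat.
Qed.

Section Uniqueness.
Variables (m1 m2 : {measure set T -> \bar R}) (C : R).
Hypothesis lapE : forall th : 'cV[R]_L, (forall l, 0 <= th l ord0) -> laplace m1 th = laplace m2 th.
Hypothesis lapC : forall th : 'cV[R]_L, (forall l, 0 <= th l ord0) -> (laplace m1 th <= C%:E)%E.

Let m1N : m1 (~` nonneg) = 0%E.
Proof.
apply: (@laplace_bounded_nonneg _ C) => l k; apply: lapC => l'.
by rewrite !mxE mulr_ge0.
Qed.

Let m2N : m2 (~` nonneg) = 0%E.
Proof.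
apply: (@laplace_bounded_nonneg _ C) => l k.
have h l' : 0 <= (k%:R *: delta_mx l ord0 : 'cV[R]_L) l' ord0 by rewrite !mxE mulr_ge0.
by rewrite -lapE//; exact: lapC.
Qed.

Local Open Scope ereal_scope.

Let integral_nonneg (m : {measure set T -> \bar R}) (g : T -> \bar R) : m (~` nonneg) = 0 ->
  measurable_fun setT g -> (forall y, 0 <= g y) ->
  \int[m]_y g y = \int[m]_(y in nonneg) g y.
Proof.
move=> mN mg g0; rewrite [RHS]integral_mkcond; apply: ae_eq_integral => //.
  by apply/(measurable_restrictT _ mnonneg); exact: measurable_funTS.
exists (~` nonneg); split => //; first exact: measurableC.
by move=> y /= ny yN; apply: ny => _; rewrite patchE mem_set.
Qed.

Let mexp (th : 'cV[R]_L) : measurable_fun setT (fun y : T => expR (- inner th y)).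
Proof. by do 2 apply: measurableT_comp => //; exact: measurable_inner. Qed.

Let exp0 y : expR (- inner (0 : 'cV[R]_L) y) = 1%R.
Proof. by rewrite /inner big1 ?oppr0 ?expR0// => l _; rewrite mxE mul0r. Qed.

Let fin (m : {measure set T -> \bar R}) : m (~` nonneg) = 0 -> laplace m 0 <= C%:E -> m nonneg < +oo.
Proof.
move=> mN lC; apply: le_lt_trans (ltry C); apply: le_trans lC.
apply: measure_le_integral => //.
- by apply/measurable_EFinP; exact: mexp.
- by move=> y _; rewrite exp0.
Qed.

Let th0_ge0 l : (0 <= (0 : 'cV[R]_L) l ord0)%R. Proof. by rewrite mxE. Qed.

Let m1f : m1 nonneg < +oo. Proof. by apply: fin => //; exact: lapC. Qed.
Let m2f : m2 nonneg < +oo. Proof. by apply: fin => //; rewrite -lapE//; exact: lapC. Qed.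

Let agree (phi : T -> R) := [/\ measurable_fun setT phi,
  forall y, nonneg y -> (0 <= phi y <= 1)%R &
  forall th : 'cV[R]_L, (forall l, 0 <= th l ord0)%R ->
    \int[m1]_(y in nonneg) (phi y * expR (- inner th y))%:E =
    \int[m2]_(y in nonneg) (phi y * expR (- inner th y))%:E].

Let agree1 : agree (fun=> 1%R).
Proof.
split => //; first by move=> y _; rewrite lexx ler01.
move=> th h0; have := lapE h0; rewrite /laplace !integral_nonneg//;
  try by apply/measurable_EFinP; exact: mexp.
- by under eq_integral do rewrite -[expR _]mul1r; under [in RHS]eq_integral do rewrite -[expR _]mul1r.
Qed.

Let exp01 (th : 'cV[R]_L) y : (forall l, 0 <= th l ord0)%R -> nonneg y -> (0 <= expR (- inner th y) <= 1)%R.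
Proof.
move=> h0 y0; rewrite expR_ge0 /= -expR0 ler_expR oppr_le0; apply: sumr_ge0 => l _.
by rewrite mulr_ge0//; have := y0 l; rewrite mxE.
Qed.

Let agreeM phi (th' : 'cV[R]_L) : (forall l, 0 <= th' l ord0)%R -> agree phi ->
  agree (fun y => phi y * (1 - expR (- inner th' y)))%R.
Proof.
move=> h' [mphi phi01 phiE].
have mp : measurable_fun setT (fun y : T => phi y * (1 - expR (- inner th' y)))%R.
  by apply: measurable_funM => //; apply: measurable_funB => //; exact: mexp.
have p01 y : nonneg y -> (0 <= phi y * (1 - expR (- inner th' y)) <= 1)%R.
  move=> y0; have /andP[a0 a1] := phi01 y y0; have /andP[b0 b1] := exp01 h' y0.
  have c0 : (0 <= 1 - expR (- inner th' y))%R by rewrite subr_ge0.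
  have c1 : (1 - expR (- inner th' y) <= 1)%R by rewrite gerBl.
  by rewrite mulr_ge0//= -[leRHS]mulr1; exact: ler_pM.
split => // th h.
have hs l : (0 <= (th + th')%R l ord0)%R by rewrite mxE addr_ge0.
have split_ (m : {measure set T -> \bar R}) : m nonneg < +oo ->
    \int[m]_(y in nonneg) (phi y * (1 - expR (- inner th' y)) * expR (- inner th y))%:E =
    \int[m]_(y in nonneg) (phi y * expR (- inner th y))%:E -
    \int[m]_(y in nonneg) (phi y * expR (- inner (th + th')%R y))%:E.
  move=> mf.
  have fint : \int[m]_(y in nonneg) (phi y * expR (- inner (th + th')%R y))%:E \is a fin_num.
    rewrite ge0_fin_numE; last first.
      by apply: integral_ge0 => y /phi01/andP[a0 _]; rewrite lee_fin mulr_ge0 ?expR_ge0.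
    apply: le_lt_trans mf; rewrite -[leRHS]mul1e -integral_cst//.
    apply: ge0_le_integral => //.
    - by move=> y /phi01/andP[a0 _]; rewrite lee_fin mulr_ge0 ?expR_ge0.
    - by apply: measurable_funTS; apply/measurable_EFinP; apply: measurable_funM => //; exact: mexp.
    move=> y y0; have /andP[a0 a1] := phi01 y y0; have /andP[b0 b1] := exp01 hs y0.
    by rewrite lee_fin -[leRHS]mulr1; apply: ler_pM.
  rewrite -[LHS](addeK _ fint) -ge0_integralD//.
  - congr (_ - _); apply: eq_integral => y _; rewrite -EFinD; congr (_%:E).
    by rewrite innerD opprD expRD; ring.
  - by move=> y y0; have /andP[a0 _] := p01 y y0; rewrite lee_fin mulr_ge0 ?expR_ge0.
  - by apply: measurable_funTS; apply/measurable_EFinP; apply: measurable_funM => //; exact: mexp.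
  - by move=> y /phi01/andP[a0 _]; rewrite lee_fin mulr_ge0 ?expR_ge0.
  - by apply: measurable_funTS; apply/measurable_EFinP; apply: measurable_funM => //; exact: mexp.
by rewrite !split_// phiE// phiE.
Qed.

Let agree_prod (s : seq ('cV[R]_L)) : (forall th, th \in s -> forall l, 0 <= th l ord0)%R ->
  agree (fun y => \prod_(th <- s) (1 - expR (- inner th y)))%R.
Proof.
elim: s => [|th s IH] H.
  rewrite (_ : (fun y => _) = (fun=> 1%R)); first exact: agree1.
  by apply/funext => y; rewrite big_nil.
rewrite (_ : (fun y => _) = (fun y => (\prod_(th <- s) (1 - expR (- inner th y))) *
   (1 - expR (- inner th y)))%R); last by apply/funext => y; rewrite big_cons mulrC.
apply: agreeM; first by apply: H; rewrite mem_head.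
by apply: IH => th' hs; apply: H; rewrite inE hs orbT.
Qed.

(** The powers of [1 - exp (- k y)] are polynomials in exponentials, so their
    integrals only depend on the Laplace transform; dominated convergence yields
    the orthant. *)
Lemma laplace_unique a : m1 (orthant a) = m2 (orthant a).
Proof.
pose s k := flatten [seq nseq (threshold_exponent (a ord0 l) k) (k.+1%:R *: delta_mx l ord0 : 'cV[R]_L)
  | l <- enum 'I_L].
pose P k (y : T) : R := (\prod_(th <- s k) (1 - expR (- inner th y)))%R.
have PE k y : P k y = (\prod_(l < L) (1 - expR (- (k.+1%:R * (y : 'rV[R]_L) ord0 l))) ^+
    threshold_exponent (a ord0 l) k)%R.
  rewrite /P /s big_flatten big_map big_enum /=; apply: eq_bigr => l _.
  by rewrite big_nseq iter_mulr_1 inner_delta.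
have aP k : agree (P k).
  apply: agree_prod => th /flattenP[_ /mapP[l _ ->]] /nseqP[-> _] l'.
  by rewrite !mxE mulr_ge0.
have cvP (m : {measure set T -> \bar R}) : m nonneg < +oo -> m (~` nonneg) = 0 ->
    \int[m]_(y in nonneg) (P k y)%:E @[k --> \oo] --> m (orthant a).
  move=> mf mN.
  have mO : measurable (orthant a : set T) by exact: measurable_orthant.
  have -> : m (orthant a) = \int[m]_(y in nonneg) (\1_(orthant a : set T) y)%:E.
    rewrite -integral_nonneg//; first by rewrite integral_indic// setIT.
    by apply/measurable_EFinP; exact: measurable_indic.
  apply: (@bounded_cvg_integral _ _ _ _ _ _ _ 1%R) => //.
  - by move=> k; apply: measurable_funTS; have [] := aP k.
  - move=> k y y0; have [_ /(_ y y0)/andP[h0 h1] _] := aP k.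
    by rewrite ger0_norm.
  move=> y y0.
  have -> : \1_(orthant a : set T) y = (\prod_(l < L) (a ord0 l <= (y : 'rV[R]_L) ord0 l)%R%:R)%R :> R.
    rewrite indicE; case: (boolP (y \in _)).
      by rewrite inE => h; rewrite big1// => l _; rewrite h.
    rewrite notin_setE => h; have [l hl] : exists l, ~~ (a ord0 l <= (y : 'rV[R]_L) ord0 l)%R.
      by apply/existsP; rewrite -negb_forall; apply/negP => /forallP.
    by rewrite (bigD1 l)//= (negbTE hl) mul0r.
  under eq_fun do rewrite PE.
  apply: cvg_prodr => l; apply: threshold_cvg.
  by have := y0 l; rewrite mxE.
have h1 := cvP _ m1f m1N; have h2 := cvP _ m2f m2N.
have E : (fun k => \int[m1]_(y in nonneg) (P k y)%:E) = (fun k => \int[m2]_(y in nonneg) (P k y)%:E).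
  apply/funext => k; have [_ _ /(_ 0%R th0_ge0)] := aP k.
  by under eq_integral do rewrite exp0 mulr1; under [in RHS]eq_integral do rewrite exp0 mulr1.
rewrite E in h1; exact: (cvg_unique (@ereal_hausdorff R) h1 h2).
Qed.

End Uniqueness.
End Laplace.

End Laplace.
Export Laplace.

(** * Probability and moments as averages over the paths *)

Module Model.
Local Open Scope ereal_scope.

Lemma same_law_integral d1 d2 d (O1 : measurableType d1) (O2 : measurableType d2)
    (X : measurableType d) (R : realType) (P1 : {measure set O1 -> \bar R})
    (P2 : {measure set O2 -> \bar R}) (J1 : {mfun O1 >-> X}) (J2 : {mfun O2 >-> X})
    (h : X -> \bar R) :
  (forall F, measurable F -> P1 (J1 @^-1` F) = P2 (J2 @^-1` F)) ->
  measurable_fun setT h -> (forall x, 0 <= h x) ->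
  \int[P1]_w h (J1 w) = \int[P2]_w h (J2 w).
Proof.
move=> H mh h0.
have m1 : measurable_fun setT J1 by exact: measurable_funPT.
have m2 : measurable_fun setT J2 by exact: measurable_funPT.
rewrite -(ge0_integral_push P1 m1 mh h0) -(ge0_integral_push P2 m2 mh h0).
apply: (@eq_measure_integral _ X R setT (push_measure P2 m2) (push_measure P1 m1) h) => F mF _.
have -> : push_measure P1 m1 F = P1 (J1 @^-1` F) by exact: push_measureE.
have -> : push_measure P2 m2 F = P2 (J2 @^-1` F) by exact: push_measureE.
exact: H.
Qed.

Lemma integral_density d (X : measurableType d) (R : realType) (m : {measure set X -> \bar R})
    (p : X -> R) (mp : measurable_fun setT (EFin \o p)) (p0 : forall x, 0 <= (EFin \o p) x)
    (g : X -> \bar R) : measurable_fun setT g -> (forall x, 0 <= g x) ->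
  \int[density m mp p0]_x g x = \int[m]_x ((p x)%:E * g x).
Proof.
move=> mg g0.
by apply: (@density_integral _ X R m (density m mp p0) (EFin \o p)) => // x; rewrite ltry.
Qed.

Lemma expe_untilt (R : realType) (l : R) (y : \bar R) n :
  (expR (n%:R * l))%:E * ((expR (- l))%:E * y) ^+ n = y ^+ n.
Proof.
elim: n => [|n IH]; first by rewrite mul0r expR0 mul1e.
rewrite !expeS mulrS mulrDl mul1r expRD EFinM muleACA IH; congr (_ * _).
by rewrite muleA -EFinM -expRD addrN expR0 mul1e.
Qed.

Section Model.
Context {R : realType} {L d : nat} {t : R}.
Local Notation T := (borelV R L).
Local Notation X := (bpath d t).
Local Notation St := 'I_d.+1.
Variables (lam : St -> R) (mu : St -> probability T R) (r : St -> 'M[R]_L) (a : 'rV[R]_L)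
  (bs : X -> 'rV[R]_L) (ths : X -> 'cV[R]_L) (kap : R.-pker X ~> T).
Hypotheses (t0 : (0 < t)%R) (lam0 : forall j, (0 < lam j)%R).
Hypothesis mu_ge0 : forall j, {ae mu j, forall x : T, forall l, (0 <= (x : 'rV[R]_L) ord0 l)%R}.
Hypothesis r0 : forall j i i', (0 <= r j i i')%R.
Hypothesis opt : forall f, optimizers lam mu r a f (bs f) (ths f).
Hypothesis mths : forall l, measurable_fun setT (fun f => ths f l ord0).
Hypothesis twisted : twisted_kernel lam mu r ths kap.

Let lam_ge0 j : (0 <= lam j)%R. Proof. exact: ltW. Qed.
Let t_ge0 : (0 <= t)%R. Proof. exact: ltW. Qed.

Local Notation M := (@Mf R L d t lam mu r).
Local Notation nu := (path_levy lam mu r0).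

Lemma Mf_levy (f : X) (th : 'cV[R]_L) : M f th = expeR (mgf (nu f) th - (path_mass lam f)%:E).
Proof. exact: MfE. Qed.

Lemma Mf_gt0 (f : X) (th : 'cV[R]_L) : 0 < M f th.
Proof.
rewrite Mf_levy expeR_gt0//; have := mgf_ge0 (nu f) th.
by case: (mgf _ _) => [x||]//= _; rewrite -EFinB ltNyr.
Qed.

Lemma Mf_laplace (f : X) (th : 'cV[R]_L) : (forall l, (0 <= th l ord0)%R) ->
  M f (- th)%R = (expR (- laplace_exponent lam mu r th f))%:E.
Proof. by move=> h0; rewrite Mf_levy (laplace_exponentE t0 lam0 mu_ge0 r0 h0). Qed.

Lemma Mf0 (f : X) : M f 0%R = 1.
Proof.
rewrite Mf_levy; suff -> : mgf (nu f) 0%R = (path_mass lam f)%:E by rewrite subee//= expR0.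
rewrite /mgf (eq_integral (cst 1)); last first.
  by move=> y _; rewrite /inner big1 ?expR0// => l _; rewrite mxE mul0r.
by rewrite integral_cst// mul1e; exact: levy_setT.
Qed.

Definition log_Mf (f : X) : R := fine (lne (M f (ths f))).

Definition rate_of (f : X) : R := (inner (ths f) (bs f) - log_Mf f)%R.

Let lneM_fin (f : X) : lne (M f (ths f)) \is a fin_num.
Proof.
have [_ _ /(_ 0%R) + _] := opt f; rewrite /tilt Mf0 lne1 /inner big1; last first.
  by move=> l _; rewrite mxE mul0r.
rewrite sube0; have := Mf_gt0 f (ths f).
case: (M f (ths f)) => [x||]//=; rewrite ?lte_fin => x0 //.
by case: ifPn => //; move/(lt_le_trans x0); rewrite ltxx.
Qed.

Lemma Mf_ths f : M f (ths f) = (expR (log_Mf f))%:E.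
Proof.
have := lneM_fin f; rewrite /log_Mf; have := Mf_gt0 f (ths f).
case: (M f (ths f)) => [x||]//; rewrite lte_fin => x0 _.
by rewrite lne_EFin//= lnK.
Qed.

Lemma tilt_ths f : tilt lam mu r f (bs f) (ths f) = (rate_of f)%:E.
Proof. by rewrite /tilt /rate_of /log_Mf EFinB fineK// lneM_fin. Qed.

Lemma legendre_bs f : legendre lam mu r f (bs f) = (rate_of f)%:E.
Proof.
have [_ _ h _] := opt f; rewrite -tilt_ths; apply/eqP; rewrite eq_le; apply/andP; split.
  by apply: ge_ereal_sup => _ [th _ <-]; exact: h.
by apply: ereal_sup_ubound; exists (ths f).
Qed.

Lemma path_rateE f : path_rate lam mu r a f = (rate_of f)%:E.
Proof.
have [h1 h2 _ _] := opt f; rewrite -legendre_bs; apply/eqP; rewrite eq_le; apply/andP; split.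
  by apply: ereal_inf_lbound; exists (bs f).
by apply: le_ereal_inf_tmp => _ [b hb <-]; exact: h2.
Qed.

Lemma rate_of_ge0 f : (0 <= rate_of f)%R.
Proof.
have [_ _ /(_ 0%R) + _] := opt f; rewrite tilt_ths /tilt Mf0 lne1 /inner big1; last first.
  by move=> l _; rewrite mxE mul0r.
by rewrite sube0 lee_fin.
Qed.

Lemma kap_mgf f th : mgf (kap f) th = (expR (- log_Mf f))%:E * M f (th + ths f)%R.
Proof. by rewrite twisted Mf_ths inver gt_eqF ?expR_gt0// expRN muleC. Qed.

Lemma measurable_inner_ths : measurable_fun setT (fun z : X * T => inner (ths z.1) z.2).
Proof.
rewrite /inner; apply: measurable_sum => l; apply: measurable_funM.
  exact: (measurableT_comp (mths l)).
by apply: (measurableT_comp (measurable_coordV l)).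
Qed.

Lemma measurable_log_Mf : measurable_fun setT log_Mf.
Proof.
have H f : log_Mf f = (- ln (fine (\int[kap f]_y (expR (- inner (ths f) y))%:E)))%R.
  have -> : \int[kap f]_y (expR (- inner (ths f) y))%:E = mgf (kap f) (- ths f)%R.
    by rewrite /mgf; apply: eq_integral => y _; rewrite innerN.
  by rewrite kap_mgf addNr Mf0 mule1 /= expRK opprK.
rewrite (funext H).
apply: measurableT_comp => //; apply: measurableT_comp; first exact: measurable_ln.
apply: measurableT_comp => //.
apply: (@measurable_integral_kernel _ _ X T R kap _ _ (fun z => (expR (- inner (ths z.1) z.2))%:E)).
- by move=> U mU; exact: measurable_kernel.
- by move=> f; exact: prob_kernel.
- by move=> z; rewrite lee_fin expR_ge0.
- apply/measurable_EFinP; do 2 apply: measurableT_comp => //; exact: measurable_inner_ths.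
Qed.

Section FixedNumber.
Variable n : nat.
Hypothesis n0 : (0 < n)%N.

Definition untwist (z : X * T) : R := expR (- inner (ths z.1) z.2 + n%:R * log_Mf z.1).

Lemma measurable_untwist : measurable_fun setT untwist.
Proof.
apply: measurableT_comp => //; apply: measurable_funD.
  by apply: measurableT_comp => //; exact: measurable_inner_ths.
apply: measurable_funM => //; exact: (measurableT_comp measurable_log_Mf).
Qed.

Lemma untwist_ge0 z : (0 <= untwist z)%R. Proof. exact: expR_ge0. Qed.

Lemma measurable_untwist_at f : measurable_fun setT (EFin \o (fun y : T => untwist (f, y))).
Proof.
apply/measurable_EFinP; apply: (measurableT_comp measurable_untwist).
exact: measurable_fun_pair.
Qed.

Lemma untwist_at_ge0 f y : 0 <= (EFin \o (fun y : T => untwist (f, y))) y.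
Proof. by rewrite lee_fin untwist_ge0. Qed.

Definition twisted_law f : {measure set T -> \bar R} := cpow (kapf kap f) n.

Definition storage_law f : {measure set T -> \bar R} :=
  density (twisted_law f) (measurable_untwist_at f) (untwist_at_ge0 f).

Lemma integral_storage_law f (g : T -> \bar R) : measurable_fun setT g ->
  (forall y, 0 <= g y) ->
  \int[storage_law f]_y g y = \int[twisted_law f]_y ((untwist (f, y))%:E * g y).
Proof. by move=> mg g0; rewrite integral_density. Qed.

Lemma mgf_storage_law f th : mgf (storage_law f) th = M f th ^+ n.
Proof.
rewrite /mgf integral_storage_law//; last exact: measurable_expinner.
transitivity (\int[twisted_law f]_y ((expR (n%:R * log_Mf f))%:E * (expR (inner (th - ths f)%R y))%:E)).
  apply: eq_integral => y _; rewrite /untwist /= -!EFinM -!expRD; congr (expR _)%:E.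
  by rewrite innerD innerN; ring.
rewrite ge0_integralZl//; last exact: measurable_expinner.
rewrite -/(mgf _ _) mgf_cpow.
have -> : mgf (kapf kap f) (th - ths f)%R = (expR (- log_Mf f))%:E * M f th.
  by rewrite -[RHS](_ : mgf (kap f) (th - ths f)%R = _)// kap_mgf subrK.
exact: expe_untilt.
Qed.

Lemma measurable_kernel_integral (g : X * T -> \bar R) : measurable_fun setT g ->
  (forall z, 0 <= g z) ->
  measurable_fun setT (fun f => \int[twisted_law f]_y g (f, y)).
Proof.
move=> mg g0; have [mi _] := iter_convK kap n mg g0.
have -> : (fun f => \int[twisted_law f]_y g (f, y)) = (fun f => iter n (convK kap) g (f, zeroV)).
  apply/funext => f; rewrite iter_convKE//; apply: eq_integral => y _.
  by rewrite /addV /zeroV /= add0r.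
by apply: (measurableT_comp mi); apply: measurable_fun_pair.
Qed.

Definition scaled : set T := orthant (n%:R *: a)%R.

Lemma scaledE y : scaled y <-> orthant a (n%:R^-1 *: (y : 'rV[R]_L))%R.
Proof.
rewrite /scaled /orthant /=; split=> h l; have := h l; rewrite !mxE.
  by rewrite ler_pdivlMl ?ltr0n.
by rewrite ler_pdivlMl ?ltr0n.
Qed.

Lemma measurable_scaled : measurable scaled. Proof. exact: measurable_orthant. Qed.

Definition path_prob f : \bar R := storage_law f scaled.

Lemma path_probE f : path_prob f = \int[twisted_law f]_y ((untwist (f, y))%:E * (\1_scaled y)%:E).
Proof.
rewrite -integral_storage_law//; last by apply/measurable_EFinP; apply: measurable_indic; exact: measurable_scaled.
by rewrite integral_indic ?setIT//; exact: measurable_scaled.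
Qed.

Lemma measurable_path_prob : measurable_fun setT path_prob.
Proof.
have -> : path_prob = (fun f => \int[twisted_law f]_y ((untwist (f, y))%:E * (\1_scaled y)%:E)).
  by apply/funext => f; rewrite path_probE.
apply: (measurable_kernel_integral (g := fun z => (untwist z)%:E * (\1_scaled z.2)%:E)).
  apply: emeasurable_funM; first by apply/measurable_EFinP; exact: measurable_untwist.
  apply/measurable_EFinP; apply: (@measurableT_comp _ _ _ _ _ _ (\1_scaled : T -> R)) => //.
  by apply: measurable_indic; exact: measurable_scaled.
by move=> z; rewrite mule_ge0// lee_fin untwist_ge0.
Qed.

Context dO (Om : measurableType dO) (P : probability Om R).
Context (Q : 'M[R]_d.+1) (j0 : St).
Variables (J : {mfun Om >-> X}) (E : St -> nat -> {mfun Om >-> R})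
  (B : St -> nat -> {mfun Om >-> T}) (Y : R -> {mfun Om >-> T}).
Hypothesis net : network lam mu r Q j0 n%:R P J E B Y.
Context dO' (Om' : measurableType dO') (QQ : probability Om' R).
Variables (JQ : {mfun Om' >-> X}) (V : 'I_n -> {mfun Om' >-> T}).
Hypothesis smp : sampling P J kap QQ JQ V.

Let LR := likelihood_ratio lam mu r ths JQ V.
Let Ind := rare_indicator a V.

Lemma integral_sampling (g : X * T -> \bar R) : measurable_fun setT g ->
  (forall z, 0 <= g z) ->
  \int[QQ]_w g (JQ w, sum_vectors V w) = \int[P]_o \int[twisted_law (J o)]_y g (J o, y).
Proof.
move=> mg g0; rewrite (sampling_sum (sampling_vectors smp) mg g0).
apply: (@same_law_integral _ _ _ Om' Om X R QQ P JQ J (fun f => \int[twisted_law f]_y g (f, y))).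
- exact: (sampling_path smp).
- exact: measurable_kernel_integral.
- by move=> f; exact: integral_ge0.
Qed.

Lemma rare_indicatorE w : Ind w = \1_scaled (sum_vectors V w : T).
Proof.
rewrite /Ind /rare_indicator !indicE; congr (nat_of_bool _)%:R.
by apply/idP/idP; rewrite !inE /rare_event /=; move/scaledE.
Qed.

(** Averaged over the path, the storage law and the untwisted law of the sampled
    sum have the same Laplace transform. *)
Lemma rare_prob :
  P [set o | orthant a (n%:R^-1 *: (Y t o : 'rV[R]_L))%R] = \int[P]_o path_prob (J o).
Proof.
have mY : measurable_fun setT (Y t) by exact: measurable_funPT.
pose m1 := push_measure P mY.
have -> : P [set o | orthant a (n%:R^-1 *: (Y t o : 'rV[R]_L))%R] = m1 scaled.
  by rewrite push_measureE; congr (P _); apply/seteqP; split => o /=; move/scaledE.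
have mS : measurable_fun setT (fun w => sum_vectors V w : T).
  apply: measurable_to_borelV => // l; under eq_fun do rewrite /sum_vectors summxE.
  by apply: measurable_sum => i; apply: (measurableT_comp (measurable_coordV l)); exact: measurable_funPT.
have mL : measurable_fun setT (EFin \o (fun w => untwist (JQ w, sum_vectors V w))).
  apply/measurable_EFinP; apply: (measurableT_comp measurable_untwist).
  by apply: measurable_fun_pair => //; exact: measurable_funPT.
have L0 w : 0 <= (EFin \o (fun w => untwist (JQ w, sum_vectors V w))) w by rewrite lee_fin untwist_ge0.
pose m2 := push_measure (density QQ mL L0) mS.
have m2E (g : T -> \bar R) : measurable_fun setT g -> (forall y, 0 <= g y) ->
    \int[m2]_y g y = \int[P]_o \int[storage_law (J o)]_y g y.
  move=> mg g0; rewrite ge0_integral_push//.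
    rewrite (@integral_density _ _ _ _ _ mL L0 (g \o (fun w => sum_vectors V w : T))); last 2 first.
    - exact: measurableT_comp.
    - by move=> w; exact: g0.
  rewrite (integral_sampling (g := fun z => (untwist z)%:E * g z.2)).
  - by apply: eq_integral => o _; rewrite integral_storage_law.
  - apply: emeasurable_funM; first by apply/measurable_EFinP; exact: measurable_untwist.
    exact: measurableT_comp.
  - by move=> z; rewrite mule_ge0// lee_fin untwist_ge0.
have lap2 (th : 'cV[R]_L) : (forall l, (0 <= th l ord0)%R) ->
    laplace m2 th = \int[P]_o (expR (- (n%:R * laplace_exponent lam mu r th (J o))))%:E.
  move=> h0; rewrite /laplace m2E//; last first.
    by apply/measurable_EFinP; do 2 apply: measurableT_comp => //; exact: measurable_inner.
  apply: eq_integral => o _; rewrite -/(laplace _ _) laplaceE mgf_storage_law Mf_laplace//.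
  by rewrite -EFin_expe -expRM_natr mulNr [X in (- X)%R]mulrC.
have lap1 (th : 'cV[R]_L) : (forall l, (0 <= th l ord0)%R) ->
    laplace m1 th = \int[P]_o (expR (- (n%:R * laplace_exponent lam mu r th (J o))))%:E.
  move=> h0; rewrite /laplace ge0_integral_push//; last first.
    by apply/measurable_EFinP; do 2 apply: measurableT_comp => //; exact: measurable_inner.
  apply: (network_laplace t0 _ lam0 mu_ge0 r0 net h0).
  by rewrite ltr0n.
rewrite (@laplace_unique R L m1 m2 1%R).
- have -> : m2 scaled = \int[m2]_y (\1_scaled y)%:E.
    by rewrite integral_indic ?setIT//; exact: measurable_scaled.
  rewrite m2E//; last by apply/measurable_EFinP; apply: measurable_indic; exact: measurable_scaled.
  by apply: eq_integral => o _; rewrite integral_indic ?setIT//; exact: measurable_scaled.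
- by move=> th h0; rewrite lap1// lap2.
- move=> th h0; rewrite lap1//.
  apply: (@le_trans _ _ (\int[P]_o (cst 1 o))); last first.
    by rewrite integral_cst// mul1e; exact: probability_le1.
  apply: ge0_le_integral => //.
  + have -> : (fun o => (expR (- (n%:R * laplace_exponent lam mu r th (J o))))%:E) =
      (fun f => \int[twisted_law f]_y ((untwist (f, y))%:E * (expR (- inner th y))%:E)) \o J.
      apply/funext => o /=; rewrite -integral_storage_law.
      + by rewrite -/(laplace _ _) laplaceE mgf_storage_law Mf_laplace// -EFin_expe -expRM_natr mulNr [X in (- X)%R]mulrC.
      + by apply/measurable_EFinP; do 2 apply: measurableT_comp => //; exact: measurable_inner.
      + by move=> y; rewrite lee_fin expR_ge0.
    apply: measurableT_comp; last exact: measurable_funPT.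
    apply: (measurable_kernel_integral (g := fun z => (untwist z)%:E * (expR (- inner th z.2))%:E)).
      apply: emeasurable_funM; first by apply/measurable_EFinP; exact: measurable_untwist.
      apply/measurable_EFinP; do 2 apply: measurableT_comp => //.
      by apply: (measurableT_comp (measurable_inner th)).
    by move=> z; rewrite mule_ge0// lee_fin (untwist_ge0, expR_ge0).
  move=> o _; rewrite lee_fin -expR0 ler_expR oppr_le0 mulr_ge0//.
  exact: laplace_exponent_ge0.
Qed.

Lemma sampling_mean : 'E_QQ[fun w => (LR w * Ind w)%R] = \int[P]_o path_prob (J o).
Proof.
rewrite unlock.
have := @integral_sampling (fun z => (untwist z)%:E * (\1_scaled z.2)%:E).
rewrite /= => H; etransitivity; last first.
  etransitivity; first (apply: H).
  - apply: emeasurable_funM; first by apply/measurable_EFinP; exact: measurable_untwist.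
    apply/measurable_EFinP; apply: (@measurableT_comp _ _ _ _ _ _ (\1_scaled : T -> R)) => //.
    by apply: measurable_indic; exact: measurable_scaled.
  - by move=> z; rewrite mule_ge0// lee_fin untwist_ge0.
  by apply: eq_integral => o _; rewrite path_probE.
by apply: eq_integral => w _; rewrite -rare_indicatorE EFinM.
Qed.

Lemma sampling_second_moment : 'E_QQ[fun w => (LR w ^+ 2 * Ind w)%R] =
  \int[P]_o \int[twisted_law (J o)]_y (((untwist (J o, y)) ^+ 2)%:E * (\1_scaled y)%:E).
Proof.
rewrite unlock.
have H := @integral_sampling (fun z => ((untwist z) ^+ 2)%:E * (\1_scaled z.2)%:E).
rewrite -H.
- by apply: eq_integral => w _; rewrite -rare_indicatorE EFinM.
- apply: emeasurable_funM; first by apply/measurable_EFinP; apply: measurable_funX; exact: measurable_untwist.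
  apply/measurable_EFinP; apply: (@measurableT_comp _ _ _ _ _ _ (\1_scaled : T -> R)) => //.
  by apply: measurable_indic; exact: measurable_scaled.
- by move=> z; rewrite mule_ge0// lee_fin sqr_ge0.
Qed.

End FixedNumber.
End Model.

End Model.
Export Model.

(** * Complementarity for optimal tilts *)

Module Compl.
Local Open Scope ereal_scope.

Section Centroid.
Context {R : realType} {L : nat}.
Local Notation T := (borelV R L).
Variables (q : {measure set T -> \bar R}) (G : set T) (C : R).
Hypothesis (qfin : q setT < +oo) (mG : measurable G).
Hypothesis Gbnd : forall y : T, G y -> forall l, (`|(y : 'rV[R]_L) ord0 l| <= C)%R.

Let qG : q G < +oo.
Proof. by apply: le_lt_trans qfin; apply: le_measure; rewrite ?inE. Qed.

Lemma integrable_inner (v : 'cV[R]_L) : q.-integrable G (fun y : T => (inner v y)%:E).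
Proof.
apply: (measurable_bounded_integrable mG qG).
  by apply: measurable_funTS; exact: measurable_inner.
exists (\sum_(l < L) `|v l ord0| * C)%R; split; first exact: num_real.
move=> K /ltW Kge y /= Gy; apply: le_trans Kge; rewrite /inner (le_trans (ler_norm_sum _ _ _))//.
by apply: ler_sum => l _; rewrite normrM ler_wpM2l// Gbnd.
Qed.

Definition moment : 'rV[R]_L := \row_l fine (\int[q]_(y in G) ((y : 'rV[R]_L) ord0 l)%:E).

Lemma integral_inner (v : 'cV[R]_L) : \int[q]_(y in G) (inner v y)%:E = (inner v moment)%:E.
Proof.
have I l : q.-integrable G (fun y : T => ((y : 'rV[R]_L) ord0 l)%:E).
  apply: eq_integrable (integrable_inner (delta_mx l ord0)) => // y _.
  by rewrite -[delta_mx _ _]scale1r inner_delta mul1r.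
rewrite /inner -sumEFin.
transitivity (\int[q]_(y in G) (\sum_(l < L) (v l ord0)%:E * ((y : 'rV[R]_L) ord0 l)%:E)).
  by apply: eq_integral => y _; rewrite -sumEFin.
rewrite integral_sum//; last by move=> l; apply: integrableZl.
apply: eq_bigr => l _; rewrite integralZl// EFinM mxE fineK//.
exact: integrable_fin_num.
Qed.

Lemma moment_le (v : 'cV[R]_L) c : (forall y, G y -> (inner v y <= c)%R) ->
  (inner v moment <= c * fine (q G))%R.
Proof.
move=> h; rewrite -lee_fin -integral_inner EFinM fineK ?ge0_fin_numE//.
rewrite -integral_cst//; apply: le_integral => //.
- exact: integrable_inner.
- by apply: (measurable_bounded_integrable mG qG) => //; exact: bounded_cst.
- by move=> y; rewrite inE => /h; rewrite lee_fin.
Qed.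

End Centroid.

Lemma innerZ (R : realType) L k (v : 'cV[R]_L) (y : 'rV[R]_L) :
  inner (k *: v)%R y = (k * inner v y)%R.
Proof. by rewrite /inner mulr_sumr; apply: eq_bigr => l _; rewrite mxE mulrA. Qed.

Section ExponentialMean.
Context {R : realType} {L : nat}.
Local Notation T := (borelV R L).
Variables (q : {measure set T -> \bar R}) (G : set T) (C : R).
Hypothesis (q1 : q setT = 1) (mG : measurable G).
Hypothesis Gbnd : forall y : T, G y -> forall l, (`|(y : 'rV[R]_L) ord0 l| <= C)%R.

Let qfin : q setT < +oo. Proof. by rewrite q1 ltry. Qed.
Let qG : q G < +oo.
Proof. by apply: le_lt_trans qfin; apply: le_measure; rewrite ?inE. Qed.
Let qG1 : (fine (q G) <= 1)%R.
Proof.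
rewrite -lee_fin fineK ?ge0_fin_numE// -q1.
by apply: le_measure; rewrite ?inE.
Qed.

(** With [z = exp (X / 2) - 1], use [X <= 2 z] and [2 dl z <= z ^ 2 + dl ^ 2]; the
    hypotheses on [mgf q] bound the mean of [z ^ 2] by [exp c - 1], which is at
    most [2 c] when [c <= 1/2]. Otherwise [X <= exp (X - c) + c - 1] suffices. *)
Lemma moment_exponential (v : 'cV[R]_L) (beta c dl : R) : (0 <= c)%R -> (0 < dl)%R ->
  (dl <= 2^-1)%R -> mgf q v = (expR (c + beta))%:E ->
  (expR (beta / 2))%:E <= mgf q ((2^-1)%R *: v)%R ->
  (dl * (inner v (moment q G) - beta * fine (q G)) <= 2 * c + dl ^+ 2)%R.
Proof.
move=> c0 dl0 dl2 qv qv2.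
pose X (y : T) : R := (inner v y - beta)%R.
have mX : measurable_fun setT X by apply: measurable_funB => //; exact: measurable_inner.
have GX : q.-integrable G (EFin \o X).
  apply: eq_integrable (integrableB mG (integrable_inner qfin mG Gbnd v)
    (measurable_bounded_integrable mG qG (@measurable_cst _ _ _ _ _ beta) (bounded_cst _ _))) => //.
have Icst (z : R) : \int[q]_(y in G) (cst z y)%:E = z%:E * q G by rewrite -integral_cst.
have IX : \int[q]_(y in G) (X y)%:E = (inner v (moment q G) - beta * fine (q G))%:E.
  transitivity (\int[q]_(y in G) ((inner v y)%:E - (cst beta y)%:E)); first by [].
  rewrite integralB_EFin//; first last.
  - exact: (measurable_bounded_integrable mG qG (@measurable_cst _ _ _ _ _ beta) (bounded_cst _ _)).
  - exact: (integrable_inner qfin mG Gbnd v).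
  by rewrite (integral_inner qfin mG Gbnd) Icst EFinB EFinM fineK// ge0_fin_numE.
have eX : \int[q]_y (expR (X y))%:E = (expR c)%:E.
  rewrite (_ : (fun y => _) = fun y : T => (expR (- beta))%:E * (expR (inner v y))%:E); last first.
    by apply/funext => y; rewrite -EFinM -expRD addrC.
  rewrite ge0_integralZl//; first by rewrite -/(mgf _ _) qv -EFinM -expRD addrC addrK.
  exact: measurable_expinner.
have eXc : \int[q]_y (expR (X y - c))%:E = 1.
  rewrite (_ : (fun y => _) = fun y : T => (expR (- c))%:E * (expR (X y))%:E); last first.
    by apply/funext => y; rewrite -EFinM -expRD addrC.
  rewrite ge0_integralZl//; last by apply/measurable_EFinP; exact: measurableT_comp.
  by rewrite eX -EFinM -expRD addNr expR0.
have eX2 : 1 <= \int[q]_y (expR (X y / 2))%:E.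
  rewrite (_ : (fun y => _) = fun y : T => (expR (- (beta / 2)))%:E * (expR (inner (2^-1 *: v)%R y))%:E); last first.
    apply/funext => y; rewrite -EFinM -expRD; congr (expR _)%:E.
    by rewrite innerZ /X; ring.
  rewrite ge0_integralZl//; last exact: measurable_expinner.
  rewrite -/(mgf _ _); apply: le_trans (lee_wpmul2l _ qv2); last by rewrite lee_fin expR_ge0.
  by rewrite -EFinM -expRD addNr expR0.
have meX : measurable_fun setT (fun y => (expR (X y))%:E).
  by apply/measurable_EFinP; apply: measurableT_comp.
have meX2 : measurable_fun setT (fun y => (expR (X y / 2))%:E).
  by apply/measurable_EFinP; apply: measurableT_comp => //; apply: measurable_funM.
have iG (g : T -> R) c' : measurable_fun setT g -> (forall y, 0 <= g y)%R ->
    \int[q]_y (g y)%:E <= c'%:E -> q.-integrable G (EFin \o g).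
  move=> mg g0 gc; apply: (@integrableS _ _ _ q setT) => //; apply/integrableP; split.
    exact/measurable_EFinP.
  apply: le_lt_trans (ltry c'); rewrite (eq_integral (EFin \o g))// => y _.
  by rewrite /= ger0_norm.
have [c2|c2] := leP c 2^-1%R.
  pose Z y := ((expR (X y / 2) - 1) ^+ 2)%R.
  have mZ : measurable_fun setT Z.
    by apply: measurable_funX; apply: measurable_funB => //; apply/measurable_EFinP.
  have EZ : \int[q]_y (Z y)%:E <= (2 * c)%:E.
    have E1 : \int[q]_y ((Z y)%:E + 2%:E * (expR (X y / 2))%:E) = (expR c)%:E + 1.
      rewrite -eX -[X in _ + X]q1 -[X in _ + X]mul1e -integral_cst//.
      rewrite -ge0_integralD//.
      apply: eq_integral => y _; rewrite /Z -EFinM -!EFinD; congr EFin.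
      have -> : (X y = X y / 2 + X y / 2)%R by rewrite -splitr.
      by rewrite expRD -splitr; ring.
    have Z0 y : 0 <= (Z y)%:E by rewrite lee_fin sqr_ge0.
    move: E1; rewrite ge0_integralD//; last 2 first.
    - exact/measurable_EFinP.
    - by apply: emeasurable_funM.
    rewrite ge0_integralZl// => E1.
    have : \int[q]_y (Z y)%:E + 2%:E <= (expR c)%:E + 1.
      by rewrite -E1 leeD2l// -[X in X <= _]mule1 lee_wpmul2l.
    have {E1} : 0 <= \int[q]_y (Z y)%:E by apply: integral_ge0 => y _.
    case: (\int[q]_y (Z y)%:E) => [z||]//; rewrite -!EFinD !lee_fin => z0 zc.
    have : (expR c <= 1 + 2 * c)%R.
      have e1 := expR_ge1Dx (- c).
      have e0 : (0 < expR c)%R := expR_gt0 c.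
      have ee : (expR c * expR (- c) = 1)%R by rewrite -expRD addrN expR0.
      have : (expR c * (1 - c) <= 1)%R by rewrite -[leRHS]ee ler_pM2l.
      by nra.
    by move=> *; lra.
  have := @le_integral _ _ _ q G mG (fun y => dl%:E * (X y)%:E) (fun y => (Z y)%:E + (cst (dl ^+ 2) y)%:E).
  rewrite integralZl// IX => /(_ _ _ _)/wrap[].
  - exact: integrableZl.
  - apply: integrableD => //.
      by apply: (iG Z (2 * c)%R) => // y; exact: sqr_ge0.
    by apply: (measurable_bounded_integrable mG qG) => //; exact: bounded_cst.
  - move=> y _; rewrite -EFinM -EFinD lee_fin /Z /=.
    have e1 := expR_ge1Dx (X y / 2); have := sqr_ge0 (expR (X y / 2) - 1 - dl)%R.
    by rewrite !expr2; nra.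
  rewrite integralD_EFin//; first last.
  - by apply: (measurable_bounded_integrable mG qG) => //; exact: bounded_cst.
  - by apply: (iG Z (2 * c)%R) => // y; exact: sqr_ge0.
  rewrite Icst => H.
  rewrite -lee_fin EFinM; apply: (le_trans H); rewrite EFinD; apply: leeD.
    apply: le_trans EZ; apply: ge0_subset_integral => //; first exact/measurable_EFinP.
    by move=> y _; rewrite lee_fin sqr_ge0.
  rewrite -[X in _ <= X]mule1; apply: lee_wpmul2l; first by rewrite lee_fin sqr_ge0.
  by rewrite -q1; apply: le_measure; rewrite ?inE.
have H : (inner v (moment q G) - beta * fine (q G) <= 1 + (c - 1) * fine (q G))%R.
  rewrite -lee_fin -IX.
  apply: (@le_trans _ _ (\int[q]_(y in G) ((expR (X y - c))%:E + (cst (c - 1)%R y)%:E))).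
    apply: le_integral => //.
    - apply: integrableD => //.
        apply: (iG (fun y => expR (X y - c)) 1%R) => //.
        + by apply: measurableT_comp => //; apply: measurable_funB.
        + by rewrite eXc.
      by apply: (measurable_bounded_integrable mG qG) => //; exact: bounded_cst.
    - move=> y _; rewrite -EFinD lee_fin /=; have := expR_ge1Dx (X y - c); lra.
  rewrite integralD_EFin//; first last.
  - by apply: (measurable_bounded_integrable mG qG) => //; exact: bounded_cst.
  - apply: (iG (fun y => expR (X y - c)) 1%R) => //; last by rewrite eXc.
    by apply: measurableT_comp => //; apply: measurable_funB.
  rewrite Icst [in leRHS]EFinD [in leRHS]EFinM fineK ?ge0_fin_numE//; apply: leeD => //.
  rewrite -eXc; apply: ge0_subset_integral => //.
    by apply/measurable_EFinP; apply: measurableT_comp => //; exact: measurable_funB.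
  by move=> y _; rewrite lee_fin expR_ge0.
have q0 : (0 <= fine (q G))%R by exact: fine_ge0.
have {}H : (inner v (moment q G) - beta * fine (q G) <= 2 * c)%R.
  have [c1|c1] := leP c 1%R.
    have : ((c - 1) * fine (q G) <= 0)%R by rewrite mulr_le0_ge0// subr_le0.
    by lra.
  have : ((c - 1) * fine (q G) <= c - 1)%R by rewrite ler_piMr// subr_ge0 ltW.
  by lra.
have := sqr_ge0 dl.
by case: (leP (inner v (moment q G) - beta * fine (q G))%R 0%R) => W0; nra.
Qed.

End ExponentialMean.

Section Complementarity.
Context {R : realType} {L : nat}.
Local Notation T := (borelV R L).
Variables (q : {measure set T -> \bar R}) (n : R) (a b : 'rV[R]_L) (th : 'cV[R]_L).
Hypotheses (q1 : q setT = 1) (n1 : (1 <= n)%R) (ab : orthant a b).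
Hypothesis mgf_ge : forall v, (expR (n * inner v b))%:E <= mgf q v.
Hypothesis mgf_near : forall b', orthant a b' -> forall e : R, (0 < e)%R ->
  exists v w, mgf q v = (expR (n * w))%:E /\ (w < inner (th + v)%R b' - inner th b + e)%R.

Lemma innerDr (v : 'cV[R]_L) (x y : 'rV[R]_L) : inner v (x + y)%R = (inner v x + inner v y)%R.
Proof. by rewrite /inner -big_split; apply: eq_bigr => l _; rewrite mxE mulrDr. Qed.

Lemma innerZr (v : 'cV[R]_L) k (x : 'rV[R]_L) : inner v (k *: x)%R = (k * inner v x)%R.
Proof. by rewrite /inner mulr_sumr; apply: eq_bigr => l _; rewrite mxE mulrCA. Qed.

(** Otherwise the mean [bG] over [G] would lie in the orthant with a smaller
    value of [inner th]; nearly optimal tilts for a point close to [b] on the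
    way to [bG] then contradict [moment_exponential]. *)
Lemma low_part_null (C dl : R) (G : set T) : (0 < dl)%R -> measurable G ->
  (forall y : T, G y -> forall l, `|(y : 'rV[R]_L) ord0 l| <= C)%R ->
  (forall y, G y -> orthant (n *: a)%R y) ->
  (forall y, G y -> inner th y <= n * (inner th b - dl))%R -> q G = 0.
Proof.
move=> dl0 mG Gbnd GA Gth; apply/eqP; rewrite -measure_le0 leNgt; apply/negP => qG0.
have n0 : (0 < n)%R by exact: lt_le_trans n1.
have qfin : q setT < +oo by rewrite q1 ltry.
have qG : q G < +oo by apply: le_lt_trans qfin; apply: le_measure; rewrite ?inE.
set ga := fine (q G).
have ga0 : (0 < ga)%R by apply: fine_gt0; rewrite qG0 qG.
set g := moment q G; pose bG := ((n * ga)^-1 *: g)%R.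
have gE : g = ((n * ga) *: bG)%R.
  by rewrite scalerA mulfV ?scale1r// gt_eqF// mulr_gt0.
clearbody bG.
have nga : (0 < n * ga)%R by rewrite mulr_gt0.
have abG : orthant a bG.
  move=> l; have := @moment_le R L q G C qfin mG Gbnd (- 1 *: delta_mx l ord0)%R (- (n * a ord0 l))%R.
  rewrite -/g inner_delta gE mxE => /(_ _)/wrap[] => [y /GA/(_ l)|].
    by rewrite mxE inner_delta => ?; lra.
  by rewrite -/ga => H; rewrite -(ler_pM2l nga); lra.
have thbG : (inner th bG - inner th b <= - dl)%R.
  have := @moment_le R L q G C qfin mG Gbnd th _ Gth.
  by rewrite -/g gE innerZr -/ga => H; rewrite -(ler_pM2l nga); lra.
pose d := Num.min 2^-1%R (ga * dl / 4)%R.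
have d0 : (0 < d)%R by rewrite lt_min invr_gt0 ltr0n/= divr_gt0// mulr_gt0.
have d2 : (d <= 2^-1)%R by rewrite ge_min lexx.
have d4 : (d <= ga * dl / 4)%R by rewrite ge_min lexx orbT.
pose e := Num.min 1%R (Num.min (dl / 4) (d * ga / 4))%R.
have e0 : (0 < e)%R by rewrite !lt_min ltr01/= !divr_gt0// mulr_gt0.
have e1 : (e <= 1)%R by rewrite ge_min lexx.
have e4 : (e <= dl / 4)%R by rewrite !ge_min lexx/= orbT.
have e5 : (e <= d * ga / 4)%R by rewrite !ge_min lexx/= !orbT.
have abe : orthant a (b + e *: (bG - b))%R.
  by move=> l; rewrite !mxE; have := ab l; have := abG l; nra.
have [v [w [vw ww]]] := mgf_near abe (exprn_gt0 2 e0).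
pose m := (w - inner v b)%R.
have m0 : (0 <= m)%R.
  by have := mgf_ge v; rewrite vw lee_fin ler_expR ler_pM2l// subr_ge0.
pose z := (inner v bG - inner v b)%R.
have := @moment_exponential R L q G C q1 mG Gbnd v (n * inner v b)%R (n * m)%R d.
rewrite -/g gE innerZr -/ga => /(_ _ d0 d2 _ _)/wrap[].
- by rewrite mulr_ge0// ltW.
- by rewrite vw; congr (expR _)%:E; rewrite /m; ring.
- by apply: le_trans (mgf_ge _); rewrite lee_fin ler_expR innerZ; lra.
have -> : (n * ga * inner v bG - n * inner v b * ga = n * (ga * z))%R by rewrite /z; ring.
move=> H.
have {}H : (d * (ga * z) <= 2 * m + d ^+ 2)%R.
  rewrite -(ler_pM2l n0); apply: le_trans (le_trans H _); first by rewrite mulrCA.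
  by have := ler_wpM2r (sqr_ge0 d) n1; lra.
have {}ww : (m < e * (- dl + z) + e ^+ 2)%R.
  apply: (lt_le_trans (y := (e * (inner th bG - inner th b + z) + e ^+ 2)%R)); last by nra.
  have inB (u : 'cV[R]_L) : inner u (bG - b)%R = (inner u bG - inner u b)%R.
    by rewrite innerDr -scaleN1r innerZr mulN1r.
  move: ww; rewrite /m innerDr innerZr !innerD !inB.
  by rewrite /z => ?; lra.
have dga : (0 < d * ga)%R by rewrite mulr_gt0.
have H1 : (d * ga * m < e * (- (dl * (d * ga)) + 2 * m + d ^+ 2) + e ^+ 2 * (d * ga))%R.
  have : (d * ga * m < d * ga * (e * (- dl + z) + e ^+ 2))%R by rewrite ltr_pM2l.
  move/lt_le_trans; apply; have := ler_wpM2l (ltW e0) H; lra.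
have H2 : (e * m <= d * ga / 4 * m)%R by exact: ler_wpM2r.
have H3 : (e * d ^+ 2 <= e * (d * (ga * dl / 4)))%R.
  by rewrite ler_pM2l// expr2 ler_pM2l.
have H4 : (e ^+ 2 * (d * ga) <= e * (dl / 4) * (d * ga))%R.
  by rewrite ler_pM2r// expr2 ler_pM2l.
have H5 : (0 < e * (dl * (d * ga)))%R by rewrite !mulr_gt0.
have H6 : (0 <= d * ga * m)%R by rewrite mulr_ge0// ltW.
lra.
Qed.

Lemma complementarity :
  {ae q, forall y : T, orthant (n *: a)%R y -> (n * inner th b <= inner th y)%R}.
Proof.
have n0 : (0 < n)%R by exact: lt_le_trans n1.
pose G k : set T := orthant (n *: a)%R `&`
  [set y : T | (inner th y <= n * (inner th b - k.+1%:R^-1))%R] `&`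
  \bigcap_(l in [set: 'I_L]) [set y : T | (`|(y : 'rV[R]_L) ord0 l| <= k%:R)%R].
have mG k : measurable (G k).
  apply: measurableI; first apply: measurableI.
  - exact: measurable_orthant.
  - rewrite -[X in measurable X]setTI; apply: measurable_fun_le => //; exact: measurable_inner.
  - apply: fin_bigcap_measurable => // l _.
    rewrite -[X in measurable X]setTI; apply: measurable_fun_le => //.
    by apply: measurableT_comp => //; exact: measurable_coordV.
have G0 k : q.-negligible (G k).
  apply/negligibleP => //; apply: (@low_part_null k%:R k.+1%:R^-1) => //.
  - by move=> y [_ +] l; apply.
  - by move=> y [[]].
  - by move=> y [[]].
apply: negligibleS (negligible_bigcup G0) => y /= /not_implyP[yA /negP]; rewrite -ltNge => yth.
pose K := (\sum_(l < L) `|(y : 'rV[R]_L) ord0 l|)%R.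
have y0 : (0 < n * inner th b - inner th y)%R by rewrite subr_gt0.
pose k := (Num.truncn (n / (n * inner th b - inner th y)) + Num.truncn K)%N.
have k1 : (n / (n * inner th b - inner th y) <= k.+1%:R)%R.
  by apply: ltW; apply: lt_le_trans (truncnS_gt _) _; rewrite ler_nat ltnS leq_addr.
have k2 : (K <= k.+1%:R)%R.
  by apply: ltW; apply: lt_le_trans (truncnS_gt _) _; rewrite ler_nat ltnS leq_addl.
exists k.+1 => //; split; first split => //=.
  have k3 : (n / (n * inner th b - inner th y) <= k.+2%:R)%R.
    by apply: le_trans k1 _; rewrite ler_nat.
  rewrite mulrBr lerBrDl -lerBrDr ler_pdivrMr ?ltr0n//.
  by move: k3; rewrite ler_pdivrMr// mulrC.
move=> l _ /=; apply: le_trans k2.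
by rewrite /K (bigD1 l)//= lerDl sumr_ge0.
Qed.

End Complementarity.

End Compl.
Export Compl.

(** * Exponential upper bounds *)

Module Upper.
Local Open Scope ereal_scope.

Section SecondMoment.
Context d (Om : measurableType d) (R : realType) (P : probability Om R) (Z : Om -> R).
Hypotheses (mZ : measurable_fun setT Z) (Z0 : forall w, (0 <= Z w)%R).
Hypothesis Zfin : 'E_P[fun w => (Z w ^+ 2)%R] < +oo.

Lemma square_integrable_Lfun : Z \in Lfun P 2%:E.
Proof.
rewrite inE/=; apply/andP; split; rewrite inE//=.
rewrite /finite_norm unlock poweR_lty//.
rewrite (eq_integral (fun w => (Z w ^+ 2)%:E)).
  by move: Zfin; rewrite unlock.
by move=> w _ /=; rewrite ger0_norm// powR_mulrn.
Qed.

Lemma mean_fin : 'E_P[Z] \is a fin_num.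
Proof. by apply: expectation_fin_num; apply: Lfun_subset12 square_integrable_Lfun; rewrite fin_num_measure. Qed.

Lemma variance_split : 'V_P[Z] = 'E_P[fun w => (Z w ^+ 2)%R] - 'E_P[Z] ^+ 2.
Proof. by rewrite varianceE//; exact: square_integrable_Lfun. Qed.

Lemma mean_square : 'E_P[Z] ^+ 2 = ((fine 'E_P[Z]) ^+ 2)%:E.
Proof. by rewrite EFin_expe fineK// mean_fin. Qed.

Lemma second_moment_ge : 'E_P[Z] ^+ 2 <= 'E_P[fun w => (Z w ^+ 2)%R].
Proof.
by have := variance_ge0 P Z; rewrite variance_split mean_square sube_ge0.
Qed.

Lemma variance_le : 'V_P[Z] <= 'E_P[fun w => (Z w ^+ 2)%R].
Proof.
by rewrite variance_split mean_square leeBlDr// leeDl// lee_fin sqr_ge0.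
Qed.

(* Only the deviation of Z from its mean where Z vanishes is kept. *)
Lemma variance_ge (A : set Om) : measurable A -> (forall w, A w -> Z w = 0%R) ->
  'E_P[Z] ^+ 2 * P A <= 'V_P[Z].
Proof.
move=> mA ZA; rewrite mean_square; set m := fine _; rewrite /variance unlock -/m unlock.
rewrite -integral_cst//.
rewrite -[leRHS]/(\int[P]_w (((Z w - m) * (Z w - m))%R)%:E).
have mD : measurable_fun setT (fun w => (((Z w - m) * (Z w - m))%R)%:E).
  by apply/measurable_EFinP; apply: measurable_funM; apply: measurable_funB.
have D0 w : setT w -> 0 <= (((Z w - m) * (Z w - m))%R)%:E.
  by rewrite lee_fin -expr2 sqr_ge0.
apply: (@le_trans _ _ (\int[P]_(w in A) (((Z w - m) * (Z w - m))%R)%:E)); last first.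
  exact: ge0_subset_integral.
apply: ge0_le_integral => //.
- by move=> w _ /=; rewrite lee_fin sqr_ge0.
- exact: measurable_funTS.
- by move=> w Aw /=; rewrite (ZA w Aw) sub0r mulrNN -expr2.
Qed.

End SecondMoment.

Lemma mgf0 (R : realType) L (m : {measure set (borelV R L) -> \bar R}) : mgf m 0%R = m setT.
Proof.
rewrite /mgf (eq_integral (cst 1)); first by rewrite integral_cst// mul1e.
by move=> y _; rewrite /inner big1 ?expR0// => l _; rewrite mxE mul0r.
Qed.

Lemma lee_pexp (R : realType) (x y : \bar R) n : 0 <= x -> x <= y -> x ^+ n <= y ^+ n.
Proof.
move=> x0 xy; elim: n => [|n IH]//; rewrite !expeS; apply: lee_pmul => //.
exact: expe_ge0.
Qed.

Lemma expR_expe (R : realType) (x : R) n : (expR x)%:E ^+ n = (expR (n%:R * x))%:E.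
Proof. by rewrite -EFin_expe -expRM_natr mulrC. Qed.

Section Upper.
Context {R : realType} {L d : nat} {t : R}.
Local Notation T := (borelV R L).
Local Notation X := (bpath d t).
Local Notation St := 'I_d.+1.
Variables (lam : St -> R) (mu : St -> probability T R) (r : St -> 'M[R]_L) (a : 'rV[R]_L)
  (bs : X -> 'rV[R]_L) (ths : X -> 'cV[R]_L) (kap : R.-pker X ~> T).
Hypotheses (t0 : (0 < t)%R) (lam0 : forall j, (0 < lam j)%R).
Hypothesis mu_ge0 : forall j, {ae mu j, forall x : T, forall l, (0 <= (x : 'rV[R]_L) ord0 l)%R}.
Hypothesis r0 : forall j i i', (0 <= r j i i')%R.
Hypothesis opt : forall f, optimizers lam mu r a f (bs f) (ths f).
Hypothesis mths : forall l, measurable_fun setT (fun f => ths f l ord0).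
Hypothesis twisted : twisted_kernel lam mu r ths kap.
Local Notation M := (@Mf R L d t lam mu r).
Local Notation log_Mf := (@Model.log_Mf R L d t lam mu r ths).
Local Notation rate_of := (@Model.rate_of R L d t lam mu r bs ths).
Local Notation untwist := (@Model.untwist R L d t lam mu r ths).
Local Notation path_prob := (Model.path_prob t0 lam0 r0 opt mths twisted).
Local Notation twisted_law := (Model.twisted_law kap).

Lemma twisted_law_setT n f : twisted_law n f setT = 1.
Proof.
rewrite -mgf0 mgf_cpow mgf0 [X in X ^+ _](_ : _ = 1); last exact: prob_kernel.
by elim: n => // n IH; rewrite expeS IH mul1e.
Qed.

Lemma mgf_twisted_law n f v : mgf (twisted_law n f) v = mgf (kap f) v ^+ n.
Proof. exact: mgf_cpow. Qed.

Lemma Mf_fin f th : M f th < +oo -> exists z, M f th = (expR z)%:E.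
Proof.
have := Mf_gt0 mu t0 lam0 r0 f th; case: (M f th) => [z||]//; rewrite lte_fin => z0 _.
by exists (ln z); rewrite lnK.
Qed.

Lemma tilt_Mf f b th z : M f th = (expR z)%:E -> tilt lam mu r f b th = (inner th b - z)%:E.
Proof. by move=> Mz; rewrite /tilt Mz lne_EFin ?expR_gt0// expRK EFinB. Qed.

Lemma kap_mgf_exp f v z : M f (v + ths f)%R = (expR z)%:E ->
  mgf (kap f) v = (expR (z - log_Mf f))%:E.
Proof.
by move=> Mz; rewrite (kap_mgf t0 lam0 r0 opt twisted) Mz -EFinM -expRD addrC.
Qed.

Lemma kap_mgf_ge f v : (expR (inner v (bs f)))%:E <= mgf (kap f) v.
Proof.
have [Mfin|] := ltP (M f (v + ths f)%R) +oo; last first.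
  rewrite leye_eq => /eqP Moo.
  by rewrite (kap_mgf t0 lam0 r0 opt twisted) Moo gt0_muley ?leey// lte_fin expR_gt0.
have [z Mz] := Mf_fin Mfin.
have [_ _ /(_ (v + ths f)%R) + _] := opt f.
rewrite (tilt_ths t0 lam0 r0 opt) (tilt_Mf _ Mz) (kap_mgf_exp Mz) !lee_fin ler_expR.
by rewrite /Model.rate_of innerD; lra.
Qed.

(** [bs f] minimises the Legendre transform over the orthant with [ths f] as
    multiplier, so the law twisted by [ths f] cannot charge the part of the
    orthant below the supporting hyperplane. *)
Lemma twisted_complementarity n f : (0 < n)%N ->
  {ae twisted_law n f, forall y : T, scaled a n y -> (n%:R * inner (ths f) (bs f) <= inner (ths f) y)%R}.
Proof.
move=> n0; have [ab _ _ _] := opt f.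
apply: complementarity => //.
- exact: twisted_law_setT.
- by rewrite ler1n.
- by move=> v; rewrite mgf_twisted_law -expR_expe; apply: lee_pexp; [rewrite lee_fin expR_ge0|exact: kap_mgf_ge].
move=> b' ab' e e0.
have : (rate_of f - e)%:E < legendre lam mu r f b'.
  apply: (@lt_le_trans _ _ (rate_of f)%:E); first by rewrite lte_fin ltrBlDr ltrDl.
  by rewrite -(legendre_bs t0 lam0 r0 opt); have [_ h _ _] := opt f; exact: h.
move=> /ereal_sup_gt[_ [th _ <-] lt].
have Mfin : M f th < +oo.
  rewrite ltey; apply/eqP => Moo; move: lt; rewrite /tilt Moo.
  by rewrite /= addeNy.
have [z Mz] := Mf_fin Mfin.
exists (th - ths f)%R, (z - log_Mf f)%R; split.
  have Mz' : M f (th - ths f + ths f)%R = (expR z)%:E by rewrite subrK.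
  by rewrite mgf_twisted_law -expR_expe (kap_mgf_exp Mz').
have -> : (ths f + (th - ths f) = th)%R by rewrite addrC subrK.
by move: lt; rewrite (tilt_Mf _ Mz) lte_fin /Model.rate_of; lra.
Qed.

Lemma path_second_moment n f : (0 < n)%N ->
  \int[twisted_law n f]_y (((untwist n (f, y)) ^+ 2)%:E * (\1_(scaled a n) y)%:E)
    <= (expR (- (n%:R * (2 * rate_of f))))%:E.
Proof.
move=> n0.
have mS : measurable (scaled a n : set T) := measurable_scaled a n.
have mu1 := @measurable_untwist_at _ _ _ _ _ _ _ _ _ _ _ t0 lam0 r0 opt mths twisted n f.
rewrite -[leRHS]mule1 -(twisted_law_setT n f) -integral_cst//.
apply: ae_ge0_le_integral => //.
- by move=> y _; rewrite mule_ge0// lee_fin sqr_ge0.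
- apply: emeasurable_funM; first by apply/measurable_EFinP; apply: measurable_funX; apply/measurable_EFinP.
  by apply/measurable_EFinP; exact: measurable_indic.
- by move=> y _; rewrite lee_fin expR_ge0.
apply: filterS (twisted_complementarity f n0) => y H _.
rewrite indicE; case: (boolP (y \in _)) => [|_]; last by rewrite mule0 lee_fin expR_ge0.
rewrite inE => /H {}H; rewrite mule1 lee_fin /= -expRM_natr ler_expR /Model.rate_of.
by rewrite /=; lra.
Qed.

Lemma path_prob_le n f : (0 < n)%N -> path_prob n f <= (expR (- (n%:R * rate_of f)))%:E.
Proof.
move=> n0.
have mS : measurable (scaled a n : set T) := measurable_scaled a n.
have mu1 := @measurable_untwist_at _ _ _ _ _ _ _ _ _ _ _ t0 lam0 r0 opt mths twisted n f.
rewrite path_probE -[leRHS]mule1 -(twisted_law_setT n f) -integral_cst//.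
apply: ae_ge0_le_integral => //.
- by move=> y _; rewrite mule_ge0// lee_fin expR_ge0.
- by apply: emeasurable_funM => //; apply/measurable_EFinP; exact: measurable_indic.
- by move=> y _; rewrite lee_fin expR_ge0.
apply: filterS (twisted_complementarity f n0) => y H _.
rewrite indicE; case: (boolP (y \in _)) => [|_]; last by rewrite mule0 lee_fin expR_ge0.
rewrite inE => /H {}H; rewrite mule1 lee_fin /= ler_expR /Model.rate_of.
by rewrite /=; lra.
Qed.

End Upper.

End Upper.
Export Upper.

(** * Positivity of the rate *)

Module Rate.
Local Open Scope ereal_scope.

Lemma le_integralT d (X : measurableType d) (R : realType) (m : {measure set X -> \bar R})
    (f g : X -> \bar R) : measurable_fun setT f -> measurable_fun setT g ->
  (forall x, 0 <= f x) -> (forall x, f x <= g x) -> \int[m]_x f x <= \int[m]_x g x.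
Proof. by move=> mf mg f0 fg; apply: ge0_le_integral. Qed.

Lemma integralDT d (X : measurableType d) (R : realType) (m : {measure set X -> \bar R})
    (f g : X -> \bar R) : measurable_fun setT f -> measurable_fun setT g ->
  (forall x, 0 <= f x) -> (forall x, 0 <= g x) ->
  \int[m]_x (f x + g x) = \int[m]_x f x + \int[m]_x g x.
Proof. by move=> mf mg f0 g0; rewrite ge0_integralD. Qed.

Lemma integralZT d (X : measurableType d) (R : realType) (m : {measure set X -> \bar R})
    (k : R) (g : X -> \bar R) : measurable_fun setT g -> (forall x, 0 <= g x) -> (0 <= k)%R ->
  \int[m]_x (k%:E * g x) = k%:E * \int[m]_x g x.
Proof. by move=> mg g0 k0; rewrite ge0_integralZl. Qed.

Lemma expR_quadratic (R : realType) (x : R) : (expR x <= 1 + x + x ^+ 2 * expR `|x|)%R.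
Proof.
have e0 := expR_gt0 x; have e1 := expR_ge1Dx x; have e2 := expR_ge1Dx (- x).
have ee : (expR x * expR (- x) = 1)%R by rewrite -expRD addrN expR0.
have H : (expR x <= 1 + x * expR x)%R.
  by have : (expR x * (1 - x) <= 1)%R by [rewrite -[leRHS]ee ler_pM2l|]; lra.
have [x0|x0] := leP 0%R x.
  by rewrite ger0_norm//; have := ler_wpM2l x0 H; rewrite expr2; lra.
have x2 : (x * expR x <= x + x ^+ 2)%R by rewrite expr2; nra.
have : (x ^+ 2 <= x ^+ 2 * expR `|x|)%R.
  by rewrite ler_peMr ?sqr_ge0// -expR0 ler_expR.
by lra.
Qed.

Lemma expR_convex_comb (R : realType) (u x : R) : (0 <= u)%R -> (u <= 1)%R ->
  (expR (u * x) <= u * expR x + (1 - u))%R.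
Proof.
move=> u0 u1; have p0 := expR_gt0 (u * x).
have h1 := expR_ge1Dx ((1 - u) * x); have h2 := expR_ge1Dx (- (u * x)).
have e1 : (expR x = expR (u * x) * expR ((1 - u) * x))%R by rewrite -expRD; congr expR; ring.
have e2 : (1 = expR (u * x) * expR (- (u * x)))%R by rewrite -expRD addrN expR0.
have k1 : (expR (u * x) * (1 + (1 - u) * x) <= expR x)%R by rewrite e1 ler_pM2l.
have k2 : (expR (u * x) * (1 - u * x) <= 1)%R by rewrite [leRHS]e2 ler_pM2l.
have k3 := ler_wpM2l u0 k1.
have k4 : ((1 - u) * (expR (u * x) * (1 - u * x)) <= (1 - u) * 1)%R by rewrite ler_wpM2l// subr_ge0.
by lra.
Qed.

Section Levy.
Context {R : realType} {L d : nat} {t : R}.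
Local Notation T := (borelV R L).
Local Notation X := (bpath d t).
Local Notation St := 'I_d.+1.
Variables (lam : St -> R) (mu : St -> probability T R) (r : St -> 'M[R]_L).
Hypotheses (t0 : (0 < t)%R) (lam0 : forall j, (0 < lam j)%R).
Hypothesis mu_ge0 : forall j, {ae mu j, forall x : T, forall l, (0 <= (x : 'rV[R]_L) ord0 l)%R}.
Hypothesis mu_exp : forall j, exists2 del : R, (0 < del)%R &
     forall th : 'cV[R]_L, (forall l, `|th l ord0| <= del)%R -> (mgf (mu j) th < +oo)%E.
Hypothesis r0 : forall j i i', (0 <= r j i i')%R.
Let lam_ge0 j : (0 <= lam j)%R. Proof. exact: ltW. Qed.
Local Notation nu := (@path_levy R L d t lam mu r r0).


Lemma path_levy_ge0 f : {ae nu f, forall y : T, forall l, (0 <= (y : 'rV[R]_L) ord0 l)%R}.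
Proof.
apply: (@negligibleS _ _ _ _ (~` orthant 0%R : set T)).
  by move=> y /= h yA; apply: h => l; have := yA l; rewrite mxE.
apply/negligibleP; first by apply: measurableC; exact: measurable_orthant.
apply: (@laplace_bounded_nonneg _ _ _ (path_mass lam f)) => l k.
pose th := (k%:R *: delta_mx l ord0 : 'cV[R]_L)%R.
have th0 l' : (0 <= th l' ord0)%R by rewrite !mxE mulr_ge0.
rewrite laplaceE -/th.
have := laplace_exponentE t0 lam0 mu_ge0 r0 th0 f.
have : (0 <= laplace_exponent lam mu r th f)%R by exact: laplace_exponent_ge0.
case: (mgf _ _) => [x||]//=; rewrite -EFinB => e0 [xE].
by rewrite lee_fin; lra.
Qed.

(* The transfer matrices are substochastic, so they do not increase a constant
   vector. *)
Lemma path_levy_exp : exists2 h0 : R, (0 < h0)%R & forall f, mgf (nu f) (const_mx h0) < +oo.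
Proof.
have [del del0 dmgf] : exists2 del : R, (0 < del)%R & forall j, mgf (mu j) (const_mx del) < +oo.
  pose D j := sval (cid2 (mu_exp j)).
  have D0 j : (0 < D j)%R by rewrite /D; case: cid2.
  have Dm j := svalP (cid2 (mu_exp j)).
  exists (\big[Num.min/1%R]_j D j); first by elim/big_ind: _ => // x y x0 y0; rewrite lt_min x0.
  move=> j; have [_ h] := Dm j; apply: h => l; rewrite mxE ger0_norm.
    by rewrite (bigD1 j)//= ge_min lexx.
  by elim/big_ind: _ => // [x y x0 y0|i _]; [rewrite le_min x0|exact: ltW].
exists del => // f; rewrite mgf_path_levy//.
rewrite lte_sum_pinfty// => j _; rewrite lte_mul_pinfty ?lee_fin//.
have mo : measurable (occupied t (path_at f) j) by exact: measurable_occupied (path_flow_is_flow r0 f) j.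
apply: (@le_lt_trans _ _ (\int[lebesgue_measure]_(u in occupied t (path_at f) j) mgf (mu j) (const_mx del))).
  apply: ge0_le_integral; [exact: mo|by move=> u _; exact: mgf_ge0| |exact: measurable_cst|].
    apply: measurable_funTS; apply: measurable_mgf_mx => i i'.
    exact: (flow_mD (path_flow_is_flow r0 f)).
  move=> u [/= + _]; rewrite in_itv /= => /andP[_ ut].
  have [D0 D1] := flow_substoch (path_flow_is_flow r0 f) ut.
  apply: ae_ge0_le_integral => //; try exact: measurable_expinner.
  apply: filterS (mu_ge0 j) => y y0 _; rewrite lee_fin ler_expR.
  apply: ler_sum => l _; apply: ler_wpM2r => //; rewrite !mxE.
  rewrite (eq_bigr (fun i => path_flow r f u l i * del)%R); last by move=> i _; rewrite mxE.
  by rewrite -mulr_suml ler_piMl// ltW.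
rewrite integral_cst//; apply: lte_mul_pinfty; first exact: mgf_ge0.
  by rewrite ge0_fin_numE ?dmgf// mgf_ge0.
exact: occupied_fin (path_flow_is_flow r0 f) j.
Qed.

Variable f : X.

Lemma mgf_levy_le (th th' : 'cV[R]_L) : (forall l, (th l ord0 <= th' l ord0)%R) ->
  mgf (nu f) th <= mgf (nu f) th'.
Proof.
move=> thth'; apply: ae_ge0_le_integral => //; try exact: measurable_expinner.
apply: filterS (path_levy_ge0 f) => y y0 _; rewrite lee_fin ler_expR.
by apply: ler_sum => l _; apply: ler_wpM2r.
Qed.


Lemma mgf_levy_fin l : exists2 h0 : R, (0 < h0)%R & mgf (nu f) (h0 *: delta_mx l ord0)%R < +oo.
Proof.
have [h0 h00 hf] := path_levy_exp; exists h0 => //; apply: le_lt_trans (hf f).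
apply: mgf_levy_le => k; rewrite !mxE; case: eqP => _ /=; first by rewrite mulr1.
by rewrite mulr0 ltW.
Qed.

Lemma nu_fin : nu f setT = (path_mass lam f)%:E.
Proof. exact: levy_setT. Qed.

Lemma Mf_log_mgf th z : mgf (nu f) th = z%:E -> Mf lam mu r f th = (expR (z - path_mass lam f))%:E.
Proof. by move=> E; rewrite (Mf_levy mu t0 lam0 r0) E. Qed.

(** Quadratic bounds for the exponential, integrated against the jumps; the
    second order term is controlled by an exponential moment. *)
Lemma log_mgf_expansion l : exists g C h1 : R, [/\ (0 <= C)%R, (0 < h1)%R & forall h : R, (`|h| <= h1)%R ->
  exists z, [/\ Mf lam mu r f (h *: delta_mx l ord0)%R = (expR z)%:E, (h * g <= z)%R
    & (z <= h * g + C * h ^+ 2)%R]].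
Proof.
have [h0 h00 hfin] := mgf_levy_fin l.
pose N h := mgf (nu f) (h *: delta_mx l ord0)%R.
pose y_ (y : T) := (y : 'rV[R]_L) ord0 l.
have my : measurable_fun setT y_ by exact: measurable_coordV.
have NE h : N h = \int[nu f]_y (expR (h * y_ y))%:E.
  by apply: eq_integral => y _; rewrite inner_delta.
have mE h : measurable_fun setT (fun y => (expR (h * y_ y))%:E).
  by apply/measurable_EFinP; apply: measurableT_comp => //; apply: measurable_funM.
have N0 : N 0%R = (path_mass lam f)%:E by rewrite /N scale0r mgf0 nu_fin.
set c := path_mass lam f.
have y0 : {ae nu f, forall y, (0 <= y_ y)%R} by apply: filterS (path_levy_ge0 f) => y; apply.
pose yp y := Num.max 0%R (y_ y).
have myp : measurable_fun setT yp by apply: measurable_maxr.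
have yp0 y : (0 <= yp y)%R by rewrite le_max lexx.
have ypE : {ae nu f, forall y, yp y = y_ y}.
  by apply: filterS y0 => y ?; rewrite /yp; apply/max_idPr.
have NE' h : N h = \int[nu f]_y (expR (h * yp y))%:E.
  rewrite NE; apply: ge0_ae_eq_integral => //.
  - by apply/measurable_EFinP; apply: measurableT_comp => //; apply: measurable_funM.
  - by apply: filterS ypE => y ->.
have mE' h : measurable_fun setT (fun y => (expR (h * yp y))%:E).
  by apply/measurable_EFinP; apply: measurableT_comp => //; apply: measurable_funM.
have Nge0 h : 0 <= N h by exact: mgf_ge0.
have : N h0 < +oo by []; move: (Nge0 h0); case E0 : (N h0) => [n0||]// n0ge _.
pose G := \int[nu f]_y (yp y)%:E.
have Gge0 : 0 <= G by apply: integral_ge0 => y _; rewrite lee_fin.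
have mypE : measurable_fun setT (fun y => (yp y)%:E) by exact/measurable_EFinP.
have : G <= (h0^-1)%:E * N h0.
  rewrite NE' -ge0_integralZl//; last by rewrite lee_fin invr_ge0 ltW.
  apply: le_integralT => [//||y|y]; [exact: emeasurable_funM|by rewrite lee_fin|].
  rewrite -EFinM lee_fin ler_pdivlMl//.
  by have := expR_ge1Dx (h0 * yp y); lra.
rewrite E0 -EFinM; case EG : G Gge0 => [g||]// g0 _.
pose K := (16 / h0 ^+ 2)%R.
have K0 : (0 <= K)%R by rewrite divr_ge0// sqr_ge0.
have quad h y : (`|h| <= h0 / 2)%R -> (expR (h * yp y) <= 1 + h * yp y + K * h ^+ 2 * expR (h0 * yp y))%R.
  move=> hh; apply: le_trans (expR_quadratic _) _; rewrite lerD2l.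
  rewrite normrM (ger0_norm (yp0 y)).
  have -> : (K * h ^+ 2 * expR (h0 * yp y) = h ^+ 2 * (K * expR (h0 * yp y)))%R by ring.
  rewrite exprMn -mulrA; apply: ler_wpM2l; first exact: sqr_ge0.
  have e1 : (expR (`|h| * yp y) <= expR (h0 / 2 * yp y))%R by rewrite ler_expR; apply: ler_wpM2r.
  apply: (@le_trans _ _ (yp y ^+ 2 * expR (h0 / 2 * yp y))%R); first by rewrite ler_wpM2l ?sqr_ge0.
  have -> : (expR (h0 * yp y) = expR (h0 / 2 * yp y) * expR (h0 / 2 * yp y))%R.
    by rewrite -expRD; congr expR; lra.
  rewrite mulrA; apply: ler_wpM2r; first exact: expR_ge0.
  have -> : (expR (h0 / 2 * yp y) = expR (h0 / 4 * yp y) ^+ 2)%R.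
    by rewrite -expRM_natr; congr expR; lra.
  rewrite /K mulrAC ler_pdivlMr ?exprn_gt0//.
  have := expR_ge1Dx (h0 / 4 * yp y); have := yp0 y => yy ee.
  have u0 : (0 <= h0 / 4 * yp y)%R by rewrite mulr_ge0// divr_ge0// ltW.
  have : ((h0 / 4 * yp y) ^+ 2 <= expR (h0 / 4 * yp y) ^+ 2)%R.
    by rewrite ler_sqr ?nnegrE ?expR_ge0//; lra.
  have -> : (yp y ^+ 2 * h0 ^+ 2 = 16 * (h0 / 4 * yp y) ^+ 2)%R by field.
  by rewrite ler_pM2l.
have key h : (`|h| <= h0 / 2)%R -> exists n, [/\ N h = n%:E, (c + h * g <= n)%R & (n <= c + h * g + K * n0 * h ^+ 2)%R].
  move=> hh; have Q y := quad h y hh.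
  have B y := expR_ge1Dx (h * yp y).
  have iK : \int[nu f]_y ((K * h ^+ 2)%R%:E * (expR (h0 * yp y))%:E) = (K * h ^+ 2 * n0)%:E.
    rewrite ge0_integralZl//; last by rewrite lee_fin mulr_ge0// sqr_ge0.
    by rewrite -NE' E0 EFinM.
  have i1 : \int[nu f]_y (cst 1 y) = c%:E by rewrite integral_cst// mul1e nu_fin.
  have K2 y : 0 <= (K * h ^+ 2)%R%:E * (expR (h0 * yp y))%:E.
    by apply: mule_ge0; rewrite lee_fin ?expR_ge0// mulr_ge0// sqr_ge0.
  have mK : measurable_fun setT (fun y => (K * h ^+ 2)%R%:E * (expR (h0 * yp y))%:E) by exact: emeasurable_funM.
  have [h_ge0|h_lt0] := leP 0%R h.
    have ih : \int[nu f]_y (h%:E * (yp y)%:E) = (h * g)%:E.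
      by rewrite integralZT// -/G EG EFinM.
    have mh : measurable_fun setT (fun y => h%:E * (yp y)%:E) by exact: emeasurable_funM.
    have hy0 y : 0 <= h%:E * (yp y)%:E by rewrite -EFinM lee_fin mulr_ge0.
    have lo : (c + h * g)%:E <= N h.
      rewrite EFinD -i1 -ih -integralDT// NE'; apply: le_integralT => //.
      - exact: emeasurable_funD.
      - by move=> y; apply: adde_ge0.
    have up : N h <= (c + h * g + K * n0 * h ^+ 2)%:E.
      rewrite mulrAC !EFinD -iK -i1 -ih -integralDT// -integralDT//; last 2 first.
      - exact: emeasurable_funD.
      - by move=> y; apply: adde_ge0.
      rewrite NE'; apply: le_integralT => //.
      by apply: emeasurable_funD => //; apply: emeasurable_funD.
    move: lo up (Nge0 h); case: (N h) => [n||]//; rewrite !lee_fin => lo up _.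
    by exists n.
  have ih : \int[nu f]_y ((- h)%R%:E * (yp y)%:E) = (- h * g)%:E.
    by rewrite integralZT// ?oppr_ge0 ?ltW// -/G EG EFinM.
  have mh : measurable_fun setT (fun y => (- h)%R%:E * (yp y)%:E) by exact: emeasurable_funM.
  have hy0 y : 0 <= (- h)%R%:E * (yp y)%:E by rewrite -EFinM lee_fin mulr_ge0// oppr_ge0 ltW.
  have lo : c%:E <= N h + (- h * g)%:E.
    rewrite -i1 -ih NE' -integralDT//.
    apply: le_integralT => //; first exact: emeasurable_funD.
    by move=> y; rewrite -EFinM -EFinD lee_fin; have := B y; lra.
  have up : N h + (- h * g)%:E <= (c + K * n0 * h ^+ 2)%:E.
    rewrite mulrAC EFinD -iK -i1 -ih NE' -!integralDT//.
    apply: le_integralT => //.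
    - exact: emeasurable_funD.
    - exact: emeasurable_funD.
    - by move=> y; apply: adde_ge0.
    by move=> y; rewrite -!EFinM -!EFinD lee_fin; have := Q y; lra.
  move: lo up (Nge0 h); case: (N h) => [n||]//; rewrite -?EFinD !lee_fin => lo up _.
  by exists n; split => //; lra.
exists g, (K * n0)%R, (h0 / 2)%R; split; [exact: mulr_ge0|by rewrite divr_gt0|].
move=> h /key[n [Nn lo up]]; exists (n - c)%R; split; [exact: Mf_log_mgf|lra|lra].
Qed.

End Levy.

Lemma slope_le0 (R : realType) (s C h1 : R) : (0 <= C)%R -> (0 < h1)%R ->
  (forall h, 0 < h -> h <= h1 -> h * s <= C * h ^+ 2)%R -> (s <= 0)%R.
Proof.
move=> C0 h10 H; rewrite leNgt; apply/negP => s0.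
pose h := Num.min h1 (s / (2 * (C + 1)))%R.
have hp : (0 < h)%R by rewrite lt_min h10 divr_gt0// mulr_gt0// ltr_wpDl.
have := H h hp; rewrite ge_min lexx => /(_ isT).
rewrite expr2 mulrCA ler_pM2l// => sC.
have : (h <= s / (2 * (C + 1)))%R by rewrite ge_min lexx orbT.
rewrite ler_pdivlMr ?mulr_gt0 ?ltr_wpDl// => hC.
by nra.
Qed.

(** A function that is the exponential of an almost linear one near the origin
    has the expected derivative there. *)
Lemma derive1_exp (R : realType) (F : R -> R) (g C h1 : R) : (0 <= C)%R -> (0 < h1)%R ->
  (forall h, (`|h| <= h1)%R -> exists z, [/\ F h = expR z, (h * g <= z)%R & (z <= h * g + C * h ^+ 2)%R]) ->
  derive1 F 0%R = g.
Proof.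
move=> C0 h10 H.
have F0 : F 0%R = 1%R.
  have [|z [-> z1 z2]] := H 0%R; first by rewrite normr0 ltW.
  have -> : z = 0%R; last by rewrite expR0.
  by move: z1 z2; rewrite expr2 !mul0r mulr0 addr0 => ? ?; apply/eqP; rewrite eq_le; apply/andP.
pose B := (`|g| + C * h1)%R; pose D := (C + B ^+ 2 * expR (h1 * B))%R.
have B0 : (0 <= B)%R by rewrite addr_ge0// mulr_ge0// ltW.
have D0 : (0 <= D)%R by rewrite addr_ge0// mulr_ge0 ?sqr_ge0 ?expR_ge0.
have bound h : (`|h| <= h1)%R -> (`|F h - 1 - h * g| <= `|h| * (`|h| * D))%R.
  move=> hh; have [z [-> z1 z2]] := H h hh.
  have hsq : (h ^+ 2 = `|h| * `|h|)%R by rewrite -expr2 real_normK// num_real.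
  have zB : (`|z| <= `|h| * B)%R.
    have hg : (`|h * g| = `|h| * `|g|)%R by rewrite normrM.
    have hC : (C * h ^+ 2 <= `|h| * (C * h1))%R.
      by rewrite hsq mulrCA; apply: ler_wpM2l => //; apply: ler_wpM2l.
    have hC0 : (0 <= C * h ^+ 2)%R by rewrite mulr_ge0 ?sqr_ge0.
    rewrite /B mulrDr ler_norml; apply/andP; split.
      by have := ler_norm (- (h * g)); rewrite normrN hg; lra.
    by have := ler_norm (h * g); rewrite hg; lra.
  have e1 := expR_ge1Dx z; have e2 := expR_quadratic z.
  have e3 : (z ^+ 2 * expR `|z| <= `|h| * (`|h| * (B ^+ 2 * expR (h1 * B))))%R.
    have -> : (`|h| * (`|h| * (B ^+ 2 * expR (h1 * B))) = (`|h| * B) ^+ 2 * expR (h1 * B))%R by ring.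
    apply: ler_pM; rewrite ?sqr_ge0 ?expR_ge0//.
      by rewrite -[(z ^+ 2)%R]real_normK ?num_real// ler_sqr ?nnegrE// mulr_ge0.
    by rewrite ler_expR (le_trans zB)// ler_wpM2r.
  have -> : (`|h| * (`|h| * D) = C * h ^+ 2 + `|h| * (`|h| * (B ^+ 2 * expR (h1 * B))))%R.
    by rewrite hsq /D; ring.
  by rewrite ger0_norm; lra.
rewrite /derive1; apply: cvg_lim => //.
apply/cvgrPdist_le => e e0; near=> h.
have hn0 : h != 0%R by near: h; exact: nbhs_dnbhs_neq.
have hh1 : (`|h| <= h1)%R by near: h; exact: dnbhs0_le.
have hhe : (`|h| <= e / (D + 1))%R by near: h; apply: dnbhs0_le; rewrite divr_gt0// ltr_wpDl.
have nh : (0 < `|h|)%R by rewrite normr_gt0.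
rewrite addr0 F0 -(ler_pM2l nh) -normrM mulrBr.
have -> : (h * (h^-1 *: (F h - 1)))%R = (F h - 1)%R by rewrite /GRing.scale /= mulrA mulfV// mul1r.
rewrite distrC; apply: le_trans (bound h hh1) _; apply: ler_wpM2l => //.
apply: (@le_trans _ _ (e / (D + 1) * D)%R); first exact: ler_wpM2r.
by rewrite mulrAC ler_pdivrMr ?ltr_wpDl// ler_pM2l// lerDl.
Unshelve. all: by end_near. Qed.

Lemma ray_equality (R : realType) (x m n1 n2 n3 u s : R) :
  (0 = x - (n1 - m) - (u * x - (n2 - m)) ->
   0 <= x - (n1 - m) - ((1 + u) / 2 * x - (n3 - m)) ->
   s + 2 * n3 = n1 + n2 -> 0 <= s -> s = 0)%R.
Proof. by move=> *; lra. Qed.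

Lemma ray_fixed (R : realType) (x u : R) : (u < 1 -> x / 2 = u * x / 2 -> x = 0)%R.
Proof.
move=> u1 h; have : ((1 - u) * x = 0)%R by lra.
by move/eqP; rewrite mulf_eq0 subr_eq0 gt_eqF//= => /eqP.
Qed.

Lemma ray_degenerate (R : realType) (x m u : R) : (u < 1 ->
  0 = x - (m - m) - (u * x - (m - m)) -> 0 < x - (m - m) -> False)%R.
Proof.
move=> u1; rewrite subrr !subr0 => h x0.
have : ((1 - u) * x = 0)%R by lra.
by move/eqP; rewrite mulf_eq0 subr_eq0 !gt_eqF.
Qed.

Section Gap.
Context {R : realType} {L d : nat} {t : R}.
Local Notation T := (borelV R L).
Local Notation X := (bpath d t).
Local Notation St := 'I_d.+1.
Variables (lam : St -> R) (mu : St -> probability T R) (r : St -> 'M[R]_L) (a : 'rV[R]_L)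
  (bs : X -> 'rV[R]_L) (ths : X -> 'cV[R]_L).
Hypotheses (t0 : (0 < t)%R) (lam0 : forall j, (0 < lam j)%R).
Hypothesis mu_ge0 : forall j, {ae mu j, forall x : T, forall l, (0 <= (x : 'rV[R]_L) ord0 l)%R}.
Hypothesis mu_exp : forall j, exists2 del : R, (0 < del)%R &
     forall th : 'cV[R]_L, (forall l, `|th l ord0| <= del)%R -> (mgf (mu j) th < +oo)%E.
Hypothesis r0 : forall j i i', (0 <= r j i i')%R.
Hypothesis opt : forall f, optimizers lam mu r a f (bs f) (ths f).
Hypothesis rare : forall f : X, ~ orthant a (grad_Mf0 lam mu r f).
Local Notation M := (@Mf R L d t lam mu r).
Local Notation log_Mf := (@Model.log_Mf R L d t lam mu r ths).
Local Notation rate_of := (@Model.rate_of R L d t lam mu r bs ths).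
Local Notation nu := (@path_levy R L d t lam mu r r0).

(** If the rate vanished, the mean of the storage would be the optimal point. *)
Lemma rate_of_gt0 f : (0 < rate_of f)%R.
Proof.
rewrite lt_neqAle (rate_of_ge0 t0 lam0 r0 opt) andbT; apply/eqP => rate0.
have [ab _ H _] := opt f; apply: (rare (f := f)).
suff -> : grad_Mf0 lam mu r f = bs f by [].
apply/rowP => l; rewrite /grad_Mf0 mxE.
have [g [C [h1 [C0 h10 HM]]]] := log_mgf_expansion t0 lam0 mu_ge0 mu_exp r0 f l.
have Hb h : (`|h| <= h1)%R -> (h * (bs f ord0 l - g) <= C * h ^+ 2)%R.
  move=> /HM[z [Mz z1 z2]]; have := H (h *: delta_mx l ord0)%R.
  rewrite (tilt_ths t0 lam0 r0 opt) (tilt_Mf _ Mz) -rate0 lee_fin inner_delta; lra.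
have g1 : (bs f ord0 l - g <= 0)%R.
  by apply: (slope_le0 C0 h10) => h hp hh; apply: Hb; rewrite gtr0_norm.
have g2 : (g - bs f ord0 l <= 0)%R.
  apply: (slope_le0 C0 h10) => h hp hh; have := Hb (- h)%R.
  by rewrite normrN gtr0_norm// sqrrN => /(_ hh); lra.
have <- : g = bs f ord0 l by lra.
apply: (derive1_exp C0 h10) => h /HM[z [-> z1 z2]]; by exists z.
Qed.

(** Loss of [u *: ths f] with respect to the optimal tilt. *)
Definition gap f (u : R) : R :=
  (rate_of f - (u * inner (ths f) (bs f) - fine (lne (M f (u *: ths f))))%R)%R.

Variable f : X.
Let th := ths f.

Let mass := path_mass lam f.

Let N1 : exists2 n, mgf (nu f) th = n%:E & log_Mf f = (n - mass)%R.
Proof.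
have := Mf_ths t0 lam0 r0 opt f; rewrite (Mf_levy mu t0 lam0 r0).
have := mgf_ge0 (nu f) th; rewrite -/th -/mass.
case: (mgf _ _) => [n||]//= _ [E]; exists n => //.
exact/esym/expR_inj.
Qed.

Let Nu u : (0 <= u <= 1)%R -> exists n, [/\ mgf (nu f) (u *: th)%R = n%:E,
  fine (lne (M f (u *: ths f)%R)) = (n - mass)%R & (n - mass <= u * log_Mf f)%R].
Proof.
move=> /andP[u0 u1]; have [n1 En1 lM] := N1.
have : mgf (nu f) (u *: th)%R <= (u * n1 + (1 - u) * mass)%:E.
  rewrite EFinD !EFinM -En1 -(nu_fin mu lam0 r0 f) -mgf0 /mgf.
  rewrite -!ge0_integralZl//; try exact: measurable_expinner; try by rewrite lee_fin ?subr_ge0.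
  rewrite -integralDT; first last.
  - by move=> y; rewrite -EFinM lee_fin mulr_ge0 ?expR_ge0// subr_ge0.
  - by move=> y; rewrite -EFinM lee_fin mulr_ge0 ?expR_ge0.
  - by apply: emeasurable_funM => //; exact: measurable_expinner.
  - by apply: emeasurable_funM => //; exact: measurable_expinner.
  apply: le_integralT.
  - exact: measurable_expinner.
  - by apply: emeasurable_funD; apply: emeasurable_funM => //; exact: measurable_expinner.
  - by move=> y; rewrite lee_fin expR_ge0.
  move=> y; rewrite -!EFinM -EFinD lee_fin innerZ.
  have -> : inner (0 : 'cV[R]_L)%R y = 0%R by rewrite /inner big1// => l _; rewrite mxE mul0r.
  by rewrite expR0 mulr1; exact: expR_convex_comb.
have := mgf_ge0 (nu f) (u *: th)%R.
case E : (mgf _ _) => [n||]//= _; rewrite lee_fin => nle; exists n; split => //; last by rewrite lM; lra.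
by rewrite (Mf_levy mu t0 lam0 r0) E lne_EFin ?expR_gt0// expRK.
Qed.

Lemma Mf_ray u : (0 <= u <= 1)%R -> M f (u *: ths f)%R = (expR (fine (lne (M f (u *: ths f)%R))))%:E.
Proof. by move=> /Nu[n [E -> _]]; rewrite (Mf_levy mu t0 lam0 r0) E. Qed.

Lemma gap_ge0 u : (0 <= u <= 1)%R -> (0 <= gap f u)%R.
Proof.
move=> uI; have [_ _ /(_ (u *: ths f)%R) + _] := opt f.
by rewrite (tilt_ths t0 lam0 r0 opt) (tilt_Mf _ (Mf_ray uI)) lee_fin innerZ /gap; lra.
Qed.

Lemma gap_le u : (0 <= u <= 1)%R -> (gap f u <= (1 - u) * rate_of f)%R.
Proof. by move=> /Nu[n [_ E le]]; rewrite /gap E /Model.rate_of; lra. Qed.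

(** The integral of [S] measures the strict convexity of the moment generating
    function between [u *: th] and [th]; were the gap zero, it would vanish, so
    that [<th, y>] would be zero for almost all jumps and the rate would be
    zero. *)
Lemma gap_gt0 u : (0 <= u < 1)%R -> (0 < gap f u)%R.
Proof.
move=> /andP[u0 u1].
have uI : (0 <= u <= 1)%R by rewrite u0 ltW.
rewrite lt_neqAle gap_ge0// andbT; apply/eqP => gap0.
pose w := ((1 + u) / 2)%R.
have wI : (0 <= w <= 1)%R by rewrite /w; lra.
have [n1 En1 lM] := N1.
have [nu_ [Enu Lu _]] := Nu uI; have [nw [Enw Lw _]] := Nu wI.
pose X_ (y : T) := inner th y.
have mX : measurable_fun setT X_ by exact: measurable_inner.
pose S y := ((expR (X_ y / 2) - expR (u * X_ y / 2)) ^+ 2)%R.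
have mS : measurable_fun setT S.
  by apply: measurable_funX; apply: measurable_funB; apply: measurableT_comp => //; apply: measurable_funM => //; apply: measurable_funM.
have mE v : measurable_fun setT (fun y => (expR (v * X_ y))%:E).
  by apply/measurable_EFinP; apply: measurableT_comp => //; apply: measurable_funM.
have IE v : \int[nu f]_y (expR (v * X_ y))%:E = mgf (nu f) (v *: th)%R.
  by apply: eq_integral => y _; rewrite innerZ.
have IE1 : mgf (nu f) th = \int[nu f]_y (expR (1 * X_ y))%:E by rewrite IE scale1r.
have IS : \int[nu f]_y (S y)%:E + 2%:E * nw%:E = n1%:E + nu_%:E.
  rewrite -Enw -Enu -En1 IE1 -!IE -ge0_integralZl//.
  rewrite -!integralDT//; first last.
  - by move=> y; rewrite lee_fin sqr_ge0.
  - exact: emeasurable_funM.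
  - exact/measurable_EFinP.
  apply: eq_integral => y _; rewrite -EFinM -!EFinD; congr EFin; rewrite /S sqrrB.
  move: (X_ y) => x.
  rewrite -!expRM_natr -expRD.
  have -> : (w * x = x / 2 + u * x / 2)%R by rewrite /w; field.
  have -> : (x / 2 * 2 = 1 * x)%R by field.
  have -> : (u * x / 2 * 2 = u * x)%R by field.
  by rewrite mulr_natl; ring.
have S0 : 0 <= \int[nu f]_y (S y)%:E by apply: integral_ge0 => y _; rewrite lee_fin sqr_ge0.
have IS0 : \int[nu f]_y (S y)%:E = 0.
  have := gap_ge0 wI; rewrite /gap Lw; move: gap0; rewrite /gap Lu.
  move: IS S0; case: (\int[nu f]_y (S y)%:E) => [s||]//.
  rewrite -EFinM -!EFinD lee_fin => -[sE] s0 g1 g2; congr EFin.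
  move: g1 g2 sE s0; rewrite /Model.rate_of lM /w.
  exact: ray_equality.
have X0 : {ae nu f, forall y, X_ y = 0%R}.
  have : ae_eq (nu f) setT (EFin \o S) (cst 0).
    apply/ae_eq_integral_abs => //; first exact/measurable_EFinP.
    rewrite -[RHS]IS0; apply: eq_integral => y _ /=.
    by rewrite ger0_norm// sqr_ge0.
  apply: filterS => y /(_ I) [] /eqP; rewrite sqrf_eq0 subr_eq0 => /eqP/expR_inj.
  exact: ray_fixed.
have Nc v : mgf (nu f) (v *: th)%R = mass%:E.
  rewrite -IE -(nu_fin mu lam0 r0 f) -[RHS]mul1e -integral_cst//.
  apply: ge0_ae_eq_integral => //.
  by apply: filterS X0 => y -> _; rewrite mulr0 expR0.
have En1m : n1 = mass by apply: EFin_inj; rewrite -En1 -(scale1r th) Nc.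
have Enum : nu_ = mass by apply: EFin_inj; rewrite -Enu Nc.
have := rate_of_gt0 f; move: gap0; rewrite /gap Lu /Model.rate_of lM En1m Enum.
exact: ray_degenerate.
Qed.

End Gap.

End Rate.
Export Rate.

(** * Failure of the rare event under the twisted law *)

Module Escape.
Local Open Scope ereal_scope.

Section Divergence.
Context d (Om : measurableType d) (R : realType) (P : probability Om R).
Variables (g : nat -> Om -> \bar R) (B : set Om).
Hypotheses (mg : forall n, measurable_fun setT (g n)) (g0 : forall n w, 0 <= g n w).
Hypotheses (mB : measurable B) (PB : 0 < P B).
Hypothesis gB : forall w, B w -> forall K : R, \forall n \near \oo, K%:E <= g n w.

(** Fatou's lemma applied to the sequence on [B]. *)
Lemma integral_diverges (K : R) : \forall n \near \oo, K%:E <= \int[P]_w g n w.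
Proof.
have PBfin : P B \is a fin_num by rewrite fin_num_measure.
have c0 : (0 < fine (P B))%R by rewrite fine_gt0// PB ltey_eq PBfin.
pose c := (fine (P B) / 2)%R.
have cp : (0 < c)%R by rewrite divr_gt0.
pose K' := (Num.max 0 K / c)%R.
have K'0 : (0 <= K')%R by rewrite divr_ge0 ?le_max ?lexx// ltW.
pose E n := B `&` \bigcap_(m in [set m | (n <= m)%N]) [set w | K'%:E <= g m w].
have mE n : measurable (E n).
  apply: measurableI => //; apply: bigcap_measurable; first by exists n => /=.
  by move=> m _; rewrite -[X in measurable X]setTI; exact: emeasurable_fun_c_infty.
have EB : \bigcup_n E n = B.
  apply/seteqP; split => [w [n _ []]//|w Bw].
  by have [n _ nK] := gB Bw K'; exists n => //; split.
have E_nd : {homo E : n m / (n <= m)%N >-> (n <= m)%O}.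
  move=> n m nm; apply/subsetPset => w [Bw h]; split => // k /= mk; apply: h => /=.
  exact: leq_trans mk.
have PE : (P \o E) x @[x --> \oo] --> (fine (P B))%:E.
  by rewrite fineK// -EB; apply: nondecreasing_cvg_mu => //; rewrite EB.
have : \forall n \near \oo, c%:E < P (E n).
  have /fine_cvgP[_ PE'] := PE.
  have cB : (c < fine (P B))%R by rewrite /c; lra.
  near=> n; rewrite -[P (E n)]fineK ?fin_num_measure// lte_fin.
  by near: n; exact: (@cvgr_gt _ _ _ _ _ _ PE').
apply: filterS => n cE.
apply: (@le_trans _ _ (\int[P]_(w in E n) (cst K'%:E w))).
  rewrite integral_cst//; apply: (@le_trans _ _ (K'%:E * c%:E)).
    by rewrite -EFinM lee_fin /K' divfK ?gt_eqF// le_max lexx orbT.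
  by apply: lee_wpmul2l; [rewrite lee_fin|exact: ltW].
apply: (@le_trans _ _ (\int[P]_(w in E n) g n w)); last first.
  by apply: ge0_subset_integral => //; exact: mg.
apply: ge0_le_integral => //.
- by apply: measurable_funTS; exact: mg.
- by move=> w [_] /(_ n) /= ; apply.
Unshelve. all: by end_near. Qed.

End Divergence.

(** Cylinders over sorted times generate the paths and are stable under
    intersection. *)
Lemma ctmc_same_law (R : realType) (d : nat) (t : R) (Q : 'M[R]_d.+1) (j0 : 'I_d.+1)
    d1 (O1 : measurableType d1) (P1 : probability O1 R) (J1 : {mfun O1 >-> bpath d t})
    d2 (O2 : measurableType d2) (P2 : probability O2 R) (J2 : {mfun O2 >-> bpath d t}) :
  ctmc Q j0 P1 J1 -> ctmc Q j0 P2 J2 ->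
  forall F : set (bpath d t), measurable F -> P1 (J1 @^-1` F) = P2 (J2 @^-1` F).
Proof.
move=> H1 H2 F mF.
have m1 : measurable_fun setT J1 by exact: measurable_funPT.
have m2 : measurable_fun setT J2 by exact: measurable_funPT.
pose cyl (ss : seq (R * 'I_d.+1)) : set (bpath d t) :=
  [set f | forall p, p \in ss -> path_at f p.1 = p.2].
pose C : set (set (bpath d t)) :=
  [set F | exists2 ss : seq (R * 'I_d.+1), all (fun u => 0 <= u <= t)%R (unzip1 ss) & F = cyl ss].
have cylT : cyl [::] = setT by apply/seteqP; split.
have -> : P1 (J1 @^-1` F) = push_measure P1 m1 F by rewrite push_measureE.
have -> : P2 (J2 @^-1` F) = push_measure P2 m2 F by rewrite push_measureE.
apply: (measure_unique C (fun=> setT)) => //.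
- apply/seteqP; split; apply: smallest_sub; try exact: smallest_sigma_algebra.
    move=> _ [s [x [s0 st ->]]]; apply: sub_sigma_algebra; exists [:: (s, x)] => /=.
      by rewrite s0 st.
    apply/seteqP; split => f /=; first by move=> h p; rewrite inE => /eqP ->.
    by move=> /(_ (s, x)); rewrite inE eqxx; apply.
  move=> _ [ss ssP ->]; elim: ss ssP => [_|p ss IH /= /andP[/andP[p0 pt] /IH mss]].
    by rewrite cylT; exact: (@measurableT _ (bpath d t)).
  rewrite (_ : cyl _ = [set f | path_at f p.1 = p.2] `&` cyl ss).
    apply: (@measurableI _ (bpath d t)) => //; apply: sub_sigma_algebra.
    by exists p.1, p.2.
  apply/seteqP; split => f /=.
    by move=> h; split => [|q qs]; apply: h; rewrite inE ?eqxx// qs orbT.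
  by move=> [h1 h2] q; rewrite inE => /orP[/eqP->|/h2].
- move=> _ _ [s1 a1 ->] [s2 a2 ->]; exists (s1 ++ s2).
    by rewrite /unzip1 map_cat all_cat; apply/andP.
  apply/seteqP; split => f /=.
    by move=> [h1 h2] q; rewrite mem_cat => /orP[/h1|/h2].
  by move=> h; split => q qs; apply: h; rewrite mem_cat qs ?orbT.
- by move=> _; exists [::].
- by rewrite bigcup_const.
- move=> _ [ss ssP ->]; rewrite !push_measureE.
  pose leR : rel (R * 'I_d.+1) := fun p q => (p.1 <= q.1)%R.
  have leT : total leR by move=> p q; exact: le_total.
  have sE : cyl ss = cyl (sort leR ss).
    by apply/seteqP; split => f h p ps; apply: h; rewrite mem_sort in ps *.
  have sP : all (fun u => 0 <= u <= t)%R (unzip1 (sort leR ss)).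
    by rewrite /unzip1 all_map (perm_all _ (permEl (perm_sort _ _))) -all_map.
  have pP : path (fun u v => (u <= v)%R) 0%R (unzip1 (sort leR ss)).
    have := sort_sorted leT ss; move: sP; case: (sort leR ss) => //= p s /andP[/andP[p0 _] _].
    rewrite p0 /= /unzip1 path_map; exact.
  have tP : all (fun u => (u <= t)%R) (unzip1 (sort leR ss)).
    by apply: sub_all sP => u /andP[].
  rewrite sE; transitivity ((ctmc_fdd Q j0 0 (sort leR ss))%:E).
    exact: H1.
  by symmetry; exact: H2.
- by move=> _; rewrite push_measureE preimage_setT probability_lty.
Qed.

Section Escape.
Context {R : realType} {L d : nat} {t : R}.
Local Notation T := (borelV R L).
Local Notation X := (bpath d t).
Local Notation St := 'I_d.+1.
Variables (lam : St -> R) (mu : St -> probability T R) (r : St -> 'M[R]_L) (a : 'rV[R]_L)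
  (bs : X -> 'rV[R]_L) (ths : X -> 'cV[R]_L) (kap : R.-pker X ~> T).
Hypotheses (t0 : (0 < t)%R) (lam0 : forall j, (0 < lam j)%R).
Hypothesis mu_ge0 : forall j, {ae mu j, forall x : T, forall l, (0 <= (x : 'rV[R]_L) ord0 l)%R}.
Hypothesis mu_exp : forall j, exists2 del : R, (0 < del)%R &
     forall th : 'cV[R]_L, (forall l, `|th l ord0| <= del)%R -> (mgf (mu j) th < +oo)%E.
Hypothesis r0 : forall j i i', (0 <= r j i i')%R.
Hypothesis opt : forall f, optimizers lam mu r a f (bs f) (ths f).
Hypothesis rare : forall f : X, ~ orthant a (grad_Mf0 lam mu r f).
Hypothesis mths : forall l, measurable_fun setT (fun f => ths f l ord0).
Hypothesis twisted : twisted_kernel lam mu r ths kap.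
Local Notation rate_of := (@Model.rate_of R L d t lam mu r bs ths).
Local Notation gap := (@Rate.gap R L d t lam mu r bs ths).
Local Notation twisted_law := (Model.twisted_law kap).

Lemma kap_ray f s : (0 <= s <= 1)%R -> mgf (kap f) (- s *: ths f)%R =
  (expR (gap f (1 - s) - s * inner (ths f) (bs f)))%:E.
Proof.
move=> sI; have s1 : (0 <= 1 - s <= 1)%R by lra.
have Mz : Mf lam mu r f (- s *: ths f + ths f)%R =
    (expR (fine (lne (Mf lam mu r f ((1 - s) *: ths f)%R))))%:E.
  rewrite -[X in (_ + X)%R](scale1r (ths f)) -scalerDl addrC.
  exact: (Mf_ray t0 lam0 r0 opt f s1).
rewrite (kap_mgf_exp t0 lam0 r0 opt twisted Mz); congr (expR _)%:E.
by rewrite /Rate.gap /Model.rate_of; ring.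
Qed.

(** By complementarity [W] is at most 1 on the rare event, while its mean grows
    exponentially by [gap_gt0]. So [W] has mass off the event, and its second
    moment, at most [k], limits how little probability can carry it. *)
Lemma escape_prob f s : (0 < s)%R -> (s <= 2^-1)%R -> \forall n \near \oo,
  (expR (- (n%:R * (2 * s * rate_of f))) / 2)%:E <= twisted_law n f (~` scaled a n).
Proof.
move=> s0 s2; set rho := rate_of f; set th := ths f; set tb := inner th (bs f).
pose ms := gap f (1 - s).
have ms0 : (0 < ms)%R by apply: (gap_gt0 t0 lam0 mu_ge0 mu_exp r0 opt rare); lra.
have m2s : (gap f (1 - 2 * s) <= 2 * s * rho)%R.
  have uI : (0 <= 1 - 2 * s <= 1)%R by lra.
  by have := gap_le t0 lam0 r0 opt f uI; rewrite -/rho; lra.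
near=> n.
have n0 : (0 < n)%N by near: n; exists 1%N.
have nms : (1 <= n%:R * ms)%R.
  rewrite -ler_pdivrMr//; near: n; exact: nbhs_infty_ger.
set q := twisted_law n f.
have q1 : q setT = 1 by exact: twisted_law_setT.
pose A : set T := scaled a n.
have mA : measurable A by exact: measurable_scaled.
pose W (y : T) : R := expR (- s * (inner th y - n%:R * tb)).
have mW : measurable_fun setT W.
  apply: measurableT_comp => //; apply: measurable_funM => //; apply: measurable_funB => //.
  exact: measurable_inner.
pose k := expR (n%:R * (2 * s * rho)).
have k0 : (0 < k)%R := expR_gt0 _.
have IW v : (0 <= v <= 1)%R -> \int[q]_y (expR (- v * (inner th y - n%:R * tb)))%:E = (expR (n%:R * gap f (1 - v)))%:E.
  move=> vI; rewrite (_ : (fun y => _) = fun y : T => (expR (n%:R * (v * tb)))%:E * (expR (inner (- v *: th)%R y))%:E); last first.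
    by apply/funext => y; rewrite -EFinM -expRD innerZ; congr (expR _)%:E; ring.
  rewrite integralZT ?expR_ge0//; last exact: measurable_expinner.
  rewrite -/(mgf _ _) mgf_twisted_law (kap_ray f vI) expR_expe -EFinM -expRD.
  by congr (expR _)%:E; rewrite -/th -/tb; ring.
have IW1 : \int[q]_y (W y)%:E = (expR (n%:R * ms))%:E by apply: IW; lra.
have IW2 : \int[q]_y ((W y) ^+ 2)%:E <= k%:E.
  rewrite (_ : (fun y => _) = fun y : T => (expR (- (2 * s) * (inner th y - n%:R * tb)))%:E); last first.
    by apply/funext => y; rewrite /W -expRM_natr; congr (expR _)%:E; ring.
  by rewrite IW ?lee_fin ?ler_expR ?ler_pM2l ?ltr0n//; lra.
pose dl := q (~` A).
have IA : \int[q]_y (\1_(~` A) y)%:E = dl by rewrite integral_indic ?setIT//; exact: measurableC.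
have mIA : measurable_fun setT (fun y : T => (\1_(~` A) y : R)%:E).
  by apply/measurable_EFinP; apply: measurable_indic; exact: measurableC.
have mW2 : measurable_fun setT (fun y : T => ((W y) ^+ 2)%:E).
  by apply/measurable_EFinP; exact: measurable_funX.
have k4 : (0 <= (4 * k)^-1)%R by rewrite invr_ge0 mulr_ge0// ltW.
pose U (y : T) : \bar R := cst 1 y + (k%:E * (\1_(~` A) y)%:E + ((4 * k)^-1)%:E * ((W y) ^+ 2)%:E).
have IU : \int[q]_y U y = 1 + (k%:E * dl + ((4 * k)^-1)%:E * \int[q]_y ((W y) ^+ 2)%:E).
  rewrite /U integralDT//; first last.
  - move=> y; apply: adde_ge0; apply: mule_ge0; rewrite lee_fin// ?sqr_ge0//; exact: ltW.
  - by apply: emeasurable_funD; apply: emeasurable_funM.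
  rewrite integral_cst// mul1e q1 integralDT//; first last.
  - by move=> y; apply: mule_ge0; rewrite lee_fin ?sqr_ge0.
  - by move=> y; apply: mule_ge0; rewrite lee_fin//; exact: ltW.
  - exact: emeasurable_funM.
  - exact: emeasurable_funM.
  rewrite integralZT//; last exact: ltW.
  by rewrite integralZT ?IA// => y; rewrite lee_fin sqr_ge0.
have WU : \int[q]_y (W y)%:E <= \int[q]_y U y.
  apply: ae_ge0_le_integral => //.
  - by move=> y _; rewrite lee_fin expR_ge0.
  - exact/measurable_EFinP.
  - move=> y _; apply: adde_ge0 => //; apply: adde_ge0; apply: mule_ge0; rewrite lee_fin// ?sqr_ge0//; exact: ltW.
  - by apply: emeasurable_funD => //; apply: emeasurable_funD; apply: emeasurable_funM.
  apply: filterS (twisted_complementarity t0 lam0 r0 opt twisted f n0) => y H _.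
  rewrite /U indicE; case: (boolP (y \in _)) => [|yA].
    move=> _; rewrite mule1 -EFinM -!EFinD lee_fin /=.
    have : ((4 * k)^-1 * (W y) ^+ 2 = (W y - 2 * k) ^+ 2 / (4 * k) + W y - k)%R by field; rewrite gt_eqF.
    have : (0 <= (W y - 2 * k) ^+ 2 / (4 * k))%R by rewrite mulr_ge0 ?sqr_ge0.
    by lra.
  have yA' : A y by move: yA; rewrite notin_setE => /contrapT.
  rewrite mule0 add0e -EFinM -EFinD lee_fin /=.
  have W1 : (W y <= 1)%R.
    rewrite /W -[leRHS]expR0 ler_expR; have := H yA'; rewrite -/th -/tb => Hy.
    by have := ler_wpM2l (ltW s0) Hy; lra.
  by apply: (le_trans W1); rewrite lerDl mulr_ge0 ?sqr_ge0.
have dlfin : dl \is a fin_num.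
  have dl0 : 0 <= dl by exact: measure_ge0.
  rewrite ge0_fin_numE//; apply: (@le_lt_trans _ _ (q setT)); last by rewrite q1 ltry.
  by apply: le_measure; rewrite ?inE//; exact: measurableC.
rewrite -/A -/dl; move: WU dlfin; rewrite IU IW1; clear IA IU; clearbody dl; case: dl => [x||]// H _.
have {}H : (expR (n%:R * ms) <= 1 + (k * x + 4^-1))%R.
  rewrite -lee_fin; apply: le_trans H _; rewrite !EFinD !EFinM.
  apply: leeD => //; apply: leeD => //.
  apply: le_trans (lee_wpmul2l _ IW2) _; first by rewrite lee_fin.
  by rewrite -EFinM lee_fin invfM -mulrA mulVf ?mulr1// gt_eqF.
rewrite lee_fin expRN -/k -(ler_pM2l k0).
have -> : (k * (k^-1 / 2) = 2^-1)%R by rewrite mulrA mulfV ?mul1r// gt_eqF.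
by have := expR_ge1Dx (n%:R * ms); lra.
Unshelve. all: by end_near. Qed.

End Escape.

End Escape.
Export Escape.

(** * Truncated tilts of the jump measure *)

Module Tilt.
Local Open Scope ereal_scope.

Lemma exp_eseries (R : realType) (x : R) : \sum_(0 <= k <oo) (exp_coeff x k)%:E = (expR x)%:E.
Proof.
apply: cvg_lim => //; rewrite (_ : (fun n => _) = EFin \o series (exp_coeff x)); last first.
  by apply/funext => n /=; rewrite sumEFin.
apply: cvg_EFin; first by apply: nearW.
exact: is_cvg_series_exp_coeff.
Qed.

Section Tilt.
Context {R : realType} {L : nat}.
Local Notation T := (borelV R L).
Variables (nu : {finite_measure set T -> \bar R}) (th : 'cV[R]_L) (K : R).

(** A continuous compactly supported minorant of the constant 1. *)
Definition cutoff (y : T) : R :=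
  (Num.max 0 (Num.min 1 (K - \sum_(l < L) `|(y : 'rV[R]_L) ord0 l|)))%R.

Lemma measurable_cutoff : measurable_fun setT cutoff.
Proof.
apply: measurable_maxr => //; apply: measurable_minr => //; apply: measurable_funB => //.
by apply: measurable_sum => l; apply: measurableT_comp => //; exact: measurable_coordV.
Qed.

Lemma cutoff_ge0 y : (0 <= cutoff y)%R. Proof. by rewrite /cutoff le_max lexx. Qed.

Lemma cutoff_le1 y : (cutoff y <= 1)%R.
Proof. by rewrite /cutoff ge_max ler01/= ge_min lexx. Qed.

Lemma cutoff_support y : (K < \sum_(l < L) `|(y : 'rV[R]_L) ord0 l|)%R -> cutoff y = 0%R.
Proof.
move=> yK; rewrite /cutoff; apply/max_idPl.
by rewrite ge_min subr_le0 (ltW yK) orbT.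
Qed.

Definition tilt_density (y : T) : R := (cutoff y * expR (inner th y))%R.

Lemma measurable_tilt_density : measurable_fun setT (EFin \o tilt_density).
Proof.
apply/measurable_EFinP; apply: measurable_funM; first exact: measurable_cutoff.
by apply: measurableT_comp => //; exact: measurable_inner.
Qed.

Lemma tilt_density_ge0 y : 0 <= (EFin \o tilt_density) y.
Proof. by rewrite lee_fin mulr_ge0 ?cutoff_ge0 ?expR_ge0. Qed.

Definition tilted : set T -> \bar R := density nu measurable_tilt_density tilt_density_ge0.

HB.instance Definition _ := Measure.on tilted.

Lemma integral_tilted (g : T -> \bar R) : measurable_fun setT g -> (forall y, 0 <= g y) ->
  \int[tilted]_y g y = \int[nu]_y ((tilt_density y)%:E * g y).
Proof. exact: integral_density. Qed.

Definition norm1 (v : 'cV[R]_L) : R := (\sum_(l < L) `|v l ord0|)%R.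

Lemma support_inner (v : 'cV[R]_L) (y : T) :
  (\sum_(l < L) `|(y : 'rV[R]_L) ord0 l| <= K)%R -> (`|inner v y| <= norm1 v * K)%R.
Proof.
move=> yK; apply: le_trans (ler_norm_sum _ _ _) _; rewrite /norm1 mulr_suml.
apply: ler_sum => l _; rewrite normrM ler_wpM2l//; apply: le_trans yK.
by rewrite (bigD1 l)//= lerDl sumr_ge0.
Qed.

Lemma tilt_density_le y : (tilt_density y <= expR (norm1 th * K))%R.
Proof.
rewrite /tilt_density; have [yK|/cutoff_support ->] := leP (\sum_(l < L) `|(y : 'rV[R]_L) ord0 l|)%R K.
  rewrite -[leRHS]mul1r; apply: ler_pM; rewrite ?cutoff_ge0 ?expR_ge0 ?cutoff_le1// ler_expR.
  exact: le_trans (ler_norm _) (support_inner _ yK).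
by rewrite mul0r expR_ge0.
Qed.

Lemma tilted_fin : fin_num_fun tilted.
Proof.
apply: lty_fin_num_fun.
rewrite [X in X < _](_ : _ = \int[tilted]_y cst 1 y); last by rewrite integral_cst// mul1e.
rewrite integral_tilted//.
apply: (@le_lt_trans _ _ (\int[nu]_y cst (expR (norm1 th * K))%:E y)).
  apply: le_integralT => //.
  - by apply: emeasurable_funM => //; exact: measurable_tilt_density.
  - by move=> y; rewrite mule1; exact: tilt_density_ge0.
  by move=> y; rewrite mule1 lee_fin tilt_density_le.
by rewrite integral_cst// lte_mul_pinfty ?lee_fin ?expR_ge0// -ge0_fin_numE// fin_num_measure.
Qed.

HB.instance Definition _ := Measure_isFinite.Build _ _ _ tilted tilted_fin.

(** The exponential weights multiply over the jumps and cancel; the cutoffs are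
    at most 1. *)
Lemma cpow_tilted_le k (g : T -> \bar R) : measurable_fun setT g -> (forall y, 0 <= g y) ->
  \int[cpow tilted k]_y ((expR (- inner th y))%:E * g y) <= \int[cpow nu k]_y g y.
Proof.
have me : measurable_fun setT (fun y : T => (expR (- inner th y))%:E).
  by apply/measurable_EFinP; do 2 apply: measurableT_comp => //; exact: measurable_inner.
elim: k g => [|k IH] g mg g0.
  rewrite !integral_cpow0//; last exact: emeasurable_funM.
  by rewrite /zeroV (_ : inner th _ = 0%R) ?oppr0 ?expR0 ?mul1e// /inner big1// => l _; rewrite mxE mulr0.
have g'0 y : 0 <= (expR (- inner th y))%:E * g y by rewrite mule_ge0// lee_fin expR_ge0.
rewrite !integral_cpowS//; last exact: emeasurable_funM.
pose G x := \int[cpow nu k]_y g (addV (x, y)).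
have mgx x : measurable_fun setT (fun y => g (addV (x, y))).
  by apply: (measurableT_comp mg); apply: (measurableT_comp measurable_addV); exact: measurable_fun_pair.
have mG : measurable_fun setT G.
  apply: (@measurable_fun_fubini_tonelli_F _ _ T T R (cpow nu k) (g \o addV)).
    by apply: measurableT_comp => //; exact: measurable_addV.
  by move=> z; exact: g0.
have G0 x : 0 <= G x by apply: integral_ge0.
apply: (@le_trans _ _ (\int[tilted]_x ((expR (- inner th x))%:E * G x))).
  apply: le_integralT.
  - apply: (@measurable_fun_fubini_tonelli_F _ _ T T R (cpow tilted k) ((fun y => (expR (- inner th y))%:E * g y) \o addV)).
      by apply: measurableT_comp; [exact: emeasurable_funM|exact: measurable_addV].
    by move=> z; exact: g'0.
  - exact: emeasurable_funM.
  - by move=> x; apply: integral_ge0.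
  move=> x; rewrite (_ : (fun y => _) = fun y => (expR (- inner th x))%:E * ((expR (- inner th y))%:E * g (addV (x, y)))); last first.
    by apply/funext => y; rewrite mgf_addV opprD expRD EFinM muleA.
  rewrite integralZT//; last 2 first.
  - exact: emeasurable_funM.
  - by move=> y; rewrite mule_ge0// lee_fin expR_ge0.
  by apply: lee_wpmul2l; [rewrite lee_fin expR_ge0|exact: IH].
rewrite integral_tilted; last 2 first.
- exact: emeasurable_funM.
- by move=> x; rewrite mule_ge0// lee_fin expR_ge0.
apply: le_integralT => //.
- by apply: emeasurable_funM; [exact: measurable_tilt_density|exact: emeasurable_funM].
- by move=> x; apply: mule_ge0; [exact: tilt_density_ge0|rewrite mule_ge0// lee_fin expR_ge0].
move=> x; rewrite muleA -EFinM /tilt_density -mulrA -expRD addrN expR0 mulr1.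
by rewrite -[leRHS]mul1e lee_wpmul2r// lee_fin cutoff_le1.
Qed.

End Tilt.

Section CompoundPoisson.
Context {R : realType} {L : nat}.
Local Notation T := (borelV R L).
Variables (nu : {finite_measure set T -> \bar R}) (th : 'cV[R]_L) (K : R).
Hypothesis nu_ge0 : {ae nu, forall y : T, forall l, (0 <= (y : 'rV[R]_L) ord0 l)%R}.
Local Notation eta := (tilted nu th K).

Definition tilt_mass : R := fine (eta setT).

Definition centroid : 'rV[R]_L := \row_l fine (\int[nu]_y ((y : 'rV[R]_L) ord0 l * tilt_density th K y)%:E).

Let eta_setT : eta setT = tilt_mass%:E.
Proof. by rewrite /tilt_mass fineK// fin_num_measure. Qed.

Lemma tilt_mass_ge0 : (0 <= tilt_mass)%R. Proof. exact: fine_ge0. Qed.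

Lemma tilted_ge0 : {ae eta, forall y : T, forall l, (0 <= (y : 'rV[R]_L) ord0 l)%R}.
Proof.
case: nu_ge0 => A [mA A0 h]; exists A; split => //.
apply/eqP; rewrite -measure_le0 [leLHS](_ : _ = \int[eta]_y (\1_A y)%:E); last by rewrite integral_indic ?setIT.
have mI : measurable_fun setT (fun y => (\1_A y : R)%:E) by apply/measurable_EFinP; exact: measurable_indic.
rewrite integral_tilted//.
apply: (@le_trans _ _ (\int[nu]_y ((expR (norm1 th * K))%:E * (\1_A y)%:E))).
  apply: le_integralT.
  - by apply: emeasurable_funM => //; exact: measurable_tilt_density.
  - exact: emeasurable_funM.
  - by move=> y; apply: mule_ge0; [exact: tilt_density_ge0|rewrite lee_fin].
  - by move=> y; apply: lee_wpmul2r; rewrite lee_fin// tilt_density_le.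
rewrite integralZT//.
by rewrite integral_indic// setIT [X in _ * X](_ : _ = 0) ?mule0//; exact: A0.
Qed.

Lemma cpow_tilted_ge0 k : {ae cpow eta k, forall y : T, forall l, (0 <= (y : 'rV[R]_L) ord0 l)%R}.
Proof.
apply: (@negligibleS _ _ _ _ (~` orthant 0%R : set T)).
  by move=> y /= h yA; apply: h => l; have := yA l; rewrite mxE.
apply/negligibleP; first by apply: measurableC; exact: measurable_orthant.
apply: (@laplace_bounded_nonneg _ _ _ (tilt_mass ^+ k)%R) => l j.
rewrite laplaceE mgf_cpow EFin_expe; apply: lee_pexp; first exact: mgf_ge0.
rewrite -eta_setT -mgf0 /mgf; apply: ae_ge0_le_integral => //; try exact: measurable_expinner.
apply: filterS tilted_ge0 => y y0 _; rewrite lee_fin ler_expR innerN inner_delta.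
have -> : inner (0 : 'cV[R]_L)%R y = 0%R by rewrite /inner big1// => i _; rewrite mxE mul0r.
by rewrite oppr_le0 mulr_ge0.
Qed.

Lemma mgf_tilted_fin v : mgf eta v \is a fin_num.
Proof.
rewrite ge0_fin_numE ?mgf_ge0// /mgf integral_tilted; [|exact: measurable_expinner|by move=> y; rewrite lee_fin expR_ge0].
apply: (@le_lt_trans _ _ (\int[nu]_y cst (expR (norm1 (v + th) * K))%:E y)).
  apply: le_integralT => //.
  - by apply: emeasurable_funM; [exact: measurable_tilt_density|exact: measurable_expinner].
  - by move=> y; apply: mule_ge0; [exact: tilt_density_ge0|rewrite lee_fin expR_ge0].
  move=> y; rewrite -EFinM lee_fin; apply: le_trans (tilt_density_le _ _ y).
  by rewrite /tilt_density -mulrA -expRD addrC innerD.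
by rewrite integral_cst// lte_mul_pinfty ?lee_fin ?expR_ge0// -ge0_fin_numE// fin_num_measure.
Qed.

(** The centroid is the derivative at the origin; the cutoff bounds the second
    order term. *)
Lemma chernoff_slope (v : 'cV[R]_L) (x : R) : (inner v centroid < x)%R ->
  exists2 tau0 : R, (0 < tau0)%R & forall tau, (0 < tau)%R -> (tau <= tau0)%R ->
    (fine (mgf eta (tau *: v)%R) < tilt_mass + tau * x)%R.
Proof.
move=> vx.
have K0 := normr_ge0 K.
pose B := (norm1 v * `|K|)%R.
have B0 : (0 <= B)%R by rewrite mulr_ge0// sumr_ge0.
pose D := (B ^+ 2 * expR B * tilt_mass)%R.
have D0 : (0 <= D)%R by apply: mulr_ge0; [rewrite mulr_ge0 ?sqr_ge0 ?expR_ge0|exact: tilt_mass_ge0].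
have mtd : measurable_fun setT (tilt_density th K).
  by apply/measurable_EFinP; exact: measurable_tilt_density.
have td0 y : (0 <= tilt_density th K y)%R by have := tilt_density_ge0 th K y; rewrite lee_fin.
have itd (g : T -> R) M : measurable_fun setT g -> (forall y, `|g y| <= M)%R -> nu.-integrable setT (EFin \o g).
  move=> mg gM; apply: measurable_bounded_integrable => //.
    by rewrite -ge0_fin_numE// fin_num_measure.
  by exists M; split; [exact: num_real|move=> M' /ltW MM y _; apply: le_trans MM].
have suppB y : (tilt_density th K y != 0)%R -> (`|inner v y| <= B)%R.
  rewrite /tilt_density; have [yK _|/cutoff_support ->] := leP (\sum_(l < L) `|(y : 'rV[R]_L) ord0 l|)%R K; last by rewrite mul0r eqxx.
  apply: le_trans (support_inner v yK) _; apply: ler_wpM2l; [exact: sumr_ge0|exact: ler_norm].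
have mv : measurable_fun setT (fun y : T => inner v y) by exact: measurable_inner.
have I1 : nu.-integrable setT (EFin \o (fun y => inner v y * tilt_density th K y)%R).
  apply: (itd _ (B * expR (norm1 th * K))%R); first exact: measurable_funM.
  move=> y; rewrite normrM (ger0_norm (td0 y)).
  have [->|h] := eqVneq (tilt_density th K y) 0%R; first by rewrite mulr0 mulr_ge0// expR_ge0.
  by apply: ler_pM => //; [exact: suppB|exact: tilt_density_le].
have E1 : \int[nu]_y (inner v y * tilt_density th K y)%:E = (inner v centroid)%:E.
  have Il l : nu.-integrable setT (fun y : T => ((y : 'rV[R]_L) ord0 l * tilt_density th K y)%:E).
    apply: (itd _ (`|K| * expR (norm1 th * K))%R).
      by apply: measurable_funM => //; exact: measurable_coordV.
    move=> y; rewrite normrM (ger0_norm (td0 y)).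
    have [yK|/cutoff_support yK] := leP (\sum_(l < L) `|(y : 'rV[R]_L) ord0 l|)%R K; last first.
      by rewrite /tilt_density yK mul0r mulr0 mulr_ge0// expR_ge0.
    apply: ler_pM => //; last exact: tilt_density_le.
    apply: le_trans (ler_norm K); apply: le_trans yK.
    by rewrite (bigD1 l)//= lerDl sumr_ge0.
  transitivity (\sum_(l < L) (v l ord0 * centroid ord0 l)%:E); last by rewrite sumEFin.
  transitivity (\int[nu]_y (\sum_(l < L) (v l ord0)%:E * ((y : 'rV[R]_L) ord0 l * tilt_density th K y)%:E)).
    apply: eq_integral => y _; rewrite /inner mulr_suml -sumEFin.
    by apply: eq_bigr => l _; rewrite -mulrA EFinM.
  rewrite integral_sum//; last by move=> l; apply: integrableZl.
  apply: eq_bigr => l _; rewrite integralZl// EFinM mxE fineK//.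
  exact: integrable_fin_num.
have I0 : nu.-integrable setT (EFin \o tilt_density th K).
  by apply: (itd _ (expR (norm1 th * K))%R) => // y; rewrite ger0_norm// tilt_density_le.
have E0 : \int[nu]_y (tilt_density th K y)%:E = tilt_mass%:E.
  rewrite -eta_setT [RHS](_ : _ = \int[eta]_y cst 1 y); last by rewrite integral_cst// mul1e.
  by rewrite integral_tilted//; apply: eq_integral => y _; rewrite mule1.
have bound tau : (0 < tau)%R -> (tau <= 1)%R ->
    (fine (mgf eta (tau *: v)%R) <= tilt_mass + tau * inner v centroid + tau ^+ 2 * D)%R.
  move=> tau0 tau1; rewrite -lee_fin fineK ?mgf_tilted_fin//.
  rewrite /mgf integral_tilted; [|exact: measurable_expinner|by move=> y; rewrite lee_fin expR_ge0].
  have -> : (tilt_mass + tau * inner v centroid + tau ^+ 2 * D)%:E =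
      \int[nu]_y ((tilt_density th K y)%:E + (tau%:E * (inner v y * tilt_density th K y)%:E +
        (tau ^+ 2 * (B ^+ 2 * expR B))%:E * (tilt_density th K y)%:E)).
    rewrite integralD//; [|exact: integrableD (integrableZl _ _ _) (integrableZl _ _ _)].
    rewrite integralD//; [|exact: integrableZl|exact: integrableZl].
    rewrite integralZl// integralZl// E0 E1 -!EFinM -!EFinD.
    by congr EFin; rewrite /D; ring.
  apply: le_integral => //.
  - apply: (itd (fun y => tilt_density th K y * expR (inner (tau *: v)%R y))%R (expR (norm1 (tau *: v + th)%R * K))).
      by apply: measurable_funM => //; apply: measurableT_comp => //; exact: measurable_inner.
    move=> y; rewrite (ger0_norm (mulr_ge0 (td0 y) (expR_ge0 _))); apply: le_trans (tilt_density_le _ _ y).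
    by rewrite /tilt_density -mulrA -expRD addrC innerD.
  - by apply: integrableD => //; apply: integrableD => //; apply: integrableZl.
  move=> y _; rewrite -!EFinM -!EFinD lee_fin innerZ.
  have [->|h] := eqVneq (tilt_density th K y) 0%R; first by rewrite !(mulr0, mul0r) !addr0.
  have vB := suppB y h; have Q := expR_quadratic (tau * inner v y)%R.
  have Q2 : ((tau * inner v y) ^+ 2 * expR `|tau * inner v y| <= tau ^+ 2 * (B ^+ 2 * expR B))%R.
    rewrite exprMn -mulrA; apply: ler_wpM2l; first exact: sqr_ge0.
    apply: ler_pM; rewrite ?sqr_ge0 ?expR_ge0//.
      by rewrite -[(inner v y ^+ 2)%R]real_normK ?num_real// ler_sqr ?nnegrE.
    rewrite ler_expR normrM gtr0_norm//; apply: le_trans vB; exact: ler_piMl.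
  have := ler_wpM2l (td0 y) (le_trans Q (lerD (lexx _) Q2)); lra.
pose s := (x - inner v centroid)%R.
have s0 : (0 < s)%R by rewrite subr_gt0.
have D1 : (0 < D + 1)%R by rewrite ltr_wpDl.
exists (Num.min 1%R (s / (D + 1))%R); first by rewrite lt_min ltr01 divr_gt0.
move=> tau tau0; rewrite le_min => /andP[tau1]; rewrite ler_pdivlMr// => ts.
apply: le_lt_trans (bound tau tau0 tau1) _.
have : (tau * (tau * D) < tau * (x - inner v centroid))%R by rewrite ltr_pM2l//; move: ts; rewrite /s; lra.
by lra.
Qed.

End CompoundPoisson.

End Tilt.
Export Tilt.

(** * Lower bound along a path *)

Module Lower.
Local Open Scope ereal_scope.

Section Lower.
Context {R : realType} {L d : nat} {t : R}.
Local Notation T := (borelV R L).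
Local Notation X := (bpath d t).
Local Notation St := 'I_d.+1.
Variables (lam : St -> R) (mu : St -> probability T R) (r : St -> 'M[R]_L) (a : 'rV[R]_L)
  (bs : X -> 'rV[R]_L) (ths : X -> 'cV[R]_L) (kap : R.-pker X ~> T).
Hypotheses (t0 : (0 < t)%R) (lam0 : forall j, (0 < lam j)%R).
Hypothesis mu_ge0 : forall j, {ae mu j, forall x : T, forall l, (0 <= (x : 'rV[R]_L) ord0 l)%R}.
Hypothesis r0 : forall j i i', (0 <= r j i i')%R.
Hypothesis opt : forall f, optimizers lam mu r a f (bs f) (ths f).
Hypothesis mths : forall l, measurable_fun setT (fun f => ths f l ord0).
Hypothesis twisted : twisted_kernel lam mu r ths kap.
Local Notation path_prob := (Model.path_prob t0 lam0 r0 opt mths twisted).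
Local Notation nu := (@path_levy R L d t lam mu r r0).

Let nu_lty f : nu f setT < +oo. Proof. by rewrite (nu_fin mu lam0 r0) ltry. Qed.

Definition jump_measure f : {finite_measure set T -> \bar R} := restrict_fin measurableT (nu_lty f).

Lemma integral_jump f (g : T -> \bar R) : measurable_fun setT g -> (forall y, 0 <= g y) ->
  \int[jump_measure f]_y g y = \int[nu f]_y g y.
Proof. exact: integral_restrict_fin. Qed.

Lemma mgf_jump f v : mgf (jump_measure f) v = mgf (nu f) v.
Proof. by rewrite /mgf integral_jump//; exact: measurable_expinner. Qed.

Lemma jump_ge0 f : {ae jump_measure f, forall y : T, forall l, (0 <= (y : 'rV[R]_L) ord0 l)%R}.
Proof.
have [A [mA A0 h]] := path_levy_ge0 t0 lam0 mu_ge0 r0 f; exists A; split => //.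
have E : jump_measure f A = nu f (A `&` setT) by [].
by rewrite E setIT.
Qed.

Local Notation c := (path_mass lam).

Definition poisson_weight (f : X) (n k : nat) : R := (expR (- (n%:R * c f)) * exp_coeff n%:R k)%R.

Lemma poisson_weight_ge0 f n k : (0 <= poisson_weight f n k)%R.
Proof. by rewrite mulr_ge0 ?expR_ge0// /exp_coeff divr_ge0// exprn_ge0. Qed.

Lemma poisson_weight_sum f n (A q : R) : (0 <= A)%R -> (0 <= q)%R ->
  \sum_(0 <= k <oo) (poisson_weight f n k * (A * q ^+ k))%:E = (expR (- (n%:R * c f)) * A * expR (n%:R * q))%:E.
Proof.
move=> A0 q0; rewrite EFinM -exp_eseries -nneseriesZl; last first.
  by move=> k _; rewrite lee_fin /exp_coeff divr_ge0// exprn_ge0// mulr_ge0.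
apply: eq_eseriesr => k _; rewrite -EFinM /poisson_weight /exp_coeff /=; congr EFin.
by rewrite exprMn; ring.
Qed.

Definition cpoisson f n : {measure set T -> \bar R} :=
  mseries (fun k => mscale (NngNum (poisson_weight_ge0 f n k)) (cpow (jump_measure f) k)) 0%N.

Lemma integral_cpoisson f n (g : T -> \bar R) : measurable_fun setT g -> (forall y, 0 <= g y) ->
  \int[cpoisson f n]_y g y =
    \sum_(0 <= k <oo) (poisson_weight f n k)%:E * \int[cpow (jump_measure f) k]_y g y.
Proof.
move=> mg g0; rewrite ge0_integral_measure_series//.
by apply: eq_eseriesr => k _; rewrite ge0_integral_mscale.
Qed.

(** The law of the storage given the path is the Poisson mixture of the
    convolution powers of the jump measure, as both have the same Laplace
    transform. *)
Lemma path_prob_series n f :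
  path_prob n f = \sum_(0 <= k <oo) (poisson_weight f n k)%:E * cpow (jump_measure f) k (scaled a n).
Proof.
rewrite /Model.path_prob /scaled.
have lap (th : 'cV[R]_L) : (forall l, (0 <= th l ord0)%R) ->
    laplace (storage_law t0 lam0 r0 opt mths twisted n f) th =
    (expR (- (n%:R * laplace_exponent lam mu r th f)))%:E.
  move=> h0; rewrite laplaceE mgf_storage_law (Mf_laplace t0 lam0 mu_ge0 r0 f h0) expR_expe.
  by rewrite mulrN.
rewrite (@laplace_unique R L _ (cpoisson f n) 1%R).
- have -> : cpoisson f n (orthant (n%:R *: a)%R) = \int[cpoisson f n]_y (\1_(orthant (n%:R *: a)%R) y)%:E.
    by rewrite integral_indic ?setIT//; exact: measurable_orthant.
  rewrite integral_cpoisson//; last by apply/measurable_EFinP; apply: measurable_indic; exact: measurable_orthant.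
  by apply: eq_eseriesr => k _; rewrite integral_indic ?setIT//; exact: measurable_orthant.
- move=> th h0; rewrite lap// laplaceE /mgf integral_cpoisson; last 2 first.
  + exact: measurable_expinner.
  + by move=> y; rewrite lee_fin expR_ge0.
  have := laplace_exponentE t0 lam0 mu_ge0 r0 h0 f; rewrite -mgf_jump.
  have := mgf_ge0 (jump_measure f) (- th)%R.
  case E : (mgf _ _) => [q||]//=; rewrite lee_fin => q0; rewrite -EFinB => -[qE].
  rewrite (eq_eseriesr (g := fun k => (poisson_weight f n k * (1 * q ^+ k))%:E)); last first.
    by move=> k _; rewrite -/(mgf _ _) mgf_cpow E -EFin_expe EFinM mul1r.
  rewrite poisson_weight_sum// mulr1 -expRD; congr (expR _)%:E.
  by have -> : q = (c f - laplace_exponent lam mu r th f)%R by [lra|]; ring.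
- move=> th h0; rewrite lap// lee_fin -expR0 ler_expR oppr_le0 mulr_ge0//.
  exact: laplace_exponent_ge0.
Qed.

Section Bound.
Variables (f : X) (th : 'cV[R]_L) (K s beta : R).
Local Notation eta := (tilted (jump_measure f) th K).
Local Notation tot := (tilt_mass (jump_measure f) th K).
Local Notation ctr := (centroid (jump_measure f) th K).
Hypothesis s1 : (1 <= s)%R.
Hypothesis interior : forall l, (0 < a ord0 l)%R -> (a ord0 l < s * ctr ord0 l)%R.
Hypothesis beta_gt : (s * inner th ctr < beta)%R.

Let s0 : (0 < s)%R. Proof. exact: lt_le_trans s1. Qed.
Let C : R := (expR 1 * (s * tot) + 1)%R.
Let m (v : 'cV[R]_L) : R := fine (mgf eta v).

Let mE v : mgf eta v = (m v)%:E.
Proof. by rewrite fineK// mgf_tilted_fin. Qed.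

Let m_ge0 v : (0 <= m v)%R.
Proof. by rewrite fine_ge0// mgf_ge0. Qed.

Let m0 : m 0%R = tot. Proof. by rewrite /m mgf0. Qed.

(* The test exponents: one for every constraint of the orthant, one for the
   weight of the tilt. *)
Let tests : exists (V : option 'I_L -> 'cV[R]_L) (x : option 'I_L -> R),
  (forall i, (s * m (V i) < s * tot + x i)%R) /\
  forall n y, (forall l, (0 <= (y : 'rV[R]_L) ord0 l)%R) -> (forall i, (inner (V i) y < n%:R * x i)%R) ->
    scaled a n y /\ (inner th y <= n%:R * beta)%R.
Proof.
have H i : exists V x, (s * m V < s * tot + x)%R /\
    forall n (y : 'rV[R]_L), (forall l, (0 <= y ord0 l)%R) -> (inner V y < n%:R * x)%R ->
      (if i is Some l then (n%:R * a ord0 l <= y ord0 l)%R else (inner th y <= n%:R * beta)%R).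
  case: i => [l|].
    have [al|al] := leP (a ord0 l) 0%R.
      exists 0%R, 1%R; split; first by rewrite m0 ltrDl.
      by move=> n y y0 _; apply: le_trans (y0 l); rewrite mulr_ge0_le0.
    have := @chernoff_slope R L (jump_measure f) th K (- 1 *: delta_mx l ord0)%R (- a ord0 l / s)%R.
    rewrite inner_delta ltr_pdivlMr// => /(_ _)/wrap[]; first by have := interior al; lra.
    move=> [tau tau0 /(_ tau tau0 (lexx _)) H]; exists (tau *: (- 1 *: delta_mx l ord0))%R, (- (tau * a ord0 l))%R; split.
      rewrite -(ltr_pM2l s0) in H; apply: lt_le_trans H _; rewrite mulrDr lerD2l.
      by rewrite mulrCA [(s * _)%R]mulrC divfK ?gt_eqF// mulrN.
    move=> n y y0; rewrite innerZ inner_delta => h; apply: ltW.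
    by rewrite -(ltr_pM2l tau0); lra.
  have := @chernoff_slope R L (jump_measure f) th K th (beta / s)%R.
  rewrite ltr_pdivlMr// mulrC => /(_ beta_gt)[tau tau0 /(_ tau tau0 (lexx _)) H].
  exists (tau *: th)%R, (tau * beta)%R; split.
    rewrite -(ltr_pM2l s0) in H; apply: lt_le_trans H _; rewrite mulrDr lerD2l.
    by rewrite mulrCA [(s * _)%R]mulrC divfK ?gt_eqF.
  by move=> n y y0; rewrite innerZ mulrCA ltr_pM2l// => /ltW.
pose V i := sval (cid (H i)); pose xx i := sval (cid (svalP (cid (H i)))).
have VP i := svalP (cid (svalP (cid (H i)))).
exists V, xx; split => [i|n y y0 h]; first by have [] := VP i.
split; last by have [_ /(_ n y y0)] := VP None; apply; exact: (h None).
by move=> l; rewrite mxE; have [_ /(_ n y y0)] := VP (Some l); apply; exact: (h (Some l)).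
Qed.

(** The number of jumps is kept below [C n] and Chernoff bounds control each
    constraint and the weight of the tilt; inflating the tilted measure by [s]
    moves its mean from the boundary into the interior of the orthant. The term
    with [ln s] is the price of the inflation. *)
Lemma path_prob_lower : \forall n \near \oo,
  (expR (n%:R * (- c f + s * tot - beta - C * ln s)) / 2)%:E <= path_prob n f.
Proof.
have [V [x [Vx Vtest]]] := tests.
pose gam := Num.min 1%R (\big[Num.min/1%R]_i (s * tot + x i - s * m (V i))%R).
have gam0 : (0 < gam)%R.
  rewrite lt_min ltr01/=; elim/big_ind: _ => // [u v u0 v0|i _]; first by rewrite lt_min u0.
  by rewrite subr_gt0.
have gam_le i : (gam <= s * tot + x i - s * m (V i))%R by rewrite /gam (bigD1 i)//= !ge_min lexx orbT.
have gam1 : (gam <= 1)%R.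
  by rewrite /gam ge_min lexx.
have tot0 : (0 <= tot)%R := tilt_mass_ge0 _ _ _.
have sge0 := ltW s0.
near=> n.
have n0 : (0 < n)%N by near: n; exists 1%N.
have ngam : (2 * (L.+2)%:R <= n%:R * gam)%R.
  rewrite -ler_pdivrMr//; near: n; exact: nbhs_infty_ger.
pose Z := expR (- (n%:R * beta) - n%:R * C * ln s).
have Z0 : (0 <= Z)%R := expR_ge0 _.
have ls0 : (0 <= ln s)%R by rewrite ln_ge0.
have mA : measurable (scaled a n : set T) := measurable_scaled a n.
have ex1 (z : R) : (0 <= z)%R -> (1 <= expR z)%R by move=> ?; rewrite -[leLHS]expR0 ler_expR.
have step k : (Z * (s * tot) ^+ k)%:E <= cpow (jump_measure f) k (scaled a n) +
    ((Z * expR (- (n%:R * C)) * (expR 1 * (s * tot)) ^+ k)%:E +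
     \sum_i (Z * expR (- (n%:R * x i)) * (s * m (V i)) ^+ k)%:E).
  pose q := cpow eta k.
  have sk : (s ^+ k = expR (k%:R * ln s))%R by rewrite expRM_natl lnK.
  have sk0 : (0 <= s ^+ k)%R by rewrite exprn_ge0// ltW.
  have mind : measurable_fun setT (fun y : T => (\1_(scaled a n) y : R)%:E).
    by apply/measurable_EFinP; exact: measurable_indic.
  have mexpn : measurable_fun setT (fun y : T => (expR (- inner th y))%:E).
    by apply/measurable_EFinP; do 2 apply: measurableT_comp => //; exact: measurable_inner.
  have tk : q setT = (tot ^+ k)%:E.
    by rewrite -mgf0 /q mgf_cpow mE m0 EFin_expe.
  have Icst (z : R) : \int[q]_y cst z%:E y = (z * tot ^+ k)%:E.
    by rewrite integral_cst// EFinM; apply: (f_equal (mule _)); exact: tk.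
  pose g1 (y : T) := (expR (- inner th y))%:E * (\1_(scaled a n) y : R)%:E.
  pose g2 (i : option 'I_L) (y : T) := (Z * s ^+ k * expR (- (n%:R * x i)))%:E * (expR (inner (V i) y))%:E.
  have g20 i y : 0 <= g2 i y by rewrite /g2 -EFinM lee_fin !mulr_ge0 ?expR_ge0.
  have mg2 i : measurable_fun setT (g2 i) by apply: emeasurable_funM => //; exact: measurable_expinner.
  have Ig2 i : \int[q]_y g2 i y = (Z * expR (- (n%:R * x i)) * (s * m (V i)) ^+ k)%:E.
    rewrite integralZT ?mulr_ge0 ?expR_ge0//; last exact: measurable_expinner.
    by rewrite -/(mgf _ _) /q mgf_cpow mE -EFin_expe -EFinM exprMn; congr EFin; ring.
  have Ig1 : \int[q]_y g1 y <= cpow (jump_measure f) k (scaled a n).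
    apply: le_trans (cpow_tilted_le _ _ _ _ mind _) _ => [y|]; first by rewrite lee_fin.
    by rewrite integral_indic ?setIT.
  pose A1 : R := (Z * s ^+ k * expR (k%:R - n%:R * C))%R.
  have A10 : (0 <= A1)%R by rewrite !mulr_ge0 ?expR_ge0.
  have g10 y : 0 <= g1 y by rewrite /g1 mule_ge0// lee_fin expR_ge0.
  have main : \int[q]_y cst (Z * s ^+ k)%:E y <= \int[q]_y (g1 y + (cst A1%:E y + \sum_i g2 i y)).
    apply: ae_ge0_le_integral => //.
    - by move=> y _; rewrite lee_fin mulr_ge0.
    - by move=> y _; apply: adde_ge0; [exact: g10|apply: adde_ge0; [rewrite lee_fin|exact: sume_ge0]].
    - apply: emeasurable_funD; first exact: emeasurable_funM.
      by apply: emeasurable_funD => //; exact: emeasurable_sum.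
    apply: filterS (@cpow_tilted_ge0 R L (jump_measure f) th K (jump_ge0 f) k) => y y0 _.
    have S0 : 0 <= \sum_i g2 i y by apply: sume_ge0.
    have [kC|kC] := leP (n%:R * C)%R k%:R.
      rewrite -[leLHS]add0e; apply: leeD => //; rewrite -[leLHS]adde0; apply: leeD => //.
      by rewrite lee_fin /A1 ler_peMr ?mulr_ge0// ex1// subr_ge0.
    have [/existsP[i hi]|/existsPn h] := boolP [exists i, n%:R * x i <= inner (V i) y]%R.
      rewrite -[leLHS]add0e; apply: leeD => //; rewrite -[leLHS]add0e; apply: leeD; first by rewrite lee_fin.
      rewrite (bigD1 i)//= -[leLHS]adde0; apply: leeD; last exact: sume_ge0.
      rewrite /g2 -EFinM lee_fin.
      have -> : (Z * s ^+ k * expR (- (n%:R * x i)) * expR (inner (V i) y) =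
          Z * s ^+ k * expR (inner (V i) y - n%:R * x i))%R by rewrite [in RHS]expRD; ring.
      by rewrite ler_peMr ?mulr_ge0// ex1// subr_ge0.
    have [yA yb] : scaled a n y /\ (inner th y <= n%:R * beta)%R.
      by apply: Vtest => // i; rewrite ltNge; exact: h.
    rewrite -[leLHS]adde0; apply: leeD; last by rewrite adde_ge0// lee_fin.
    rewrite /g1 indicE mem_set// mule1 lee_fin sk /Z -expRD ler_expR.
    have : ((n%:R * C - k%:R) * ln s >= 0)%R by rewrite mulr_ge0// subr_ge0 ltW.
    by lra.
  have -> : (Z * (s * tot) ^+ k)%:E = \int[q]_y cst (Z * s ^+ k)%:E y.
    by rewrite Icst exprMn mulrA.
  apply: le_trans main _; rewrite integralDT; first last.
  - by move=> y; rewrite adde_ge0 ?sume_ge0 ?lee_fin.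
  - exact: g10.
  - by apply: emeasurable_funD => //; exact: emeasurable_sum.
  - exact: emeasurable_funM.
  apply: leeD => //; rewrite integralDT//; first last.
  - by move=> y; exact: sume_ge0.
  - exact: emeasurable_sum.
  rewrite Icst ge0_integral_sum//.
  apply: leeD; last by under eq_bigr do rewrite Ig2.
  rewrite lee_fin /A1 expRD -[expR k%:R](_ : (expR 1) ^+ k = _)%R; last by rewrite -expRM_natl mulr1.
  by rewrite le_eqVlt; apply/orP; left; apply/eqP; rewrite !exprMn; ring.
have W0 k := poisson_weight_ge0 f n k.
have sumle : (expR (- (n%:R * c f)) * Z * expR (n%:R * (s * tot)))%:E <= path_prob n f +
    ((expR (- (n%:R * c f)) * (Z * expR (- (n%:R * C))) * expR (n%:R * (expR 1 * (s * tot))))%:E +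
     \sum_i (expR (- (n%:R * c f)) * (Z * expR (- (n%:R * x i))) * expR (n%:R * (s * m (V i))))%:E).
  rewrite path_prob_series -!poisson_weight_sum ?mulr_ge0 ?expR_ge0//.
  under eq_bigr => i _ do rewrite -poisson_weight_sum ?mulr_ge0 ?expR_ge0 ?(ltW s0)//.
  have a0 k : (0 <= Z * expR (- (n%:R * C)) * (expR 1 * (s * tot)) ^+ k)%R.
    by rewrite !mulr_ge0 ?exprn_ge0 ?expR_ge0 ?mulr_ge0 ?expR_ge0 ?(ltW s0).
  have b0 k i : (0 <= Z * expR (- (n%:R * x i)) * (s * m (V i)) ^+ k)%R.
    by rewrite !mulr_ge0 ?exprn_ge0 ?expR_ge0 ?mulr_ge0 ?(ltW s0).
  rewrite -nneseries_sum; last by move=> i k _; rewrite lee_fin mulr_ge0.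
  rewrite -nneseriesD; first last.
  - by move=> k _ _; apply: sume_ge0 => i _; rewrite lee_fin mulr_ge0.
  - by move=> k _ _; rewrite lee_fin mulr_ge0.
  rewrite -nneseriesD; first last.
  - by move=> k _ _; rewrite adde_ge0 ?sume_ge0// => *; rewrite lee_fin mulr_ge0.
  - by move=> k _ _; rewrite mule_ge0// lee_fin.
  apply: lee_nneseries => k _.
    by move=> _; rewrite lee_fin !mulr_ge0 ?exprn_ge0 ?mulr_ge0 ?(ltW s0).
  have B0 : 0 <= \sum_i (Z * expR (- (n%:R * x i)) * (s * m (V i)) ^+ k)%:E.
    by apply: sume_ge0 => i _; rewrite lee_fin.
  have W0' : 0 <= (poisson_weight f n k)%:E by rewrite lee_fin.
  have := lee_wpmul2l W0' (step k).
  rewrite -EFinM ge0_muleDr ?measure_ge0 ?adde_ge0 ?lee_fin// ge0_muleDr ?lee_fin//.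
  rewrite ge0_sume_distrr; last by move=> i _; rewrite lee_fin.
  by rewrite -EFinM; under eq_bigr do rewrite -EFinM.
set P := path_prob n f in sumle *.
have : 0 <= P by exact: measure_ge0.
clearbody P; case: P sumle => [p sumle P0|_ _|]; [move: sumle P0|by rewrite leey|by []].

rewrite sumEFin -!EFinD !lee_fin => H p0.
pose U := expR (n%:R * (- c f + s * tot - beta - C * ln s)).
have U0 : (0 < U)%R := expR_gt0 _.
have UE : (expR (- (n%:R * c f)) * Z * expR (n%:R * (s * tot)) = U)%R.
  by rewrite /Z -!expRD; congr expR; ring.
have e1 g : (gam <= g)%R -> (expR (- (n%:R * g)) <= (2 * L.+2%:R)^-1)%R.
  move=> gg; apply: (@le_trans _ _ (expR (n%:R * gam))^-1%R).
    by rewrite -expRN ler_expR lerN2 ler_wpM2l.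
  rewrite lef_pV2 ?posrE ?expR_gt0 ?mulr_gt0//.
  by apply: le_trans ngam _; have := expR_ge1Dx (n%:R * gam); lra.
have t1 : (expR (- (n%:R * c f)) * (Z * expR (- (n%:R * C))) * expR (n%:R * (expR 1 * (s * tot))) <= U * (2 * L.+2%:R)^-1)%R.
  have -> : (expR (- (n%:R * c f)) * (Z * expR (- (n%:R * C))) * expR (n%:R * (expR 1 * (s * tot))) =
      U * expR (- (n%:R * (s * tot + 1))))%R.
    by rewrite /Z /U -!expRD; congr expR; rewrite /C; ring.
  by rewrite ler_pM2l//; apply: e1; apply: le_trans gam1 _; rewrite lerDr mulr_ge0// ltW.
have t2 i : (expR (- (n%:R * c f)) * (Z * expR (- (n%:R * x i))) * expR (n%:R * (s * m (V i))) <= U * (2 * L.+2%:R)^-1)%R.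
  have -> : (expR (- (n%:R * c f)) * (Z * expR (- (n%:R * x i))) * expR (n%:R * (s * m (V i))) =
      U * expR (- (n%:R * (s * tot + x i - s * m (V i)))))%R.
    by rewrite /Z /U -!expRD; congr expR; ring.
  by rewrite ler_pM2l//; exact: e1.
have t3 : (\sum_i (expR (- (n%:R * c f)) * (Z * expR (- (n%:R * x i))) * expR (n%:R * (s * m (V i)))) <= L.+1%:R * (U * (2 * L.+2%:R)^-1))%R.
  apply: le_trans (ler_sum _ (fun i _ => t2 i)) _.
  by rewrite sumr_const card_option card_ord -[leLHS]mulr_natl lexx.
rewrite UE in H.
have : (U * (2 * L.+2%:R)^-1 + L.+1%:R * (U * (2 * L.+2%:R)^-1) = U / 2)%R.
  have -> : (L.+2%:R = L.+1%:R + 1 :> R)%R by rewrite -natr1.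
  have : (L.+1%:R + 1 != 0 :> R)%R by rewrite natr1 pnatr_eq0.
  by move: (L.+1%:R : R) => x' x'0; field.
move=> HE; have H2 := lerD t1 t3; rewrite HE in H2.
have {H2 HE t1 t2 t3 H} H3 := le_trans H (lerD (lexx p) H2).
by rewrite -/U; move: (U) H3 => u H3; lra.
Unshelve. all: by end_near. Qed.

End Bound.
End Lower.

End Lower.
Export Lower.

(** * Nearly optimal truncated tilts *)

Module Penalty.
Section Continuity.
Context {R : realType} {U : topologicalType}.

Lemma cont_sum (I : Type) (s : seq I) (f : I -> U -> R) :
  (forall i, continuous (f i)) -> continuous (fun u => \sum_(i <- s) f i u).
Proof. by move=> H u; apply: cvg_sumr => i; exact: H. Qed.

Lemma cont_scale (f : U -> R) k : continuous f -> continuous (fun u => f u * k).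
Proof. by move=> H u; apply: cvgM; [exact: H|exact: cvg_cst]. Qed.

Lemma cont_sqr (f : U -> R) : continuous f -> continuous (fun u => f u ^+ 2).
Proof.
move=> H u; rewrite (_ : (fun u => _) = (fun u => f u * f u)); last by apply/funext => v; rewrite expr2.
by apply: cvgM; exact: H.
Qed.

Lemma cont_dist (f : U -> R) k : continuous f -> continuous (fun u => `|f u - k|).
Proof. by move=> H u; apply: cvg_norm; apply: cvgB; [exact: H|exact: cvg_cst]. Qed.

Lemma contD (f g : U -> R) : continuous f -> continuous g -> continuous (fun u => f u + g u).
Proof. by move=> H1 H2 u; apply: cvgD; [exact: H1|exact: H2]. Qed.

Lemma contB (f g : U -> R) : continuous f -> continuous g -> continuous (fun u => f u - g u).
Proof. by move=> H1 H2 u; apply: cvgB; [exact: H1|exact: H2]. Qed.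

(** Control of the logarithm by a modulus of continuity. *)
Lemma cont_exp_squeeze (g rho : U -> R) (K : R) (u : U) : rho u' @[u' --> u] --> 0 ->
  (forall u', expR (- K * rho u') * g u <= g u' <= expR (K * rho u') * g u) -> g u' @[u' --> u] --> g u.
Proof.
move=> r0 H.
have E k : expR (k * rho u') * g u @[u' --> u] --> g u.
  rewrite -[X in _ --> X]mul1r -expR0 -(mulr0 k); apply: cvgM; last exact: cvg_cst.
  apply: (@cvg_comp _ _ _ (fun u' => k * rho u') expR _ (nbhs (k * 0))); last exact: continuous_expR.
  by apply: cvgM; [exact: cvg_cst|exact: r0].
apply: (squeeze_cvgr _ (E (- K)) (E K)).
by apply: nearW.
Qed.

End Continuity.

Lemma foc_arith (R : realType) (m0 m1 i q t s b w g : R) : 0 < t -> t <= g ->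
  m0 - i + q / 2 <= m1 - (i + t * s * b) + (q + 2 * (t * s) * w + t ^+ 2) / 2 ->
  m1 < m0 + t * (s * (b - w) - g / 2) -> False.
Proof.
move=> t0 tg h1 h2; have : t * g < t * t by rewrite expr2 in h1; lra.
by rewrite ltr_pM2l// ltNge tg.
Qed.

Section Minimise.
Context {R : realType} {L : nat}.
Local Notation T := (borelV R L).
Variables (nu : {finite_measure set T -> \bar R}) (th : 'cV[R]_L) (b : 'rV[R]_L) (N : R).
Hypothesis mgf_th : mgf nu th = N%:E.
Hypothesis optimal : forall v : 'cV[R]_L, ((N + inner v b)%:E <= mgf nu (th + v)%R)%E.

Lemma tilt_mass_integral th' K : (tilt_mass nu th' K)%:E = (\int[nu]_y (tilt_density th' K y)%:E)%E.
Proof.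
by rewrite /tilt_mass fineK ?fin_num_measure.
Qed.

Let mtd th' K : measurable_fun setT (fun y : T => (tilt_density th' K y)%:E : \bar R).
Proof. exact: measurable_tilt_density. Qed.

Let td0 (th' : 'cV[R]_L) K (y : T) : 0 <= tilt_density th' K y.
Proof. by rewrite mulr_ge0 ?cutoff_ge0 ?expR_ge0. Qed.

Lemma tilt_mass_le th1 K1 th2 K2 k : 0 <= k ->
  (forall y, tilt_density th1 K1 y <= k * tilt_density th2 K2 y) ->
  tilt_mass nu th1 K1 <= k * tilt_mass nu th2 K2.
Proof.
move=> k0 H; rewrite -lee_fin EFinM !tilt_mass_integral -integralZT//; last first.
  by move=> y; rewrite lee_fin.
apply: le_integralT => //; first exact: emeasurable_funM.
by move=> y; rewrite lee_fin.
Qed.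

Lemma cutoff_mono K K' (y : T) : K <= K' -> cutoff K y <= cutoff K' y.
Proof.
by move=> KK; rewrite /cutoff ge_max le_max lexx/= le_max le_min !ge_min lexx/= lerD2r KK !orbT.
Qed.

Lemma tilt_mass_mono th' K K' : K <= K' -> tilt_mass nu th' K <= tilt_mass nu th' K'.
Proof.
move=> KK; rewrite -[leRHS]mul1r; apply: tilt_mass_le => // y.
by rewrite mul1r; apply: ler_wpM2r; [exact: expR_ge0|exact: cutoff_mono].
Qed.

Lemma tilt_mass_ratio th1 th2 K : 
  tilt_mass nu th1 K <= expR (norm1 (th1 - th2) * K) * tilt_mass nu th2 K.
Proof.
apply: tilt_mass_le; first exact: expR_ge0.
move=> y; rewrite /tilt_density.
have [yK|/cutoff_support ->] := leP (\sum_(l < L) `|(y : 'rV[R]_L) ord0 l|) K; last by rewrite !mul0r mulr0.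
rewrite mulrCA; apply: ler_wpM2l; first exact: cutoff_ge0.
rewrite -expRD ler_expR -lerBlDr -innerN -innerD.
exact: le_trans (ler_norm _) (support_inner _ yK).
Qed.

Lemma tilt_mass_lim th' B : (forall k : nat, tilt_mass nu th' k%:R <= B) -> (mgf nu th' <= B%:E)%E.
Proof.
move=> H.
have C := @cvg_monotone_convergence _ T R nu setT measurableT
  (fun k y => (tilt_density th' k%:R y)%:E) (fun k => mtd th' k%:R).
have {}C := C (fun k y _ => td0 th' k%:R y).
have nd y : setT y -> nondecreasing_seq (fun k : nat => (tilt_density th' k%:R y)%:E).
  move=> _ k k' kk; rewrite lee_fin; apply: ler_wpM2r; first exact: expR_ge0.
  by apply: cutoff_mono; rewrite ler_nat.
have {}C := C nd.
rewrite (_ : mgf nu th' = \int[nu]_y limn (fun k : nat => (tilt_density th' k%:R y)%:E))%E; last first.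
  apply: eq_integral => y _; apply/esym/cvg_lim => //; apply: cvg_near_cst.
  near=> k; rewrite /tilt_density (_ : cutoff _ _ = 1) ?mul1r//.
  rewrite /cutoff; have : \sum_(l < L) `|(y : 'rV[R]_L) ord0 l| + 1 <= k%:R.
    by near: k; exact: nbhs_infty_ger.
  rewrite addrC -lerBrDr => /min_idPl ->; exact/max_idPr.
apply: cvge_le C; apply: nearW => k /=; rewrite -tilt_mass_integral lee_fin; exact: H.
Unshelve. all: by end_near. Qed.

Let phi K (w : 'rV[R]_L) : R := tilt_mass nu (th + w^T) K - inner w^T b.

Let coordT l : continuous (fun w : 'rV[R]_L => w^T l ord0).
Proof.
rewrite (_ : (fun w => _) = fun w : 'rV[R]_L => w ord0 l); first exact: coord_continuous.
by apply/funext => w; rewrite mxE.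
Qed.

Lemma norm1N (v : 'cV[R]_L) : norm1 (- v) = norm1 v.
Proof. by apply: eq_bigr => l _; rewrite mxE normrN. Qed.

Lemma phi_continuous K : continuous (phi K).
Proof.
apply: contB; last by apply: cont_sum => l; apply: cont_scale; exact: coordT.
move=> w.
pose rho (w' : 'rV[R]_L) := \sum_(l < L) `|w'^T l ord0 - w^T l ord0|.
have rhoE w' : norm1 ((th + w'^T) - (th + w^T)) = rho w'.
  by apply: eq_bigr => l _; rewrite !mxE; congr `|_|; ring.
have rhow : rho w = 0 by rewrite /rho big1// => l _; rewrite subrr normr0.
apply: (@cont_exp_squeeze R _ (fun w => tilt_mass nu (th + w^T) K) rho K w).
  rewrite -rhow; have : continuous rho by apply: cont_sum => l; apply: cont_dist; exact: coordT.
  exact.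
move=> w'; apply/andP; split; last by rewrite mulrC -rhoE [X in expR X]mulrC mulrC tilt_mass_ratio.
rewrite mulNr expRN -ler_pdivlMl ?invr_gt0 ?expR_gt0// invrK -rhoE -norm1N opprB [K * _]mulrC.
exact: tilt_mass_ratio.
Qed.

Let box : set 'rV[R]_L := [set w | forall l, `[-1, 1]%classic (w ord0 l)].

Let cbox : compact box.
Proof. by apply: (@rV_compact R L (fun=> `[-1, 1]%classic)) => l; exact: segment_compact. Qed.

Let box0 : box 0.
Proof. by move=> l /=; rewrite mxE in_itv/=; lra. Qed.

(** Compactness turns pointwise convergence of the truncated masses into a bound
    that is uniform on a cube. *)
Lemma uniform_cutoff del : 0 < del -> exists k : nat, forall w, box w -> N - del <= phi k%:R w.
Proof.
move=> del0; apply: contrapT => /forallNP H.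
have /choice[w_ wP] k : exists w, box w /\ phi k%:R w < N - del.
  have /existsNP[w /not_implyP[wb /negP]] := H k; rewrite -ltNge => wlt; by exists w.
have [w [wb wcl]] : box `&` cluster (w_ @ \oo) !=set0.
  by apply: cbox; exists 0%N => // k _; have [] := wP k.
have low k : phi k%:R w <= N - del.
  rewrite leNgt; apply/negP => gt.
  have V : nbhs w [set w' | N - del < phi k%:R w'].
    exact: (@cvgr_gt _ _ _ _ _ _ (@phi_continuous k%:R w) _ gt).
  have tail : (w_ @ \oo) [set w' | exists2 m, (k <= m)%N & w' = w_ m].
    by exists k => // m /= km; exists m.
  have [w' [[m km ->]] /=] := wcl _ _ tail V.
  have [_ lt] := wP m; rewrite ltNge => /negP; apply; apply: le_trans (ltW lt).
  by rewrite lerD2r; apply: tilt_mass_mono; rewrite ler_nat.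
have := @tilt_mass_lim (th + w^T) (N - del + inner w^T b) _.
move=> /(_ (fun k => _))/wrap[k|].
  by have := low k; rewrite /phi; lra.
move=> /(le_trans (optimal w^T)); rewrite lee_fin; lra.
Qed.

Definition sqnorm (w : 'rV[R]_L) : R := \sum_(l < L) w ord0 l ^+ 2.

Lemma sqnorm_ge (w : 'rV[R]_L) l : w ord0 l ^+ 2 <= sqnorm w.
Proof. by rewrite /sqnorm (bigD1 l)//= lerDl sumr_ge0// => k _; exact: sqr_ge0. Qed.

Lemma sqnorm0 : sqnorm 0 = 0.
Proof. by apply: big1 => l _; rewrite mxE expr0n. Qed.

Lemma sqnorm_shift w l (h : R) :
  sqnorm (w + h *: delta_mx ord0 l) = sqnorm w + 2 * h * w ord0 l + h ^+ 2.
Proof.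
rewrite /sqnorm (bigD1 l)//= [in RHS](bigD1 l)//= !mxE !eqxx/= mulr1.
under eq_bigr => k kl do rewrite !mxE (negbTE kl) andbF mulr0 addr0.
by ring.
Qed.

Lemma sqnorm_continuous : continuous sqnorm.
Proof.
by apply: cont_sum => l; apply: cont_sqr; exact: coord_continuous.
Qed.

(** The truncated and tilted jump measure with the prescribed mean: a quadratic
    penalty makes the minimiser interior, so that the first order condition
    gives its mean exactly. *)
Lemma near_optimal_tilt del : 0 < del -> del < 2^-1 ->
  exists (w : 'rV[R]_L) (K : R), [/\ sqnorm w <= 2 * del,
    forall l, centroid nu (th + w^T) K ord0 l = b ord0 l - w ord0 l,
    N - del + inner w^T b <= tilt_mass nu (th + w^T) K &
    tilt_mass nu (th + w^T) K <= N + inner w^T b].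
Proof.
move=> del0 del2; have [k Hk] := uniform_cutoff del0.
set K : R := k%:R; pose psi w := phi K w + sqnorm w / 2.
have cpsi : {within box, continuous psi}.
  apply: continuous_subspaceT; apply: contD; first exact: phi_continuous.
  by apply: cont_scale; exact: sqnorm_continuous.
have [w /[!inE] wb wmin] := EVT_min_rV (ex_intro _ _ box0) cbox cpsi.
have psi0 : psi 0 <= N.
  rewrite /psi /phi sqnorm0 trmx0 addr0 mul0r addr0 (_ : inner 0 b = 0) ?subr0; last first.
    by rewrite /inner big1// => l _; rewrite mxE mul0r.
  rewrite -lee_fin -mgf_th tilt_mass_integral; apply: le_integralT => //.
  - exact: measurable_expinner.
  - by move=> y; rewrite lee_fin.
  - by move=> y; rewrite lee_fin /tilt_density ler_piMl ?expR_ge0 ?cutoff_le1.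
have psiw : psi w <= N by apply: le_trans psi0; apply: wmin; rewrite inE.
have sq : sqnorm w <= 2 * del by have := Hk w wb; rewrite -/K; move: psiw; rewrite /psi; lra.
have sq0 : 0 <= sqnorm w by apply: sumr_ge0 => l _; exact: sqr_ge0.
exists w, K; split => //; last first.
- by move: psiw; rewrite /psi /phi; lra.
- by have := Hk w wb; rewrite /phi -/K; lra.
have w1 l : -1 < w ord0 l < 1.
  by have := sqnorm_ge w l => h; apply/andP; split; rewrite ?expr2 in h *; nra.
(* One-sided first order condition along the direction sg *: e_l. *)
have foc l (sg : R) : sg ^+ 2 = 1 -> sg * (b ord0 l - w ord0 l) <= sg * centroid nu (th + w^T) K ord0 l.
  move=> sg1; rewrite leNgt; apply/negP => lt.
  pose gp := sg * (b ord0 l - w ord0 l) - sg * centroid nu (th + w^T) K ord0 l.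
  have gp0 : 0 < gp by rewrite subr_gt0.
  pose x := sg * (b ord0 l - w ord0 l) - gp / 2.
  have : inner (sg *: delta_mx l ord0) (centroid nu (th + w^T) K) < x.
    by rewrite inner_delta /x /gp; move: lt; lra.
  move=> /chernoff_slope[tau0 tau00 H].
  have /andP[wl wu] := w1 l.
  pose tau := Num.min tau0 (Num.min gp (Num.min (1 - w ord0 l) (1 + w ord0 l))).
  have taup : 0 < tau by rewrite !lt_min tau00 gp0/=; lra.
  have tau_le : tau <= tau0 by rewrite ge_min lexx.
  have tau_gp : tau <= gp by rewrite !ge_min lexx orbT.
  have tau_u : tau <= 1 - w ord0 l by rewrite !ge_min lexx !orbT.
  have tau_l : tau <= 1 + w ord0 l by rewrite !ge_min lexx !orbT.
  have := H tau taup tau_le.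
  have -> : fine (mgf (tilted nu (th + w^T) K) (tau *: (sg *: delta_mx l ord0))) =
      tilt_mass nu (th + (w + (tau * sg) *: delta_mx ord0 l)^T) K.
    apply: EFin_inj; rewrite fineK ?mgf_tilted_fin// tilt_mass_integral /mgf integral_tilted; last 2 first.
    - exact: measurable_expinner.
    - by move=> y; rewrite lee_fin expR_ge0.
    have -> : th + (w + (tau * sg) *: delta_mx ord0 l)^T = th + w^T + tau *: (sg *: delta_mx l ord0).
      by rewrite linearD linearZ/= trmx_delta scalerA addrA.
    by apply: eq_integral => y _; rewrite -EFinM /tilt_density [in RHS]innerD expRD mulrA.
  have wb' : box (w + (tau * sg) *: delta_mx ord0 l).
    move=> k' /=; rewrite !mxE eqxx/=; have [->|kl] := eqVneq k' l; last by rewrite mulr0 addr0; exact: wb.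
    rewrite mulr1 in_itv/=.
    have [->|->] : sg = 1 \/ sg = -1.
      by move/eqP: sg1; rewrite sqrf_eq1 => /orP[] /eqP ->; [left|right].
    - by lra.
    - by lra.
  have := wmin _ (mem_set wb'); rewrite /psi /phi sqnorm_shift linearD linearZ/= trmx_delta innerD inner_delta.
  have -> : (tau * sg) ^+ 2 = tau ^+ 2 by rewrite exprMn sg1 mulr1.
  by rewrite /x => h1 h2; exact: (foc_arith taup tau_gp h1 h2).
move=> l; apply/eqP; rewrite eq_le; apply/andP; split.
  by have := foc l (-1); rewrite sqrrN expr1n => /(_ erefl); lra.
by have := foc l 1; rewrite expr1n => /(_ erefl); lra.
Qed.

End Minimise.

End Penalty.
Export Penalty.

(** * Openness of the lower bound *)

Module Good.
Local Open Scope ereal_scope.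

Definition seq_continuous (R : realType) L (phi : borelV R L -> R) :=
  forall (x_ : nat -> 'rV[R]_L) (x : 'rV[R]_L),
    (forall l, x_ m ord0 l @[m --> \oo] --> x ord0 l) -> phi (x_ m) @[m --> \oo] --> phi x.

Lemma tilt_density_seq_continuous (R : realType) L (th : 'cV[R]_L) K :
  seq_continuous (tilt_density th K).
Proof.
move=> x_ x H; apply: cvgM; last first.
  apply: (@cvg_comp _ _ _ (fun m => inner th (x_ m)) expR _ (nbhs (inner th x))); last exact: continuous_expR.
  by apply: cvg_sumr => l; apply: cvgM; [exact: cvg_cst|exact: H].
rewrite /cutoff; set S := (K - _)%R.
have cS : (K - \sum_(l < L) `|x_ m ord0 l|)%R @[m --> \oo] --> S.
  by apply: cvgB; [exact: cvg_cst|apply: cvg_sumr => l; apply: cvg_norm; exact: H].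
have cmin : Num.min 1%R (K - \sum_(l < L) `|x_ m ord0 l|)%R @[m --> \oo] --> Num.min 1%R S.
  under eq_fun do rewrite minr_absE; rewrite minr_absE.
  apply: cvgM; last exact: cvg_cst.
  apply: cvgB; first by apply: cvgD; [exact: cvg_cst|exact: cS].
  by apply: cvg_norm; apply: cvgB; [exact: cvg_cst|exact: cS].
under eq_fun do rewrite maxr_absE; rewrite maxr_absE.
apply: cvgM; last exact: cvg_cst.
apply: cvgD; first by apply: cvgD; [exact: cvg_cst|exact: cmin].
by apply: cvg_norm; apply: cvgB; [exact: cvg_cst|exact: cmin].
Qed.

Definition moment_density (R : realType) L (th : 'cV[R]_L) K l (y : borelV R L) : R :=
  (Num.max 0 ((y : 'rV[R]_L) ord0 l) * tilt_density th K y)%R.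

Lemma moment_density_seq_continuous (R : realType) L (th : 'cV[R]_L) K l :
  seq_continuous (moment_density th K l).
Proof.
move=> x_ x H; apply: cvgM; last exact: tilt_density_seq_continuous.
under eq_fun do rewrite maxr_absE; rewrite maxr_absE.
apply: cvgM; last exact: cvg_cst.
apply: cvgD; first by apply: cvgD; [exact: cvg_cst|exact: H].
by apply: cvg_norm; apply: cvgB; [exact: cvg_cst|exact: H].
Qed.

Lemma measurable_moment_density (R : realType) L (th : 'cV[R]_L) K l :
  measurable_fun setT (moment_density th K l).
Proof.
apply: measurable_funM; first by apply: measurable_maxr => //; exact: measurable_coordV.
by apply/measurable_EFinP; exact: measurable_tilt_density.
Qed.

Lemma moment_density_ge0 (R : realType) L (th : 'cV[R]_L) K l y : (0 <= moment_density th K l y)%R.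
Proof. by rewrite mulr_ge0 ?le_max ?lexx// mulr_ge0 ?cutoff_ge0 ?expR_ge0. Qed.

Lemma moment_density_le (R : realType) L (th : 'cV[R]_L) K l y :
  (moment_density th K l y <= `|K| * expR (norm1 th * K))%R.
Proof.
rewrite /moment_density.
have [yK|/cutoff_support yK] := leP (\sum_(l < L) `|(y : 'rV[R]_L) ord0 l|)%R K; last first.
  by rewrite /tilt_density yK mul0r mulr0 mulr_ge0// expR_ge0.
apply: ler_pM => //; first by rewrite le_max lexx.
- by rewrite mulr_ge0 ?cutoff_ge0 ?expR_ge0.
- rewrite ge_max normr_ge0/=; apply: le_trans (ler_norm _) _.
  apply: le_trans (ler_norm K); apply: le_trans yK.
  by rewrite (bigD1 l)//= lerDl sumr_ge0.
- exact: tilt_density_le.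
Qed.

Section Convergence.
Context {R : realType} {L d : nat} {t : R}.
Local Notation T := (borelV R L).
Local Notation X := (bpath d t).
Local Notation St := 'I_d.+1.
Variables (lam : St -> R) (mu : St -> probability T R) (r : St -> 'M[R]_L).
Hypotheses (t0 : (0 < t)%R) (lam0 : forall j, (0 < lam j)%R).
Hypothesis r0 : forall j i i', (0 <= r j i i')%R.
Local Notation nu := (@path_levy R L d t lam mu r r0).
Let lam_ge0 j : (0 <= lam j)%R. Proof. exact: ltW. Qed.

(** The state and the flow converge at all but finitely many times; dominated
    convergence, over the job sizes and then over time, does the rest. *)
Lemma path_levy_cvg (f_ : nat -> X) (g : X) (phi : T -> R) (B : R) :
  (forall v, (0 < v)%R -> (v < t)%R -> ~ (v \in unzip1 (val g).2) ->
     \forall m \near \oo, path_at (f_ m) v = path_at g v) ->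
  measurable_fun setT phi -> (forall y, 0 <= phi y)%R -> (forall y, phi y <= B)%R ->
  seq_continuous phi ->
  \int[nu (f_ m)]_y (phi y)%:E @[m --> \oo] --> \int[nu g]_y (phi y)%:E.
Proof.
move=> Hphi mphi phi0 phiB cphi.
have B0 : (0 <= B)%R by apply: le_trans (phiB (0%R : 'rV[R]_L)).
have mphiE : measurable_fun setT (fun y => (phi y)%:E) by exact/measurable_EFinP.
pose Phi j (f : X) u := fine (\int[mu j]_x (phi (delivered (path_flow r f) (u, x)))%:E).
have mdel (f : X) : measurable_fun setT (delivered (path_flow r f) : measurableTypeR R * T -> T).
  exact: measurable_delivered (path_flow_is_flow r0 f).
have mdelu (f : X) u : measurable_fun setT (fun x : T => phi (delivered (path_flow r f) (u, x))).
  apply: (measurableT_comp mphi); apply: (measurableT_comp (mdel f)); exact: measurable_fun_pair.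
have Phi_int j (f : X) u : 0 <= \int[mu j]_x (phi (delivered (path_flow r f) (u, x)))%:E <= B%:E.
  apply/andP; split; first by apply: integral_ge0 => x _; rewrite lee_fin.
  apply: (@le_trans _ _ (\int[mu j]_x cst B%:E x)).
    by apply: le_integralT => //; [exact/measurable_EFinP|move=> x; rewrite lee_fin|move=> x; rewrite lee_fin].
  by rewrite integral_cst// -[leRHS]mule1 lee_wpmul2l ?lee_fin// probability_le1.
have PhiE j (f : X) u : \int[mu j]_x (phi (delivered (path_flow r f) (u, x)))%:E = (Phi j f u)%:E.
  have /andP[h1 h2] := Phi_int j f u; rewrite fineK// ge0_fin_numE//.
  exact: le_lt_trans h2 (ltry _).
have Phi0 j f u : (0 <= Phi j f u)%R by have /andP[h _] := Phi_int j f u; exact: fine_ge0.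
have PhiB j f u : (Phi j f u <= B)%R by have /andP[_] := Phi_int j f u; rewrite PhiE lee_fin.
have mPhi j f : measurable_fun setT (Phi j f).
  apply: measurableT_comp => //.
  apply: (@measurable_fun_fubini_tonelli_F _ _ (measurableTypeR R) T R (mu j) ((fun y => (phi y)%:E) \o delivered (path_flow r f))).
    exact: measurableT_comp.
  by move=> z; rewrite lee_fin.
pose F j (f : X) u : R := (\1_[set v | path_at f v = j] u * Phi j f u)%R.
have mI (j : St) (f : X) : measurable ([set v | path_at f v = j] : set R).
  exact: (flow_mphi (path_flow_is_flow r0 f)).
have mF j f : measurable_fun setT (F j f).
  by apply: measurable_funM; [apply: measurable_indic; exact: mI|exact: mPhi].
have FE f : \int[nu f]_y (phi y)%:E = \sum_j (lam j)%:E * \int[lebesgue_measure]_(u in `[0%R, t]) (F j f u)%:E.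
  rewrite integral_path_levy//.
  apply: eq_bigr => j _; apply: (f_equal (mule _)).
  rewrite integral_mkcond [in RHS]integral_mkcond; apply: eq_integral => u _.
  rewrite !patchE /F indicE /occupied in_setI PhiE.
  by case: (u \in `[0%R, t]%classic) => //=; case: (u \in _); rewrite ?mul1r ?mul0r.
have -> : (fun m => \int[nu (f_ m)]_y (phi y)%:E) = (fun m => \sum_j (lam j)%:E * \int[lebesgue_measure]_(u in `[0%R, t]) (F j (f_ m) u)%:E).
  by apply/funext => m; exact: FE.
rewrite FE; apply: cvg_nnesum => j _.
  apply: nearW => m; rewrite mule_ge0// ?lee_fin//; apply: integral_ge0 => u _.
  by rewrite lee_fin mulr_ge0.
apply: cvgeZl => //.
pose S := [set` t :: 0%R :: unzip1 (val g).2] : set R.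
have Sfin : finite_set S by exact: finite_seq.
apply: (@bounded_cvg_integral_ae _ _ _ _ _ _ _ B) => //.
- rewrite [X in (X < _)](_ : _ = lebesgue_measure (`[0%R, t]%classic : set R))//.
  by rewrite lebesgue_measure_itv /=; case: ifP => // _; rewrite -EFinB ltry.
- by move=> m; apply: measurable_funTS; exact: mF.
- by apply: measurable_funTS; exact: mF.
- move=> m u _; rewrite /F ger0_norm ?mulr_ge0// indicE.
  by case: (_ \in _); rewrite ?mul1r ?mul0r.
exists S; split.
- by apply: countable_measurable => //; exact: finite_set_countable.
- by apply: countable_lebesgue_measure0; exact: finite_set_countable.
move=> u /= nu_; apply: contrapT => nS; apply: nu_; rewrite in_itv/= => /andP[u0 ut].
have uS : ~ (u \in unzip1 (val g).2) by move=> h; apply: nS; rewrite /S /= !inE h !orbT.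
have ut' : (u < t)%R.
  by rewrite lt_neqAle ut andbT; apply/negP => /eqP ut'; apply: nS; rewrite /S /= inE ut' eqxx.
have u0' : (0 < u)%R.
  by rewrite lt_neqAle u0 andbT eq_sym; apply/negP => /eqP u00; apply: nS; rewrite /S /= !inE u00 eqxx orbT.
have agree := Hphi u u0' ut' uS.
apply: cvgM.
  apply: cvg_near_cst; apply: filterS agree => m E.
  by rewrite !indicE; congr (nat_of_bool _)%:R; apply/idP/idP; rewrite !inE /= E.
have Dcvg := flow_cvg r0 (fun m => path_flow_is_flow r0 (f_ m)) (fun m => @path_at_constant R d t (f_ m)) Hphi u0 ut.
suff : \int[mu j]_x (phi (delivered (path_flow r (f_ m)) (u, x)))%:E @[m --> \oo] -->
    \int[mu j]_x (phi (delivered (path_flow r g) (u, x)))%:E.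
  by rewrite PhiE => /fine_cvgP[_].
apply: (@bounded_cvg_integral _ _ _ _ _ _ _ B) => //.
- by rewrite [X in X < _](_ : _ = 1) ?ltry//; exact: (@probability_setT _ _ _ (mu j)).
- by move=> m x _; rewrite ger0_norm.
move=> x _; apply: cphi => l; rewrite /delivered /=.
under eq_fun do rewrite mxE; rewrite mxE; apply: cvg_sumr => k.
by apply: cvgM; [exact: cvg_cst|exact: Dcvg].
Qed.

End Convergence.

Section Good.
Context {R : realType} {L d : nat} {t : R}.
Local Notation T := (borelV R L).
Local Notation X := (bpath d t).
Local Notation St := 'I_d.+1.
Variables (lam : St -> R) (mu : St -> probability T R) (r : St -> 'M[R]_L) (a : 'rV[R]_L)
  (bs : X -> 'rV[R]_L) (ths : X -> 'cV[R]_L) (kap : R.-pker X ~> T).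
Hypotheses (t0 : (0 < t)%R) (lam0 : forall j, (0 < lam j)%R).
Hypothesis mu_ge0 : forall j, {ae mu j, forall x : T, forall l, (0 <= (x : 'rV[R]_L) ord0 l)%R}.
Hypothesis r0 : forall j i i', (0 <= r j i i')%R.
Hypothesis opt : forall f, optimizers lam mu r a f (bs f) (ths f).
Hypothesis mths : forall l, measurable_fun setT (fun f => ths f l ord0).
Hypothesis twisted : twisted_kernel lam mu r ths kap.
Local Notation path_prob := (Model.path_prob t0 lam0 r0 opt mths twisted).
Local Notation nu := (@path_levy R L d t lam mu r r0).
Local Notation jump := (@jump_measure R L d t lam mu r lam0 r0).
Local Notation rate_of := (@Model.rate_of R L d t lam mu r bs ths).
Local Notation c := (@path_mass R d t lam).

(** Exponential rate guaranteed by the tilt [th], the cutoff [K] and the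
    inflation factor [s]. *)
Definition guaranteed (th : 'cV[R]_L) (K s : R) (f : X) : R :=
  (- c f + s * tilt_mass (jump f) th K - s * inner th (centroid (jump f) th K)
   - (expR 1 * (s * tilt_mass (jump f) th K) + 1) * ln s)%R.

Definition good (th : 'cV[R]_L) (K s v : R) : set X :=
  [set f | (forall l, (0 < a ord0 l)%R -> (a ord0 l < s * centroid (jump f) th K ord0 l)%R) /\
           (v < guaranteed th K s f)%R].

(** Half of the slack between [v] and the guaranteed rate is used as the margin
    of the Chernoff bound; the other half makes the normalised probability
    diverge. *)
Lemma good_diverges th K s v f : (1 <= s)%R -> good th K s v f ->
  forall B : R, \forall n \near \oo, B%:E <= (expR (- (n%:R * v)))%:E * path_prob n f.
Proof.
move=> s1 [gi gv] B.
pose g := ((guaranteed th K s f - v) / 2)%R.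
have g0 : (0 < g)%R by rewrite divr_gt0// subr_gt0.
pose beta := (s * inner th (centroid (jump f) th K) + g)%R.
have beta_gt : (s * inner th (centroid (jump f) th K) < beta)%R by rewrite ltrDl.
have H : \forall n \near \oo, (expR (n%:R * (- c f + s * tilt_mass (jump f) th K - beta -
     (expR 1 * (s * tilt_mass (jump f) th K) + 1) * ln s)) / 2)%:E <= path_prob n f.
  by apply: path_prob_lower.
near=> n.
have Hn : (expR (n%:R * (v + g)) / 2)%:E <= path_prob n f.
  have : (expR (n%:R * (- c f + s * tilt_mass (jump f) th K - beta -
     (expR 1 * (s * tilt_mass (jump f) th K) + 1) * ln s)) / 2)%:E <= path_prob n f by near: n.
  apply: le_trans; rewrite lee_fin ler_pM2r// ler_expR ler_wpM2l//.
  by rewrite /beta /g /guaranteed; lra.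
apply: le_trans (lee_wpmul2l _ Hn); last by rewrite lee_fin expR_ge0.
rewrite -EFinM lee_fin mulrA -expRD.
have -> : (- (n%:R * v) + n%:R * (v + g) = n%:R * g)%R by ring.
have : (2 * B <= n%:R * g)%R by rewrite -ler_pdivrMr//; near: n; exact: nbhs_infty_ger.
by have := expR_ge1Dx (n%:R * g); lra.
Unshelve. all: by end_near. Qed.

Let jumpE f (phi : T -> R) : measurable_fun setT phi -> (forall y, 0 <= phi y)%R ->
  \int[jump f]_y (phi y)%:E = \int[nu f]_y (phi y)%:E.
Proof.
by move=> mp p0; apply: integral_jump; [exact/measurable_EFinP|move=> y; rewrite lee_fin].
Qed.

Let mtd th K : measurable_fun setT (tilt_density th K : T -> R).
Proof. by apply/measurable_EFinP; exact: measurable_tilt_density. Qed.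

Let td0 th K (y : T) : (0 <= tilt_density th K y)%R.
Proof. by rewrite mulr_ge0 ?cutoff_ge0 ?expR_ge0. Qed.

Lemma massE f : c f = fine (\int[nu f]_y (cst 1%R y)%:E).
Proof. by rewrite (eq_integral (cst 1))// integral_cst// mul1e (nu_fin mu lam0 r0). Qed.

Lemma tilt_massE th K f : tilt_mass (jump f) th K = fine (\int[nu f]_y (tilt_density th K y)%:E).
Proof. by rewrite -jumpE// -tilt_mass_integral. Qed.

Lemma centroidE th K f l :
  centroid (jump f) th K ord0 l = fine (\int[nu f]_y (moment_density th K l y)%:E).
Proof.
rewrite mxE -jumpE; [|exact: measurable_moment_density|exact: moment_density_ge0].
congr fine; apply: ae_eq_integral => //.
- apply/measurable_EFinP; apply: measurable_funM => //; exact: measurable_coordV.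
- by apply/measurable_EFinP; exact: measurable_moment_density.
apply: filterS (jump_ge0 t0 lam0 mu_ge0 r0 f) => y y0 _; congr (_ * _)%:E.
by apply/esym/max_idPr.
Qed.

Let measurable_fint (phi : T -> R) : measurable_fun setT phi -> (forall y, 0 <= phi y)%R ->
  measurable_fun setT (fun f => fine (\int[nu f]_y (phi y)%:E)).
Proof.
move=> mp p0; apply: measurableT_comp => //.
have mpE : measurable_fun setT (fun y => (phi y)%:E) by exact/measurable_EFinP.
have h0 y : 0 <= (phi y)%:E by rewrite lee_fin.
exact: (measurable_integral_path_levy t0 r0 mu (fun j => ltW (lam0 j)) mpE h0).
Qed.

Let mmass : measurable_fun setT c.
Proof. by rewrite (funext massE); apply: measurable_fint. Qed.

Let mtilt th K : measurable_fun setT (fun f => tilt_mass (jump f) th K).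
Proof. by rewrite (funext (tilt_massE th K)); apply: measurable_fint. Qed.

Let mcent th K l : measurable_fun setT (fun f => centroid (jump f) th K ord0 l).
Proof.
rewrite (funext (fun f => centroidE th K f l)); apply: measurable_fint.
  exact: measurable_moment_density.
exact: moment_density_ge0.
Qed.

Let mguar th K s : measurable_fun setT (guaranteed th K s).
Proof.
apply: measurable_funB.
  apply: measurable_funB.
    by apply: measurable_funD; [exact: measurableT_comp|exact: measurable_funM].
  apply: measurable_funM => //; apply: measurable_sum => l; exact: measurable_funM.
apply: measurable_funM => //; apply: measurable_funD => //.
by apply: measurable_funM => //; exact: measurable_funM.
Qed.

Let measurable_gt (h : X -> R) v : measurable_fun setT h -> measurable [set f | (v < h f)%R].
Proof.
move=> mh; rewrite (_ : mkset _ = ~` [set f | (h f <= v)%R]); last first.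
  by apply/seteqP; split => f /=; rewrite ltNge => /negP.
by apply: measurableC; rewrite -[X in measurable X]setTI; exact: measurable_fun_le.
Qed.

Lemma measurable_good th K s v : measurable (good th K s v).
Proof.
rewrite (_ : good th K s v = (\bigcap_(l in [set l : 'I_L | (0 < a ord0 l)%R])
   [set f | (a ord0 l < s * centroid (jump f) th K ord0 l)%R]) `&`
   [set f | (v < guaranteed th K s f)%R]); last first.
  by apply/seteqP; split => f [h1 h2]; split => // l; exact: h1.
apply: measurableI; last by apply: measurable_gt; exact: mguar.
apply: fin_bigcap_measurable => // l _.
by apply: measurable_gt; exact: measurable_funM.
Qed.

(** All the quantities involved are integrals against [path_levy] of functions
    that are bounded and continuous, thanks to the cutoff. *)
Lemma good_open th K s v (f_ : nat -> X) (g : X) : good th K s v g ->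
  (forall u, (0 < u)%R -> (u < t)%R -> ~ (u \in unzip1 (val g).2) ->
     \forall m \near \oo, path_at (f_ m) u = path_at g u) ->
  \forall m \near \oo, good th K s v (f_ m).
Proof.
move=> [gi gv] H.
have fcvg (phi : T -> R) B : measurable_fun setT phi -> (forall y, 0 <= phi y)%R -> (forall y, phi y <= B)%R ->
    seq_continuous phi -> \int[nu g]_y (phi y)%:E \is a fin_num ->
    fine (\int[nu (f_ m)]_y (phi y)%:E) @[m --> \oo] --> fine (\int[nu g]_y (phi y)%:E).
  move=> mp p0 pB cp fin.
  have := path_levy_cvg (r0 := r0) (mu := mu) lam0 H mp p0 pB cp.
  by rewrite -[X in _ --> X]fineK// => /fine_cvgP[_].
have nug : nu g setT < +oo by rewrite (nu_fin mu lam0 r0) ltry.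
have fing (phi : T -> R) B : measurable_fun setT phi -> (forall y, 0 <= phi y)%R -> (forall y, phi y <= B)%R ->
    \int[nu g]_y (phi y)%:E \is a fin_num.
  move=> mp p0 pB; apply: integrable_fin_num => //; apply: measurable_bounded_integrable => //.
  exists B; split; first exact: num_real.
  by move=> B' /ltW BB y _ /=; rewrite ger0_norm//; apply: le_trans BB.
have cc : c (f_ m) @[m --> \oo] --> c g.
  rewrite massE; under eq_fun do rewrite massE.
  apply: (fcvg (cst 1%R) 1%R) => //; first by move=> x_ x _; exact: cvg_cst.
  exact: (fing (cst 1%R) 1%R).
have ct : tilt_mass (jump (f_ m)) th K @[m --> \oo] --> tilt_mass (jump g) th K.
  rewrite tilt_massE; under eq_fun do rewrite tilt_massE.
  apply: (fcvg _ (expR (norm1 th * K))) => //.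
  - by move=> y; exact: tilt_density_le.
  - exact: tilt_density_seq_continuous.
  - by apply: (fing _ (expR (norm1 th * K))) => // y; exact: tilt_density_le.
have cb l : centroid (jump (f_ m)) th K ord0 l @[m --> \oo] --> centroid (jump g) th K ord0 l.
  have -> : (fun m => centroid (jump (f_ m)) th K ord0 l) =
      (fun m => fine (\int[nu (f_ m)]_y (moment_density th K l y)%:E)).
    by apply/funext => m; exact: centroidE.
  rewrite (centroidE th K g l).
  apply: (fcvg _ (`|K| * expR (norm1 th * K))%R).
  - exact: measurable_moment_density.
  - exact: moment_density_ge0.
  - exact: moment_density_le.
  - exact: moment_density_seq_continuous.
  - apply: (fing _ (`|K| * expR (norm1 th * K))%R); [exact: measurable_moment_density|exact: moment_density_ge0|exact: moment_density_le].
have cg : guaranteed th K s (f_ m) @[m --> \oo] --> guaranteed th K s g.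
  apply: cvgB.
    apply: cvgB; first by apply: cvgD; [exact: cvgN|apply: cvgM; [exact: cvg_cst|exact: ct]].
    apply: cvgM; first exact: cvg_cst.
    by apply: cvg_sumr => l; apply: cvgM; [exact: cvg_cst|exact: cb].
  apply: cvgM; last exact: cvg_cst.
  apply: cvgD; last exact: cvg_cst.
  by apply: cvgM; [exact: cvg_cst|apply: cvgM; [exact: cvg_cst|exact: ct]].
have ch : \forall m \near \oo, forall l, (0 < a ord0 l)%R ->
    (a ord0 l < s * centroid (jump (f_ m)) th K ord0 l)%R.
  apply: filter_forall => l; have [al|al] := ltP 0%R (a ord0 l); last by apply: nearW.
  have csb : (s * centroid (jump (f_ m')) th K ord0 l)%R @[m' --> \oo] --> (s * centroid (jump g) th K ord0 l)%R.
    by apply: cvgM; [exact: cvg_cst|exact: cb].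
  by apply: filterS (@cvgr_gt _ _ _ _ _ _ csb _ (gi l al)) => m' h _.
near=> m; split; last by near: m; exact: (@cvgr_gt _ _ _ _ _ _ cg _ gv).
by near: m; exact: ch.
Unshelve. all: by end_near. Qed.

(** The constants are chosen in the order [k], [rr], [del]: the inflation [1 +
    k] costs at most a third of [eps], and the deviation [w] of the mean is
    small compared with the room [k * a l] that the inflation creates in each
    constraint. *)
Lemma good_exists g eps : (0 < eps)%R ->
  exists th K s, (1 <= s)%R /\ good th K s (- rate_of g - eps)%R g.
Proof.
move=> eps0; have [ab _ Hopt _] := opt g.
have Mths := Mf_ths t0 lam0 r0 opt g.
set th := ths g; set b := bs g; set lM := Model.log_Mf lam mu r ths g in Mths.
pose N := (lM + c g)%R.
have mgf_th : mgf (jump g) th = N%:E.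
  rewrite mgf_jump; move: Mths; rewrite (Mf_levy mu t0 lam0 r0).
  have := mgf_ge0 (nu g) th; rewrite -/th.
  by case: (mgf _ _) => [n||]//= _ [/expR_inj E]; congr EFin; rewrite /N -E subrK.
have optimal v : (N + inner v b)%:E <= mgf (jump g) (th + v)%R.
  have := Hopt (th + v)%R; rewrite (tilt_ths t0 lam0 r0 opt) mgf_jump.
  have := mgf_ge0 (nu g) (th + v)%R; case E : (mgf _ _) => [n||]// _; last by rewrite leey.
  rewrite (tilt_Mf _ (Mf_log_mgf t0 lam0 E)) !lee_fin /Model.rate_of -/th -/b -/lM innerD /N; lra.
pose H := norm1 th.
have H0 : (0 <= H)%R by exact: sumr_ge0.
pose Bn := (\sum_(l < L) `|b ord0 l|)%R.
have Bn0 : (0 <= Bn)%R by exact: sumr_ge0.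
pose B2 := (`|N| + Bn)%R.
pose B1 := (`|N| + `|inner th b| + 1 + H)%R.
have e0 : (0 < expR 1 :> R)%R := expR_gt0 _.
pose D := (B1 + 2 * expR 1 * B2 + 1)%R.
have D0 : (0 < D)%R.
  have B1p : (0 <= B1)%R by rewrite /B1 !addr_ge0.
  have B2p : (0 <= B2)%R by rewrite /B2 addr_ge0.
  have eB : (0 <= 2 * expR 1 * B2)%R by rewrite mulr_ge0// mulr_ge0// ltW.
  by rewrite /D ltr_wpDl// addr_ge0.
pose k := Num.min 1%R (eps / 3 / D)%R.
have k0 : (0 < k)%R by rewrite lt_min ltr01/= !divr_gt0.
have k1 : (k <= 1)%R by rewrite ge_min lexx.
have kD : (k * D <= eps / 3)%R by rewrite -ler_pdivlMr// ge_min lexx orbT.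
pose rr := Num.min (2^-1)%R (Num.min (eps / 3 / (H + 1))%R
  (\big[Num.min/1%R]_(l < L | (0 < a ord0 l)%R) (k * a ord0 l / 3)%R)).
have rr0 : (0 < rr)%R.
  rewrite !lt_min invr_gt0 ltr0n/= !divr_gt0 ?ltr_wpDl//=.
  elim/big_ind: _ => // [x y x0 y0|l al]; first by rewrite lt_min x0.
  by rewrite divr_gt0// mulr_gt0.
have rr2 : (rr <= 2^-1)%R by rewrite ge_min lexx.
have rrH : (rr * (H + 1) <= eps / 3)%R by rewrite -ler_pdivlMr ?ltr_wpDl// !ge_min lexx orbT.
have rra l : (0 < a ord0 l)%R -> (rr <= k * a ord0 l / 3)%R.
  by move=> al; rewrite /rr (bigD1 l)//= !ge_min lexx !orbT.
pose del := (rr ^+ 2 / 2)%R.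
have del0 : (0 < del)%R by rewrite divr_gt0// exprn_gt0.
have delr : (del <= rr / 2)%R by rewrite /del ler_pM2r// expr2 ler_piMl ?ltW//; lra.
have del2 : (del < 2^-1)%R by lra.
have [w [K [sq cE mlo mhi]]] := near_optimal_tilt mgf_th optimal del0 del2.
have wr l : (`|w ord0 l| <= rr)%R.
  rewrite -(ler_sqr (normr_ge0 _) (ltW rr0)) real_normK ?num_real//.
  by apply: le_trans (sqnorm_ge w l) _; move: sq; rewrite /del; lra.
exists (th + w^T)%R, K, (1 + k)%R; split; first by rewrite lerDl ltW.
have ctrE : centroid (jump g) (th + w^T)%R K = (b - w)%R.
  by apply/rowP => l; rewrite cE !mxE.
split => [l al|].
  rewrite cE; have := rra l al; have := wr l; rewrite ler_norml => /andP[_ wl].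
  have := ab l; rewrite -/b => abl rl.
  have h1 : ((1 + k) * (a ord0 l - rr) <= (1 + k) * (b ord0 l - w ord0 l))%R.
    by rewrite ler_pM2l; lra.
  apply: lt_le_trans h1; have : ((1 + k) * rr < k * a ord0 l)%R.
    have : ((1 + k) * rr <= 2 * rr)%R by rewrite ler_pM2r//; lra.
    have : (0 < k * a ord0 l)%R by rewrite mulr_gt0.
    by lra.
  by lra.
rewrite /guaranteed ctrE.
set Tm := tilt_mass _ _ _ in mlo mhi *.
have T0 : (0 <= Tm)%R by exact: tilt_mass_ge0.
have wb : (`|inner w^T b| <= Bn)%R.
  apply: le_trans (ler_norm_sum _ _ _) _; apply: ler_sum => l _.
  by rewrite mxE normrM ler_piMl//; have := wr l; lra.
have thw : (`|inner th w| <= H * rr)%R.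
  apply: le_trans (ler_norm_sum _ _ _) _; rewrite /H /norm1 mulr_suml; apply: ler_sum => l _.
  by rewrite normrM ler_wpM2l.
have in_E : inner (th + w^T)%R (b - w)%R = (inner th b - inner th w + inner w^T b - sqnorm w)%R.
  have inB (u : 'cV[R]_L) : inner u (b - w)%R = (inner u b - inner u w)%R.
    by rewrite innerDr -scaleN1r innerZr mulN1r.
  rewrite innerD !inB; have -> : inner w^T w = sqnorm w.
    by apply: eq_bigr => l _; rewrite mxE expr2.
  by ring.
have sq0 : (0 <= sqnorm w)%R by apply: sumr_ge0 => l _; exact: sqr_ge0.
pose V := (Tm - inner (th + w^T)%R (b - w)%R)%R.
have hw1 := ler_norm (inner th w); have hw2 := ler_norm (- inner th w); rewrite normrN in hw2.
have hb1 := ler_norm (inner w^T b).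
have hN1 := ler_norm N; have hN2 := ler_norm (- N); rewrite normrN in hN2.
have ht1 := ler_norm (inner th b).
have V1 : (N - del - inner th b - H * rr <= V)%R by rewrite /V in_E; lra.
have Hr : (H * rr <= H)%R by rewrite ler_piMr//; lra.
have V2 : (- B1 <= V)%R by rewrite /B1; lra.
have T2 : (Tm <= B2)%R by rewrite /B2; lra.
have ls : (ln (1 + k) <= k)%R by apply: le_ln1Dx; lra.
have ls0 : (0 <= ln (1 + k))%R by rewrite ln_ge0// lerDl ltW.
have cost : ((expR 1 * ((1 + k) * Tm) + 1) * ln (1 + k) <= (2 * expR 1 * B2 + 1) * k)%R.
  have X0 : (0 <= expR 1 * ((1 + k) * Tm))%R by rewrite !mulr_ge0 ?(ltW e0)// addr_ge0// ltW.
  have X1 : (expR 1 * ((1 + k) * Tm) <= 2 * expR 1 * B2)%R.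
    rewrite mulrA [(2 * _)%R]mulrC -!mulrA ler_pM2l//; apply: ler_pM => //; first by rewrite addr_ge0// ltW.
    by lra.
  by apply: ler_pM => //; [rewrite addr_ge0|rewrite lerD2r].
have kV : (- (k * B1) <= k * V)%R by rewrite -mulrN ler_pM2l.
have -> : (- c g + (1 + k) * Tm - (1 + k) * inner (th + w^T)%R (b - w)%R = - c g + V + k * V)%R.
  by rewrite /V; ring.
have rE : rate_of g = (inner th b - N + c g)%R by rewrite /Model.rate_of -/th -/b -/lM /N; ring.
have rH1 : (H * rr + rr <= eps / 3)%R by move: rrH; rewrite mulrDr mulr1 [(rr * H)%R]mulrC.
have kD' : (k * B1 + (2 * expR 1 * B2 + 1) * k <= eps / 3)%R.
  by apply: le_trans kD; rewrite /D; lra.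
rewrite rE; lra.
Qed.

End Good.

End Good.
Export Good.

(** * Neighborhoods of a path are charged *)

Module Nearby.
Section Shadow.
Context {R : realType} {d : nat} {t : R}.
Local Notation X := (bpath d t).
Variables (Q : 'M[R]_d.+1) (j0 : 'I_d.+1) (dO : measure_display) (Om : measurableType dO)
  (P : probability Om R) (J : {mfun Om >-> X}).
Hypotheses (t0 : 0 < t) (genQ : generator Q) (irrQ : irreducible_gen Q).
Hypothesis HJ : ctmc Q j0 P J.

Let Q0 i j : i != j -> 0 <= Q i j. Proof. by case: genQ => H _; exact: H. Qed.
Let kappa : R := entry_sum Q.
Let kappa0 : 0 <= kappa. Proof. exact: entry_sum_ge0. Qed.

Lemma fdd_ge0 x s ss : path <=%R s (unzip1 ss) -> 0 <= ctmc_fdd Q x s ss.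
Proof.
elim: ss x s => [|[v y] ss IH] x s //= /andP[sv pv].
by rewrite mulr_ge0 ?IH// expmx_metzler_ge0// subr_ge0.
Qed.

(** Each step costs at most [exp (- kappa de)], and the lengths of the steps add
    up, so the bound does not depend on the subdivision. *)
Lemma fdd_stay (y : 'I_d.+1) (s de : R) j n ss : 0 <= de ->
  path <=%R (s + (j + n)%:R * de) (unzip1 ss) ->
  let l := [seq (s + k.+1%:R * de, y) | k <- iota j n] in
  path <=%R (s + j%:R * de) (unzip1 (l ++ ss)) /\
  expR (- kappa * (n%:R * de)) * ctmc_fdd Q y (s + (j + n)%:R * de) ss
    <= ctmc_fdd Q y (s + j%:R * de) (l ++ ss).
Proof.
move=> de0; elim: n j => [|n IH] j pss; first by rewrite addn0 /= mul0r mulr0 expR0 mul1r; move: pss; rewrite addn0.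
have [|p1 p2] := IH j.+1; first by rewrite addSnnS.
have step : s + j%:R * de <= s + j.+1%:R * de by rewrite lerD2l ler_wpM2r// ler_nat.
split; first by rewrite /= step.
rewrite /=; have -> : s + j.+1%:R * de - (s + j%:R * de) = de by rewrite -natr1; ring.
apply: (@le_trans _ _ (expR (- kappa * de) * (expR (- kappa * (n%:R * de)) * ctmc_fdd Q y (s + (j.+1 + n)%:R * de) ss))).
  rewrite addSnnS mulrA -expRD; apply: ler_wpM2r; first exact: fdd_ge0.
  by rewrite ler_expR -natr1; lra.
apply: ler_pM => //; rewrite ?expR_ge0//; last exact: expmx_metzler_diag.
by rewrite mulr_ge0 ?expR_ge0// addSnnS fdd_ge0.
Qed.

(** On the cells that [g] leaves, nothing is asked inside; irreducibility makes
    every transition over one cell possible. *)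
Lemma transition_bound (h : R) : 0 < h ->
  exists2 p : R, 0 < p & p <= expR (- kappa * h) /\ forall x y, p <= expmx (h *: Q) x y.
Proof.
move=> h0; pose p := Num.min (expR (- kappa * h))
  (\big[Num.min/1]_(xy : 'I_d.+1 * 'I_d.+1) expmx (h *: Q) xy.1 xy.2).
exists p.
  rewrite lt_min expR_gt0/=; elim/big_ind: _ => // [x y x0 y0|[x y] _ /=]; first by rewrite lt_min x0.
  by apply: expmx_irreducible_gt0.
split; first by rewrite ge_min lexx.
by move=> x y; rewrite ge_min (bigD1 (x, y))//= ge_min lexx orbT.
Qed.

Section Path.
Variable g : X.

Local Notation grid := (@grid R t).

Definition calm m i := (i != 0)%N &&
  `[< forall v, grid m i <= v -> v <= grid m i.+1 -> path_at g v = path_at g (grid m i) >].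

Definition cell_points m M i : seq (R * 'I_d.+1) :=
  if calm m i then
    [seq (grid m i + k.+1%:R * (t / m.+1%:R / 2 ^+ M), path_at g (grid m i)) | k <- iota 0 (2 ^ M)]
  else [:: (grid m i.+1, path_at g (grid m i.+1))].

Definition cells_points m M i n := flatten [seq cell_points m M k | k <- iota i n].

Definition shadow_at m M : set X :=
  [set f | forall p, p \in cells_points m M 0 m.+1 -> path_at f p.1 = p.2].

(** The paths that follow [g] on the cells of the grid where [g] does not move,
    the initial cell excepted: the chain may have to leave its initial state to join [g]. *)
Definition shadow m : set X := \bigcap_M shadow_at m M.

Let calm_end m i : calm m i -> path_at g (grid m i.+1) = path_at g (grid m i).
Proof.
by move=> /andP[_ /asboolP H]; apply: H => //; rewrite -subr_ge0 grid_step divr_ge0// ltW.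
Qed.

Let refine (h : R) M : (2 ^ M)%:R * (h / 2 ^+ M) = h.
Proof. by rewrite natrX mulrCA mulfV ?mulr1// expf_neq0. Qed.

Let fine_cell m M i : grid m i + (2 ^ M)%:R * (t / m.+1%:R / 2 ^+ M) = grid m i.+1.
Proof.
by rewrite refine -(@grid_step R t m i) addrC subrK.
Qed.

Lemma cells_fdd m M p i n x : 0 <= p -> p <= expR (- kappa * (t / m.+1%:R)) ->
  (forall x y, p <= expmx ((t / m.+1%:R) *: Q) x y) ->
  (i != 0)%N ==> (x == path_at g (grid m i)) ->
  [/\ path <=%R (grid m i) (unzip1 (cells_points m M i n)),
      all (fun u => u <= grid m (i + n)) (unzip1 (cells_points m M i n)) &
      p ^+ n <= ctmc_fdd Q x (grid m i) (cells_points m M i n)].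
Proof.
move=> p0 p1 p2; set h := t / m.+1%:R in p1 p2.
have h0 : 0 <= h by rewrite divr_ge0// ltW.
elim: n i x => [|n IH] i x xg; first by rewrite /= expr0.
have [|q1 q2 q3] := IH i.+1 (path_at g (grid m i.+1)); first by rewrite eqxx implybT.
have gi : grid m i.+1 <= grid m (i + n.+1) by apply: grid_le => //; rewrite addnS ltnS leq_addr.
rewrite addSnnS in q2.
rewrite /cells_points /= -/(cells_points m M i.+1 n) /cell_points; case: ifPn => [ci|_]; last first.
  have gii : grid m i <= grid m i.+1 by exact: grid_le.
  split; rewrite /= ?gii ?gi// grid_step exprS ler_pM//; exact: exprn_ge0.
have [ci0 _] := andP ci; move: xg; rewrite ci0 /= => /eqP ->.
have de0 : 0 <= h / 2 ^+ M by rewrite divr_ge0// exprn_ge0.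
have := @fdd_stay (path_at g (grid m i)) (grid m i) (h / 2 ^+ M) 0 (2 ^ M) (cells_points m M i.+1 n) de0.
rewrite add0n fine_cell mul0r addr0 => /(_ q1)[r1 r2]; split => //.
- rewrite /unzip1 map_cat all_cat q2 andbT -map_comp all_map; apply/allP => k; rewrite mem_iota add0n => /andP[_ kM] /=.
  apply: le_trans gi; rewrite -(fine_cell m M i) lerD2l ler_wpM2r// ler_nat.
  exact: kM.
- apply: le_trans r2; rewrite exprS; apply: ler_pM => //; first exact: exprn_ge0.
    by rewrite refine.
  by rewrite -(calm_end ci).
Qed.

Let shadow_fdd m : exists2 c : R, 0 < c & forall M, (c%:E <= P (J @^-1` shadow_at m M))%E.
Proof.
have h0 : 0 < t / m.+1%:R by rewrite divr_gt0.
have [p p0 [p1 p2]] := transition_bound h0.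
exists (p ^+ m.+1); first exact: exprn_gt0.
move=> M; have [|q1 q2 q3] := @cells_fdd m M p 0 m.+1 j0 (ltW p0) p1 p2; first by [].
have g00 : grid m 0 = 0 :> R by rewrite /grid mul0r.
rewrite add0n grid_last in q2; rewrite g00 in q1 q3.
by rewrite (HJ q1 q2) lee_fin.
Qed.

Lemma measurable_shadow_at m M : measurable (shadow_at m M).
Proof.
have step0 x y : 0 <= expmx ((t / m.+1%:R) *: Q) x y.
  by apply: expmx_metzler_ge0 => //; rewrite divr_ge0// ltW.
have [|q1 q2 _] := @cells_fdd m M 0 0 m.+1 j0 (lexx 0) (expR_ge0 _) step0; first by [].
rewrite add0n grid_last in q2; have g00 : grid m 0 = 0 :> R by rewrite /grid mul0r.
rewrite g00 in q1.
have -> : shadow_at m M = \bigcap_(p in [set` cells_points m M 0 m.+1]) [set f | path_at f p.1 = p.2].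
  by apply/seteqP; split => f H p; exact: H.
apply: fin_bigcap_measurable => [|p pm]; first exact: finite_seq.
have pu : p.1 \in unzip1 (cells_points m M 0 m.+1) by apply: map_f.
apply: measurable_path_at_fixed.
  have := order_path_min (@le_trans _ R) q1 => /allP; exact.
by move/allP : q2; exact.
Qed.

Lemma measurable_shadow m : measurable (shadow m).
Proof. by apply: bigcapT_measurable => M; exact: measurable_shadow_at. Qed.

Let cells_mem m M i p : (i < m.+1)%N -> p \in cell_points m M i -> p \in cells_points m M 0 m.+1.
Proof. by move=> im pi; apply/flattenP; exists (cell_points m M i) => //; apply: map_f; rewrite mem_iota. Qed.

Let halve (x y z : R) : x * (y / z) = 2 * x * (y / (2 * z)).
Proof. by rewrite invfM; set w := z^-1; field. Qed.

Lemma shadow_at_nested m M : shadow_at m M.+1 `<=` shadow_at m M.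
Proof.
move=> f H p /flattenP[l /mapP[i]]; rewrite mem_iota add0n => im -> pi.
apply: H; apply: (cells_mem im); move: pi; rewrite /cell_points; case: ifP => // _.
move=> /mapP[k]; rewrite mem_iota add0n => /andP[_ kM] ->; apply/mapP; exists (k.+1.*2.-1).
  rewrite mem_iota add0n expnS mul2n; have := kM; rewrite -leq_double => kM'; exact: kM'.
congr pair; congr (_ + _); rewrite prednK ?double_gt0// -mul2n natrM exprS.
exact: halve.
Qed.

(** Refining the observation times inside calm cells leaves the lower bound of
    the probability unchanged, so it survives in the limit. *)
Lemma shadow_pos m : (0 < P (J @^-1` shadow m))%E.
Proof.
have [c c0 H] := shadow_fdd m.
have mJ F : measurable F -> measurable (J @^-1` F) by move=> mF; rewrite -[_ @^-1` _]setTI; exact: measurable_funP.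
have nest : nonincreasing_seq (fun M => J @^-1` shadow_at m M).
  by apply/nonincreasing_seqP => M; apply/subsetPset => w; exact: shadow_at_nested.
have := @nonincreasing_cvg_mu _ _ _ P _ _ (fun M => mJ _ (measurable_shadow_at m M)) _ nest.
rewrite -preimage_bigcap -/(shadow m) => C.
have {}C : P (J @^-1` shadow_at m M) @[M --> \oo] --> P (J @^-1` shadow m).
  apply: C; first by apply: le_lt_trans (probability_le1 _ _) (ltry _); by apply: mJ; exact: measurable_shadow_at.
  by apply: mJ; exact: measurable_shadow.
apply: (@lt_le_trans _ _ c%:E); first by rewrite lte_fin.
rewrite -(cvg_lim _ C)//; apply: lime_ge; first by apply/cvg_ex; exists (P (J @^-1` shadow m)).
exact: nearW.
Qed.

Let shadow_grid m i f : shadow m f -> (i < m.+1)%N -> path_at f (grid m i.+1) = path_at g (grid m i.+1).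
Proof.
move=> H im; have := H 0%N I; rewrite /shadow_at /= => Hf.
apply: (Hf (grid m i.+1, path_at g (grid m i.+1))); apply: (cells_mem im).
rewrite /cell_points; case: ifP => [ci|_]; last by rewrite inE eqxx.
by rewrite /= inE calm_end// -(fine_cell m 0 i) expr0 divr1.
Qed.

Let shadow_calm m i f u : shadow m f -> (i < m.+1)%N -> calm m i ->
  grid m i <= u -> u < grid m i.+1 -> path_at f u = path_at g u.
Proof.
move=> H im ci iu ui; have [e e0 He] := path_at_rcont f u.
have h0 : 0 < t / m.+1%:R by rewrite divr_gt0.
pose e' := Num.min e (grid m i.+1 - u).
have e'0 : 0 < e' by rewrite lt_min e0 subr_gt0.
have [M Me] : exists M, t / m.+1%:R / 2 ^+ M < e'.
  have [M MM] : exists M : nat, t / m.+1%:R / e' < M%:R.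
    by exists (Num.bound (t / m.+1%:R / e')); exact: archi_boundP (ltW (divr_gt0 h0 e'0)).
  exists M; rewrite ltr_pdivrMr ?exprn_gt0// [ltRHS]mulrC -ltr_pdivrMr//; apply: lt_trans MM _.
  by rewrite -natrX ltr_nat ltn_expl.
set de := t / m.+1%:R / 2 ^+ M in Me.
have de0 : 0 < de by rewrite divr_gt0// exprn_gt0.
pose k := Num.truncn ((u - grid m i) / de).
have /andP[k1 k2] : k%:R <= (u - grid m i) / de < k.+1%:R.
  by apply: truncn_itv; rewrite divr_ge0 ?subr_ge0// ltW.
rewrite ler_pdivlMr// in k1; rewrite ltr_pdivrMr// in k2.
pose v := grid m i + k.+1%:R * de.
have uv : u <= v by rewrite /v; lra.
have vu : v < u + e' by rewrite /v -natr1; move: k1 Me; rewrite mulrDl mul1r; lra.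
have ve : v < u + e by apply: lt_le_trans vu _; rewrite lerD2l ge_min lexx.
have vi : v < grid m i.+1.
  by apply: lt_le_trans vu _; rewrite -lerBrDl ge_min lexx orbT.
have kM : (k < 2 ^ M)%N.
  have : k.+1%:R * de < (2 ^ M)%:R * de by move: vi; rewrite -(fine_cell m M i) ltrD2l.
  by rewrite ltr_pM2r// ltr_nat => /ltnW.
rewrite -(He v uv ve).
have := H M I; rewrite /shadow_at /= => /(_ (v, path_at g (grid m i)))/= ->.
  by have /andP[_ /asboolP/(_ u iu (ltW ui)) ->] := ci.
apply: (cells_mem im); rewrite /cell_points ci; apply/mapP; exists k => //.
by rewrite mem_iota.
Qed.

Let isolated (b : seq R) u : ~ (u \in b) -> exists2 e : R, 0 < e & forall s, s \in b -> ~ (u - e < s < u + e).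
Proof.
elim: b => [|s b IH] ub; first by exists 1.
have [|e e0 He] := IH; first by move=> h; apply: ub; rewrite inE h orbT.
have su : 0 < `|u - s| by rewrite normr_gt0 subr_eq0; apply/negP => /eqP E; apply: ub; rewrite inE E eqxx.
exists (Num.min e `|u - s|); first by rewrite lt_min e0.
move=> v; rewrite inE => /orP[/eqP ->|vb] /andP[h1 h2]; last first.
  apply: (He v vb); rewrite (le_lt_trans _ h1) ?(lt_le_trans h2)// ?lerD2l ?ge_min ?lexx// lerN2 ge_min lexx//.
have h3 : u - s < `|u - s| by apply: lt_le_trans (_ : Num.min e `|u - s| <= _); [lra|rewrite ge_min lexx orbT].
have h4 : s - u < `|u - s| by apply: lt_le_trans (_ : Num.min e `|u - s| <= _); [lra|rewrite ge_min lexx orbT].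
by have := ltxx `|u - s|; rewrite {1}/Num.norm; case: (lerP 0 (u - s)) h3 h4 => h; [rewrite ger0_norm|rewrite ltr0_norm]; lra.
Qed.

Let arith (x y h e u : R) : y - x = h -> h < e -> x <= u -> u <= y -> u - e < x /\ y < u + e.
Proof. by move=> *; split; lra. Qed.

(** Right-continuity extends the agreement at dyadic times to the calm cells,
    and a time that is not a jump time ends up in a calm cell. *)
Lemma shadow_cvg (f_ : nat -> X) : (forall m, shadow m (f_ m)) ->
  forall u, 0 < u -> u < t -> ~ (u \in unzip1 (val g).2) ->
    \forall m \near \oo, path_at (f_ m) u = path_at g u.
Proof.
move=> H u u0 ut uj; have [e e0 He] := isolated uj.
have const v w : u - e < v -> v <= w -> w < u + e -> path_at g w = path_at g v.
  move=> ev vw we; apply: (@path_at_constant R d t g v (u + e) w) => //.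
  by move=> s sj /andP[vs se]; apply: (He s sj); rewrite se (lt_trans ev vs).
near=> m.
have me : t / m.+1%:R < e by near: m; exact: grid_mesh_cvg.
have mu : t / m.+1%:R < u by near: m; exact: grid_mesh_cvg.
have [||i [/andP[_ im] _ iu ui]] := @grid_jstate R d t m 0 m (fun=> j0) u.
- by rewrite /grid mul0r ltW.
- by rewrite add0n grid_last ltW.
rewrite add0n in im.
have step := @grid_step R t m i.
have [ui'|ui'] := eqVneq u (grid m i.+1); first by rewrite ui'; exact: shadow_grid.
have i0 : (i != 0)%N.
  by apply/negP => /eqP i0; move: ui step; rewrite i0 {1}/grid mul1r => ui1; have := le_lt_trans ui1 mu; rewrite ltxx.
apply: (shadow_calm (H m) im _ iu); last by rewrite lt_neqAle ui'.
apply/andP; split => //; apply/asboolP => v iv vi.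
have [h1 h2] := arith step me iu ui.
by apply: const => //; exact: le_lt_trans vi h2.
Unshelve. all: by end_near. Qed.

(** Otherwise every shadow of [g] would contain a path off [G], and these paths
    would converge to [g]. *)
Lemma neighborhood_pos (G : set X) : measurable G ->
  (forall f_ : nat -> X, (forall u, 0 < u -> u < t -> ~ (u \in unzip1 (val g).2) ->
     \forall m \near \oo, path_at (f_ m) u = path_at g u) -> \forall m \near \oo, G (f_ m)) ->
  (0 < P (J @^-1` G))%E.
Proof.
move=> mG HG.
have [m sub] : exists m, shadow m `<=` G.
  apply: contrapT => /forallNP nsub.
  have /choice[f_ Hf] : forall m, exists f, shadow m f /\ ~ G f.
    move=> m; apply: contrapT => nf; apply: (nsub m) => f sf; apply: contrapT => nG.
    by apply: nf; exists f.
  have [N _ /(_ N (leqnn _))] := HG f_ (shadow_cvg (fun m => (Hf m).1)).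
  by case: (Hf N).
have mJ F : measurable F -> measurable (J @^-1` F) by move=> mF; rewrite -[_ @^-1` _]setTI; exact: measurable_funP.
apply: (lt_le_trans (shadow_pos m)); apply: le_measure; rewrite ?inE; [by apply: mJ; exact: measurable_shadow|exact: mJ|].
by move=> w; exact: sub.
Qed.

End Path.
End Shadow.

End Nearby.
Export Nearby.

(** * Limits *)

Module Final.
Local Open Scope ereal_scope.

Lemma lne_bounds (R : realType) (n : nat) (x : \bar R) (rho e : R) : (0 < n)%N ->
  (expR (- (n%:R * (rho + e))))%:E <= x -> x <= (expR (- (n%:R * (rho - e))))%:E ->
  exists2 z : R, (n%:R^-1)%:E * lne x = z%:E & (`|- rho - z| <= e)%R.
Proof.
move=> n0 lo hi.
have n0' : (0 < n%:R :> R)%R by rewrite ltr0n.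
have [y xE] : exists y : R, x = y%:E.
  by exists (fine x); rewrite fineK//; apply: fin_real; rewrite (lt_le_trans _ lo) ?ltNyr//= (le_lt_trans hi)// ltry.
move: lo hi; rewrite xE !lee_fin => lo hi.
have y0 : (0 < y)%R by apply: lt_le_trans lo; exact: expR_gt0.
exists (n%:R^-1 * ln y)%R; first by rewrite lne_EFin// EFinM.
have lo' : (- (n%:R * (rho + e)) <= ln y)%R by rewrite -[leLHS]expRK ler_ln ?posrE ?expR_gt0.
have hi' : (ln y <= - (n%:R * (rho - e)))%R by rewrite -[leRHS]expRK ler_ln ?posrE ?expR_gt0.
have lo2 : (- (rho + e) <= n%:R^-1 * ln y)%R by rewrite ler_pdivlMl// mulrN.
have hi2 : (n%:R^-1 * ln y <= - (rho - e))%R by rewrite ler_pdivrMl// mulrN.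
by rewrite ler_norml; apply/andP; split; lra.
Qed.

Lemma exponential_rate (R : realType) (x : nat -> \bar R) (rho : R) :
  (forall e : R, (0 < e)%R -> \forall n \near \oo, (expR (- (n%:R * (rho + e))))%:E <= x n) ->
  (forall e : R, (0 < e)%R -> \forall n \near \oo, x n <= (expR (- (n%:R * (rho - e))))%:E) ->
  (n%:R^-1)%:E * lne (x n) @[n --> \oo] --> (- rho)%:E.
Proof.
move=> lo hi.
have H (e : R) : (0 < e)%R -> \forall n \near \oo,
    exists2 z : R, (n%:R^-1)%:E * lne (x n) = z%:E & (`|- rho - z| <= e)%R.
  move=> e0; near=> n; apply: lne_bounds.
  - by near: n; exact: nbhs_infty_gt.
  - by near: n; exact: lo.
  - by near: n; exact: hi.
apply/fine_cvgP; split.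
  by apply: filterS (H 1%R ltr01) => n [z -> _].
by apply/cvgrPdist_le => e e0; apply: filterS (H e e0) => n [z /= -> ].
Unshelve. all: by end_near. Qed.

Lemma le_ratio (R : realType) (C q de : R) (V : \bar R) : (0 < C)%R -> (0 < q)%R ->
  (q%:E ^+ 2 * de%:E <= V) -> (C * de)%:E <= C%:E * (V / (q%:E * q%:E)).
Proof.
move=> C0 q0 H; rewrite EFinM lee_wpmul2l ?lee_fin ?(ltW C0)//.
have qq : (0 < q * q)%R by rewrite mulr_gt0.
by rewrite -EFinM inver (gt_eqF qq) lee_pdivlMr// EFinM muleC.
Qed.

Lemma ratio_le (R : realType) (C q b : R) (V : \bar R) : (0 < C)%R -> (0 < q)%R ->
  (V <= b%:E) -> C%:E * (V / (q%:E * q%:E)) <= (C * (b / (q * q)))%:E.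
Proof.
move=> C0 q0 H; rewrite EFinM lee_wpmul2l ?lee_fin ?(ltW C0)//.
have qq : (0 < q * q)%R by rewrite mulr_gt0.
by rewrite -EFinM inver (gt_eqF qq) lee_pdivrMr// -EFinM divfK ?gt_eqF.
Qed.

Section Assembly.
Context {R : realType} {L d : nat} {t : R}.
Local Notation T := (borelV R L).
Local Notation X := (bpath d t).
Local Notation St := 'I_d.+1.
Context {lam : St -> R} {mu : St -> probability T R} {r : St -> 'M[R]_L}
  {Q : 'M[R]_d.+1} {j0 : St} {a : 'rV[R]_L}
  {dO : nat -> measure_display} {Om : forall n, measurableType (dO n)}
  {P : forall n, probability (Om n) R} {J : forall n, {mfun Om n >-> X}}
  {E : forall n, St -> nat -> {mfun Om n >-> R}}
  {B : forall n, St -> nat -> {mfun Om n >-> T}}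
  {Y : forall n, R -> {mfun Om n >-> T}}
  {bs : X -> 'rV[R]_L} {ths : X -> 'cV[R]_L} {kap : R.-pker X ~> T}
  {dO' : nat -> measure_display} {Om' : forall n, measurableType (dO' n)}
  {QQ : forall n, probability (Om' n) R} {JQ : forall n, {mfun Om' n >-> X}}
  {V : forall n, 'I_n -> {mfun Om' n >-> T}}.
Hypotheses (t0 : (0 < t)%R) (genQ : generator Q) (irrQ : irreducible_gen Q).
Hypothesis lam0 : forall j, (0 < lam j)%R.
Hypothesis mu_ge0 : forall j, {ae mu j, forall x : T, forall l, (0 <= (x : 'rV[R]_L) ord0 l)%R}.
Hypothesis mu_exp : forall j, exists2 del : R, (0 < del)%R &
     forall th : 'cV[R]_L, (forall l, `|th l ord0| <= del)%R -> mgf (mu j) th < +oo.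
Hypothesis r0 : forall j i i', (0 <= r j i i')%R.
Hypothesis net : forall n, (0 < n)%N -> network lam mu r Q j0 n%:R (P n) (J n) (E n) (B n) (Y n).
Hypothesis rare : forall f : X, ~ orthant a (grad_Mf0 lam mu r f).
Hypothesis opt : forall f, optimizers lam mu r a f (bs f) (ths f).
Hypothesis mths : forall l, measurable_fun setT (fun f => ths f l ord0).
Hypothesis twisted : twisted_kernel lam mu r ths kap.
Hypothesis smp : forall n, (0 < n)%N -> sampling (P n) (J n) kap (QQ n) (JQ n) (@V n).

Local Notation path_prob := (Model.path_prob t0 lam0 r0 opt mths twisted).
Local Notation rate_of := (@Model.rate_of R L d t lam mu r bs ths).
Local Notation twisted_law := (@Model.twisted_law R L d t kap).
Local Notation untwist := (Model.untwist lam mu r ths).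
Local Notation p n := (P n [set w | orthant a (n%:R^-1 *: (Y n t w : 'rV[R]_L))%R]).
Local Notation LR n := (likelihood_ratio lam mu r ths (JQ n) (@V n)).
Local Notation Ind n := (rare_indicator a (@V n)).
Local Notation rate := (ereal_inf [set path_rate lam mu r a f | f in [set: X]]).

Let rho : R := fine rate.

Let rate_fin : rate \is a fin_num.
Proof.
rewrite fin_real//; apply/andP; split.
  apply: (@lt_le_trans _ _ 0); first exact: ltNy0.
  apply/ereal_infP => _ [f _ <-]; rewrite (Model.path_rateE t0 lam0 r0 opt) lee_fin.
  exact: (Model.rate_of_ge0 t0 lam0 r0 opt).
apply: le_lt_trans (ltry (rate_of (point : rawpath d t))).
by apply: ereal_inf_lbound; exists (point : rawpath d t) => //; rewrite (Model.path_rateE t0 lam0 r0 opt).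
Qed.

Lemma rateE : rate = rho%:E. Proof. by rewrite fineK. Qed.

Let rho_le f : (rho <= rate_of f)%R.
Proof.
rewrite -lee_fin -rateE -(Model.path_rateE t0 lam0 r0 opt).
by apply: ereal_inf_lbound; exists f.
Qed.

Let near_optimal_path (e : R) : (0 < e)%R -> exists g, (rate_of g < rho + e)%R.
Proof.
move=> e0; have [_ [g _ <-]] := lb_ereal_inf_adherent e0 rate_fin.
by rewrite rateE (Model.path_rateE t0 lam0 r0 opt) -EFinD lte_fin; exists g.
Qed.

Let same_path_law n (h : X -> \bar R) : (0 < n)%N -> measurable_fun setT h ->
  (forall f, 0 <= h f) -> \int[P n]_o h (J n o) = \int[P 1%N]_o h (J 1%N o).
Proof.
move=> n0 mh h0; apply: (same_law_integral _ mh h0) => F mF.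
exact: (ctmc_same_law (network_ctmc (net n0)) (network_ctmc (net (ltn0Sn 0)))).
Qed.

Let pp_ge0 n f : 0 <= path_prob n f. Proof. exact: measure_ge0. Qed.

Let pE n : (0 < n)%N -> p n = \int[P 1%N]_o path_prob n (J 1%N o).
Proof.
move=> n0; rewrite (rare_prob t0 lam0 mu_ge0 r0 opt mths twisted n0 (net n0) (smp n0)).
by apply: same_path_law => //; exact: measurable_path_prob.
Qed.

Let meanE n : (0 < n)%N -> 'E_(QQ n)[fun w => (LR n w * Ind n w)%R] = p n.
Proof.
move=> n0; rewrite (sampling_mean t0 lam0 r0 opt mths twisted n0 (smp n0)).
by rewrite (rare_prob t0 lam0 mu_ge0 r0 opt mths twisted n0 (net n0) (smp n0)).
Qed.

Let mS n : measurable_fun setT (fun w => sum_vectors (@V n) w : T).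
Proof.
apply: measurable_to_borelV => // l; under eq_fun do rewrite /sum_vectors summxE.
by apply: measurable_sum => i; apply: (measurableT_comp (measurable_coordV l)); exact: measurable_funPT.
Qed.

Let mZ n : (0 < n)%N -> measurable_fun setT (fun w => (LR n w * Ind n w)%R).
Proof.
move=> n0; apply: measurable_funM.
  have -> : LR n = (fun w => untwist n (JQ n w, sum_vectors (@V n) w : T)) by [].
  apply: (measurableT_comp (measurable_untwist t0 lam0 r0 opt mths twisted n)).
  by apply: measurable_fun_pair => //; exact: measurable_funPT.
rewrite (funext (rare_indicatorE a n0 (@V n))).
apply: (measurableT_comp _ (@mS n)); apply: measurable_indic; exact: measurable_scaled.
Qed.

Let Z_ge0 n w : (0 <= LR n w * Ind n w)%R.
Proof. by rewrite mulr_ge0 ?expR_ge0. Qed.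

Let squareE n : (fun w => ((LR n w * Ind n w) ^+ 2)%R) = (fun w => (LR n w ^+ 2 * Ind n w)%R).
Proof.
apply/funext => w; rewrite exprMn; congr (_ * _)%R.
by rewrite /rare_indicator indicE; case: (_ \in _); rewrite ?expr1n ?expr0n.
Qed.

Let average_le n (h : X -> \bar R) (b : R) : (0 <= b)%R -> (forall f, 0 <= h f) -> measurable_fun setT h ->
  (forall f, h f <= b%:E) -> \int[P n]_o h (J n o) <= b%:E.
Proof.
move=> b0 h0 mh hb; apply: (@le_trans _ _ (\int[P n]_o (cst b%:E o))).
  apply: le_integralT => //; first by apply: (measurableT_comp mh); exact: measurable_funPT.
by rewrite integral_cst// -[leRHS]mule1 lee_wpmul2l ?lee_fin//; exact: probability_le1.
Qed.

Let p_up n : (0 < n)%N -> p n <= (expR (- (n%:R * rho)))%:E.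
Proof.
move=> n0; rewrite (rare_prob t0 lam0 mu_ge0 r0 opt mths twisted n0 (net n0) (smp n0)).
apply: average_le => //; [exact: measurable_path_prob|] => f.
apply: le_trans (path_prob_le t0 lam0 r0 opt mths twisted f n0) _.
by rewrite lee_fin ler_expR lerN2 ler_wpM2l.
Qed.

Let m2_up n : (0 < n)%N ->
  'E_(QQ n)[fun w => (LR n w ^+ 2 * Ind n w)%R] <= (expR (- (n%:R * (2 * rho))))%:E.
Proof.
move=> n0; rewrite (sampling_second_moment t0 lam0 r0 opt mths twisted n0 (smp n0)).
apply: (@average_le n (fun f => \int[twisted_law n f]_y ((untwist n (f, y) ^+ 2)%:E * (\1_(scaled a n) y)%:E))).
- exact: expR_ge0.
- by move=> f; apply: integral_ge0 => y _; rewrite mule_ge0// lee_fin sqr_ge0.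
- apply: (@measurable_kernel_integral _ _ _ _ kap n (fun z => (untwist n z ^+ 2)%:E * (\1_(scaled a n) z.2)%:E)).
    apply: emeasurable_funM.
      by apply/measurable_EFinP; apply: measurable_funX; exact: (measurable_untwist t0 lam0 r0 opt mths twisted).
    apply/measurable_EFinP; apply: (@measurableT_comp _ _ _ _ _ _ (\1_(scaled a n) : T -> R)) => //.
    by apply: measurable_indic; exact: measurable_scaled.
  by move=> z; rewrite mule_ge0// lee_fin sqr_ge0.
move=> f; apply: le_trans (path_second_moment t0 lam0 r0 opt mths twisted f n0) _.
by rewrite lee_fin ler_expR lerN2 !ler_wpM2l.
Qed.

Let p_low (e : R) : (0 < e)%R -> \forall n \near \oo, (expR (- (n%:R * (rho + e))))%:E <= p n.
Proof.
move=> e0; have e2 : (0 < e / 2)%R by rewrite divr_gt0.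
have [g gr] := near_optimal_path e2.
have [th [K [s [s1 gg]]]] := good_exists t0 lam0 r0 opt g e2.
set v := (- rate_of g - e / 2)%R in gg.
pose G : set X := good mu a lam0 r0 th K s v.
have mG : measurable G by exact: measurable_good.
have PG : 0 < P 1%N (J 1%N @^-1` G).
  apply: (neighborhood_pos t0 genQ irrQ (network_ctmc (net (ltn0Sn 0))) (g := g)) => // f_ H.
  by apply: good_open gg H.
have mpp n : measurable_fun setT (fun o => (expR (- (n%:R * v)))%:E * path_prob n (J 1%N o)).
  apply: emeasurable_funM => //; apply: (measurableT_comp (measurable_path_prob t0 lam0 r0 opt mths twisted n)).
  exact: measurable_funPT.
have D : \forall n \near \oo, 1%:E <= \int[P 1%N]_o ((expR (- (n%:R * v)))%:E * path_prob n (J 1%N o)).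
  apply: (integral_diverges mpp _ _ PG).
  - by move=> n o; rewrite mule_ge0// lee_fin expR_ge0.
  - by rewrite -[X in measurable X]setTI; exact: measurable_funPT.
  - move=> o Go B0; have Gf : good mu a lam0 r0 th K s v (J 1%N o) := Go.
    by apply: good_diverges Gf B0.
near=> n; have n0 : (0 < n)%N by near: n; exact: nbhs_infty_gt.
have : 1%:E <= \int[P 1%N]_o ((expR (- (n%:R * v)))%:E * path_prob n (J 1%N o)) by near: n; exact: D.
rewrite ge0_integralZl//; last first.
  by apply: (measurableT_comp (measurable_path_prob t0 lam0 r0 opt mths twisted n)); exact: measurable_funPT.
rewrite -pE// => H; apply: (@le_trans _ _ (expR (n%:R * v))%:E).
  rewrite lee_fin ler_expR -mulrN ler_wpM2l// /v; move: gr; lra.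
rewrite -[leLHS]mule1; apply: le_trans (lee_wpmul2l _ H) _; first by rewrite lee_fin expR_ge0.
by rewrite muleA -EFinM -expRD subrr expR0 mul1e.
Unshelve. all: by end_near. Qed.

Let m2_fin n : (0 < n)%N -> 'E_(QQ n)[fun w => ((LR n w * Ind n w) ^+ 2)%R] < +oo.
Proof. by move=> n0; rewrite squareE; apply: le_lt_trans (m2_up n0) (ltry _). Qed.

Let m2_ge n : (0 < n)%N -> p n ^+ 2 <= 'E_(QQ n)[fun w => (LR n w ^+ 2 * Ind n w)%R].
Proof.
move=> n0; rewrite -squareE -meanE//.
by apply: second_moment_ge (m2_fin n0) => //; exact: mZ.
Qed.

Let p_real n (q : R) : (0 < n)%N -> (0 < q)%R -> q%:E <= p n -> exists2 q' : R, p n = q'%:E & (q <= q')%R.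
Proof.
move=> n0 q0 H; have pf : p n \is a fin_num.
  by rewrite ge0_fin_numE//; apply: le_lt_trans (p_up n0) (ltry _).
by exists (fine (p n)); rewrite -?lee_fin fineK.
Qed.

Lemma prob_limit : (2 / n%:R)%:E * lne (p n) @[n --> \oo] --> (- 2%:E * rate).
Proof.
have H : (n%:R^-1)%:E * lne (p n) @[n --> \oo] --> (- rho)%:E.
  apply: exponential_rate; first exact: p_low.
  move=> e e0; near=> n; have n0 : (0 < n)%N by near: n; exact: nbhs_infty_gt.
  by apply: le_trans (p_up n0) _; rewrite lee_fin ler_expR lerN2 ler_wpM2l//; lra.
have -> : - 2%:E * rate = 2%:E * (- rho)%:E by rewrite rateE EFinN mulNe muleN.
under eq_fun do rewrite EFinM -muleA.
exact: cvgeZl.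
Unshelve. all: by end_near. Qed.

Lemma second_moment_limit :
  (n%:R^-1)%:E * lne ('E_(QQ n)[fun w => (LR n w ^+ 2 * Ind n w)%R]) @[n --> \oo] --> (- 2%:E * rate).
Proof.
have -> : - 2%:E * rate = (- (2 * rho))%:E by rewrite rateE -EFinN -EFinM mulNr.
apply: exponential_rate => e e0; near=> n; have n0 : (0 < n)%N by near: n; exact: nbhs_infty_gt.
  apply: le_trans (m2_ge n0).
  have H : (expR (- (n%:R * (rho + e / 2))))%:E <= p n.
    by near: n; apply: p_low; rewrite divr_gt0.
  apply: le_trans (lee_pexp 2 _ H); last by rewrite lee_fin expR_ge0.
  rewrite -EFin_expe lee_fin expr2 -expRD ler_expR le_eqVlt; apply/orP; left; apply/eqP; by field.
by apply: le_trans (m2_up n0) _; rewrite lee_fin ler_expR lerN2 ler_wpM2l//; lra.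
Unshelve. all: by end_near. Qed.

Let failureE n : (0 < n)%N ->
  [set w | Ind n w = 0%R] = (fun w => sum_vectors (@V n) w : T) @^-1` (~` scaled a n).
Proof.
move=> n0; apply/seteqP; split => w /=; rewrite (rare_indicatorE a n0 (@V n)) indicE.
  by case: (boolP (_ \in _)) => [_ /eqP|/negP nS _ S]; rewrite ?oner_eq0//; apply: nS; rewrite inE.
by move=> nS; rewrite memNset.
Qed.

(** Under the twisted law the rare event fails often enough for the variance
    to be of the order of the squared probability, up to a subexponential factor. *)
Let escape (e K : R) : (0 < e)%R -> \forall n \near \oo,
  (K * expR (- (n%:R * e)))%:E <= QQ n [set w | Ind n w = 0%R].
Proof.
move=> e0.
have mtw n : measurable_fun setT (fun f : X => twisted_law n f (~` scaled a n)).
  have ms : measurable (~` scaled a n : set T) by apply: measurableC; exact: measurable_scaled.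
  have -> : (fun f : X => twisted_law n f (~` scaled a n)) =
      (fun f => \int[twisted_law n f]_y ((\1_(~` scaled a n) (f, y).2)%:E)).
    by apply/funext => f /=; rewrite integral_indic// setIT.
  apply: (@measurable_kernel_integral _ _ _ _ kap n (fun z => (\1_(~` scaled a n) z.2)%:E)).
    apply/measurable_EFinP; apply: (@measurableT_comp _ _ _ _ _ _ (\1_(~` scaled a n) : T -> R)) => //.
  by move=> z; rewrite lee_fin.
have mtwJ n : measurable_fun setT (fun o => (expR (n%:R * e))%:E * twisted_law n (J 1%N o) (~` scaled a n)).
  by apply: emeasurable_funM => //; apply: (measurableT_comp (mtw n)); exact: measurable_funPT.
have D : \forall n \near \oo, K%:E <= \int[P 1%N]_o ((expR (n%:R * e))%:E * twisted_law n (J 1%N o) (~` scaled a n)).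
  apply: (@integral_diverges _ _ _ _ _ setT mtwJ) => //.
    have p1 : P 1%N setT = 1 := probability_setT (P 1%N).
    by rewrite p1.
  move=> o _ K'; set f := J 1%N o.
  have rf0 : (0 < rate_of f)%R by apply: (rate_of_gt0 t0 lam0 mu_ge0 mu_exp r0 opt rare).
  pose s := Num.min (2^-1)%R (e / 4 / rate_of f)%R.
  have s0 : (0 < s)%R by rewrite lt_min invr_gt0 ltr0n/= !divr_gt0.
  have s2 : (s <= 2^-1)%R by rewrite ge_min lexx.
  have se : (s * rate_of f <= e / 4)%R by rewrite -ler_pdivlMr// ge_min lexx orbT.
  near=> n.
  have H : (expR (- (n%:R * (2 * s * rate_of f))) / 2)%:E <= twisted_law n f (~` scaled a n).
    by near: n; exact: (escape_prob t0 lam0 mu_ge0 mu_exp r0 opt rare twisted f s0 s2).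
  apply: le_trans (lee_wpmul2l _ H); last by rewrite lee_fin expR_ge0.
  rewrite -EFinM lee_fin [leRHS]mulrA -expRD ler_pdivlMr//.
  have h1 : (n%:R * (e / 2) <= n%:R * e + - (n%:R * (2 * s * rate_of f)))%R.
    rewrite -mulrBr ler_wpM2l//; move: se; set sr := (s * _)%R; rewrite -mulrA -/sr; lra.
  have h2 : (K' * 2 <= n%:R * (e / 2))%R.
    by rewrite -ler_pdivrMr ?divr_gt0//; near: n; exact: nbhs_infty_ger.
  have := expR_ge1Dx (n%:R * e + - (n%:R * (2 * s * rate_of f))); lra.
near=> n; have n0 : (0 < n)%N by near: n; exact: nbhs_infty_gt.
have : K%:E <= \int[P 1%N]_o ((expR (n%:R * e))%:E * twisted_law n (J 1%N o) (~` scaled a n)) by near: n; exact: D.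
rewrite ge0_integralZl//; last first.
  by apply: (measurableT_comp (mtw n)); exact: measurable_funPT.
have -> : \int[P 1%N]_o twisted_law n (J 1%N o) (~` scaled a n) = QQ n [set w | Ind n w = 0%R].
  rewrite -(@same_path_law n (fun f => twisted_law n f (~` scaled a n)))//.
  have ms : measurable (~` scaled a n : set T) by apply: measurableC; exact: measurable_scaled.
  rewrite failureE//.
  set F := _ @^-1` _.
  have mF : measurable F by rewrite /F -[X in measurable X]setTI; exact: mS.
  transitivity (\int[QQ n]_w (\1_F w)%:E); last by rewrite integral_indic// setIT.
  have H := integral_sampling (smp n0) (g := fun z => (\1_(~` scaled a n) z.2)%:E).
  transitivity (\int[P n]_o \int[twisted_law n (J n o)]_y ((\1_(~` scaled a n) y)%:E)).
    by apply: eq_integral => o _; rewrite integral_indic// setIT.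
  rewrite -H//; apply/measurable_EFinP; apply: (@measurableT_comp _ _ _ _ _ _ (\1_(~` scaled a n) : T -> R)) => //.
move=> H; rewrite EFinM muleC.
apply: le_trans (lee_wpmul2l _ H) _; first by rewrite lee_fin expR_ge0.
by rewrite muleA -EFinM -expRD addNr expR0 mul1e.
Unshelve. all: by end_near. Qed.

Lemma number_of_runs_limit (T0 eps : R) : (0 < T0)%R -> (0 < eps)%R ->
  (n%:R^-1)%:E * lne ((T0 ^+ 2 / eps ^+ 2)%:E *
     ('V_(QQ n)[fun w => (LR n w * Ind n w)%R] / (p n * p n))) @[n --> \oo] --> (0 : \bar R).
Proof.
move=> T00 eps0; set C := (T0 ^+ 2 / eps ^+ 2)%R.
have C0 : (0 < C)%R by rewrite divr_gt0// exprn_gt0.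
have -> : (0 : \bar R) = (- (0 : R))%:E by rewrite oppr0.
apply: exponential_rate => e e0; near=> n; have n0 : (0 < n)%N by near: n; exact: nbhs_infty_gt.
  have [q pq q0] : exists2 q : R, p n = q%:E & (expR (- (n%:R * (rho + 1))) <= q)%R.
    by apply: p_real => //; [exact: expR_gt0|near: n; apply: p_low; exact: ltr01].
  have {}q0 : (0 < q)%R by apply: lt_le_trans q0; exact: expR_gt0.
  have es : (C^-1 * expR (- (n%:R * e)))%:E <= QQ n [set w | Ind n w = 0%R] by near: n; exact: escape.
  rewrite pq add0r; apply: le_trans (le_ratio C0 q0 (de := (C^-1 * expR (- (n%:R * e)))%R) _).
    by rewrite mulrA mulfV ?gt_eqF// mul1r.
  have mA : measurable [set w | Ind n w = 0%R].
    by rewrite failureE// -[X in measurable X]setTI; apply: mS => //; apply: measurableC; exact: measurable_scaled.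
  have := variance_ge (mZ n0) (@Z_ge0 n) (m2_fin n0) mA _.
  rewrite meanE// pq => H; apply: le_trans (H _); last by move=> w /= ->; rewrite mulr0.
  by rewrite lee_wpmul2l// -EFin_expe lee_fin sqr_ge0.
have [q pq q0] : exists2 q : R, p n = q%:E & (expR (- (n%:R * (rho + e / 4))) <= q)%R.
  by apply: p_real => //; [exact: expR_gt0|near: n; apply: p_low; rewrite divr_gt0].
have q0' : (0 < q)%R by apply: lt_le_trans q0; exact: expR_gt0.
have vb : 'V_(QQ n)[fun w => (LR n w * Ind n w)%R] <= (expR (- (n%:R * (2 * rho))))%:E.
  apply: le_trans (variance_le (mZ n0) (@Z_ge0 n) (m2_fin n0)) _.
  by rewrite squareE; exact: m2_up.
rewrite pq; apply: le_trans (ratio_le C0 q0' vb) _; rewrite lee_fin sub0r mulrN opprK.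
have qq : (expR (- (n%:R * (2 * rho + e / 2))) <= q * q)%R.
  apply: le_trans (ler_pM _ _ q0 q0); rewrite ?expR_ge0// -expRD ler_expR.
  by rewrite le_eqVlt; apply/orP; left; apply/eqP; field.
have h1 : (expR (- (n%:R * (2 * rho))) / (q * q) <= expR (n%:R * (e / 2)))%R.
  rewrite ler_pdivrMr ?mulr_gt0//; apply: le_trans (ler_wpM2l (expR_ge0 _) qq).
  by rewrite -expRD ler_expR le_eqVlt; apply/orP; left; apply/eqP; field.
have h2 : (C <= expR (n%:R * (e / 2)))%R.
  have : (C <= n%:R * (e / 2))%R by rewrite -ler_pdivrMr ?divr_gt0//; near: n; exact: nbhs_infty_ger.
  by have := expR_ge1Dx (n%:R * (e / 2)); lra.
have -> : (n%:R * e = n%:R * (e / 2) + n%:R * (e / 2))%R by field.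
rewrite expRD; apply: ler_pM => //; first exact: ltW.
by rewrite divr_ge0 ?expR_ge0// mulr_ge0// ltW.
Unshelve. all: by end_near. Qed.

End Assembly.

End Final.
Export Final.

Unset Implicit Arguments.
Set Strict Implicit.

Theorem proposition3 (R : realType) (L d : nat) (t : R)
  (lam : 'I_d.+1 -> R) (mu : 'I_d.+1 -> probability (borelV R L) R)
  (r : 'I_d.+1 -> 'M[R]_L) (Q : 'M[R]_d.+1) (j0 : 'I_d.+1) (a : 'rV[R]_L)
  (* original (scaled) networks, n = 1, 2, ... *)
  (dO : nat -> measure_display) (Om : forall n, measurableType (dO n))
  (P : forall n, probability (Om n) R)
  (J : forall n, {mfun Om n >-> bpath d t})
  (E : forall n, 'I_d.+1 -> nat -> {mfun Om n >-> R})
  (B : forall n, 'I_d.+1 -> nat -> {mfun Om n >-> borelV R L})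
  (Y : forall n, R -> {mfun Om n >-> borelV R L})
  (* optimizers, twisted laws and importance sampling measures *)
  (bs : bpath d t -> 'rV[R]_L) (ths : bpath d t -> 'cV[R]_L)
  (kap : R.-pker (bpath d t) ~> borelV R L)
  (dO' : nat -> measure_display) (Om' : forall n, measurableType (dO' n))
  (QQ : forall n, probability (Om' n) R)
  (JQ : forall n, {mfun Om' n >-> bpath d t})
  (V : forall n, 'I_n -> {mfun Om' n >-> borelV R L})
  (* critical value and precision *)
  (T eps : R) :
  0 < t -> 0 < T -> 0 < eps ->
  generator Q -> irreducible_gen Q ->
  (forall j, 0 < lam j) ->
  (forall j, {ae mu j, forall x : borelV R L, forall l, 0 <= (x : 'rV[R]_L) ord0 l}) ->
  (forall j, exists2 del : R, 0 < del &
     forall th : 'cV[R]_L, (forall l, `|th l ord0| <= del) ->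
       (mgf (mu j) th < +oo)%E) ->
  (forall j i i', 0 <= r j i i') ->
  (forall n, (0 < n)%N ->
     network lam mu r Q j0 n%:R (P n) (J n) (E n) (B n) (Y n)) ->
  (forall f : bpath d t, ~ orthant a (grad_Mf0 lam mu r f)) ->
  (forall f, optimizers lam mu r a f (bs f) (ths f)) ->
  (forall l, measurable_fun setT (fun f => ths f l ord0)) ->
  twisted_kernel lam mu r ths kap ->
  (forall n, (0 < n)%N -> sampling (P n) (J n) kap (QQ n) (JQ n) (V n)) ->
  let p n : \bar R := P n [set w | orthant a (n%:R^-1 *: (Y n t w : 'rV[R]_L))] in
  let LR n := likelihood_ratio lam mu r ths (JQ n) (V n) in
  let I n := rare_indicator a (V n) in
  let Sigma n : \bar R :=
    ((T ^+ 2 / eps ^+ 2)%:E * ('V_(QQ n)[fun w => (LR n w * I n w)%R] / (p n * p n)))%E in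
  let rate : \bar R := ereal_inf [set path_rate lam mu r a f | f in [set: bpath d t]] in
  [/\ ((n%:R^-1)%:E * lne ('E_(QQ n)[fun w => (LR n w ^+ 2 * I n w)%R]))%E
        @[n --> \oo] --> (- 2%:E * rate)%E,
      ((2 / n%:R)%:E * lne (p n))%E @[n --> \oo] --> (- 2%:E * rate)%E
    & ((n%:R^-1)%:E * lne (Sigma n))%E @[n --> \oo] --> (0 : \bar R)].
Proof.
move=> t0 T0 eps0 genQ irrQ lam0 mu_ge0 mu_exp r0 net rare opt mths twisted smp p LR I Sigma rate.
split.
- exact: (second_moment_limit t0 genQ irrQ lam0 mu_ge0 r0 net opt mths twisted smp).
- exact: (prob_limit t0 genQ irrQ lam0 mu_ge0 r0 net opt mths twisted smp).
- exact: (number_of_runs_limit t0 genQ irrQ lam0 mu_ge0 mu_exp r0 net rare opt mths twisted smp).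
Qed.
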